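(* Let $\nu>0$ be real and let $z\in\mathbb{C}$ with $\mathrm{Re}\,z>0$. Then $$\int_0^{\pi/2}\tan\theta\;K_0(z\sin^2\theta)\,I_\nu(z\cos^2\theta)\,d\theta=\frac{I_\nu(z)}{4\sqrt\pi}\,G_{2,4}^{3,1}\left(z^2\left|\begin{array}{c}\frac12,\ 1\\ 0,\ 0,\ \nu,\ -\nu\end{array}\right.\right)+\frac{K_\nu(z)\,(z/2)^{2\nu}}{2\nu\,\Gamma^2(\nu+1)}\,{}_2F_3\left(\left.\begin{array}{c}\nu,\ \nu+\frac12\\ \nu+1,\ \nu+1,\ 2\nu+1\end{array}\right|z^2\right).$$
   Context: Powers take their principal values. $I_\nu(z)=(z/2)^\nu\sum_{k\ge0}\frac{(z/2)^{2k}}{k!\,\Gamma(\nu+k+1)}$, and $K_\nu(z)=\frac\pi2\frac{I_{-\nu}(z)-I_\nu(z)}{\sin\pi\nu}$ for $\nu\notin\mathbb{Z}$ (defined by the limit in $\nu$ for integral $\nu$). ${}_pF_q\left(\left.\begin{array}{c}a_1,\dots,a_p\\ b_1,\dots,b_q\end{array}\right|x\right)=\sum_{k\ge0}\frac{(a_1)_k\cdots(a_p)_k}{(b_1)_k\cdots(b_q)_k}\frac{x^k}{k!}$ with $(\alpha)_k=\alpha(\alpha+1)\cdots(\alpha+k-1)$. The Meijer $G$-function is $$G_{p,q}^{m,n}\left(x\left|\begin{array}{c}a_1,\dots,a_p\\ b_1,\dots,b_q\end{array}\right.\right)=\frac1{2\pi i}\int_L\frac{\prod_{\ell=1}^m\Gamma(b_\ell-s)\prod_{\ell=1}^n\Gamma(1-a_\ell+s)}{\prod_{\ell=m+1}^{q}\Gamma(1-b_\ell+s)\prod_{\ell=n+1}^{p}\Gamma(a_\ell-s)}\,x^s\,ds,$$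 where $L$ separates the poles of the factors $\Gamma(b_\ell-s)$ ($1\le\ell\le m$) from those of the factors $\Gamma(1-a_\ell+s)$ ($1\le\ell\le n$); for $p<q$ one may take $L$ to be a loop starting and ending at $+\infty$ and encircling all poles of the $\Gamma(b_\ell-s)$, but none of the $\Gamma(1-a_\ell+s)$, once in the negative (clockwise) direction. $x^s$ is the principal value. *)

(* Defs.v *)
From Stdlib Require Import Reals Factorial List ClassicalEpsilon.
From Coquelicot Require Import Coquelicot.
Import ListNotations.

Open Scope R_scope.
Open Scope C_scope.

(** * Elementary complex functions *)

Definition Cexp (z : C) : C := (exp (Re z) * cos (Im z), exp (Re z) * sin (Im z))%R.

Definition Csin (z : C) : C := (sin (Re z) * cosh (Im z), cos (Re z) * sinh (Im z))%R.

(** Principal argument, in (-PI, PI]; meaningful for [z <> 0] only. *)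
Definition Arg (z : C) : R :=
  if Rlt_dec (Im z) 0 then (- acos (Re z / Cmod z))%R else acos (Re z / Cmod z).

Definition Cln (z : C) : C := (ln (Cmod z), Arg z).

(** Principal value of [z ^ s], for [z <> 0]. *)
Definition Cpower (z s : C) : C := Cexp (s * Cln z).

(** Limits and sums of complex sequences, taken on real and imaginary parts. *)
Definition CLim_seq (u : nat -> C) : C :=
  (real (Lim_seq (fun n => Re (u n))), real (Lim_seq (fun n => Im (u n)))).

Definition CSeries (u : nat -> C) : C :=
  (Series (fun n => Re (u n)), Series (fun n => Im (u n))).

Definition Cprod (l : list C) : C := fold_right Cmult (RtoC 1) l.

(** * Gamma, Bessel and hypergeometric functions *)

(** Rising factorial. *)
Fixpoint poch (a : C) (k : nat) : C :=
  match k with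
  | O => 1
  | S j => poch a j * (a + INR j)
  end.

(** Euler-Gauss limit n! n^s / (s (s+1) ... (s+n)), valid at every [s] that is
    not a pole.  At the poles s = 0, -1, -2, ... division by zero makes the value
    0, so that [/ Cgamma s] is the entire function 1/Gamma at every [s]. *)
Definition Cgamma (s : C) : C :=
  CLim_seq (fun n => INR (fact n) * Cexp (s * ln (INR n)) / poch s (S n)).

Definition BesselI (nu z : C) : C :=
  Cpower (z / 2) nu
  * CSeries (fun k => (z / 2) ^ (2 * k) / (INR (fact k) * Cgamma (nu + INR k + 1))).

Definition BesselK_nonint (nu z : C) : C :=
  PI / 2 * ((BesselI (- nu) z - BesselI nu z) / Csin (PI * nu)).

(** [C_lim] approaches [nu] along the line of constant imaginary part, hence
    through real orders when [nu] is an integer. *)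
Definition BesselK (nu z : C) : C :=
  if excluded_middle_informative (exists n : Z, nu = RtoC (IZR n))
  then C_lim (fun mu => BesselK_nonint mu z) nu
  else BesselK_nonint nu z.

Definition pFq (a b : list C) (x : C) : C :=
  CSeries (fun k =>
    Cprod (map (fun al => poch al k) a) / Cprod (map (fun be => poch be k) b)
    * (x ^ k / INR (fact k))).

(** * The Meijer G-function, p < q *)

(** [a] lists a_1, ..., a_p and [b] lists b_1, ..., b_q. *)
Definition meijerG_integrand (m n : nat) (a b : list C) (x s : C) : C :=
  Cprod (map (fun be => Cgamma (be - s)) (firstn m b))
  * Cprod (map (fun al => Cgamma (1 - al + s)) (firstn n a))
  / (Cprod (map (fun be => Cgamma (1 - be + s)) (skipn m b))
     * Cprod (map (fun al => Cgamma (al - s)) (skipn n a)))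
  * Cpower x s.

(** [is_loop_integral f sigma c1 c2 l]: the integral of [f] along the loop
      +oo + i c1  -->  sigma + i c1  -->  sigma + i c2  -->  +oo + i c2
    converges to [l].  For c1 < c2 it encircles the half-strip
    Re s > sigma, c1 < Im s < c2 once, clockwise. *)
Definition is_loop_integral (f : C -> C) (sigma c1 c2 : R) (l : C) : Prop :=
  exists l1 l2 l3 : C,
    is_RInt_gen (V := C_R_NormedModule) (fun t : R => f (t, c1))
      (at_point sigma) (Rbar_locally p_infty) l1 /\
    is_RInt (V := C_R_NormedModule) (fun t : R => Ci * f (sigma, t)) c1 c2 l2 /\
    is_RInt_gen (V := C_R_NormedModule) (fun t : R => f (t, c2))
      (at_point sigma) (Rbar_locally p_infty) l3 /\
    l = - l1 + l2 + l3.

(** The loop encircles every pole b_l + k (l <= m) of the Gamma(b_l - s), and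
    every pole a_l - 1 - k (l <= n) of the Gamma(1 - a_l + s) lies strictly
    outside it. *)
Definition loop_separates (m n : nat) (a b : list C) (sigma c1 c2 : R) : Prop :=
  (c1 < c2)%R /\
  (forall (be : C) (k : nat), In be (firstn m b) ->
     (sigma < Re (be + INR k))%R /\ (c1 < Im (be + INR k) < c2)%R) /\
  (forall (al : C) (k : nat), In al (firstn n a) ->
     ~ ((sigma <= Re (al - 1 - INR k))%R /\ (c1 <= Im (al - 1 - INR k) <= c2)%R)).

(** [g] is the value of G^{m,n}_{p,q}(x | a; b): separating loops exist, and the
    integral converges to 2 pi i g along each of them. *)
Definition is_meijerG (m n : nat) (a b : list C) (x g : C) : Prop :=
  (length a < length b)%nat /\
  (exists sigma c1 c2 : R, loop_separates m n a b sigma c1 c2) /\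
  (forall sigma c1 c2 : R, loop_separates m n a b sigma c1 c2 ->
     is_loop_integral (meijerG_integrand m n a b x) sigma c1 c2 (2 * PI * Ci * g)).

(* Main.v *)
(** Both factors of the integrand are expanded in powers of [z], and the integral is taken termwise:
    it becomes a double series of beta integrals and of their logarithmic derivatives.  Along the
    diagonals this series is summed by the Rothe-Hagen convolution identity and its derivative in a
    parameter, and the integral comes out as [- 1/(2 nu) * d I_nu(z) / d nu].

    The loop integral defining the G-function is the sum of the residues at the double poles [k] and
    the simple poles [nu + k], found by exhausting the loop with rectangles; the sides between the
    poles tend to zero because [s -> s + 1] multiplies the integrand by [O(1/k)].  When [nu] is not an
    integer, both sides are then combinations of explicit power series, and the identity reduces to
    the recurrence satisfied by the coefficients of [d I_nu / d nu].  An integral order is reached as a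
    limit of non-integral ones: the rectangle integrals are continuous in [nu] and uniformly dominated. *)

Require Import Defs.
From Stdlib Require Import Reals ZArith Factorial List Lra Lia Psatz Classical ClassicalEpsilon.
From Coquelicot Require Import Coquelicot.
Import ListNotations.

Open Scope R_scope.
Open Scope C_scope.

(** The shape of the right-hand side comes from variation of parameters. Differentiating Bessel's
    equation in the order gives an inhomogeneous equation for [d I_nu / d nu]; its solution pairs
    [I_nu] with an integral of [I_nu I_{-nu}] and [I_{-nu}] with an integral of [I_nu^2]. The latter
    integral is the [2F3], the former is the series of residues of the G-function at the integers,
    and the residues at [nu + k] account for the passage from [I_{-nu}] to [K_nu]. The logarithms in
    the integrand come from [K_0], minus the derivative of [I_nu] in the order at 0.

    The obstacle is an integral [nu]: the poles [k] and [nu + k] merge and the separate residue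
    series blow up. Their sum is a contour integral over paths that keep their distance from all
    poles, and in that form the limit exists.

    Everything is phrased with the entire function [1/Gamma], so that poles become zeros. Holomorphy
    is a quadratic Taylor bound with a uniform constant; such bounds pass from finite products to
    [1/Gamma], and from there to Bessel series as functions of the order. *)

(** * Modulus and total inverse of complex numbers *)

Lemma Cmod_le_Re_Im (z : C) : (Cmod z <= Rabs (Re z) + Rabs (Im z))%R.
Proof.
  destruct z as [x y]; unfold Cmod, Re, Im; simpl fst; simpl snd.
  apply Rsqr_incr_0_var.
  - rewrite Rsqr_sqrt by nra. unfold Rsqr.
    pose proof (Rabs_pos x); pose proof (Rabs_pos y).
    rewrite <- (pow2_abs x), <- (pow2_abs y). nra.
  - pose proof (Rabs_pos x); pose proof (Rabs_pos y); lra.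
Qed.

Lemma im_le_Cmod (z : C) : (Rabs (Im z) <= Cmod z)%R.
Proof. eapply Rle_trans; [|apply Rmax_Cmod]. apply Rmax_r. Qed.

Lemma Cmod_minus_sym (a b : C) : Cmod (a - b) = Cmod (b - a).
Proof. rewrite <- Cmod_opp. f_equal. ring. Qed.

Lemma Cmod_triangle_minus (a b : C) : (Cmod (a - b) <= Cmod a + Cmod b)%R.
Proof. unfold Cminus. rewrite <- (Cmod_opp b). apply Cmod_triangle. Qed.

Lemma Cmod_triangle_inv (a b : C) : (Cmod a - Cmod b <= Cmod (a - b))%R.
Proof.
  replace a with ((a - b) + b) at 1 by ring.
  pose proof (Cmod_triangle (a - b) b). lra.
Qed.

Lemma Cmod_inv_total (z : C) : Cmod (/ z) = (/ Cmod z)%R.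
Proof.
  destruct (Ceq_dec z 0) as [->|H]; [|now apply Cmod_inv].
  replace (/ 0) with (RtoC 0).
  - rewrite Cmod_0, Rinv_0; reflexivity.
  - unfold Cinv, RtoC; simpl. f_equal; unfold Rdiv; ring.
Qed.

Lemma Cmod_nonneg (x : R) : (0 <= x)%R -> Cmod x = x.
Proof. intros; rewrite Cmod_R; now apply Rabs_pos_eq. Qed.

Lemma RtoC_neq_0 (x : R) : x <> 0%R -> RtoC x <> 0.
Proof. intros H E. apply H. now injection E. Qed.

Lemma Cinv_0 : / 0 = RtoC 0.
Proof. unfold Cinv, RtoC; simpl. f_equal; unfold Rdiv; ring. Qed.

(** Division by zero gives 0, so both sides vanish together with a factor. Quotients of Gamma
    factors can thus be rearranged without side conditions, even at poles. *)
Lemma Cinv_total_mult (a b : C) : / (a * b) = / a * / b.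
Proof.
  destruct (Ceq_dec a 0) as [->|Ha]; [rewrite Cmult_0_l, Cinv_0; ring|].
  destruct (Ceq_dec b 0) as [->|Hb]; [rewrite Cmult_0_r, Cinv_0; ring|].
  field; auto.
Qed.

Lemma Cinv_inv_total (z : C) : / / z = z.
Proof.
  destruct (Ceq_dec z 0) as [->|H]; [now rewrite !Cinv_0|].
  field; auto.
Qed.

Lemma Cmod_norm_R (z : C) : norm (V := C_R_NormedModule) z = Cmod z.
Proof.
  destruct z as [x y]. unfold Cmod; simpl fst; simpl snd.
  change (sqrt (Rabs x ^ 2 + Rabs y ^ 2) = sqrt (x ^ 2 + y ^ 2))%R.
  now rewrite !pow2_abs.
Qed.

Lemma scal_C_R (k : R) (z : C) : scal (V := C_R_NormedModule) k z = k * z.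
Proof.
  destruct z as [x y]. change (((k * x)%R, (k * y)%R) = RtoC k * (x, y)).
  unfold Cmult, RtoC; simpl. f_equal; ring.
Qed.

(** * Convergence of complex sequences *)

(** Componentwise, to match [CLim_seq] and [CSeries]; [cv_Cmod] gives the metric form. *)
Definition cv (u : nat -> C) (l : C) : Prop :=
  is_lim_seq (fun n => Re (u n)) (Re l) /\ is_lim_seq (fun n => Im (u n)) (Im l).

Lemma cv_ext (u v : nat -> C) (l : C) : (forall n, u n = v n) -> cv u l -> cv v l.
Proof.
  intros H [A B]; split.
  - eapply is_lim_seq_ext; [|exact A]. intros; simpl; now rewrite H.
  - eapply is_lim_seq_ext; [|exact B]. intros; simpl; now rewrite H.
Qed.

Lemma cv_ext_loc (u v : nat -> C) (l : C) :
  eventually (fun n => u n = v n) -> cv u l -> cv v l.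
Proof.
  intros H [A B]; split.
  - eapply is_lim_seq_ext_loc; [|exact A].
    eapply filter_imp; [|exact H]. intros n E; simpl; now rewrite E.
  - eapply is_lim_seq_ext_loc; [|exact B].
    eapply filter_imp; [|exact H]. intros n E; simpl; now rewrite E.
Qed.

Lemma cv_const (a : C) : cv (fun _ => a) a.
Proof. split; apply is_lim_seq_const. Qed.

Lemma cv_Cmod (u : nat -> C) (l : C) :
  cv u l <-> is_lim_seq (fun n => Cmod (u n - l)) 0.
Proof.
  split.
  - intros [A B].
    assert (A' : is_lim_seq (fun n => Rabs (Re (u n) - Re l)) 0).
    { replace (Finite 0) with (Rbar_abs (Finite (Re l - Re l))).
      apply is_lim_seq_abs. apply is_lim_seq_minus'; [exact A | apply is_lim_seq_const].
      simpl. f_equal. rewrite Rminus_diag. apply Rabs_R0. }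
    assert (B' : is_lim_seq (fun n => Rabs (Im (u n) - Im l)) 0).
    { replace (Finite 0) with (Rbar_abs (Finite (Im l - Im l))).
      apply is_lim_seq_abs. apply is_lim_seq_minus'; [exact B | apply is_lim_seq_const].
      simpl. f_equal. rewrite Rminus_diag. apply Rabs_R0. }
    apply is_lim_seq_le_le with (u := fun _ => 0%R)
      (w := fun n => (Rabs (Re (u n) - Re l) + Rabs (Im (u n) - Im l))%R).
    + intros n. split; [apply Cmod_ge_0|].
      eapply Rle_trans; [apply Cmod_le_Re_Im|].
      right. reflexivity.
    + apply is_lim_seq_const.
    + replace (Finite 0) with (Finite (0 + 0)) by (f_equal; ring).
      now apply is_lim_seq_plus'.
  - intros H. split.
    + apply is_lim_seq_spec in H. apply is_lim_seq_spec. intros eps.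
      destruct (H eps) as [N HN]. exists N. intros n Hn.
      specialize (HN n Hn). simpl in HN. rewrite Rminus_0_r, Rabs_pos_eq in HN by apply Cmod_ge_0.
      eapply Rle_lt_trans; [|exact HN]. apply (re_le_Cmod (u n - l)).
    + apply is_lim_seq_spec in H. apply is_lim_seq_spec. intros eps.
      destruct (H eps) as [N HN]. exists N. intros n Hn.
      specialize (HN n Hn). simpl in HN. rewrite Rminus_0_r, Rabs_pos_eq in HN by apply Cmod_ge_0.
      eapply Rle_lt_trans; [|exact HN]. apply (im_le_Cmod (u n - l)).
Qed.

Lemma cv_squeeze (u : nat -> C) (l : C) (a : nat -> R) :
  (forall n, (Cmod (u n - l) <= a n)%R) -> is_lim_seq a 0 -> cv u l.
Proof.
  intros H Ha. apply cv_Cmod.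
  apply is_lim_seq_le_le with (u := fun _ => 0%R) (w := a); auto.
  - intros n; split; [apply Cmod_ge_0 | apply H].
  - apply is_lim_seq_const.
Qed.

Lemma cv_plus (u v : nat -> C) (a b : C) :
  cv u a -> cv v b -> cv (fun n => u n + v n) (a + b).
Proof. intros [A B] [A' B']; split; now apply is_lim_seq_plus'. Qed.

Lemma cv_opp (u : nat -> C) (a : C) : cv u a -> cv (fun n => - u n) (- a).
Proof.
  intros [A B]; split.
  - apply (proj1 (is_lim_seq_opp _ _) A).
  - apply (proj1 (is_lim_seq_opp _ _) B).
Qed.

Lemma cv_minus (u v : nat -> C) (a b : C) :
  cv u a -> cv v b -> cv (fun n => u n - v n) (a - b).
Proof. intros; apply cv_plus; auto; now apply cv_opp. Qed.

Lemma cv_mult (u v : nat -> C) (a b : C) :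
  cv u a -> cv v b -> cv (fun n => u n * v n) (a * b).
Proof.
  intros [A B] [A' B']; split.
  - apply (is_lim_seq_minus' (fun n => Re (u n) * Re (v n))%R (fun n => Im (u n) * Im (v n))%R);
      now apply is_lim_seq_mult'.
  - apply (is_lim_seq_plus' (fun n => Re (u n) * Im (v n))%R (fun n => Im (u n) * Re (v n))%R);
      now apply is_lim_seq_mult'.
Qed.

Lemma cv_inv (u : nat -> C) (a : C) : a <> 0 -> cv u a -> cv (fun n => / u n) (/ a).
Proof.
  intros Ha [A B].
  assert (H : (Re a ^ 2 + Im a ^ 2 <> 0)%R).
  { rewrite <- Cmod2_alt. apply pow_nonzero. apply Cmod_gt_0 in Ha. lra. }
  assert (HD : is_lim_seq (fun n => Re (u n) ^ 2 + Im (u n) ^ 2)%R (Re a ^ 2 + Im a ^ 2)%R).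
  { apply is_lim_seq_plus'; simpl; apply is_lim_seq_mult'; auto;
      apply is_lim_seq_mult'; auto; apply is_lim_seq_const. }
  split.
  - apply (is_lim_seq_div' (fun n => Re (u n)) (fun n => Re (u n) ^ 2 + Im (u n) ^ 2)%R); auto.
  - apply (is_lim_seq_div' (fun n => - Im (u n))%R (fun n => Re (u n) ^ 2 + Im (u n) ^ 2)%R); auto.
    apply (proj1 (is_lim_seq_opp _ _) B).
Qed.

Lemma cv_CLim (u : nat -> C) (l : C) : cv u l -> CLim_seq u = l.
Proof.
  intros [A B]. unfold CLim_seq.
  rewrite (is_lim_seq_unique _ _ A), (is_lim_seq_unique _ _ B).
  now destruct l.
Qed.

Lemma cv_unique (u : nat -> C) (l l' : C) : cv u l -> cv u l' -> l = l'.
Proof. intros H H'. now rewrite <- (cv_CLim _ _ H), <- (cv_CLim _ _ H'). Qed.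

Lemma cv_subseq (u : nat -> C) (l : C) (phi : nat -> nat) :
  filterlim phi eventually eventually -> cv u l -> cv (fun n => u (phi n)) l.
Proof.
  intros H [A B]; split.
  - exact (is_lim_seq_subseq (fun n => Re (u n)) _ phi H A).
  - exact (is_lim_seq_subseq (fun n => Im (u n)) _ phi H B).
Qed.

Lemma cv_incr_1 (u : nat -> C) (l : C) : cv u l -> cv (fun n => u (S n)) l.
Proof. intros [A B]; split; [apply (is_lim_seq_incr_1 (fun n => Re (u n))) | apply (is_lim_seq_incr_1 (fun n => Im (u n)))]; auto. Qed.

Lemma cv_decr_1 (u : nat -> C) (l : C) : cv (fun n => u (S n)) l -> cv u l.
Proof. intros [A B]; split; [apply (is_lim_seq_incr_1 (fun n => Re (u n))) | apply (is_lim_seq_incr_1 (fun n => Im (u n)))]; auto. Qed.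

Lemma is_lim_Cmod (u : nat -> C) (l : C) : cv u l -> is_lim_seq (fun n => Cmod (u n)) (Cmod l).
Proof.
  intros H. apply cv_Cmod in H. apply is_lim_seq_spec in H. apply is_lim_seq_spec.
  intros eps. destruct (H eps) as [N HN]. exists N. intros n Hn. specialize (HN n Hn).
  simpl in HN. rewrite Rminus_0_r, Rabs_pos_eq in HN by apply Cmod_ge_0.
  pose proof (Cmod_triangle_inv (u n) l). pose proof (Cmod_triangle_inv l (u n)) as H1.
  rewrite (Cmod_minus_sym l) in H1.
  apply Rabs_def1; lra.
Qed.

Lemma cv_Cmod_le (u : nat -> C) (l : C) (M : R) :
  cv u l -> eventually (fun n => (Cmod (u n) <= M)%R) -> (Cmod l <= M)%R.
Proof.
  intros H HM. apply is_lim_Cmod in H.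
  refine (is_lim_seq_le_loc _ _ (Finite (Cmod l)) (Finite M) _ H (is_lim_seq_const M)).
  exact HM.
Qed.

Lemma cv_RtoC (u : nat -> R) (l : R) : is_lim_seq u l -> cv (fun n => RtoC (u n)) (RtoC l).
Proof. intros H; split; [exact H | apply is_lim_seq_const]. Qed.

(** * Complex series *)

(** Sums [n] terms, the empty sum included, whereas [sum_n] takes [n + 1] terms; hence the shifts by
    one in the comparison lemmas. *)
Fixpoint psum (u : nat -> C) (n : nat) : C :=
  match n with O => 0 | S k => psum u k + u k end.

Definition cser (u : nat -> C) (l : C) : Prop := cv (psum u) l.

Definition abs_summable (u : nat -> C) : Prop := ex_series (fun n => Cmod (u n)).

Lemma psum_ext (u v : nat -> C) (n : nat) :
  (forall k, (k < n)%nat -> u k = v k) -> psum u n = psum v n.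
Proof.
  induction n; intros H; simpl; auto.
  rewrite IHn by (intros; apply H; lia). now rewrite (H n) by lia.
Qed.

Lemma psum_Re (u : nat -> C) (n : nat) : Re (psum u (S n)) = sum_n (fun k => Re (u k)) n.
Proof.
  induction n.
  - rewrite sum_O. simpl. unfold Re; simpl. ring.
  - rewrite sum_Sn, <- IHn. reflexivity.
Qed.

Lemma psum_Im (u : nat -> C) (n : nat) : Im (psum u (S n)) = sum_n (fun k => Im (u k)) n.
Proof.
  induction n.
  - rewrite sum_O. simpl. unfold Im; simpl. ring.
  - rewrite sum_Sn, <- IHn. reflexivity.
Qed.

Lemma cser_is_series (u : nat -> C) (l : C) :
  cser u l <-> is_series (fun n => Re (u n)) (Re l) /\ is_series (fun n => Im (u n)) (Im l).
Proof.
  unfold cser. split.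
  - intros H. apply cv_incr_1 in H. destruct H as [A B]. split.
    + refine (is_lim_seq_ext _ _ (Finite _) _ A). intros; apply psum_Re.
    + refine (is_lim_seq_ext _ _ (Finite _) _ B). intros; apply psum_Im.
  - intros [A B]. apply cv_decr_1. split.
    + refine (is_lim_seq_ext _ _ (Finite _) _ A). intros; symmetry; apply psum_Re.
    + refine (is_lim_seq_ext _ _ (Finite _) _ B). intros; symmetry; apply psum_Im.
Qed.

Lemma cser_CSeries (u : nat -> C) (l : C) : cser u l -> CSeries u = l.
Proof.
  intros H. apply cser_is_series in H. destruct H as [A B]. unfold CSeries.
  rewrite (is_series_unique _ _ A), (is_series_unique _ _ B). now destruct l.
Qed.

Lemma cser_ext (u v : nat -> C) (l : C) : (forall n, u n = v n) -> cser u l -> cser v l.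
Proof. intros H. apply cv_ext. intros n. apply psum_ext. auto. Qed.

Lemma cser_unique (u : nat -> C) (l l' : C) : cser u l -> cser u l' -> l = l'.
Proof. apply cv_unique. Qed.

Lemma abs_summable_le (u : nat -> C) (a : nat -> R) :
  (forall n, (Cmod (u n) <= a n)%R) -> ex_series a -> abs_summable u.
Proof.
  intros H Ha. apply (ex_series_le (K := R_AbsRing) (V := R_CompleteNormedModule)) with (b := a); auto.
  intros n. change (Rabs (Cmod (u n)) <= a n)%R. rewrite Rabs_pos_eq; auto. apply Cmod_ge_0.
Qed.

Lemma abs_summable_Re (u : nat -> C) : abs_summable u -> ex_series (fun n => Rabs (Re (u n))).
Proof.
  intros H. apply (ex_series_le (K := R_AbsRing) (V := R_CompleteNormedModule)) with (b := fun n => Cmod (u n)); auto.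
  intros n. change (Rabs (Rabs (Re (u n))) <= Cmod (u n))%R. rewrite Rabs_Rabsolu. apply re_le_Cmod.
Qed.

Lemma abs_summable_Im (u : nat -> C) : abs_summable u -> ex_series (fun n => Rabs (Im (u n))).
Proof.
  intros H. apply (ex_series_le (K := R_AbsRing) (V := R_CompleteNormedModule)) with (b := fun n => Cmod (u n)); auto.
  intros n. change (Rabs (Rabs (Im (u n))) <= Cmod (u n))%R. rewrite Rabs_Rabsolu. apply im_le_Cmod.
Qed.

Lemma abs_summable_cser (u : nat -> C) : abs_summable u -> cser u (CSeries u).
Proof.
  intros H. apply cser_is_series. split.
  - apply Series_correct, ex_series_Rabs, abs_summable_Re, H.
  - apply Series_correct, ex_series_Rabs, abs_summable_Im, H.
Qed.

Lemma psum_plus (u v : nat -> C) n : psum (fun k => u k + v k) n = psum u n + psum v n.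
Proof. induction n; simpl; [ring | rewrite IHn; ring]. Qed.

Lemma psum_scal (c : C) (u : nat -> C) n : psum (fun k => c * u k) n = c * psum u n.
Proof. induction n; simpl; [ring | rewrite IHn; ring]. Qed.

Lemma cser_plus (u v : nat -> C) (a b : C) :
  cser u a -> cser v b -> cser (fun k => u k + v k) (a + b).
Proof.
  intros A B. eapply cv_ext; [|exact (cv_plus _ _ _ _ A B)].
  intros; symmetry; apply psum_plus.
Qed.

Lemma cser_scal (c : C) (u : nat -> C) (a : C) :
  cser u a -> cser (fun k => c * u k) (c * a).
Proof.
  intros A. eapply cv_ext; [|exact (cv_mult _ _ _ _ (cv_const c) A)].
  intros; symmetry; apply psum_scal.
Qed.

Lemma cser_minus (u v : nat -> C) (a b : C) :
  cser u a -> cser v b -> cser (fun k => u k - v k) (a - b).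
Proof.
  intros A B. replace (a - b) with (a + (- (1)) * b) by ring.
  eapply cser_ext; [|apply cser_plus; [exact A | apply cser_scal; exact B]].
  intros; simpl; ring.
Qed.

Lemma psum_shift (u : nat -> C) n : psum u (S n) = u O + psum (fun k => u (S k)) n.
Proof. induction n; [simpl; ring|]. simpl in *. rewrite IHn. ring. Qed.

Lemma cser_decr_1 (u : nat -> C) (l : C) : cser (fun k => u (S k)) l -> cser u (u O + l).
Proof.
  intros H. apply cv_decr_1. eapply cv_ext; [|apply cv_plus; [apply (cv_const (u O)) | exact H]].
  intros n; simpl; symmetry; apply psum_shift.
Qed.

Lemma cser_incr_1 (u : nat -> C) (l : C) : cser u l -> cser (fun k => u (S k)) (l - u O).
Proof.
  intros H. apply cv_incr_1 in H.
  eapply cv_ext; [|apply cv_minus; [exact H | apply (cv_const (u O))]].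
  intros n; simpl. rewrite (psum_shift u n : psum u n + u n = _). ring.
Qed.

(** The real theorem is applied to the four products of real and imaginary parts. *)
Lemma cser_Cauchy_product (u v : nat -> C) (a b : C) :
  cser u a -> cser v b -> abs_summable u -> abs_summable v ->
  cser (fun n => psum (fun k => u k * v (n - k)%nat) (S n)) (a * b).
Proof.
  intros A B HA HB. apply cser_is_series in A. apply cser_is_series in B.
  destruct A as [A1 A2], B as [B1 B2].
  pose proof (abs_summable_Re _ HA); pose proof (abs_summable_Im _ HA);
  pose proof (abs_summable_Re _ HB); pose proof (abs_summable_Im _ HB).
  pose proof (is_series_mult _ _ _ _ A1 B1 ltac:(assumption) ltac:(assumption)) as M1.
  pose proof (is_series_mult _ _ _ _ A2 B2 ltac:(assumption) ltac:(assumption)) as M2.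
  pose proof (is_series_mult _ _ _ _ A1 B2 ltac:(assumption) ltac:(assumption)) as M3.
  pose proof (is_series_mult _ _ _ _ A2 B1 ltac:(assumption) ltac:(assumption)) as M4.
  apply cser_is_series; split.
  - eapply is_series_ext; [|exact (is_series_minus _ _ _ _ M1 M2)].
    intros n. rewrite psum_Re.
    change (plus ?x (opp ?y)) with (x - y)%R. rewrite <- minus_sum. rewrite sum_n_Reals.
    apply sum_eq; intros; reflexivity.
  - eapply is_series_ext; [|exact (is_series_plus _ _ _ _ M3 M4)].
    intros n. rewrite psum_Im.
    change (plus ?x ?y) with (x + y)%R. rewrite <- plus_sum. rewrite sum_n_Reals.
    apply sum_eq; intros; reflexivity.
Qed.

(** The increments are dominated by a telescoping series of sum [K]. The weight has the size [1/n^2]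
    of the corrections in the Gauss product for [1/Gamma]. *)
Lemma cv_telescope_bound (u : nat -> C) (K : R) :
  (forall n, (Cmod (u (S n) - u n) <= K * (/ INR (n + 1) - / INR (n + 2)))%R) ->
  exists l, cv u l.
Proof.
  intros H.
  assert (HS : ex_series (fun n => K * (/ INR (n + 1) - / INR (n + 2)))%R).
  { apply (ex_series_scal_l (K := R_AbsRing) (V := R_NormedModule) K (fun n => / INR (n + 1) - / INR (n + 2)))%R. exists 1%R.
    apply (is_lim_seq_ext (fun n => 1 - / INR (n + 2))%R _ (Finite 1)).
    - intros n. induction n.
      + rewrite sum_O. simpl. field.
      + rewrite sum_Sn, <- IHn. change (plus ?a ?b) with (a + b)%R.
        replace (S n + 1)%nat with (n + 2)%nat by lia. ring.
    - replace (Finite 1) with (Finite (1 - 0)) by (f_equal; ring).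
      apply is_lim_seq_minus'; [apply is_lim_seq_const|].
      apply (is_lim_seq_inv (fun n => INR (n + 2)) p_infty); [|discriminate].
      apply (is_lim_seq_incr_n INR 2 p_infty), is_lim_seq_INR. }
  pose proof (abs_summable_cser _ (abs_summable_le _ _ H HS)) as HC.
  exists (u O + CSeries (fun n => u (S n) - u n)).
  eapply cv_ext; [|apply cv_plus; [apply (cv_const (u O)) | exact HC]].
  intros n. simpl. induction n; simpl; [ring|]. rewrite Cplus_assoc, IHn. ring.
Qed.

Lemma cv_eq (u : nat -> C) (l l' : C) : l = l' -> cv u l -> cv u l'.
Proof. now intros ->. Qed.

(** * Complex exponential *)

Lemma Cexp_plus (a b : C) : Cexp (a + b) = Cexp a * Cexp b.
Proof.
  destruct a as [x y], b as [x' y']. unfold Cexp, Re, Im, Cmult, Cplus; simpl.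
  rewrite exp_plus, cos_plus, sin_plus. f_equal; ring.
Qed.

Lemma Cexp_RtoC (x : R) : Cexp (RtoC x) = RtoC (exp x).
Proof.
  unfold Cexp, RtoC, Re, Im; simpl. rewrite cos_0, sin_0. f_equal; ring.
Qed.

Lemma Cexp_0 : Cexp 0 = 1.
Proof. rewrite Cexp_RtoC. now rewrite exp_0. Qed.

Lemma Cmod_Cexp (z : C) : Cmod (Cexp z) = exp (Re z).
Proof.
  destruct z as [x y]. unfold Cexp, Cmod, Re, Im; simpl fst; simpl snd.
  replace ((exp x * cos y) ^ 2 + (exp x * sin y) ^ 2)%R with (exp x ^ 2)%R.
  - apply sqrt_pow2. left; apply exp_pos.
  - pose proof (sin2_cos2 y) as H. unfold Rsqr in H.
    transitivity (exp x ^ 2 * (sin y * sin y + cos y * cos y))%R; [rewrite H|]; ring.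
Qed.

Lemma Cexp_neq_0 (z : C) : Cexp z <> 0.
Proof. apply Cmod_gt_0. rewrite Cmod_Cexp. apply exp_pos. Qed.

Lemma Cexp_opp (z : C) : Cexp (- z) = / Cexp z.
Proof.
  assert (H : Cexp z * Cexp (- z) = 1).
  { rewrite <- Cexp_plus. replace (z + - z) with (RtoC 0) by ring. apply Cexp_0. }
  pose proof (Cexp_neq_0 z).
  rewrite <- (Cmult_1_l (/ Cexp z)), <- H. field; auto.
Qed.

Lemma exp_abs_le (x : R) : (exp x <= exp (Rabs x))%R.
Proof. destruct (Rle_lt_or_eq_dec x (Rabs x) (Rle_abs x)) as [H|H]; [left; now apply exp_increasing | rewrite <- H; lra]. Qed.

Lemma exp_ge_1_plus (x : R) : (1 + x <= exp x)%R.
Proof. destruct (Req_dec x 0) as [->|H]; [rewrite exp_0; lra | left; now apply exp_ineq1]. Qed.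

Lemma exp_abs_ge_1 (x : R) : (1 <= exp (Rabs x))%R.
Proof. pose proof (exp_ge_1_plus (Rabs x)). pose proof (Rabs_pos x). lra. Qed.

Lemma exp_minus_1_bound (x : R) : (Rabs (exp x - 1) <= Rabs x * exp (Rabs x))%R.
Proof.
  pose proof (exp_ge_1_plus x) as H1. pose proof (exp_ge_1_plus (- x)) as H2.
  pose proof (exp_abs_le x). pose proof (exp_abs_ge_1 x).
  assert (E : (exp x * exp (- x) = 1)%R) by (rewrite <- exp_plus, Rplus_opp_r; apply exp_0).
  pose proof (exp_pos x).
  destruct (Rle_dec 0 x) as [Hx|Hx].
  - rewrite (Rabs_pos_eq x) in * by lra. rewrite Rabs_pos_eq by lra. nra.
  - rewrite (Rabs_left1 x) in * by lra. assert (exp x <= 1)%R by nra.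
    rewrite Rabs_left1 by lra. nra.
Qed.

(** From [1 - x <= exp (- x)] follows [exp x - 1 - x <= x (exp x - 1)], which reduces the second
    order to the first. *)
Lemma exp_taylor2_bound (x : R) : (Rabs (exp x - 1 - x) <= x ^ 2 * exp (Rabs x))%R.
Proof.
  pose proof (exp_ge_1_plus x) as H1. pose proof (exp_ge_1_plus (- x)) as H2.
  pose proof (exp_abs_ge_1 x). pose proof (exp_minus_1_bound x) as H3.
  assert (E : (exp x * exp (- x) = 1)%R) by (rewrite <- exp_plus, Rplus_opp_r; apply exp_0).
  pose proof (exp_pos x).
  rewrite Rabs_pos_eq by lra.
  assert (exp x - 1 - x <= x * (exp x - 1))%R by nra.
  destruct (Rle_dec 0 x) as [Hx|Hx].
  - rewrite (Rabs_pos_eq x) in * by lra. rewrite Rabs_pos_eq in H3 by lra. nra.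
  - assert (x * (exp x - 1) <= x ^ 2)%R by nra. nra.
Qed.

Lemma sin_abs_le (x : R) : (Rabs (sin x) <= Rabs x)%R.
Proof.
  destruct (MVT_gen sin 0 x cos) as [c [_ Hc]].
  - intros; auto_derive; auto; ring.
  - intros; apply derivable_continuous_pt, derivable_pt_sin.
  - rewrite sin_0, !Rminus_0_r in Hc. rewrite Hc, Rabs_mult.
    pose proof (COS_bound c). assert (Rabs (cos c) <= 1)%R by (apply Rabs_le; lra).
    pose proof (Rabs_pos x). nra.
Qed.

Lemma cos_minus_1_bound (x : R) : (Rabs (cos x - 1) <= x ^ 2 / 2)%R.
Proof.
  replace x with (2 * (x / 2))%R at 1 by field. rewrite cos_2a_sin.
  pose proof (sin_abs_le (x / 2)) as H. apply Rsqr_le_abs_1 in H. unfold Rsqr in H.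
  apply Rabs_le. nra.
Qed.

Lemma sin_taylor_bound (x : R) : (Rabs (sin x - x) <= x ^ 2)%R.
Proof.
  destruct (MVT_gen (fun t => sin t - t)%R 0 x (fun t => cos t - 1)%R) as [c [Hm Hc]].
  - intros; auto_derive; auto; ring.
  - intros; apply derivable_continuous_pt, derivable_pt_minus; [apply derivable_pt_sin | apply derivable_pt_id].
  - rewrite sin_0, !Rminus_0_r in Hc. rewrite Hc, Rabs_mult.
    assert (Rabs (cos c - 1) <= Rabs x)%R.
    { assert (Rabs c <= Rabs x)%R.
      { unfold Rmin, Rmax in Hm. destruct (Rle_dec 0 x).
        - rewrite !Rabs_pos_eq; lra.
        - rewrite !Rabs_left1; lra. }
      pose proof (cos_minus_1_bound c) as H1. rewrite <- pow2_abs in H1.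
      pose proof (COS_bound c). assert (Rabs (cos c - 1) <= 2)%R by (apply Rabs_le; lra).
      pose proof (Rabs_pos c). destruct (Rle_dec (Rabs c) 2); nra. }
    rewrite <- (pow2_abs x). pose proof (Rabs_pos x). nra.
Qed.

Lemma Cexp_taylor2_bound (h : C) : (Cmod (Cexp h - 1 - h) <= 2 * Cmod h ^ 2 * exp (Cmod h))%R.
Proof.
  destruct h as [x y].
  eapply Rle_trans; [apply Cmod_le_Re_Im|].
  rewrite Cmod2_alt. unfold Re, Im; simpl fst; simpl snd.
  assert (Hx : (exp (Rabs x) <= exp (Cmod (x, y)))%R).
  { pose proof (re_le_Cmod (x, y)) as H. unfold Re in H; simpl in H.
    destruct H as [H|H]; [left; now apply exp_increasing | rewrite H; lra]. }
  pose proof (exp_abs_ge_1 x). pose proof (exp_abs_le x).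
  pose proof (exp_taylor2_bound x). pose proof (exp_minus_1_bound x).
  pose proof (cos_minus_1_bound y). pose proof (sin_taylor_bound y). pose proof (sin_abs_le y).
  pose proof (exp_pos x).
  set (E := exp (Rabs x)) in *. set (F := exp (Cmod (x, y))) in *.
  assert (A1 : (Rabs (exp x * cos y + - (1) + - x) <= x ^ 2 * E + E * (y ^ 2 / 2))%R).
  { replace (exp x * cos y + - (1) + - x)%R with ((exp x - 1 - x) + exp x * (cos y - 1))%R by ring.
    eapply Rle_trans; [apply Rabs_triang|]. rewrite Rabs_mult, (Rabs_pos_eq (exp x)) by lra.
    pose proof (Rabs_pos (cos y - 1)). apply Rplus_le_compat; [lra|].
    apply Rmult_le_compat; lra. }
  assert (A2 : (Rabs (exp x * sin y + - 0 + - y) <= Rabs x * E * Rabs y + y ^ 2)%R).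
  { replace (exp x * sin y + - 0 + - y)%R with ((exp x - 1) * sin y + (sin y - y))%R by ring.
    eapply Rle_trans; [apply Rabs_triang|]. rewrite Rabs_mult.
    apply Rplus_le_compat; [|lra].
    apply Rmult_le_compat; auto; apply Rabs_pos. }
  pose proof (pow2_abs x) as X2. pose proof (pow2_abs y) as Y2.
  pose proof (Rabs_pos x); pose proof (Rabs_pos y).
  rewrite <- X2, <- Y2 in *. set (a := Rabs x) in *. set (b := Rabs y) in *.
  apply Rle_trans with (2 * (a ^ 2 + b ^ 2) * E)%R; [|nra].
  eapply Rle_trans; [apply Rplus_le_compat; [exact A1 | exact A2]|].
  assert (Hab : (a * b <= (a ^ 2 + b ^ 2) / 2)%R) by (pose proof (pow2_ge_0 (a - b)); lra).
  assert (HE1 : (1 <= E)%R) by assumption.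
  replace (a * E * b)%R with (a * b * E)%R by ring.
  assert (a * b * E <= (a ^ 2 + b ^ 2) / 2 * E)%R by (apply Rmult_le_compat_r; lra).
  assert (b ^ 2 * 1 <= b ^ 2 * E)%R by (apply Rmult_le_compat_l; [apply pow2_ge_0 | lra]).
  pose proof (pow2_ge_0 a). pose proof (Rmult_le_pos (a ^ 2) E ltac:(auto) ltac:(lra)). lra.
Qed.

(** * Uniformly quadratic Taylor remainders *)

(* A quantitative form of holomorphy with derivative [f']: it passes to pointwise limits when [K] is uniform. *)
Definition c11 (D : C -> Prop) (f f' : C -> C) (K : R) : Prop :=
  (0 <= K)%R /\
  (forall w, D w -> (Cmod (f w) <= K)%R) /\
  (forall w, D w -> (Cmod (f' w) <= K)%R) /\
  (forall w v, D w -> D v -> (Cmod (f v - f w) <= K * Cmod (v - w))%R) /\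
  (forall w v, D w -> D v -> (Cmod (f v - f w - (v - w) * f' w) <= K * Cmod (v - w) ^ 2)%R).

Definition cball (z : C) (r : R) (w : C) : Prop := (Cmod (w - z) < r)%R.

(** One constant serves all pairs of points of a ball, so the notion is local and not merely
    pointwise: it holds again at every point near [z], and it controls [f'] there. *)
Definition holoD (f f' : C -> C) (z : C) : Prop :=
  exists r K, (0 < r)%R /\ c11 (cball z r) f f' K.

Lemma c11_sub (D E : C -> Prop) f f' K K' :
  (forall w, E w -> D w) -> (K <= K')%R -> c11 D f f' K -> c11 E f f' K'.
Proof.
  intros HD HK (H0 & H1 & H2 & H3 & H4). repeat split.
  - lra.
  - intros w Hw. specialize (H1 w (HD _ Hw)). lra.
  - intros w Hw. specialize (H2 w (HD _ Hw)). lra.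
  - intros w v Hw Hv. specialize (H3 w v (HD _ Hw) (HD _ Hv)). pose proof (Cmod_ge_0 (v - w)). nra.
  - intros w v Hw Hv. specialize (H4 w v (HD _ Hw) (HD _ Hv)). pose proof (pow2_ge_0 (Cmod (v - w))). nra.
Qed.

Lemma c11_ext (D : C -> Prop) f f' g g' K :
  (forall w, D w -> f w = g w) -> (forall w, D w -> f' w = g' w) -> c11 D f f' K -> c11 D g g' K.
Proof.
  intros E E' (H0 & H1 & H2 & H3 & H4). repeat split; auto.
  - intros; rewrite <- E; auto.
  - intros; rewrite <- E'; auto.
  - intros; rewrite <- !E; auto.
  - intros; rewrite <- !E, <- E'; auto.
Qed.

Lemma c11_const D (a : C) : c11 D (fun _ => a) (fun _ => 0) (Cmod a).
Proof.
  pose proof (Cmod_ge_0 a). repeat split; auto; intros.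
  - lra.
  - rewrite Cmod_0; auto.
  - replace (a - a) with (RtoC 0) by ring. rewrite Cmod_0. pose proof (Cmod_ge_0 (v - w)); nra.
  - replace (a - a - (v - w) * 0) with (RtoC 0) by ring. rewrite Cmod_0.
    pose proof (pow2_ge_0 (Cmod (v - w))); nra.
Qed.

Lemma c11_id (D : C -> Prop) (R0 : R) :
  (forall w, D w -> (Cmod w <= R0)%R) -> (0 <= R0)%R -> c11 D (fun w => w) (fun _ => 1) (R0 + 1).
Proof.
  intros H H0. repeat split; intros.
  - lra.
  - specialize (H w H1); lra.
  - rewrite Cmod_1; lra.
  - pose proof (Cmod_ge_0 (v - w)); nra.
  - replace (v - w - (v - w) * 1) with (RtoC 0) by ring. rewrite Cmod_0.
    pose proof (pow2_ge_0 (Cmod (v - w))); nra.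
Qed.

Lemma c11_plus D f f' g g' K L :
  c11 D f f' K -> c11 D g g' L -> c11 D (fun w => f w + g w) (fun w => f' w + g' w) (K + L).
Proof.
  intros (H0 & H1 & H2 & H3 & H4) (G0 & G1 & G2 & G3 & G4). repeat split.
  - lra.
  - intros w Hw. eapply Rle_trans; [apply Cmod_triangle|]. specialize (H1 w Hw); specialize (G1 w Hw); lra.
  - intros w Hw. eapply Rle_trans; [apply Cmod_triangle|]. specialize (H2 w Hw); specialize (G2 w Hw); lra.
  - intros w v Hw Hv. replace (f v + g v - (f w + g w)) with ((f v - f w) + (g v - g w)) by ring.
    eapply Rle_trans; [apply Cmod_triangle|].
    specialize (H3 w v Hw Hv); specialize (G3 w v Hw Hv); lra.
  - intros w v Hw Hv.
    replace (f v + g v - (f w + g w) - (v - w) * (f' w + g' w)) with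
      ((f v - f w - (v - w) * f' w) + (g v - g w - (v - w) * g' w)) by ring.
    eapply Rle_trans; [apply Cmod_triangle|].
    specialize (H4 w v Hw Hv); specialize (G4 w v Hw Hv); lra.
Qed.

Lemma c11_mult D f f' g g' K L :
  c11 D f f' K -> c11 D g g' L ->
  c11 D (fun w => f w * g w) (fun w => f' w * g w + f w * g' w) (3 * K * L).
Proof.
  intros (H0 & H1 & H2 & H3 & H4) (G0 & G1 & G2 & G3 & G4).
  assert (HKL : (0 <= K * L)%R) by nra.
  assert (MM : forall a b A B, (Cmod a <= A)%R -> (Cmod b <= B)%R -> (Cmod (a * b) <= A * B)%R).
  { intros. rewrite Cmod_mult. apply Rmult_le_compat; auto; apply Cmod_ge_0. }
  repeat split.
  - nra.
  - intros w Hw. specialize (MM _ _ _ _ (H1 w Hw) (G1 w Hw)). nra.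
  - intros w Hw. eapply Rle_trans; [apply Cmod_triangle|].
    pose proof (MM _ _ _ _ (H2 w Hw) (G1 w Hw)). pose proof (MM _ _ _ _ (H1 w Hw) (G2 w Hw)). nra.
  - intros w v Hw Hv. replace (f v * g v - f w * g w) with ((f v - f w) * g v + f w * (g v - g w)) by ring.
    eapply Rle_trans; [apply Cmod_triangle|].
    pose proof (MM _ _ _ _ (H3 w v Hw Hv) (G1 v Hv)). pose proof (MM _ _ _ _ (H1 w Hw) (G3 w v Hw Hv)).
    pose proof (Cmod_ge_0 (v - w)).
    assert (0 <= K * L * Cmod (v - w))%R by nra. nra.
  - intros w v Hw Hv.
    replace (f v * g v - f w * g w - (v - w) * (f' w * g w + f w * g' w)) with
      ((f v - f w - (v - w) * f' w) * g v + (v - w) * (f' w * (g v - g w)) + f w * (g v - g w - (v - w) * g' w)) by ring.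
    pose proof (MM _ _ _ _ (H4 w v Hw Hv) (G1 v Hv)).
    pose proof (MM _ _ _ _ (H1 w Hw) (G4 w v Hw Hv)).
    pose proof (MM (v - w) _ _ _ (Rle_refl _) (MM _ _ _ _ (H2 w Hw) (G3 w v Hw Hv))).
    eapply Rle_trans; [apply Cmod_triangle|].
    eapply Rle_trans; [apply Rplus_le_compat_r, Cmod_triangle|].
    nra.
Qed.

Lemma c11_comp (D E : C -> Prop) f f' g g' K L :
  (forall w, D w -> E (g w)) -> c11 E f f' K -> c11 D g g' L ->
  c11 D (fun w => f (g w)) (fun w => f' (g w) * g' w) (K * (1 + L + L * L)).
Proof.
  intros HE (H0 & H1 & H2 & H3 & H4) (G0 & G1 & G2 & G3 & G4).
  assert (MM : forall a b A B, (Cmod a <= A)%R -> (Cmod b <= B)%R -> (Cmod (a * b) <= A * B)%R).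
  { intros. rewrite Cmod_mult. apply Rmult_le_compat; auto; apply Cmod_ge_0. }
  assert (0 <= K * L)%R by nra. assert (0 <= K * (L * L))%R by nra.
  repeat split.
  - nra.
  - intros w Hw. specialize (H1 _ (HE w Hw)). nra.
  - intros w Hw. pose proof (MM _ _ _ _ (H2 _ (HE w Hw)) (G2 w Hw)). nra.
  - intros w v Hw Hv. specialize (H3 _ _ (HE w Hw) (HE v Hv)). specialize (G3 w v Hw Hv).
    pose proof (Cmod_ge_0 (v - w)).
    assert (K * Cmod (g v - g w) <= K * (L * Cmod (v - w)))%R by (apply Rmult_le_compat_l; auto).
    assert (0 <= K * (1 + L * L) * Cmod (v - w))%R by (apply Rmult_le_pos; nra). nra.
  - intros w v Hw Hv.
    replace (f (g v) - f (g w) - (v - w) * (f' (g w) * g' w)) with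
      ((f (g v) - f (g w) - (g v - g w) * f' (g w)) + f' (g w) * (g v - g w - (v - w) * g' w)) by ring.
    eapply Rle_trans; [apply Cmod_triangle|].
    specialize (H4 _ _ (HE w Hw) (HE v Hv)). specialize (G3 w v Hw Hv).
    pose proof (MM _ _ _ _ (H2 _ (HE w Hw)) (G4 w v Hw Hv)).
    pose proof (Cmod_ge_0 (v - w)). pose proof (Cmod_ge_0 (g v - g w)).
    assert (Cmod (g v - g w) ^ 2 <= L * L * Cmod (v - w) ^ 2)%R.
    { replace (L * L * Cmod (v - w) ^ 2)%R with ((L * Cmod (v - w)) ^ 2)%R by ring. apply pow_incr; lra. }
    assert (K * Cmod (g v - g w) ^ 2 <= K * (L * L * Cmod (v - w) ^ 2))%R by (apply Rmult_le_compat_l; auto).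
    pose proof (pow2_ge_0 (Cmod (v - w))).
    assert (0 <= K * Cmod (v - w) ^ 2)%R by nra. nra.
Qed.

(** Factoring out [Cexp w] reduces every estimate to the Taylor bound at 0 with increment [v - w],
    whose modulus is at most [2 R0]. *)
Lemma c11_Cexp (D : C -> Prop) (R0 : R) :
  (forall w, D w -> (Cmod w <= R0)%R) -> (0 <= R0)%R -> c11 D Cexp Cexp (exp R0 * (1 + 2 * (1 + 2 * R0) * exp (2 * R0))).
Proof.
  intros H H0.
  assert (He : forall x y : R, (x <= y)%R -> (exp x <= exp y)%R).
  { intros x y [Hxy|Hxy]; [left; now apply exp_increasing | subst; lra]. }
  assert (E1 : forall w, D w -> (Cmod (Cexp w) <= exp R0)%R).
  { intros w Hw. rewrite Cmod_Cexp. apply He. pose proof (re_le_Cmod w) as A.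
    pose proof (Rle_abs (Re w)). specialize (H w Hw). lra. }
  pose proof (exp_pos R0) as P0. pose proof (exp_pos (2 * R0)) as P1.
  assert (0 <= exp R0 * exp (2 * R0))%R by nra.
  assert (0 <= exp R0 * exp (2 * R0) * R0)%R by nra.
  assert (E4 : forall w v, D w -> D v ->
    (Cmod (Cexp v - Cexp w - (v - w) * Cexp w) <= exp R0 * (2 * exp (2 * R0)) * Cmod (v - w) ^ 2)%R).
  { intros w v Hw Hv. replace (Cexp v) with (Cexp w * Cexp (v - w)) by (rewrite <- Cexp_plus; f_equal; ring).
    replace (Cexp w * Cexp (v - w) - Cexp w - (v - w) * Cexp w) with (Cexp w * (Cexp (v - w) - 1 - (v - w))) by ring.
    rewrite Cmod_mult.
    assert (exp (Cmod (v - w)) <= exp (2 * R0))%R.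
    { apply He. eapply Rle_trans; [apply Cmod_triangle_minus|]. pose proof (H w Hw); pose proof (H v Hv). lra. }
    pose proof (pow2_ge_0 (Cmod (v - w))).
    rewrite Rmult_assoc. apply Rmult_le_compat; auto using Cmod_ge_0.
    eapply Rle_trans; [apply Cexp_taylor2_bound|]. nra. }
  repeat split; auto.
  - nra.
  - intros w Hw; specialize (E1 w Hw). nra.
  - intros w Hw; specialize (E1 w Hw). nra.
  - intros w v Hw Hv. specialize (E4 w v Hw Hv). specialize (E1 w Hw).
    replace (Cexp v - Cexp w) with ((Cexp v - Cexp w - (v - w) * Cexp w) + (v - w) * Cexp w) by ring.
    eapply Rle_trans; [apply Cmod_triangle|]. rewrite Cmod_mult.
    assert (Cmod (v - w) <= 2 * R0)%R.
    { eapply Rle_trans; [apply Cmod_triangle_minus|]. pose proof (H w Hw); pose proof (H v Hv). lra. }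
    pose proof (Cmod_ge_0 (v - w)). set (h := Cmod (v - w)) in *.
    assert (h * Cmod (Cexp w) <= h * exp R0)%R by (apply Rmult_le_compat_l; auto).
    assert (h ^ 2 <= 2 * R0 * h)%R by nra.
    assert (exp R0 * (2 * exp (2 * R0)) * h ^ 2 <= exp R0 * (2 * exp (2 * R0)) * (2 * R0 * h))%R by (apply Rmult_le_compat_l; nra).
    assert (0 <= exp R0 * exp (2 * R0) * h)%R by nra. nra.
  - intros w v Hw Hv. eapply Rle_trans; [apply E4; auto|].
    apply Rmult_le_compat_r; [apply pow2_ge_0|]. nra.
Qed.

(** The second-order remainder is exactly [(v - w)^2 / (v w^2)]. The three summands of the constant
    bound the value, the first-order quantities and this remainder. *)
Lemma c11_inv (D : C -> Prop) (m : R) :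
  (0 < m)%R -> (forall w, D w -> (m <= Cmod w)%R) ->
  c11 D Cinv (fun w => - / (w * w)) (/ m + / m ^ 2 + / m ^ 3).
Proof.
  intros Hm H.
  assert (HI : forall w, D w -> w <> 0 /\ (0 <= / Cmod w <= / m)%R).
  { intros w Hw. specialize (H w Hw). split; [apply Cmod_gt_0; lra|]. split.
    - left. apply Rinv_0_lt_compat. lra.
    - now apply Rinv_le_contravar. }
  assert (0 < / m)%R by now apply Rinv_0_lt_compat.
  replace (/ m ^ 2)%R with (/ m * / m)%R by (field; lra).
  replace (/ m ^ 3)%R with (/ m * / m * / m)%R by (field; lra).
  set (q := (/ m)%R) in *.
  assert (0 < q * q)%R by nra. assert (0 < q * q * q)%R by nra.
  repeat split.
  - lra.
  - intros w Hw. destruct (HI w Hw) as [A B]. rewrite Cmod_inv by auto. lra.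
  - intros w Hw. destruct (HI w Hw) as [A B]. rewrite Cmod_opp, Cmod_inv_total, Cmod_mult, Rinv_mult. nra.
  - intros w v Hw Hv. destruct (HI w Hw) as [A B]; destruct (HI v Hv) as [A' B'].
    replace (/ v - / w) with (- (/ v * / w * (v - w))) by (field; auto).
    rewrite Cmod_opp, !Cmod_mult, !Cmod_inv_total.
    apply Rmult_le_compat_r; [apply Cmod_ge_0|]. nra.
  - intros w v Hw Hv. destruct (HI w Hw) as [A B]; destruct (HI v Hv) as [A' B'].
    replace (/ v - / w - (v - w) * - / (w * w)) with (/ v * / w * / w * (v - w) ^ 2) by (field; auto).
    rewrite !Cmod_mult, !Cmod_inv_total, Cmod_pow.
    apply Rmult_le_compat_r; [apply pow2_ge_0|].
    apply Rle_trans with (q * q * q)%R; [|lra].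
    apply Rmult_le_compat; try lra; [apply Rmult_le_pos; lra|]. apply Rmult_le_compat; lra.
Qed.

Lemma cball_bounded (z : C) (r : R) (w : C) : cball z r w -> (Cmod w <= Cmod z + r)%R.
Proof.
  intros H. unfold cball in H. replace w with (z + (w - z)) by ring.
  eapply Rle_trans; [apply Cmod_triangle|]. lra.
Qed.

Lemma holoD_at (f f' : C -> C) (z : C) : holoD f f' z -> exists r K, (0 < r)%R /\ (0 <= K)%R /\
  (forall w, cball z r w -> Cmod (f w - f z) <= K * Cmod (w - z))%R /\
  (forall w, cball z r w -> Cmod (f w - f z - (w - z) * f' z) <= K * Cmod (w - z) ^ 2)%R.
Proof.
  intros (r & K & Hr & H0 & H1 & H2 & H3 & H4). exists r, K.
  assert (cball z r z) by (unfold cball; replace (z - z) with (RtoC 0) by ring; now rewrite Cmod_0).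
  repeat split; auto.
Qed.

Lemma holoD_ext_loc f f' g g' z :
  (exists r, (0 < r)%R /\ forall w, cball z r w -> f w = g w /\ f' w = g' w) ->
  holoD f f' z -> holoD g g' z.
Proof.
  intros (r & Hr & E) (r' & K & Hr' & H). exists (Rmin r r'), K. split; [now apply Rmin_pos|].
  apply c11_ext with (f := f) (f' := f').
  - intros w Hw. apply E. unfold cball in *. eapply Rlt_le_trans; [exact Hw | apply Rmin_l].
  - intros w Hw. apply E. unfold cball in *. eapply Rlt_le_trans; [exact Hw | apply Rmin_l].
  - eapply c11_sub; [|apply Rle_refl | exact H]. intros w Hw. unfold cball in *.
    eapply Rlt_le_trans; [exact Hw | apply Rmin_r].
Qed.

Lemma holoD_ext f f' g g' z :
  (forall w, f w = g w) -> (forall w, f' w = g' w) -> holoD f f' z -> holoD g g' z.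
Proof. intros E E'. apply holoD_ext_loc. exists 1%R. split; [lra|]. auto. Qed.

Lemma holoD_const (a z : C) : holoD (fun _ => a) (fun _ => 0) z.
Proof. exists 1%R, (Cmod a). split; [lra | apply c11_const]. Qed.

Lemma holoD_id (z : C) : holoD (fun w => w) (fun _ => 1) z.
Proof.
  exists 1%R, (Cmod z + 1 + 1)%R. split; [lra|]. apply c11_id.
  - apply cball_bounded.
  - pose proof (Cmod_ge_0 z); lra.
Qed.

Lemma holoD_join (f f' g g' : C -> C) z : holoD f f' z -> holoD g g' z ->
  exists r K L, (0 < r)%R /\ c11 (cball z r) f f' K /\ c11 (cball z r) g g' L.
Proof.
  intros (r & K & Hr & H) (r' & L & Hr' & H'). exists (Rmin r r'), K, L.
  split; [now apply Rmin_pos|]. split.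
  - eapply c11_sub; [|apply Rle_refl | exact H]. intros w Hw. unfold cball in *.
    eapply Rlt_le_trans; [exact Hw | apply Rmin_l].
  - eapply c11_sub; [|apply Rle_refl | exact H']. intros w Hw. unfold cball in *.
    eapply Rlt_le_trans; [exact Hw | apply Rmin_r].
Qed.

Lemma holoD_plus f f' g g' z :
  holoD f f' z -> holoD g g' z -> holoD (fun w => f w + g w) (fun w => f' w + g' w) z.
Proof.
  intros H H'. destruct (holoD_join _ _ _ _ _ H H') as (r & K & L & Hr & A & B).
  exists r, (K + L)%R. split; auto. now apply c11_plus.
Qed.

Lemma holoD_mult f f' g g' z :
  holoD f f' z -> holoD g g' z ->
  holoD (fun w => f w * g w) (fun w => f' w * g w + f w * g' w) z.
Proof.
  intros H H'. destruct (holoD_join _ _ _ _ _ H H') as (r & K & L & Hr & A & B).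
  exists r, (3 * K * L)%R. split; auto. now apply c11_mult.
Qed.

Lemma holoD_comp f f' g g' z :
  holoD f f' (g z) -> holoD g g' z -> holoD (fun w => f (g w)) (fun w => f' (g w) * g' w) z.
Proof.
  intros (r & K & Hr & H) (r' & L & Hr' & H').
  pose proof H' as (L0 & _ & _ & H3 & _).
  set (d := Rmin r' (r / (L + 1))).
  assert (Hd : (0 < d)%R) by (apply Rmin_pos; auto; apply Rdiv_lt_0_compat; lra).
  exists d, (K * (1 + L + L * L))%R. split; auto.
  assert (Hs : forall w, cball z d w -> cball z r' w).
  { intros w Hw. unfold cball in *. eapply Rlt_le_trans; [exact Hw | apply Rmin_l]. }
  apply c11_comp with (E := cball (g z) r).
  - intros w Hw. unfold cball. eapply Rle_lt_trans; [apply H3|].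
    + unfold cball. replace (z - z) with (RtoC 0) by ring. now rewrite Cmod_0.
    + now apply Hs.
    + assert (Hw' : (Cmod (w - z) < r / (L + 1))%R) by (eapply Rlt_le_trans; [exact Hw | apply Rmin_r]).
      pose proof (Cmod_ge_0 (w - z)).
      apply Rle_lt_trans with ((L + 1) * Cmod (w - z))%R; [nra|].
      replace r with ((L + 1) * (r / (L + 1)))%R by (field; lra).
      apply Rmult_lt_compat_l; lra.
  - exact H.
  - eapply c11_sub; [exact Hs | apply Rle_refl | exact H'].
Qed.

Lemma holoD_Cexp z : holoD Cexp Cexp z.
Proof.
  exists 1%R, (exp (Cmod z + 1) * (1 + 2 * (1 + 2 * (Cmod z + 1)) * exp (2 * (Cmod z + 1))))%R. split; [lra|].
  apply c11_Cexp; [apply cball_bounded|]. pose proof (Cmod_ge_0 z); lra.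
Qed.

Lemma holoD_inv (z : C) : z <> 0 -> holoD Cinv (fun w => - / (w * w)) z.
Proof.
  intros Hz. apply Cmod_gt_0 in Hz. set (m := (Cmod z / 2)%R).
  exists m, (/ m + / m ^ 2 + / m ^ 3)%R. split; [unfold m; lra|].
  apply c11_inv; [unfold m; lra|].
  intros w Hw. unfold cball in Hw. pose proof (Cmod_triangle_inv z w) as H.
  rewrite Cmod_minus_sym in H. unfold m in *. lra.
Qed.

Definition holo (f : C -> C) (z : C) : Prop := exists f', holoD f f' z.

Lemma holo_const a z : holo (fun _ => a) z.
Proof. eexists; apply holoD_const. Qed.
Lemma holo_id z : holo (fun w => w) z.
Proof. eexists; apply holoD_id. Qed.
Lemma holo_plus f g z : holo f z -> holo g z -> holo (fun w => f w + g w) z.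
Proof. intros [f' H] [g' H']; eexists; apply holoD_plus; eauto. Qed.
Lemma holo_mult f g z : holo f z -> holo g z -> holo (fun w => f w * g w) z.
Proof. intros [f' H] [g' H']; eexists; apply holoD_mult; eauto. Qed.
Lemma holo_comp f g z : holo f (g z) -> holo g z -> holo (fun w => f (g w)) z.
Proof. intros [f' H] [g' H']; eexists; apply holoD_comp; eauto. Qed.
Lemma holo_inv (f : C -> C) (z : C) : f z <> 0 -> holo f z -> holo (fun w => / f w) z.
Proof. intros Hf H. apply (holo_comp Cinv f); auto. eexists; now apply holoD_inv. Qed.
Lemma holo_opp f z : holo f z -> holo (fun w => - f w) z.
Proof.
  intros [f' H].
  destruct (holo_mult (fun _ => - (1)) f z (holo_const _ _) (ex_intro _ f' H)) as [h Hh].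
  exists h. eapply holoD_ext; [| |exact Hh]; intros; simpl; auto; ring.
Qed.
Lemma holo_minus f g z : holo f z -> holo g z -> holo (fun w => f w - g w) z.
Proof. intros; apply holo_plus; auto; now apply holo_opp. Qed.
Lemma holo_Cexp f z : holo f z -> holo (fun w => Cexp (f w)) z.
Proof. intros. apply (holo_comp Cexp f); auto. eexists; apply holoD_Cexp. Qed.
Lemma holo_ext_loc f g z : (exists r, (0 < r)%R /\ forall w, cball z r w -> f w = g w) -> holo f z -> holo g z.
Proof.
  intros (r & Hr & E) [f' H]. exists f'. eapply holoD_ext_loc; [|exact H]. exists r; split; auto.
Qed.

(** * The reciprocal Gamma function *)

Definition lnq (k : nat) : R := (ln (INR (k + 2)) - ln (INR (k + 1)))%R.

(** The quotient of two consecutive Gauss products. The exponential is [(1 + 1/(k+1))^(-s)]; it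
    cancels the linear term up to [O(1/k^2)], which makes the infinite product converge. *)
Definition gfac (k : nat) (s : C) : C := (1 + s * (/ INR (k + 2))%R) * Cexp (- (lnq k) * s).

Definition gfac' (k : nat) (s : C) : C :=
  ((/ INR (k + 2) - lnq k)%R - s * (/ INR (k + 2) * lnq k)%R) * Cexp (- (lnq k) * s).

(* [rgp k s] is [s (s+1) ... (s+n) / (n! n^s)] for [n = k + 1]. *)
Fixpoint rgp (k : nat) (s : C) : C :=
  match k with O => s * (s + 1) | S j => rgp j s * gfac j s end.

Fixpoint rgp' (k : nat) (s : C) : C :=
  match k with O => 2 * s + 1 | S j => rgp' j s * gfac j s + rgp j s * gfac' j s end.

(** The function [1/Gamma]: entire, so that the poles of Gamma are ordinary zeros here. *)
Definition rgam (s : C) : C := CLim_seq (fun n => rgp n s).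
Definition rgam' (s : C) : C := CLim_seq (fun n => rgp' n s).

Lemma lnq_bound (k : nat) : (/ INR (k + 2) <= lnq k <= / INR (k + 1))%R.
Proof.
  assert (H1 : (0 < INR (k + 1))%R) by (apply lt_0_INR; lia).
  assert (H2 : (INR (k + 2) = INR (k + 1) + 1)%R) by (rewrite !plus_INR; simpl; ring).
  unfold lnq. rewrite H2. set (x := INR (k + 1)) in *.
  assert (E : (ln (x + 1) - ln x = ln ((x + 1) / x))%R) by (rewrite ln_div; lra).
  split.
  - assert (E' : (ln (x + 1) - ln x = - ln (x / (x + 1)))%R) by (rewrite ln_div; lra).
    rewrite E'. pose proof (exp_ge_1_plus (ln (x / (x + 1)))) as H.
    rewrite exp_ln in H by (apply Rdiv_lt_0_compat; lra).
    replace (x / (x + 1))%R with (1 - / (x + 1))%R in * by (field; lra). lra.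
  - rewrite E. pose proof (exp_ge_1_plus (ln ((x + 1) / x))) as H.
    rewrite exp_ln in H by (apply Rdiv_lt_0_compat; lra).
    replace ((x + 1) / x)%R with (1 + / x)%R in * by (field; lra). lra.
Qed.

Lemma Cexp_diff_bounds (d : R) (s : C) (Rd : R) : (0 <= d <= 1)%R -> (Cmod s <= Rd)%R ->
  (Cmod (Cexp (- d * s)) <= exp Rd)%R.
Proof.
  intros Hd Hs. rewrite Cmod_Cexp.
  assert (H : (Re (- d * s) <= Rd)%R).
  { eapply Rle_trans; [apply Rle_abs|]. eapply Rle_trans; [apply re_le_Cmod|].
    rewrite Cmod_mult, Cmod_opp, Cmod_nonneg by lra. pose proof (Cmod_ge_0 s). nra. }
  destruct H as [H|H]; [left; now apply exp_increasing | rewrite H; lra].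
Qed.

(* The factors are [1 + u_k] with [u_k] and its Taylor data of size [O(1/k^2)] on bounded sets. *)
Lemma gfac_c11 (Rd : R) : (1 <= Rd)%R -> exists K, (0 <= K)%R /\ forall k,
  c11 (fun w => Cmod w <= Rd)%R (fun s => gfac k s - 1) (gfac' k)
      (K * (/ INR (k + 1) - / INR (k + 2)))%R.
Proof.
  intros HR.
  set (E1 := exp Rd). set (E2 := exp (2 * Rd)).
  set (K1 := (E1 * (4 * E2 * (1 + Rd) + 1))%R).
  set (K2 := (2 * E1 * (1 + Rd))%R).
  assert (HE1 : (1 <= E1)%R) by (unfold E1; pose proof (exp_ge_1_plus Rd); lra).
  assert (HE2 : (1 <= E2)%R) by (unfold E2; pose proof (exp_ge_1_plus (2 * Rd)); lra).
  assert (HK1 : (0 <= K1)%R) by (unfold K1; apply Rmult_le_pos; nra).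
  assert (HK2 : (0 <= K2)%R) by (unfold K2; nra).
  (* The first entry covers the derivative, the differences and the remainder; the second bounds
     [gfac k w - 1] itself, through its expansion at 0. *)
  exists (Rmax (2 * K1 * (1 + 2 * Rd) + K2) ((2 * K1 * Rd + 1) * Rd)).
  assert (HKm : (0 <= 2 * K1 * (1 + 2 * Rd) + K2)%R) by nra.
  split; [eapply Rle_trans; [|apply Rmax_l]; exact HKm|].
  intros k.
  pose proof (lnq_bound k) as Hd. set (d := lnq k) in *. set (a := (/ INR (k + 2))%R) in *.
  assert (H1 : (0 < INR (k + 1))%R) by (apply lt_0_INR; lia).
  assert (H2 : (INR (k + 2) = INR (k + 1) + 1)%R) by (rewrite !plus_INR; simpl; ring).
  assert (Hk1 : (1 <= INR (k + 1))%R) by (replace 1%R with (INR 1) by reflexivity; apply le_INR; lia).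
  set (e := (/ INR (k + 1) - a)%R).
  assert (Ha : (0 < a)%R) by (apply Rinv_0_lt_compat; lra).
  assert (Hb : (/ INR (k + 1) <= 1)%R) by (rewrite <- Rinv_1; apply Rinv_le_contravar; lra).
  assert (Hee : (e = a * / INR (k + 1))%R) by (unfold e, a; rewrite H2; field; lra).
  assert (Hb2 : (/ INR (k + 1) <= 2 * a)%R).
  { unfold a. rewrite H2. apply Rmult_le_reg_r with (INR (k + 1) * (INR (k + 1) + 1))%R; [nra|].
    field_simplify; nra. }
  assert (He0 : (0 < e)%R) by (rewrite Hee; apply Rmult_lt_0_compat; auto; now apply Rinv_0_lt_compat).
  assert (Had : (a * d <= e)%R) by (rewrite Hee; apply Rmult_le_compat_l; lra).
  assert (Hdd : (d * d <= 2 * e)%R) by (rewrite Hee; nra).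
  assert (Hda : (Rabs (a - d) <= e)%R) by (apply Rabs_le; unfold e; lra).
  assert (HD : (0 <= d <= 1)%R) by lra.
  assert (HC4 : forall w v, (Cmod w <= Rd)%R -> (Cmod v <= Rd)%R ->
    (Cmod (gfac k v - 1 - (gfac k w - 1) - (v - w) * gfac' k w) <= 2 * K1 * e * Cmod (v - w) ^ 2)%R).
  { intros w v Hw Hv. pose (h := v - w).
    (* With the exponential at [w] factored out, only second-order terms in [h] are left, each with
       a coefficient of size [d^2] or [a d], that is [O(e)]. *)
    assert (EQ : gfac k v - 1 - (gfac k w - 1) - (v - w) * gfac' k w =
      Cexp (- d * w) * ((1 + v * a) * (Cexp (- d * h) - 1 - (- d * h)) - (a * d)%R * h ^ 2)).
    { unfold gfac, gfac'. fold d a.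
      replace (Cexp (- d * v)) with (Cexp (- d * w) * Cexp (- d * h)) by (rewrite <- Cexp_plus; f_equal; unfold h; ring).
      rewrite RtoC_minus, !RtoC_mult. unfold h. ring. }
    rewrite EQ, Cmod_mult. fold h.
    assert (Hh : (Cmod h <= 2 * Rd)%R) by (eapply Rle_trans; [apply Cmod_triangle_minus|]; lra).
    pose proof (Cmod_ge_0 h) as Hh0.
    assert (T1 : (Cmod (Cexp (- d * h) - 1 - (- d * h)) <= 2 * (2 * e * Cmod h ^ 2) * E2)%R).
    { eapply Rle_trans; [apply Cexp_taylor2_bound|]. rewrite Cmod_mult, Cmod_opp, (Cmod_nonneg d) by lra.
      assert (exp (d * Cmod h) <= E2)%R.
      { unfold E2. destruct (Req_dec (d * Cmod h) (2 * Rd)) as [->|N]; [lra|left; apply exp_increasing; nra]. }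
      pose proof (exp_pos (d * Cmod h)).
      assert ((d * Cmod h) ^ 2 <= 2 * e * Cmod h ^ 2)%R.
      { replace ((d * Cmod h) ^ 2)%R with (d * d * Cmod h ^ 2)%R by ring. apply Rmult_le_compat_r; [apply pow2_ge_0 | auto]. }
      pose proof (pow2_ge_0 (d * Cmod h)).
      apply Rmult_le_compat; lra. }
    assert (T2 : (Cmod (1 + v * a) <= 1 + Rd)%R).
    { eapply Rle_trans; [apply Cmod_triangle|]. rewrite Cmod_1, Cmod_mult, (Cmod_nonneg a) by lra.
      assert (a <= 1)%R by lra. pose proof (Cmod_ge_0 v). nra. }
    replace (2 * K1 * e * Cmod h ^ 2)%R with (E1 * ((1 + Rd) * (2 * (2 * e * Cmod h ^ 2) * E2) * 2 + 2 * e * Cmod h ^ 2))%R by (unfold K1; ring).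
    apply Rmult_le_compat; try apply Cmod_ge_0; [now apply Cexp_diff_bounds|].
    eapply Rle_trans; [apply Cmod_triangle_minus|]. rewrite !Cmod_mult, Cmod_pow, (Cmod_nonneg (a * d)) by nra.
    pose proof (pow2_ge_0 (Cmod h)).
    assert (a * d * Cmod h ^ 2 <= e * Cmod h ^ 2)%R by (apply Rmult_le_compat_r; auto).
    assert (Cmod (1 + v * a) * Cmod (Cexp (- d * h) - 1 - - d * h) <= (1 + Rd) * (2 * (2 * e * Cmod h ^ 2) * E2))%R
      by (apply Rmult_le_compat; auto using Cmod_ge_0).
    assert (0 <= (1 + Rd) * (2 * (2 * e * Cmod h ^ 2) * E2))%R by (apply Rmult_le_pos; [lra|]; repeat apply Rmult_le_pos; lra).
    assert (0 <= e * Cmod h ^ 2)%R by nra. lra. }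
  assert (HC2 : forall w, (Cmod w <= Rd)%R -> (Cmod (gfac' k w) <= K2 * e)%R).
  { intros w Hw. unfold gfac'. fold d a. rewrite Cmod_mult.
    replace (K2 * e)%R with ((2 * e * (1 + Rd)) * E1)%R by (unfold K2; ring).
    apply Rmult_le_compat; try apply Cmod_ge_0; [|now apply Cexp_diff_bounds].
    eapply Rle_trans; [apply Cmod_triangle_minus|]. rewrite Cmod_mult, !Cmod_R, (Rabs_pos_eq (a * d)) by nra.
    pose proof (Cmod_ge_0 w). assert (Cmod w * (a * d) <= Rd * e)%R by (apply Rmult_le_compat; nra). nra. }
  assert (HC3 : forall w v, (Cmod w <= Rd)%R -> (Cmod v <= Rd)%R ->
    (Cmod (gfac k v - 1 - (gfac k w - 1)) <= (2 * K1 * (2 * Rd) + K2) * e * Cmod (v - w))%R).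
  { intros w v Hw Hv.
    replace (gfac k v - 1 - (gfac k w - 1)) with
      ((gfac k v - 1 - (gfac k w - 1) - (v - w) * gfac' k w) + (v - w) * gfac' k w) by ring.
    eapply Rle_trans; [apply Cmod_triangle|]. rewrite (Cmod_mult (v - w)).
    specialize (HC4 w v Hw Hv). specialize (HC2 w Hw).
    assert (Hh : (Cmod (v - w) <= 2 * Rd)%R) by (eapply Rle_trans; [apply Cmod_triangle_minus|]; lra).
    set (h := Cmod (v - w)) in *. assert (0 <= h)%R by apply Cmod_ge_0.
    assert (h * Cmod (gfac' k w) <= h * (K2 * e))%R by (apply Rmult_le_compat_l; auto).
    assert (2 * K1 * e * h ^ 2 <= 2 * K1 * e * (2 * Rd * h))%R.
    { apply Rmult_le_compat_l; [|nra]. apply Rmult_le_pos; lra. }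
    nra. }
  set (M := Rmax (2 * K1 * (1 + 2 * Rd) + K2) ((2 * K1 * Rd + 1) * Rd)).
  assert (M1 : (2 * K1 * (1 + 2 * Rd) + K2 <= M)%R) by apply Rmax_l.
  assert (M2 : ((2 * K1 * Rd + 1) * Rd <= M)%R) by apply Rmax_r.
  repeat split.
  - nra.
  - intros w Hw. cbv beta in Hw.
    assert (G0 : gfac k 0 - 1 = 0).
    { unfold gfac. rewrite Cmult_0_l, Cmult_0_r, Cexp_0. ring. }
    assert (G0' : gfac' k 0 = (a - d)%R).
    { unfold gfac'. fold d a. rewrite Cmult_0_l, Cmult_0_r, Cexp_0. ring. }
    assert (Z0 : (Cmod 0 <= Rd)%R) by (rewrite Cmod_0; lra).
    pose proof (HC4 0 w Z0 Hw) as H. rewrite G0, G0' in H.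
    replace (gfac k w - 1) with ((gfac k w - 1 - 0 - (w - 0) * (a - d)%R) + w * (a - d)%R) by ring.
    eapply Rle_trans; [apply Cmod_triangle|]. rewrite (Cmod_mult w), Cmod_R.
    replace (w - 0) with w in * by ring. pose proof (Cmod_ge_0 w).
    assert (Cmod w * Rabs (a - d) <= Rd * e)%R by (apply Rmult_le_compat; auto using Rabs_pos).
    assert (2 * K1 * e * Cmod w ^ 2 <= 2 * K1 * e * (Rd * Rd))%R by (apply Rmult_le_compat_l; [apply Rmult_le_pos; lra | nra]).
    assert ((2 * K1 * Rd + 1) * Rd * e <= M * e)%R by (apply Rmult_le_compat_r; lra). nra.
  - intros w Hw. specialize (HC2 w Hw).
    assert ((2 * K1 * (1 + 2 * Rd) + K2) * e <= M * e)%R by (apply Rmult_le_compat_r; lra).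
    assert (0 <= 2 * K1 * (1 + 2 * Rd) * e)%R by (apply Rmult_le_pos; [apply Rmult_le_pos|]; lra). nra.
  - intros w v Hw Hv. eapply Rle_trans; [apply HC3; auto|]. apply Rmult_le_compat_r; [apply Cmod_ge_0|].
    apply Rmult_le_compat_r; lra.
  - intros w v Hw Hv. eapply Rle_trans; [apply HC4; auto|]. apply Rmult_le_compat_r; [apply pow2_ge_0|].
    apply Rmult_le_compat_r; [lra|]. nra.
Qed.

(** One more factor multiplies the constant by at most [1 + 3 C0 e_k <= exp (3 C0 e_k)]. Since the
    [e_k] telescope to at most 1, the constants stay below [B exp (3 C0)]. *)
Lemma rgp_c11 (Rd : R) : (1 <= Rd)%R -> exists K, (0 <= K)%R /\ forall k,
  c11 (fun w => Cmod w <= Rd)%R (rgp k) (rgp' k) K /\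
  (forall w, (Cmod w <= Rd)%R ->
     (Cmod (rgp (S k) w - rgp k w) <= K * (/ INR (k + 1) - / INR (k + 2)))%R /\
     (Cmod (rgp' (S k) w - rgp' k w) <= K * (/ INR (k + 1) - / INR (k + 2)))%R).
Proof.
  intros HR. destruct (gfac_c11 Rd HR) as (C0 & HC0 & HG).
  assert (Base : exists B, c11 (fun w => Cmod w <= Rd)%R (rgp 0) (rgp' 0) B).
  { eexists. eapply c11_ext with (f := fun s => s * (s + 1)) (f' := fun s => 1 * (s + 1) + s * (1 + 0)).
    - reflexivity.
    - intros; simpl; ring.
    - apply c11_mult; [apply c11_id; [intros w Hw; exact Hw | lra]|].
      apply c11_plus; [apply c11_id; [intros w Hw; exact Hw | lra] | apply c11_const]. }
  destruct Base as [B HB].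
  assert (B0 : (0 <= B)%R) by apply HB.
  set (e := fun k : nat => (/ INR (k + 1) - / INR (k + 2))%R).
  assert (He : forall k, (0 <= e k)%R).
  { intros k. unfold e. assert (/ INR (k + 2) <= / INR (k + 1))%R; [|lra].
    apply Rinv_le_contravar; [apply lt_0_INR; lia | apply le_INR; lia]. }
  set (L := fun k : nat => (B * exp (3 * C0 * (1 - / INR (k + 1))))%R).
  assert (HL : forall k, c11 (fun w => Cmod w <= Rd)%R (rgp k) (rgp' k) (L k)).
  { induction k.
    - unfold L. simpl (0 + 1)%nat. simpl INR. rewrite Rinv_1, Rminus_diag, Rmult_0_r, exp_0, Rmult_1_r. exact HB.
    - eapply c11_sub; [intros w Hw; exact Hw| |].
      2:{ eapply c11_ext; [| |apply c11_plus; [exact IHk | apply c11_mult; [exact IHk | apply (HG k)]]].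
          - intros w _; simpl; ring.
          - intros w _; simpl; ring. }
      fold (e k). unfold L.
      replace (S k + 1)%nat with (k + 2)%nat by lia.
      replace (3 * C0 * (1 - / INR (k + 2)))%R with (3 * C0 * (1 - / INR (k + 1)) + 3 * C0 * e k)%R by (unfold e; ring).
      rewrite exp_plus. pose proof (exp_ge_1_plus (3 * C0 * e k)).
      assert (0 <= B * exp (3 * C0 * (1 - / INR (k + 1))))%R by (apply Rmult_le_pos; auto; left; apply exp_pos).
      nra. }
  set (K := (B * exp (3 * C0))%R).
  assert (HLK : forall k, (L k <= K)%R).
  { intros k. unfold L, K. apply Rmult_le_compat_l; auto.
    assert (0 < / INR (k + 1))%R by (apply Rinv_0_lt_compat, lt_0_INR; lia).
    assert (3 * C0 * (1 - / INR (k + 1)) <= 3 * C0)%R by nra.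
    destruct (Req_dec (3 * C0 * (1 - / INR (k + 1))) (3 * C0)) as [->|N]; [lra|].
    left; apply exp_increasing; lra. }
  assert (HK0 : (0 <= K)%R) by (eapply Rle_trans; [|apply (HLK O)]; apply (HL O)).
  exists (K + 2 * K * C0)%R. split; [nra|]. intros k.
  assert (HLk : c11 (fun w => Cmod w <= Rd)%R (rgp k) (rgp' k) K) by (eapply c11_sub; [intros w Hw; exact Hw | apply (HLK k) | apply HL]).
  split.
  - eapply c11_sub; [intros w Hw; exact Hw | | exact HLk]. nra.
  - intros w Hw. destruct HLk as (_ & F1 & F2 & _). destruct (HG k) as (_ & G1 & G2 & _).
    specialize (F1 w Hw); specialize (F2 w Hw); specialize (G1 w Hw); specialize (G2 w Hw).
    fold (e k) in *. pose proof (He k).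
    assert (MM : forall a b A B, (Cmod a <= A)%R -> (Cmod b <= B)%R -> (Cmod (a * b) <= A * B)%R).
    { intros. rewrite Cmod_mult. apply Rmult_le_compat; auto; apply Cmod_ge_0. }
    assert (0 <= K * e k)%R by nra.
    split; simpl.
    + replace (rgp k w * gfac k w - rgp k w) with (rgp k w * (gfac k w - 1)) by ring.
      pose proof (MM _ _ _ _ F1 G1). assert (0 <= K * (C0 * e k))%R by nra. nra.
    + replace (rgp' k w * gfac k w + rgp k w * gfac' k w - rgp' k w) with
        (rgp' k w * (gfac k w - 1) + rgp k w * gfac' k w) by ring.
      eapply Rle_trans; [apply Cmod_triangle|].
      pose proof (MM _ _ _ _ F1 G2). pose proof (MM _ _ _ _ F2 G1). nra.
Qed.

Lemma rgp_cv (s : C) : cv (fun n => rgp n s) (rgam s).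
Proof.
  assert (HR : (1 <= Cmod s + 1)%R) by (pose proof (Cmod_ge_0 s); lra).
  destruct (rgp_c11 _ HR) as (K & HK & H).
  destruct (cv_telescope_bound (fun n => rgp n s) K) as [l Hl].
  - intros n. apply H; lra.
  - unfold rgam. now rewrite (cv_CLim _ _ Hl).
Qed.

Lemma rgp'_cv (s : C) : cv (fun n => rgp' n s) (rgam' s).
Proof.
  assert (HR : (1 <= Cmod s + 1)%R) by (pose proof (Cmod_ge_0 s); lra).
  destruct (rgp_c11 _ HR) as (K & HK & H).
  destruct (cv_telescope_bound (fun n => rgp' n s) K) as [l Hl].
  - intros n. apply H; lra.
  - unfold rgam'. now rewrite (cv_CLim _ _ Hl).
Qed.

(** Every clause of [c11] is a closed inequality between values at one or two points, so pointwise
    convergence with a common constant is enough. *)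
Lemma c11_limit (D : C -> Prop) (f f' : nat -> C -> C) (g g' : C -> C) (K : R) :
  (forall n, c11 D (f n) (f' n) K) ->
  (forall w, D w -> cv (fun n => f n w) (g w)) ->
  (forall w, D w -> cv (fun n => f' n w) (g' w)) -> c11 D g g' K.
Proof.
  intros H Hg Hg'. repeat split.
  - apply (H O).
  - intros w Hw. eapply cv_Cmod_le; [now apply Hg|]. exists O; intros n _. now apply (H n).
  - intros w Hw. eapply cv_Cmod_le; [now apply Hg'|]. exists O; intros n _. now apply (H n).
  - intros w v Hw Hv. eapply cv_Cmod_le; [apply cv_minus; [apply (Hg v Hv) | apply (Hg w Hw)]|].
    exists O; intros n _. now apply (H n).
  - intros w v Hw Hv. eapply cv_Cmod_le.
    + apply cv_minus; [apply cv_minus; [apply (Hg v Hv) | apply (Hg w Hw)]|].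
      apply cv_mult; [apply cv_const | apply (Hg' w Hw)].
    + exists O; intros n _. now apply (H n).
Qed.

Lemma rgam_c11 (Rd : R) : (1 <= Rd)%R -> exists K, c11 (fun w => Cmod w <= Rd)%R rgam rgam' K.
Proof.
  intros HR. destruct (rgp_c11 _ HR) as (K & HK & H). exists K.
  apply c11_limit with (f := rgp) (f' := rgp').
  - apply H.
  - intros; apply rgp_cv.
  - intros; apply rgp'_cv.
Qed.

Lemma holoD_rgam (s : C) : holoD rgam rgam' s.
Proof.
  assert (HR : (1 <= Cmod s + 1)%R) by (pose proof (Cmod_ge_0 s); lra).
  destruct (rgam_c11 _ HR) as [K HK]. exists 1%R, K. split; [lra|].
  eapply c11_sub; [|apply Rle_refl | exact HK]. intros w Hw; simpl. now apply cball_bounded.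
Qed.

Lemma poch_S_shift (a : C) (n : nat) : poch a (S n) = a * poch (a + 1) n.
Proof.
  induction n; [simpl; ring|].
  change (poch a (S (S n))) with (poch a (S n) * (a + INR (S n))). rewrite IHn.
  simpl poch. rewrite S_INR, RtoC_plus. ring.
Qed.

Lemma rgp_poch (k : nat) (s : C) :
  rgp k s = poch s (S (S k)) * Cexp (- (s * ln (INR (S k)))) / INR (fact (S k)).
Proof.
  induction k.
  - simpl. rewrite ln_1. replace (- (s * 0)) with (RtoC 0) by ring. rewrite Cexp_0. field.
  - change (rgp (S k) s) with (rgp k s * gfac k s). rewrite IHk.
    change (poch s (S (S (S k)))) with (poch s (S (S k)) * (s + INR (S (S k)))).
    replace (fact (S (S k))) with (S (S k) * fact (S k))%nat by reflexivity.
    rewrite mult_INR, RtoC_mult. unfold gfac.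
    replace (k + 2)%nat with (S (S k)) by lia.
    assert (HF : RtoC (INR (fact (S k))) <> 0) by (apply RtoC_neq_0, INR_fact_neq_0).
    assert (HN : RtoC (INR (S (S k))) <> 0) by (apply RtoC_neq_0, not_0_INR; lia).
    rewrite RtoC_inv by (apply not_0_INR; lia).
    replace (Cexp (- (s * ln (INR (S (S k)))))) with (Cexp (- (s * ln (INR (S k)))) * Cexp (- lnq k * s)).
    + field. split; auto.
    + rewrite <- Cexp_plus. f_equal. unfold lnq.
      replace (k + 2)%nat with (S (S k)) by lia. replace (k + 1)%nat with (S k) by lia.
      rewrite RtoC_minus. ring.
Qed.

Lemma rgp_gauss (k : nat) (s : C) :
  INR (fact (S k)) * Cexp (s * ln (INR (S k))) / poch s (S (S k)) = / rgp k s.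
Proof.
  rewrite rgp_poch. unfold Cdiv. rewrite !Cinv_total_mult, Cinv_inv_total, Cexp_opp, Cinv_inv_total. ring.
Qed.

Lemma poch_zero (m n : nat) : (m < n)%nat -> poch (- INR m) n = 0.
Proof.
  induction n; intros H; [lia|]. simpl. destruct (Nat.eq_dec m n) as [->|N].
  - ring.
  - rewrite IHn by lia. ring.
Qed.

Lemma rgam_pole (m : nat) : rgam (- INR m) = 0.
Proof.
  symmetry. apply (cv_unique (fun n => rgp n (- INR m))); [|apply rgp_cv].
  eapply cv_ext_loc; [|apply cv_const]. exists m. intros n Hn. simpl.
  rewrite rgp_poch, poch_zero by lia. unfold Cdiv. ring.
Qed.

(** With [N = n + 1], the Gauss products at [s] and at [s + 1] differ by the factor
    [s N / (s + 1 + N)], and [N / (s + 1 + N)] tends to 1. *)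
Lemma rgam_rec (s : C) : rgam s = s * rgam (s + 1).
Proof.
  apply (cv_unique (fun n => rgp n s)); [apply rgp_cv|].
  assert (H1 : cv (fun n => s * rgp n (s + 1) * (INR (S n) / (s + 1 + INR (S n)))) (s * rgam (s + 1) * 1)).
  { apply cv_mult; [apply cv_mult; [apply cv_const | apply rgp_cv]|].
    assert (HI : is_lim_seq (fun n => / INR (S n))%R 0).
    { apply (is_lim_seq_inv (fun n => INR (S n)) p_infty); [|discriminate].
      apply (is_lim_seq_incr_1 INR p_infty), is_lim_seq_INR. }
    apply cv_ext with (u := fun n => / (1 + (s + 1) * RtoC (/ INR (S n)))).
    - intros n. assert (HN : RtoC (INR (S n)) <> 0) by (apply RtoC_neq_0, not_0_INR; lia).
      rewrite RtoC_inv by (apply not_0_INR; lia).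
      replace (1 + (s + 1) * / INR (S n)) with ((s + 1 + INR (S n)) * / INR (S n)) by (field; auto).
      rewrite Cinv_total_mult, Cinv_inv_total. unfold Cdiv; ring.
    - apply cv_eq with (/ (1 + (s + 1) * 0)); [field; replace (1 + (s + 1) * 0) with (RtoC 1) by ring; apply RtoC_neq_0; lra|].
      apply cv_inv.
      + replace (1 + (s + 1) * 0) with (RtoC 1) by ring. apply RtoC_neq_0; lra.
      + apply cv_plus; [apply cv_const|]. apply cv_mult; [apply cv_const|]. now apply cv_RtoC. }
  rewrite Cmult_1_r in H1. eapply cv_ext_loc; [|exact H1].
  (* Beyond the modulus of [s + 1] the denominator [s + 1 + (n + 1)] cannot vanish. *)
  destruct (nfloor_ex (Cmod (s + 1)) (Cmod_ge_0 _)) as [N [_ HN]].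
  exists (S N). intros n Hn.
  rewrite !rgp_poch, (poch_S_shift s).
  assert (HD : s + 1 + INR (S n) <> 0).
  { intros E. assert (E' : s + 1 = - INR (S n)) by (replace (s + 1) with (s + 1 + INR (S n) - INR (S n)) by ring; rewrite E; ring).
    rewrite E', Cmod_opp, Cmod_nonneg in HN by apply pos_INR.
    assert (INR (S N) < INR (S n))%R by (apply lt_INR; lia). rewrite S_INR in H. lra. }
  change (poch (s + 1) (S (S n))) with (poch (s + 1) (S n) * (s + 1 + INR (S n))).
  assert (HF : RtoC (INR (fact (S n))) <> 0) by (apply RtoC_neq_0, INR_fact_neq_0).
  replace (Cexp (- ((s + 1) * ln (INR (S n))))) with (Cexp (- (s * ln (INR (S n)))) * / INR (S n)).
  - assert (HN' : RtoC (INR (S n)) <> 0) by (apply RtoC_neq_0, not_0_INR; lia). field; auto.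
  - replace (- ((s + 1) * ln (INR (S n)))) with (- (s * ln (INR (S n))) + (- (ln (INR (S n))))) by ring.
    rewrite Cexp_plus. f_equal. rewrite <- RtoC_opp, Cexp_RtoC, exp_Ropp, exp_ln by (apply lt_0_INR; lia).
    now rewrite RtoC_inv by (apply not_0_INR; lia).
Qed.

Lemma rgam_1 : rgam 1 = 1.
Proof.
  apply (cv_unique (fun n => rgp n 1)); [apply rgp_cv|].
  assert (HP : forall n, poch 1 n = INR (fact n)).
  { induction n; [reflexivity|]. simpl poch. rewrite IHn.
    replace (fact (S n)) with (S n * fact n)%nat by reflexivity. rewrite mult_INR, RtoC_mult, S_INR, RtoC_plus. ring. }
  apply cv_ext with (u := fun n => 1 + RtoC (/ INR (S n))).
  - intros n. rewrite rgp_poch, HP.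
    replace (fact (S (S n))) with (S (S n) * fact (S n))%nat by reflexivity.
    rewrite mult_INR, RtoC_mult.
    assert (HF : RtoC (INR (fact (S n))) <> 0) by (apply RtoC_neq_0, INR_fact_neq_0).
    assert (HN' : RtoC (INR (S n)) <> 0) by (apply RtoC_neq_0, not_0_INR; lia).
    replace (- (1 * ln (INR (S n)))) with (RtoC (- ln (INR (S n)))) by (rewrite RtoC_opp; ring).
    rewrite Cexp_RtoC, exp_Ropp, exp_ln by (apply lt_0_INR; lia).
    rewrite RtoC_inv by (apply not_0_INR; lia). rewrite (S_INR (S n)), RtoC_plus. field; auto.
  - apply cv_eq with (1 + 0); [ring|]. apply cv_plus; [apply cv_const|]. apply cv_RtoC.
    apply (is_lim_seq_inv (fun n => INR (S n)) p_infty); [|discriminate].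
    apply (is_lim_seq_incr_1 INR p_infty), is_lim_seq_INR.
Qed.

(** Convexity: the tangent inequalities at [x L], towards 0 and towards [L], are averaged with
    weights [1 - x] and [x]. *)
Lemma exp_convex_bound (x L : R) : (0 <= x <= 1)%R -> (exp (x * L) <= 1 - x + x * exp L)%R.
Proof.
  intros Hx.
  pose proof (exp_ge_1_plus (- (x * L))) as H1. pose proof (exp_ge_1_plus (L - x * L)) as H2.
  pose proof (exp_pos (x * L)) as P.
  assert (E1 : (exp (x * L) * exp (- (x * L)) = 1)%R) by (rewrite <- exp_plus, Rplus_opp_r; apply exp_0).
  assert (E2 : (exp (x * L) * exp (L - x * L) = exp L)%R) by (rewrite <- exp_plus; f_equal; ring).
  assert (A : (exp (x * L) * (1 + - (x * L)) <= 1)%R) by (rewrite <- E1; apply Rmult_le_compat_l; lra).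
  assert (B : (exp (x * L) * (1 + (L - x * L)) <= exp L)%R) by (rewrite <- E2; apply Rmult_le_compat_l; lra).
  set (e := exp (x * L)) in *.
  assert ((1 - x) * (e * (1 + - (x * L))) + x * (e * (1 + (L - x * L))) = e)%R by ring.
  nra.
Qed.

Lemma exp_lnq (k : nat) : exp (lnq k) = (1 + / INR (k + 1))%R.
Proof.
  unfold lnq, Rminus. assert (H1 : (0 < INR (k + 1))%R) by (apply lt_0_INR; lia).
  assert (H2 : (0 < INR (k + 2))%R) by (apply lt_0_INR; lia).
  rewrite exp_plus, exp_Ropp, !exp_ln by auto.
  replace (INR (k + 2)) with (INR (k + 1) + 1)%R by (rewrite !plus_INR; simpl; ring). field; lra.
Qed.

Lemma Cmod_ge_Re (z : C) : (Re z <= Cmod z)%R.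
Proof. eapply Rle_trans; [apply Rle_abs | apply re_le_Cmod]. Qed.

(** By convexity the linear factor [1 + s/(k+2)] has modulus at least [exp (Re s * lnq (k+1))], so
    at each step the old exponential is cancelled and the next one appears. The exponent is
    positive, hence the products stay above [Cmod s], a bound that survives the limit and excludes
    zeros in the strip. *)
Lemma rgp_lower_bound (s : C) (k : nat) : (0 < Re s <= 1)%R ->
  (Cmod s * exp (Re s * lnq k) <= Cmod (rgp k s))%R.
Proof.
  intros Hs. set (x := Re s) in *.
  assert (HB : forall k, (exp (x * lnq k) <= 1 + x * / INR (k + 1))%R).
  { intros j. eapply Rle_trans; [apply exp_convex_bound; lra|]. rewrite exp_lnq. lra. }
  pose proof (Cmod_ge_0 s).
  induction k.
  - simpl. rewrite Cmod_mult. apply Rmult_le_compat_l; auto.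
    eapply Rle_trans; [apply HB|]. simpl INR. rewrite Rinv_1.
    eapply Rle_trans; [|apply Cmod_ge_Re]. unfold x, Re; simpl. lra.
  - simpl. rewrite Cmod_mult. unfold gfac. rewrite Cmod_mult, Cmod_Cexp.
    replace (Re (- lnq k * s)) with (- (x * lnq k))%R by (unfold x, Re; simpl; ring).
    apply Rle_trans with (Cmod s * (1 + x * / INR (k + 2)))%R.
    + apply Rmult_le_compat_l; auto. replace (k + 2)%nat with (S k + 1)%nat by lia. apply HB.
    + assert (H1 : (1 + x * / INR (k + 2) <= Cmod (1 + s * (/ INR (k + 2))%R))%R).
      { eapply Rle_trans; [|apply Cmod_ge_Re]. unfold x, Re; simpl. lra. }
      assert (E : (exp (x * lnq k) * exp (- (x * lnq k)) = 1)%R) by (rewrite <- exp_plus, Rplus_opp_r; apply exp_0).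
      pose proof (exp_pos (- (x * lnq k))). pose proof (exp_pos (x * lnq k)).
      replace (Cmod s * (1 + x * / INR (k + 2)))%R with
        (Cmod s * exp (x * lnq k) * ((1 + x * / INR (k + 2)) * exp (- (x * lnq k))))%R
        by (transitivity (Cmod s * (1 + x * / INR (k + 2)) * (exp (x * lnq k) * exp (- (x * lnq k))))%R; [ring | rewrite E; ring]).
      assert (0 < / INR (k + 2))%R by (apply Rinv_0_lt_compat, lt_0_INR; lia).
      apply Rmult_le_compat; auto.
      * apply Rmult_le_pos; lra.
      * apply Rmult_le_pos; nra.
      * apply Rmult_le_compat_r; lra.
Qed.

Lemma rgam_neq_0_strip (s : C) : (0 < Re s <= 1)%R -> rgam s <> 0.
Proof.
  intros Hs E.
  assert (H : is_lim_seq (fun n => Cmod (rgp n s)) (Cmod (rgam s))) by apply is_lim_Cmod, rgp_cv.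
  rewrite E, Cmod_0 in H.
  assert (Hc : (Re s <= Cmod s)%R) by apply Cmod_ge_Re.
  assert (H' : Rbar_le (Cmod s) 0%R).
  { refine (is_lim_seq_le _ _ (Finite _) (Finite _) _ (is_lim_seq_const (Cmod s)) H).
    intros n. eapply Rle_trans; [|apply rgp_lower_bound; auto].
    assert (1 <= exp (Re s * lnq n))%R; [|nra].
    rewrite <- exp_0. pose proof (lnq_bound n).
    assert (0 < / INR (n + 2))%R by (apply Rinv_0_lt_compat, lt_0_INR; lia).
    left; apply exp_increasing. nra. }
  simpl in H'. lra.
Qed.

(** The functional equation carries the nonvanishing from the strip to the right half-plane, then
    step by step to the left, where each step can only add a zero at one of the excluded points. *)
Lemma rgam_neq_0 (s : C) : (forall m : nat, s <> - INR m) -> rgam s <> 0.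
Proof.
  assert (HR : forall N (s : C), (0 < Re s <= INR N)%R -> rgam s <> 0).
  { induction N; intros t Ht; [simpl in Ht; lra|].
    destruct (Rle_dec (Re t) 1) as [H1|H1]; [apply rgam_neq_0_strip; lra|].
    intros E. apply (IHN (t - 1)).
    - rewrite S_INR in Ht. unfold Re in *; simpl in *. lra.
    - rewrite rgam_rec. replace (t - 1 + 1) with t by ring. rewrite E. ring. }
  assert (HP : forall s : C, (0 < Re s)%R -> rgam s <> 0).
  { intros t Ht. destruct (nfloor_ex (Re t) ltac:(lra)) as [N HN].
    apply (HR (S N)). rewrite S_INR. lra. }
  assert (HL : forall N (s : C), (- INR N < Re s)%R -> (forall m : nat, s <> - INR m) -> rgam s <> 0).
  { induction N; intros t Ht Hm; [apply HP; simpl in Ht; lra|].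
    rewrite rgam_rec. apply Cmult_neq_0.
    - intros E. apply (Hm O). rewrite E. simpl. ring.
    - apply IHN.
      + rewrite S_INR in Ht. unfold Re in *; simpl in *. lra.
      + intros m E. apply (Hm (S m)). rewrite S_INR, RtoC_plus.
        replace t with (t + 1 - 1) by ring. rewrite E. ring. }
  intros Hm. destruct (nfloor_ex (Rabs (Re s)) (Rabs_pos _)) as [N HN].
  apply (HL (S N)); auto. rewrite S_INR. pose proof (Rabs_maj2 (Re s)). lra.
Qed.

Lemma rgam_neq_0_Re (s : C) : (0 < Re s)%R -> rgam s <> 0.
Proof.
  intros H. apply rgam_neq_0. intros m E. rewrite E in H. unfold Re in H; simpl in H.
  pose proof (pos_INR m). lra.
Qed.

Lemma not_pole_rgp (s : C) (m n : nat) : s = - INR m -> (m < S (S n))%nat -> rgp n s = 0.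
Proof. intros -> H. rewrite rgp_poch, poch_zero by auto. unfold Cdiv. ring. Qed.

(** At a pole the Gauss products are eventually 0, and with [/ 0 = 0] both sides are 0; elsewhere
    the inverse passes to the limit. *)
Lemma Cgamma_rgam (s : C) : Cgamma s = / rgam s.
Proof.
  unfold Cgamma. apply cv_CLim. apply cv_decr_1.
  apply cv_ext with (u := fun n => / rgp n s).
  - intros n. symmetry. apply rgp_gauss.
  - destruct (Classical_Prop.classic (exists m : nat, s = - INR m)) as [[m Hm]|Hm].
    + rewrite (f_equal rgam Hm), rgam_pole, Cinv_0.
      eapply cv_ext_loc; [|apply cv_const]. exists m. intros n Hn.
      rewrite (not_pole_rgp s m n Hm) by lia. now rewrite Cinv_0.
    + apply cv_inv; [|apply rgp_cv]. apply rgam_neq_0. intros m E. apply Hm. now exists m.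
Qed.

(** * Real arguments: digamma, reflection, duplication *)

Fixpoint rsum (u : nat -> R) (n : nat) : R :=
  match n with O => 0%R | S k => (rsum u k + u k)%R end.

Lemma rsum_S (u : nat -> R) n : rsum u (S n) = (rsum u n + u n)%R.
Proof. reflexivity. Qed.

Lemma rsum_ext (u v : nat -> R) n : (forall k, (k < n)%nat -> u k = v k) -> rsum u n = rsum v n.
Proof. induction n; intros H; simpl; auto. rewrite IHn, H; auto. Qed.

Lemma rsum_shift (u : nat -> R) n : rsum u (S n) = (u O + rsum (fun k => u (S k)) n)%R.
Proof. induction n; [simpl; ring|]. simpl in *. rewrite IHn. ring. Qed.

Definition rg (x : R) : R := Re (rgam (RtoC x)).
Definition rg' (x : R) : R := Re (rgam' (RtoC x)).
(** The digamma function; the sign is due to [rg] being the reciprocal of Gamma. *)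
Definition psi (x : R) : R := (- rg' x / rg x)%R.

Lemma gfac_real k x : gfac k (RtoC x) = RtoC ((1 + x * / INR (k + 2)) * exp (- lnq k * x)).
Proof. unfold gfac. rewrite <- RtoC_opp, <- (RtoC_mult (- lnq k)), Cexp_RtoC, RtoC_mult, RtoC_plus, RtoC_mult. reflexivity. Qed.

Lemma gfac'_real k x :
  gfac' k (RtoC x) = RtoC ((/ INR (k + 2) - lnq k - x * (/ INR (k + 2) * lnq k)) * exp (- lnq k * x)).
Proof.
  unfold gfac'. rewrite <- RtoC_opp, <- (RtoC_mult (- lnq k)), Cexp_RtoC, <- RtoC_mult, <- RtoC_minus, <- RtoC_mult. reflexivity.
Qed.

Lemma rgp_real k x : Im (rgp k (RtoC x)) = 0%R.
Proof.
  induction k.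
  - unfold Im; simpl. ring.
  - simpl rgp. rewrite gfac_real. unfold Im in *; simpl. rewrite IHk. ring.
Qed.

Lemma rgp'_real k x : Im (rgp' k (RtoC x)) = 0%R.
Proof.
  induction k.
  - unfold Im; simpl. ring.
  - simpl rgp'. rewrite gfac_real, gfac'_real. pose proof (rgp_real k x) as H.
    unfold Im in *; simpl. rewrite IHk, H. ring.
Qed.

Lemma is_lim_seq_0_unique (u : nat -> R) (l : R) : (forall n, u n = 0%R) -> is_lim_seq u l -> l = 0%R.
Proof.
  intros H Hl. assert (H0 : is_lim_seq u 0%R) by (apply is_lim_seq_ext with (fun _ => 0%R); [auto | apply is_lim_seq_const]).
  apply is_lim_seq_unique in Hl. apply is_lim_seq_unique in H0. congruence.
Qed.

Lemma rgam_rg x : rgam (RtoC x) = RtoC (rg x).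
Proof.
  unfold rg. destruct (rgp_cv (RtoC x)) as [_ B].
  apply is_lim_seq_0_unique in B; [|intros; apply rgp_real].
  destruct (rgam (RtoC x)) as [a b]. unfold Im, Re, RtoC in *; simpl in *. now subst.
Qed.

Lemma rgam'_rg x : rgam' (RtoC x) = RtoC (rg' x).
Proof.
  unfold rg'. destruct (rgp'_cv (RtoC x)) as [_ B].
  apply is_lim_seq_0_unique in B; [|intros; apply rgp'_real].
  destruct (rgam' (RtoC x)) as [a b]. unfold Im, Re, RtoC in *; simpl in *. now subst.
Qed.

Lemma rgp_pos k x : (0 < x)%R -> (0 < Re (rgp k (RtoC x)))%R.
Proof.
  intros Hx. induction k.
  - unfold Re; simpl. nra.
  - simpl rgp. rewrite gfac_real. pose proof (rgp_real k x) as H.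
    unfold Re, Im in *; simpl. rewrite H, Rmult_0_l, Rminus_0_r.
    apply Rmult_lt_0_compat; auto. apply Rmult_lt_0_compat; [|apply exp_pos].
    assert (0 < / INR (k + 2))%R by (apply Rinv_0_lt_compat, lt_0_INR; lia). nra.
Qed.

Lemma rg_pos x : (0 < x)%R -> (0 < rg x)%R.
Proof.
  intros Hx. destruct (rgp_cv (RtoC x)) as [A _].
  assert (H : Rbar_le 0%R (rg x)).
  { refine (is_lim_seq_le _ _ (Finite _) (Finite _) _ (is_lim_seq_const 0) A).
    intros n. left. now apply rgp_pos. }
  simpl in H. destruct H as [H|H]; auto. exfalso.
  apply (rgam_neq_0_Re (RtoC x)); [exact Hx|]. now rewrite rgam_rg, <- H.
Qed.

Lemma rg_rec x : rg x = (x * rg (x + 1))%R.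
Proof.
  assert (H : RtoC (rg x) = RtoC (x * rg (x + 1))).
  { rewrite RtoC_mult, <- !rgam_rg, RtoC_plus. apply rgam_rec. }
  now injection H.
Qed.

Lemma rg_1 : rg 1 = 1%R.
Proof. assert (H : RtoC (rg 1) = RtoC 1) by (rewrite <- rgam_rg; apply rgam_1). now injection H. Qed.

(** The logarithmic derivative of the finite product, in closed form. In the limit it becomes the
    classical expression of the digamma function by harmonic sums. *)
Lemma rgp'_log k x : (0 < x)%R ->
  rgp' k (RtoC x) = - RtoC (ln (INR (k + 1)) - rsum (fun j => / (x + INR j))%R (k + 2)) * rgp k (RtoC x).
Proof.
  intros Hx.
  assert (HN : forall j, (x + INR j <> 0)%R) by (intros j; pose proof (pos_INR j); lra).
  induction k.
  - simpl rsum. simpl INR. rewrite ln_1. simpl rgp'. simpl rgp. simpl INR. rewrite Rplus_0_r, Rplus_0_l.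
    rewrite <- RtoC_opp, <- !RtoC_plus, <- !RtoC_mult, <- RtoC_plus. f_equal. field. split; [lra|].
    pose proof (HN 1%nat) as H; simpl in H; lra.
  - simpl rgp'. simpl rgp. rewrite IHk, gfac_real, gfac'_real.
    replace (S k + 2)%nat with (S (k + 2)) by lia. simpl rsum. replace (S k + 1)%nat with (k + 2)%nat by lia.
    set (E := exp _). set (r := rsum _ _).
    assert (EQ : ((/ INR (k + 2) - lnq k - x * (/ INR (k + 2) * lnq k)) * E =
      (1 + x * / INR (k + 2)) * E * (/ (x + INR (k + 2)) - lnq k))%R).
    { assert (INR (k + 2) <> 0)%R by (apply not_0_INR; lia). pose proof (HN (k + 2)%nat).
      field. auto. }
    rewrite EQ. unfold lnq. set (a := ((1 + x * / INR (k + 2)) * E)%R).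
    rewrite (RtoC_mult a). rewrite !RtoC_minus, RtoC_plus. ring.
Qed.

Lemma psi_lim x : (0 < x)%R ->
  is_lim_seq (fun k => ln (INR (k + 1)) - rsum (fun j => / (x + INR j))%R (k + 2))%R (psi x).
Proof.
  intros Hx. pose proof (rg_pos x Hx) as Hp.
  assert (H : cv (fun k => RtoC (ln (INR (k + 1)) - rsum (fun j => / (x + INR j))%R (k + 2))%R) (RtoC (psi x))).
  { apply cv_ext with (u := fun k => - rgp' k (RtoC x) * / rgp k (RtoC x)).
    - intros k. rewrite rgp'_log by auto. field.
      intros E. pose proof (rgp_pos k x Hx) as Hr. rewrite E in Hr. unfold Re in Hr; simpl in Hr. lra.
    - apply cv_eq with (- rgam' x * / rgam x).
      + rewrite rgam_rg, rgam'_rg. unfold psi, Rdiv.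
        rewrite RtoC_mult, RtoC_opp, RtoC_inv by lra. reflexivity.
      + apply cv_mult; [apply cv_opp, rgp'_cv|]. apply cv_inv; [|apply rgp_cv].
        now apply rgam_neq_0_Re. }
  apply H.
Qed.

Lemma psi_rg' x : (0 < x)%R -> rg' x = (- psi x * rg x)%R.
Proof. intros Hx. pose proof (rg_pos x Hx). unfold psi. field. lra. Qed.

Lemma is_lim_seq_inv_INR_S (c : R) : is_lim_seq (fun n => / (c + INR n))%R 0%R.
Proof.
  apply (is_lim_seq_inv (fun n => c + INR n)%R p_infty); [|discriminate].
  eapply is_lim_seq_plus; [apply is_lim_seq_const | apply is_lim_seq_INR | reflexivity].
Qed.

Lemma is_lim_seq_eq (u : nat -> R) (a b : R) : a = b -> is_lim_seq u a -> is_lim_seq u b.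
Proof. now intros ->. Qed.

Lemma is_lim_seq_fin_unique (u : nat -> R) (a b : R) : is_lim_seq u a -> is_lim_seq u b -> a = b.
Proof. intros H H'. apply is_lim_seq_unique in H. apply is_lim_seq_unique in H'. congruence. Qed.

Lemma psi_rec x : (0 < x)%R -> psi (x + 1) = (psi x + / x)%R.
Proof.
  intros Hx. eapply is_lim_seq_fin_unique; [apply psi_lim; lra|].
  apply is_lim_seq_eq with (psi x + / x - 0)%R; [ring|].
  eapply is_lim_seq_ext; [|apply is_lim_seq_minus'; [apply is_lim_seq_plus'; [apply (psi_lim x Hx) | apply is_lim_seq_const] | apply (is_lim_seq_inv_INR_S (x + 2))]].
  intros k. simpl.
  assert (E : rsum (fun j => / (x + 1 + INR j))%R (k + 2) = (rsum (fun j => / (x + INR j))%R (k + 2) + / (x + INR (k + 2)) - / x)%R).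
  { pose proof (rsum_shift (fun j => / (x + INR j))%R (k + 2)) as H.
    change (rsum (fun j => / (x + INR j))%R (S (k + 2))) with (rsum (fun j => / (x + INR j))%R (k + 2) + / (x + INR (k + 2)))%R in H.
    rewrite H. change (INR 0) with 0%R. rewrite Rplus_0_r.
    rewrite (rsum_ext _ (fun k0 => / (x + INR (S k0)))%R); [ring|].
    intros j _. rewrite S_INR. f_equal. ring. }
  rewrite E. rewrite (plus_INR k 2). replace (x + (INR k + INR 2))%R with (x + 2 + INR k)%R by (simpl; ring). ring.
Qed.

Lemma filterlim_affine (a b : nat) : (0 < a)%nat -> filterlim (fun k => a * k + b)%nat eventually eventually.
Proof. intros Ha P [N HN]. exists N. intros n Hn. apply HN. nia. Qed.

(** Twice the harmonic sum of length [2n] minus the one of length [n] leaves the reciprocals of the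
    odd numbers, which are the terms at 1/2; the logarithms leave [- 2 ln 2]. *)
Lemma psi_half : psi (1 / 2) = (psi 1 - 2 * ln 2)%R.
Proof.
  eapply is_lim_seq_fin_unique; [apply psi_lim; lra|].
  assert (HL : is_lim_seq (fun k => ln (2 + / INR (k + 1)))%R (ln 2)).
  { apply (is_lim_seq_continuous ln (fun k => 2 + / INR (k + 1))%R 2%R).
    - apply continuity_pt_filterlim, continuous_ln. lra.
    - apply is_lim_seq_eq with (2 + 0)%R; [ring|]. apply is_lim_seq_plus'; [apply is_lim_seq_const|].
      eapply is_lim_seq_ext; [|apply (is_lim_seq_inv_INR_S 1)]. intros n. simpl.
      rewrite plus_INR. f_equal. simpl; ring. }
  (* The sum of index [2k + 2] has [2k + 4] terms, twice the [k + 2] terms of the sum of index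
     [k]. *)
  pose proof (is_lim_seq_subseq _ _ (fun k => 2 * k + 2)%nat (filterlim_affine 2 2 ltac:(lia)) (psi_lim 1 ltac:(lra))) as H2.
  pose proof (psi_lim 1 ltac:(lra)) as H1.
  apply is_lim_seq_eq with (2 * psi 1 - psi 1 - 2 * ln 2)%R; [ring|].
  eapply is_lim_seq_ext; [|apply is_lim_seq_minus';
    [apply is_lim_seq_minus'; [apply is_lim_seq_mult'; [apply (is_lim_seq_const 2) | exact H2] | exact H1] |
     apply is_lim_seq_mult'; [apply (is_lim_seq_const 2) | exact HL]]].
  intros k. cbv beta.
  assert (E : forall n, rsum (fun j => / (1 / 2 + INR j))%R n =
     (2 * rsum (fun j => / (1 + INR j))%R (2 * n) - rsum (fun j => / (1 + INR j))%R n)%R).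
  { induction n; [simpl; ring|]. replace (2 * S n)%nat with (S (S (2 * n))) by lia.
    rewrite !rsum_S, IHn, S_INR, mult_INR. simpl INR.
    pose proof (pos_INR n). field. lra. }
  rewrite E. replace (2 * (k + 2))%nat with (2 * k + 2 + 2)%nat by lia.
  assert (HN : (0 < INR (k + 1))%R) by (apply lt_0_INR; lia).
  replace (2 + / INR (k + 1))%R with (INR (2 * k + 2 + 1) / INR (k + 1))%R.
  - rewrite ln_div by (auto; apply lt_0_INR; lia). ring.
  - rewrite !plus_INR, mult_INR. rewrite plus_INR in HN. simpl INR in *. field. lra.
Qed.

(** * Euler's sine product from Wallis integrals *)

Ltac Req := unfold minus, plus, opp, scal, mult; simpl; unfold mult; simpl;
  match goal with |- @eq _ ?a ?b => change (@eq R a b) end.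

(** [F] is a primitive of the combination [dF] of the two integrands and vanishes at both ends. The
    case [a = 0] gives the Wallis integrals, [a = 2 x] the factors of the sine product. *)
Lemma wallis_recursion (a C0 : R) (n : nat) :
  is_RInt (fun t => cos t ^ n * cos (a * t))%R 0 (PI / 2) C0 -> (INR (n + 2) ^ 2 - a ^ 2 <> 0)%R ->
  is_RInt (fun t => cos t ^ (n + 2) * cos (a * t))%R 0 (PI / 2) (INR (n + 2) * INR (n + 1) * C0 / (INR (n + 2) ^ 2 - a ^ 2))%R.
Proof.
  intros H HD. set (m := (n + 2)%nat) in *.
  pose (F := fun t => (cos t ^ (n + 1) * (INR m * sin t * cos (a * t) - a * cos t * sin (a * t)))%R).
  pose (dF := fun t => ((INR m ^ 2 - a ^ 2) * (cos t ^ m * cos (a * t)) - INR m * INR (n + 1) * (cos t ^ n * cos (a * t)))%R).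
  assert (HF : is_RInt dF 0 (PI / 2) (minus (F (PI / 2)%R) (F 0%R))).
  { apply (is_RInt_derive F dF).
    - intros t _. unfold F, dF. auto_derive; auto.
      unfold m. replace (Init.Nat.pred (n + 1)) with n by lia.
      rewrite !pow_add, !plus_INR. simpl pow. simpl INR.
      assert (S2 : (sin t * sin t = 1 - cos t * cos t)%R) by (pose proof (sin2_cos2 t) as S2; unfold Rsqr in S2; lra).
      set (c := cos t) in *. set (s := sin t) in *. set (ca := cos (a * t)). set (sa := sin (a * t)). set (p := (c ^ n)%R).
      transitivity (p * (INR n + 1) * (INR n + 2) * (- (s * s)) * ca + p * c * c * (INR n + 2) * ca - a * a * p * c * c * ca)%R; [ring|].
      rewrite S2. ring.
    - intros t _. apply (ex_derive_continuous dF). unfold dF. auto_derive; auto. }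
  unfold F in HF. rewrite cos_PI2, sin_0 in HF. replace (a * 0)%R with 0%R in HF by ring. rewrite sin_0 in HF.
  rewrite pow_i in HF by lia.
  replace (minus _ _) with 0%R in HF by (Req; ring).
  assert (HG := is_RInt_plus _ _ _ _ _ _ HF (is_RInt_scal _ _ _ (INR m * INR (n + 1))%R _ H)).
  assert (HK := is_RInt_scal _ _ _ (/ (INR m ^ 2 - a ^ 2))%R _ HG).
  replace (INR m * INR (n + 1) * C0 / (INR m ^ 2 - a ^ 2))%R with
    (scal (/ (INR m ^ 2 - a ^ 2))%R (plus 0 (scal (INR m * INR (n + 1))%R C0)))%R.
  - eapply is_RInt_ext; [|exact HK]. intros t _. unfold dF. Req. field. contradict HD. rewrite <- HD. ring.
  - Req. field. contradict HD. rewrite <- HD. ring.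
Qed.

Fixpoint wallis (m : nat) : R :=
  match m with O => (PI / 2)%R | S k => (INR (2 * k + 1) / INR (2 * k + 2) * wallis k)%R end.

Fixpoint sinprod (x : R) (m : nat) : R :=
  match m with O => 1%R | S k => (sinprod x k * (1 - x ^ 2 / INR (S k) ^ 2))%R end.

Lemma wallis_S k : wallis (S k) = (INR (2 * k + 1) / INR (2 * k + 2) * wallis k)%R.
Proof. reflexivity. Qed.

Lemma sinprod_S x k : sinprod x (S k) = (sinprod x k * (1 - x ^ 2 / INR (S k) ^ 2))%R.
Proof. reflexivity. Qed.

Lemma wallis_pos m : (0 < wallis m)%R.
Proof.
  induction m; [simpl; pose proof PI_RGT_0; lra|].
  rewrite wallis_S. apply Rmult_lt_0_compat; auto. apply Rdiv_lt_0_compat; apply lt_0_INR; lia.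
Qed.

Lemma wallis_is_RInt m : is_RInt (fun t => cos t ^ (2 * m))%R 0 (PI / 2) (wallis m).
Proof.
  apply is_RInt_ext with (f := fun t => (cos t ^ (2 * m) * cos (0 * t))%R).
  { intros t _. Req. rewrite Rmult_0_l, cos_0. ring. }
  induction m.
  - simpl. apply is_RInt_ext with (f := fun t => 1%R).
    + intros t _; Req. rewrite Rmult_0_l, cos_0. ring.
    + replace (PI / 2)%R with (scal (PI / 2 - 0)%R 1%R) at 2 by (Req; ring).
      apply (@is_RInt_const R_NormedModule).
  - replace (2 * S m)%nat with (2 * m + 2)%nat by lia.
    assert (H0 : (INR (2 * m + 2) <> 0)%R) by (apply not_0_INR; lia).
    replace (wallis (S m)) with (INR (2 * m + 2) * INR (2 * m + 1) * wallis m / (INR (2 * m + 2) ^ 2 - 0 ^ 2))%R.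
    + apply wallis_recursion; auto. replace (INR (2 * m + 2) ^ 2 - 0 ^ 2)%R with (INR (2 * m + 2) ^ 2)%R by ring. now apply pow_nonzero.
    + rewrite wallis_S. field. auto.
Qed.

(** Relative to the Wallis integral, each step of the recursion divides by one more factor
    [1 - x^2/m^2]; the start is the elementary integral of [cos (2 x t)]. Excluding integers keeps
    all denominators nonzero. *)
Lemma sinprod_is_RInt (x : R) m : (forall k : nat, x ^ 2 <> INR k ^ 2)%R ->
  is_RInt (fun t => cos t ^ (2 * m) * cos (2 * x * t))%R 0 (PI / 2)
    (wallis m * (sin (PI * x) / (PI * x)) / sinprod x m)%R /\ (sinprod x m <> 0)%R.
Proof.
  intros Hx. pose proof PI_RGT_0.
  assert (Hx0 : (x <> 0)%R) by (intros ->; apply (Hx O); simpl; ring).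
  induction m.
  - split; [|simpl; lra]. simpl.
    apply is_RInt_ext with (f := fun t => cos (2 * x * t)%R); [intros t _; Req; ring|].
    replace (PI / 2 * (sin (PI * x) / (PI * x)) / 1)%R with
      (minus (sin (2 * x * (PI / 2)) / (2 * x)) (sin (2 * x * 0) / (2 * x)))%R.
    + apply (is_RInt_derive (fun t => sin (2 * x * t) / (2 * x))%R (fun t => cos (2 * x * t)%R)).
      * intros t _. auto_derive; auto. field. auto.
      * intros t _. apply (ex_derive_continuous (fun t => cos (2 * x * t)%R)). auto_derive; auto.
    + Req. rewrite Rmult_0_r, sin_0.
      replace (2 * x * (PI / 2))%R with (PI * x)%R by field. field. lra.
  - destruct IHm as [IH NZ].
    assert (HS : (INR (S m) <> 0)%R) by (apply not_0_INR; lia).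
    assert (HF : (1 - x ^ 2 / INR (S m) ^ 2 <> 0)%R).
    { intros E. apply (Hx (S m)). apply Rmult_eq_reg_r with (/ INR (S m) ^ 2)%R.
      - rewrite Rinv_r; [unfold Rdiv in E; lra | now apply pow_nonzero].
      - now apply Rinv_neq_0_compat, pow_nonzero. }
    assert (HI : INR (2 * m + 2) = (2 * INR (S m))%R) by (rewrite <- (mult_INR 2); f_equal; lia).
    assert (HQ : (INR (S m) ^ 2 - x ^ 2 <> 0)%R) by (intros E; apply (Hx (S m)); lra).
    split; [|rewrite sinprod_S; apply Rmult_integral_contrapositive_currified; auto].
    replace (2 * S m)%nat with (2 * m + 2)%nat by lia.
    replace (wallis (S m) * (sin (PI * x) / (PI * x)) / sinprod x (S m))%R with
      (INR (2 * m + 2) * INR (2 * m + 1) * (wallis m * (sin (PI * x) / (PI * x)) / sinprod x m) / (INR (2 * m + 2) ^ 2 - (2 * x) ^ 2))%R.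
    + apply wallis_recursion; auto. rewrite HI. intros E. apply HQ. lra.
    + rewrite wallis_S, sinprod_S. rewrite HI. field. repeat split; auto; try lra.
Qed.

Lemma sin_ge_chord t : (0 <= t <= PI / 2)%R -> (2 / PI * t <= sin t)%R.
Proof.
  intros Ht. pose proof PI_RGT_0.
  destruct (Req_dec t 0) as [->|N0]; [rewrite sin_0; lra|].
  destruct (Req_dec t (PI / 2)) as [->|N1]; [rewrite sin_PI2; right; field; lra|].
  (* concavity, through two mean values of [cos] *)
  destruct (MVT_cor2 sin cos 0 t) as [c [Hc Hc']]; [lra | intros; apply derivable_pt_lim_sin|].
  destruct (MVT_cor2 sin cos t (PI / 2)) as [d [Hd Hd']]; [lra | intros; apply derivable_pt_lim_sin|].
  rewrite sin_0 in Hc. rewrite sin_PI2 in Hd.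
  assert (cos d < cos c)%R by (apply cos_decreasing_1; lra).
  apply Rmult_le_reg_l with (PI / 2)%R; [lra|].
  replace (PI / 2 * (2 / PI * t))%R with t by (field; lra).
  assert (sin t = cos c * t)%R by lra. assert (1 - sin t = cos d * (PI / 2 - t))%R by lra.
  assert (0 <= t * (PI / 2 - t) * (cos c - cos d))%R by (apply Rmult_le_pos; [apply Rmult_le_pos|]; lra).
  assert (PI / 2 * sin t - t = t * (PI / 2 - t) * (cos c - cos d))%R; [|lra].
  transitivity (sin t * (PI / 2 - t) - t * (1 - sin t))%R; [ring|]. rewrite H2 at 1. rewrite H1. ring.
Qed.

(** The weight [cos t ^ (2m)] concentrates at 0, where [cos (2 x t)] is 1. Quantitatively,
    [1 - cos (2 x t)] is at most a multiple of [t^2], hence of [sin t ^ 2], and the weighted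
    integral of [sin t ^ 2] is [wallis m - wallis (S m) = wallis m / (2m + 2)]. *)
Lemma sinprod_lim (x : R) : (forall k : nat, x ^ 2 <> INR k ^ 2)%R ->
  is_lim_seq (fun m => sin (PI * x) / (PI * x) / sinprod x m)%R 1%R.
Proof.
  intros Hx. pose proof PI_RGT_0 as HPI.
  apply is_lim_seq_spec.
  assert (HB : forall m, (Rabs (sin (PI * x) / (PI * x) / sinprod x m - 1) <= x ^ 2 * PI ^ 2 / 2 * / (2 + 2 * INR m))%R).
  { intros m. destruct (sinprod_is_RInt x m Hx) as [HI HN]. pose proof (wallis_is_RInt m) as HW.
    pose proof (wallis_is_RInt (S m)) as HW'.
    pose proof (is_RInt_minus _ _ _ _ _ _ HI HW) as HD.
    pose proof (is_RInt_scal _ _ _ (x ^ 2 * PI ^ 2 / 2)%R _ (is_RInt_minus _ _ _ _ _ _ HW HW')) as HD2.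
    assert (HL : (Rabs (wallis m * (sin (PI * x) / (PI * x)) / sinprod x m - wallis m) <=
                  x ^ 2 * PI ^ 2 / 2 * (wallis m - wallis (S m)))%R).
    { refine (norm_RInt_le (V := R_NormedModule) _ _ 0 (PI / 2) _ _ _ _ HD HD2); [lra|].
        intros t Ht. cbv beta. unfold minus, plus, opp, scal, norm, mult, abs; simpl; unfold mult, abs; simpl.
        replace (cos t ^ (m + (m + 0)) * cos (2 * x * t) + - cos t ^ (m + (m + 0)))%R with
          (cos t ^ (m + (m + 0)) * (cos (2 * x * t) - 1))%R by ring.
        replace (m + S (m + 0))%nat with (S (m + (m + 0))) by lia. simpl pow.
        assert (P : (0 <= cos t ^ (m + (m + 0)))%R) by (apply pow_le, cos_ge_0; lra).
        rewrite Rabs_mult, (Rabs_pos_eq _ P).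
        pose proof (cos_minus_1_bound (2 * x * t)) as C1. pose proof (sin_ge_chord t Ht) as S1.
        assert (S2 : (sin t * sin t = 1 - cos t * cos t)%R) by (pose proof (sin2_cos2 t) as S2; unfold Rsqr in S2; lra).
        set (p := (cos t ^ (m + (m + 0)))%R) in *.
        replace (x * (x * 1) * (PI * (PI * 1)) / 2 * (p + - (cos t * (cos t * p))))%R with
          (p * (x * (x * 1) * (PI * (PI * 1)) / 2 * (1 - cos t * cos t)))%R by ring.
        rewrite <- S2.
        apply Rmult_le_compat_l; auto. eapply Rle_trans; [exact C1|].
        assert (t <= PI / 2 * sin t)%R.
        { apply Rmult_le_reg_l with (2 / PI)%R; [apply Rdiv_lt_0_compat; lra|].
          replace (2 / PI * (PI / 2 * sin t))%R with (sin t) by (field; lra). exact S1. }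
        assert (t * t <= (PI / 2 * sin t) * (PI / 2 * sin t))%R by (apply Rmult_le_compat; lra).
        assert (0 <= x * x)%R by nra. simpl.
        assert (x * x * (t * t) <= x * x * ((PI / 2 * sin t) * (PI / 2 * sin t)))%R by (apply Rmult_le_compat_l; auto).
        lra. }
    pose proof (wallis_pos m) as WP.
    set (q := (sin (PI * x) / (PI * x))%R) in *.
    replace (wallis m * q / sinprod x m - wallis m)%R with (wallis m * (q / sinprod x m - 1))%R in HL by (field; auto).
    rewrite Rabs_mult, (Rabs_pos_eq (wallis m)) in HL by lra.
    apply Rmult_le_reg_l with (wallis m); auto. eapply Rle_trans; [exact HL|].
    right. rewrite wallis_S.
    rewrite !plus_INR, !mult_INR. simpl INR. pose proof (pos_INR m). field. lra. }
  intros eps.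
  assert (HL : is_lim_seq (fun m => x ^ 2 * PI ^ 2 / 2 * / (2 + 2 * INR m))%R 0%R).
  { apply is_lim_seq_eq with (x ^ 2 * PI ^ 2 / 4 * 0)%R; [ring|].
    eapply is_lim_seq_ext; [|apply is_lim_seq_mult'; [apply is_lim_seq_const | apply (is_lim_seq_inv_INR_S 1)]].
    intros n. simpl. pose proof (pos_INR n). field. lra. }
  apply is_lim_seq_spec in HL. destruct (HL eps) as [N HN]. exists N. intros n Hn.
  specialize (HN n Hn). eapply Rle_lt_trans; [apply HB|].
  eapply Rle_lt_trans; [apply Rle_abs|]. simpl in HN. rewrite Rminus_0_r in HN. exact HN.
Qed.

(** * Reflection and duplication for the reciprocal Gamma function *)

(** The exponential factors at [x] and [- x] are inverse to each other, which leaves the partial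
    sine product, one factor beyond the index [k]. *)
Lemma rgp_sinprod (x : R) k : rgp k (RtoC x) * rgp k (RtoC (- x)) = RtoC (- x ^ 2 * sinprod x (S k)).
Proof.
  induction k.
  - simpl. rewrite <- !RtoC_plus, <- !RtoC_mult. f_equal. field.
  - simpl rgp. replace (rgp k x * gfac k x * (rgp k (- x)%R * gfac k (- x)%R)) with
      ((rgp k x * rgp k (- x)%R) * (gfac k x * gfac k (- x)%R)) by ring.
    rewrite IHk, !gfac_real, <- !RtoC_mult. f_equal.
    change (sinprod x (S (S k))) with (sinprod x (S k) * (1 - x ^ 2 / INR (S (S k)) ^ 2))%R.
    replace (k + 2)%nat with (S (S k)) by lia.
    assert (E : (exp (- lnq k * x) * exp (- lnq k * - x) = 1)%R) by (rewrite <- exp_plus; rewrite <- exp_0; f_equal; ring).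
    assert (HN : (INR (S (S k)) <> 0)%R) by (apply not_0_INR; lia).
    transitivity (- x ^ 2 * sinprod x (S k) * ((1 + x * / INR (S (S k))) * (1 + - x * / INR (S (S k)))) * (exp (- lnq k * x) * exp (- lnq k * - x)))%R; [ring|].
    rewrite E. field. auto.
Qed.

Lemma rg_reflection (x : R) : (forall k : nat, x ^ 2 <> INR k ^ 2)%R ->
  (rg (1 + x) * rg (1 - x) = sin (PI * x) / (PI * x))%R.
Proof.
  intros Hx. pose proof PI_RGT_0.
  assert (Hx0 : (x <> 0)%R) by (intros ->; apply (Hx O); simpl; ring).
  assert (E : rgam x * rgam (RtoC (- x)) * 1 = RtoC (- x ^ 2 * (sin (PI * x) / (PI * x)))).
  { apply (cv_unique (fun k => rgp k (RtoC x) * rgp k (RtoC (- x)) * RtoC (sin (PI * x) / (PI * x) / sinprod x (S k))%R)).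
    - apply cv_mult; [apply cv_mult; apply rgp_cv|]. apply cv_RtoC.
      apply (is_lim_seq_incr_1 (fun k => sin (PI * x) / (PI * x) / sinprod x k)%R). now apply sinprod_lim.
    - eapply cv_ext; [|apply cv_const]. intros k. cbv beta. rewrite rgp_sinprod, <- RtoC_mult. f_equal.
      destruct (sinprod_is_RInt x (S k) Hx) as [_ HN]. field. repeat split; auto. lra. }
  rewrite !rgam_rg, Cmult_1_r, <- RtoC_mult in E. injection E as E.
  rewrite (rg_rec x), (rg_rec (- x)) in E.
  replace (x + 1)%R with (1 + x)%R in E by ring. replace (- x + 1)%R with (1 - x)%R in E by ring.
  apply Rmult_eq_reg_l with (- x ^ 2)%R; [|assert (x ^ 2 <> 0)%R by (apply pow_nonzero; auto); lra].
  simpl pow; rewrite <- E. ring.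
Qed.

(** Reflection at [- 1/2] yields the square, and positivity selects the root. *)
Lemma rg_half : rg (1 / 2) = (/ sqrt PI)%R.
Proof.
  pose proof PI_RGT_0.
  assert (E : (rg (1 + - (1 / 2)) * rg (1 - - (1 / 2)) = sin (PI * - (1 / 2)) / (PI * - (1 / 2)))%R).
  { apply rg_reflection. intros [|k]; [simpl; lra|]. rewrite S_INR. pose proof (pos_INR k). nra. }
  replace (PI * - (1 / 2))%R with (- (PI / 2))%R in E by field. rewrite sin_neg, sin_PI2 in E.
  replace (1 + - (1 / 2))%R with (1 / 2)%R in E by field. replace (1 - - (1 / 2))%R with (1 / 2 + 1)%R in E by field.
  pose proof (rg_rec (1 / 2)) as R1. pose proof (rg_pos (1 / 2) ltac:(lra)) as P.
  assert (S : (rg (1 / 2) * rg (1 / 2) = / PI)%R).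
  { rewrite R1 at 2. transitivity (1 / 2 * (rg (1 / 2) * rg (1 / 2 + 1)))%R; [ring|]. rewrite E. field. lra. }
  rewrite <- (sqrt_square (rg (1 / 2))) by lra. rewrite S. apply sqrt_inv.
Qed.

Lemma poch_duplication (x : C) n :
  poch x n * poch (x + (1 / 2)%R) n * 4 ^ n = poch (2 * x) (2 * n).
Proof.
  induction n; [simpl; ring|].
  replace (2 * S n)%nat with (S (S (2 * n))) by lia.
  change (poch (2 * x) (S (S (2 * n)))) with (poch (2 * x) (2 * n) * (2 * x + INR (2 * n)) * (2 * x + INR (S (2 * n)))).
  rewrite <- IHn. rewrite S_INR, mult_INR. simpl poch. rewrite RtoC_plus, RtoC_mult. simpl INR.
  replace (RtoC (1 / 2)) with (/ 2) by (unfold Rdiv; rewrite RtoC_mult, RtoC_inv by lra; ring).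
  simpl Cpow. replace (RtoC (1 + 1)) with (RtoC 2) by (f_equal; ring). field.
Qed.

(** A finite form of Legendre's formula. The same Pochhammer identity at 1/2 is multiplied across,
    so that factorials and powers of 4 cancel and no asymptotics of the factorial enter. *)
Lemma rgp_duplication (x : C) k :
  rgp k x * rgp k (x + (1 / 2)%R) * rgp (2 * k + 2) 1 * Cexp (ln (INR (2 * k + 3) / INR (k + 1))) =
  rgp (2 * k + 2) (2 * x) * Cexp (2 * x * ln (INR (2 * k + 3) / INR (k + 1))) * (rgp k (1 / 2)%R * rgp k 1).
Proof.
  assert (H1 : (0 < INR (k + 1))%R) by (apply lt_0_INR; lia).
  assert (H3 : (0 < INR (2 * k + 3))%R) by (apply lt_0_INR; lia).
  rewrite ln_div by auto. rewrite !rgp_poch.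
  replace (S (S (2 * k + 2))) with (2 * S (S k))%nat by lia.
  rewrite <- (poch_duplication x).
  replace (poch 1 (2 * S (S k))) with (poch (2 * (1 / 2)%R) (2 * S (S k))) by (f_equal; rewrite <- RtoC_mult; f_equal; field).
  rewrite <- (poch_duplication (1 / 2)%R).
  replace ((1 / 2)%R + (1 / 2)%R) with (RtoC 1) by (rewrite <- RtoC_plus; f_equal; field).
  replace (S (2 * k + 2)) with (2 * k + 3)%nat by lia. replace (S k) with (k + 1)%nat by lia.
  set (p1 := poch x _). set (p2 := poch (x + _) _). set (q1 := poch (RtoC (1 / 2)) _). set (q2 := poch 1 _).
  set (f1 := RtoC (INR (fact (k + 1)))). set (f2 := RtoC (INR (fact (2 * k + 3)))). set (w := 4 ^ S (k + 1)).
  set (l1 := ln (INR (k + 1))). set (l3 := ln (INR (2 * k + 3))).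
  unfold Cdiv.
  assert (E : Cexp (- (x * l1)) * Cexp (- ((x + (1 / 2)%R) * l1)) * Cexp (- (1 * l3)) * Cexp (l3 - l1)%R =
    Cexp (- (2 * x * l3)) * Cexp (2 * x * (l3 - l1)%R) * (Cexp (- ((1 / 2)%R * l1)) * Cexp (- (1 * l1)))).
  { rewrite <- !Cexp_plus. f_equal. rewrite RtoC_minus.
    replace (RtoC (1 / 2)) with (/ 2) by (unfold Rdiv; rewrite RtoC_mult, RtoC_inv by lra; ring). field. }
  transitivity (p1 * p2 * q1 * q2 * w * / f1 * / f1 * / f2 *
    (Cexp (- (x * l1)) * Cexp (- ((x + (1 / 2)%R) * l1)) * Cexp (- (1 * l3)) * Cexp (l3 - l1)%R)); [ring|].
  rewrite E. ring.
Qed.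

Lemma rgam_duplication (x : C) :
  rgam x * rgam (x + (1 / 2)%R) * 2 = rgam (2 * x) * Cexp (2 * x * ln 2) * RtoC (/ sqrt PI).
Proof.
  assert (HL : is_lim_seq (fun k => ln (INR (2 * k + 3) / INR (k + 1)))%R (ln 2)).
  { apply (is_lim_seq_continuous ln (fun k => INR (2 * k + 3) / INR (k + 1))%R 2%R).
    - apply continuity_pt_filterlim, continuous_ln. lra.
    - apply is_lim_seq_eq with (2 + 0)%R; [ring|].
      eapply is_lim_seq_ext; [|apply is_lim_seq_plus'; [apply is_lim_seq_const | apply (is_lim_seq_inv_INR_S 1)]].
      intros n. simpl. rewrite !plus_INR. pose proof (pos_INR n). simpl INR. field. lra. }
  assert (HE : forall a : C, cv (fun k => Cexp (a * ln (INR (2 * k + 3) / INR (k + 1)))) (Cexp (a * ln 2))).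
  { intros a. destruct (holoD_at _ _ _ (holoD_Cexp (a * ln 2))) as (r & K & Hr & HK & HLip & _).
    assert (HC : cv (fun k => a * ln (INR (2 * k + 3) / INR (k + 1))) (a * ln 2)).
    { apply cv_mult; [apply cv_const | now apply cv_RtoC]. }
    apply cv_Cmod in HC. apply cv_Cmod. apply is_lim_seq_spec in HC. apply is_lim_seq_spec. intros eps.
    assert (Hd : (0 < Rmin r (eps / (K + 1)))%R).
    { apply Rmin_pos; auto. apply Rdiv_lt_0_compat; [apply cond_pos | lra]. }
    destruct (HC (mkposreal _ Hd)) as [N HN]. exists N. intros n Hn. specialize (HN n Hn).
    rewrite Rminus_0_r, Rabs_pos_eq in * by apply Cmod_ge_0. simpl in HN.
    eapply Rle_lt_trans; [apply HLip|].
    - unfold cball. eapply Rlt_le_trans; [exact HN | apply Rmin_l].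
    - assert (A : (Cmod (a * ln (INR (2 * n + 3) / INR (n + 1)) - a * ln 2) < eps / (K + 1))%R) by (eapply Rlt_le_trans; [exact HN | apply Rmin_r]).
      pose proof (Cmod_ge_0 (a * ln (INR (2 * n + 3) / INR (n + 1)) - a * ln 2)).
      pose proof (cond_pos eps).
      apply Rle_lt_trans with ((K + 1) * Cmod (a * ln (INR (2 * n + 3) / INR (n + 1)) - a * ln 2))%R; [nra|].
      replace (pos eps) with ((K + 1) * (eps / (K + 1)))%R by (field; lra). apply Rmult_lt_compat_l; lra. }
  assert (HS : filterlim (fun k => 2 * k + 2)%nat eventually eventually) by (apply filterlim_affine; lia).
  assert (E : rgam x * rgam (x + (1 / 2)%R) * rgam 1 * Cexp (1 * ln 2) =
              rgam (2 * x) * Cexp (2 * x * ln 2) * (rgam (1 / 2)%R * rgam 1)).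
  { apply (cv_unique (fun k => rgp k x * rgp k (x + (1 / 2)%R) * rgp (2 * k + 2) 1 * Cexp (1 * ln (INR (2 * k + 3) / INR (k + 1))))).
    - apply cv_mult; [apply cv_mult; [apply cv_mult; apply rgp_cv|]|apply HE].
      apply (cv_subseq (fun n => rgp n 1) _ _ HS), rgp_cv.
    - apply cv_ext with (u := fun k => rgp (2 * k + 2) (2 * x) * Cexp (2 * x * ln (INR (2 * k + 3) / INR (k + 1))) * (rgp k (1 / 2)%R * rgp k 1)).
      { intros k. rewrite <- rgp_duplication. now rewrite Cmult_1_l. }
      apply cv_mult; [apply cv_mult; [|apply HE] | apply cv_mult; apply rgp_cv].
      apply (cv_subseq (fun n => rgp n (2 * x)) _ _ HS), rgp_cv. }
  rewrite rgam_1, Cmult_1_l, Cexp_RtoC, exp_ln, Cmult_1_r, Cmult_1_r, rgam_rg, rg_half in E by lra.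
  exact E.
Qed.

(** * Contour integrals along rectangles *)

Notation CV := C_R_NormedModule (only parsing).
Notation CCV := C_R_CompleteNormedModule (only parsing).

Lemma is_derive_C_taylor (g : R -> C) (x : R) (l : C) :
  (exists d K, (0 < d)%R /\ forall h : R, (Rabs h < d)%R -> (Cmod (g (x + h)%R - g x - h * l) <= K * h ^ 2)%R) ->
  is_derive (V := CV) g x l.
Proof.
  intros (d & K & Hd & H). split; [apply is_linear_scal_l|].
  intros x' Hx'. apply (is_filter_lim_locally_unique (K := R_AbsRing) (V := R_NormedModule)) in Hx'. subst x'.
  intros eps.
  assert (He : (0 < Rmin d (eps / (Rabs K + 1)))%R).
  { pose proof (cond_pos eps). pose proof (Rabs_pos K). apply Rmin_pos; auto. apply Rdiv_lt_0_compat; lra. }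
  exists (mkposreal _ He). intros y Hy. simpl in Hy.
  change (Rabs (y - x) < Rmin d (eps / (Rabs K + 1)))%R in Hy.
  change (norm (V := R_NormedModule) (minus y x)) with (Rabs (y - x)).
  rewrite Cmod_norm_R, scal_C_R.
  change (Cmod ((g y - g x) - (y - x)%R * l) <= eps * Rabs (y - x))%R.
  specialize (H (y - x)%R (Rlt_le_trans _ _ _ Hy (Rmin_l _ _))).
  rewrite Rplus_minus in H.
  eapply Rle_trans; [exact H|].
  assert (H2 : (Rabs (y - x) < eps / (Rabs K + 1))%R) by (eapply Rlt_le_trans; [exact Hy | apply Rmin_r]).
  rewrite <- (pow2_abs (y - x)). pose proof (Rabs_pos (y - x)). pose proof (Rabs_pos K). pose proof (Rle_abs K).
  set (t := Rabs (y - x)) in *.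
  assert (t * (Rabs K + 1) <= eps)%R.
  { replace (pos eps) with (eps / (Rabs K + 1) * (Rabs K + 1))%R by (field; lra). apply Rmult_le_compat_r; lra. }
  assert (K * t <= eps)%R by nra.
  replace (K * t ^ 2)%R with (K * t * t)%R by ring. apply Rmult_le_compat_r; lra.
Qed.

Lemma continuous_C (g : R -> C) (x : R) :
  (forall eps : R, (0 < eps)%R -> exists d, (0 < d)%R /\ forall t, (Rabs (t - x) < d)%R -> (Cmod (g t - g x) < eps)%R) ->
  continuous (U := CV) g x.
Proof.
  intros H P [eps HP]. destruct (H eps (cond_pos eps)) as (d & Hd & Hg).
  exists (mkposreal _ Hd). intros y Hy. apply HP. specialize (Hg y Hy).
  split.
  - eapply Rle_lt_trans; [|exact Hg]. apply (re_le_Cmod (g y - g x)).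
  - eapply Rle_lt_trans; [|exact Hg]. apply (im_le_Cmod (g y - g x)).
Qed.

Lemma continuous_C_lip (g : R -> C) (x : R) :
  (exists d K, (0 < d)%R /\ forall t, (Rabs (t - x) < d)%R -> (Cmod (g t - g x) <= K * Rabs (t - x))%R) ->
  continuous (U := CV) g x.
Proof.
  intros (d & K & Hd & H). apply continuous_C. intros eps He. pose proof (Rabs_pos K).
  exists (Rmin d (eps / (Rabs K + 1))). split.
  - apply Rmin_pos; auto. apply Rdiv_lt_0_compat; lra.
  - intros t Ht. eapply Rle_lt_trans; [apply H; eapply Rlt_le_trans; [exact Ht | apply Rmin_l]|].
    assert (H2 : (Rabs (t - x) < eps / (Rabs K + 1))%R) by (eapply Rlt_le_trans; [exact Ht | apply Rmin_r]).
    pose proof (Rabs_pos (t - x)). pose proof (Rle_abs K).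
    apply Rle_lt_trans with ((Rabs K + 1) * Rabs (t - x))%R; [nra|].
    replace eps with ((Rabs K + 1) * (eps / (Rabs K + 1)))%R by (field; lra). apply Rmult_lt_compat_l; lra.
Qed.

Lemma is_RInt_C_bound (g : R -> C) (a b : R) (l : C) (M : R) : (a <= b)%R ->
  (forall t, (a <= t <= b)%R -> (Cmod (g t) <= M)%R) -> is_RInt (V := CV) g a b l -> (Cmod l <= (b - a) * M)%R.
Proof.
  intros Hab H HI. rewrite <- Cmod_norm_R.
  apply (norm_RInt_le_const (V := CV) g a b l M); auto.
  intros t Ht. rewrite Cmod_norm_R. auto.
Qed.

Lemma is_RInt_C_le (g : R -> C) (k : R -> R) (a b : R) (l : C) (M : R) : (a <= b)%R ->
  (forall t, (a <= t <= b)%R -> (Cmod (g t) <= k t)%R) -> is_RInt (V := CV) g a b l -> is_RInt k a b M -> (Cmod l <= M)%R.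
Proof.
  intros Hab H HI HK. rewrite <- Cmod_norm_R.
  apply (norm_RInt_le (V := CV) g k a b l M); auto.
  intros t Ht. rewrite Cmod_norm_R. auto.
Qed.

Lemma is_RInt_Cmult (c : C) (g : R -> C) (a b : R) (l : C) :
  is_RInt (V := CV) g a b l -> is_RInt (V := CV) (fun t => c * g t) a b (c * l).
Proof.
  intros H.
  pose proof (is_RInt_fct_extend_fst (U := R_NormedModule) (V := R_NormedModule) g a b l H) as H1.
  pose proof (is_RInt_fct_extend_snd (U := R_NormedModule) (V := R_NormedModule) g a b l H) as H2.
  destruct c as [u v].
  apply (is_RInt_fct_extend_pair (U := R_NormedModule) (V := R_NormedModule)).
  - apply (is_RInt_minus (V := R_NormedModule) (fun t => scal u (fst (g t))) (fun t => scal v (snd (g t))));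
      apply (is_RInt_scal (V := R_NormedModule)); auto.
  - apply (is_RInt_plus (V := R_NormedModule) (fun t => scal u (snd (g t))) (fun t => scal v (fst (g t))));
      apply (is_RInt_scal (V := R_NormedModule)); auto.
Qed.

Lemma is_RInt_RtoC (g : R -> R) (a b l : R) : is_RInt g a b l -> is_RInt (V := CV) (fun t => RtoC (g t)) a b (RtoC l).
Proof.
  intros H. apply (is_RInt_fct_extend_pair (U := R_NormedModule) (V := R_NormedModule)); [exact H|].
  pose proof (@is_RInt_const R_NormedModule a b 0%R) as Z.
  refine (eq_rect _ (fun v => is_RInt (V := R_NormedModule) (fun _ => 0%R) a b v) Z _ _).
  exact (scal_zero_r (V := R_NormedModule) (b - a)%R).
Qed.

Lemma holoD_shift_taylor (f f' : C -> C) (z : C) : holoD f f' z ->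
  exists r K, (0 < r)%R /\ (0 <= K)%R /\ forall h, (Cmod h < r)%R ->
    (Cmod (f (z + h)%C - f z) <= K * Cmod h)%R /\ (Cmod (f (z + h)%C - f z - h * f' z) <= K * Cmod h ^ 2)%R.
Proof.
  intros H. destruct (holoD_at _ _ _ H) as (r & K & Hr & HK & H1 & H2). exists r, K. repeat split; auto;
  specialize (H1 (z + h)); specialize (H2 (z + h)); unfold cball in *;
  replace (z + h - z) with h in * by ring; auto.
Qed.

Lemma hline (x h c : R) : (((x + h)%R, c) : C) = (x, c) + h.
Proof. unfold Cplus, RtoC; simpl. f_equal; ring. Qed.

Lemma vline (x h c : R) : ((c, (x + h)%R) : C) = (c, x) + Ci * h.
Proof. unfold Cplus, Cmult, Ci, RtoC; simpl. f_equal; ring. Qed.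

Lemma Cmod_Ci_mult (h : R) : Cmod (Ci * h) = Rabs h.
Proof. rewrite Cmod_mult, Cmod_Ci, Cmod_R. ring. Qed.

Lemma holo_continuous_h f (x c : R) : holo f (x, c) -> continuous (U := CV) (fun t : R => f (t, c)) x.
Proof.
  intros [f' H]. destruct (holoD_shift_taylor _ _ _ H) as (r & K & Hr & HK & HL).
  apply continuous_C_lip. exists r, K. split; auto. intros t Ht.
  destruct (HL (RtoC (t - x))) as [A _]; [now rewrite Cmod_R|].
  rewrite <- hline in A. replace (x + (t - x))%R with t in A by ring. now rewrite Cmod_R in A.
Qed.

Lemma holo_continuous_v f (x c : R) : holo f (c, x) -> continuous (U := CV) (fun t : R => f (c, t)) x.
Proof.
  intros [f' H]. destruct (holoD_shift_taylor _ _ _ H) as (r & K & Hr & HK & HL).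
  apply continuous_C_lip. exists r, K. split; auto. intros t Ht.
  destruct (HL (Ci * RtoC (t - x))) as [A _]; [now rewrite Cmod_Ci_mult|].
  rewrite <- vline in A. replace (x + (t - x))%R with t in A by ring. now rewrite Cmod_Ci_mult in A.
Qed.

Lemma holoD_derive_h f f' (x c : R) : holoD f f' (x, c) -> is_derive (V := CV) (fun t : R => f (t, c)) x (f' (x, c)).
Proof.
  intros H. destruct (holoD_shift_taylor _ _ _ H) as (r & K & Hr & HK & HL).
  apply is_derive_C_taylor. exists r, K. split; auto. intros h Hh.
  destruct (HL (RtoC h)) as [_ A]; [now rewrite Cmod_R|].
  rewrite hline. now rewrite Cmod_R, pow2_abs in A.
Qed.

Lemma holoD_derive_v f f' (x c : R) : holoD f f' (c, x) -> is_derive (V := CV) (fun t : R => f (c, t)) x (Ci * f' (c, x)).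
Proof.
  intros H. destruct (holoD_shift_taylor _ _ _ H) as (r & K & Hr & HK & HL).
  apply is_derive_C_taylor. exists r, K. split; auto. intros h Hh.
  destruct (HL (Ci * RtoC h)) as [_ A]; [now rewrite Cmod_Ci_mult|].
  rewrite vline. rewrite Cmod_Ci_mult, pow2_abs in A.
  now replace (h * (Ci * f' (c, x))) with (Ci * h * f' (c, x)) by ring.
Qed.

(* [holoD] controls [f'] as well: exchanging the two points of the Taylor bound makes [f'] Lipschitz. *)
Lemma holoD_f'_lip (f f' : C -> C) (z : C) : holoD f f' z ->
  exists r K, (0 < r)%R /\ (0 <= K)%R /\ forall w, cball z r w -> (Cmod (f' w - f' z) <= K * Cmod (w - z))%R.
Proof.
  intros (r & K & Hr & K0 & _ & _ & _ & H4). exists r, (2 * K)%R. repeat split; auto; [lra|].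
  intros w Hw. assert (Hz : cball z r z) by (unfold cball; replace (z - z) with (RtoC 0) by ring; now rewrite Cmod_0).
  destruct (Ceq_dec w z) as [->|N].
  - replace (f' z - f' z) with (RtoC 0) by ring. replace (z - z) with (RtoC 0) by ring. rewrite Cmod_0. lra.
  - pose proof (H4 w z Hw Hz) as A. pose proof (H4 z w Hz Hw) as B.
    rewrite (Cmod_minus_sym z w) in A.
    assert (P : (0 < Cmod (w - z))%R).
    { apply Cmod_gt_0. intros E. apply N. replace w with (w - z + z) by ring. rewrite E. ring. }
    apply Rmult_le_reg_l with (Cmod (w - z)); auto. rewrite <- Cmod_mult.
    replace ((w - z) * (f' w - f' z)) with ((f z - f w - (z - w) * f' w) + (f w - f z - (w - z) * f' z)) by ring.
    eapply Rle_trans; [apply Cmod_triangle|]. nra.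
Qed.

Lemma holoD_continuous'_h f f' (x c : R) : holoD f f' (x, c) -> continuous (U := CV) (fun t : R => f' (t, c)) x.
Proof.
  intros H. destruct (holoD_f'_lip _ _ _ H) as (r & K & Hr & HK & HL).
  apply continuous_C_lip. exists r, K. split; auto. intros t Ht.
  specialize (HL (t, c)). unfold cball in HL.
  replace ((t, c) - (x, c)) with (RtoC (t - x)) in HL by (unfold Cminus, Cplus, Copp, RtoC; simpl; f_equal; ring).
  rewrite Cmod_R in HL. auto.
Qed.

Lemma holoD_continuous'_v f f' (x c : R) : holoD f f' (c, x) -> continuous (U := CV) (fun t : R => f' (c, t)) x.
Proof.
  intros H. destruct (holoD_f'_lip _ _ _ H) as (r & K & Hr & HK & HL).
  apply continuous_C_lip. exists r, K. split; auto. intros t Ht.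
  specialize (HL (c, t)). unfold cball in HL.
  replace ((c, t) - (c, x)) with (Ci * RtoC (t - x)) in HL by (unfold Ci, Cmult, Cminus, Cplus, Copp, RtoC; simpl; f_equal; ring).
  rewrite Cmod_Ci_mult in HL. auto.
Qed.

Lemma continuous_Cmult_l (c : C) (g : R -> C) (x : R) : continuous (U := CV) g x -> continuous (U := CV) (fun t => c * g t) x.
Proof.
  intros H. apply continuous_C. intros eps He.
  pose proof (Cmod_ge_0 c) as Hc. assert (He' : (0 < eps / (2 * (Cmod c + 1)))%R) by (apply Rdiv_lt_0_compat; lra).
  assert (HB : locally (T := CV) (g x) (fun y => (Cmod (y - g x) < eps / (Cmod c + 1))%R)).
  { exists (mkposreal _ He'). intros y [A B]. eapply Rle_lt_trans; [apply Cmod_le_Re_Im|].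
    unfold ball in A, B; simpl in A, B. unfold AbsRing_ball, abs, minus, plus, opp in A, B; simpl in A, B.
    replace (eps / (Cmod c + 1))%R with (eps / (2 * (Cmod c + 1)) + eps / (2 * (Cmod c + 1)))%R by (field; lra).
    unfold Re, Im; simpl. lra. }
  destruct (H _ HB) as [d Hd]. exists d. split; [apply cond_pos|]. intros t Ht. specialize (Hd t Ht). simpl in Hd.
  replace (c * g t - c * g x) with (c * (g t - g x)) by ring. rewrite Cmod_mult.
  pose proof (Cmod_ge_0 (g t - g x)).
  apply Rle_lt_trans with ((Cmod c + 1) * Cmod (g t - g x))%R; [nra|].
  replace eps with ((Cmod c + 1) * (eps / (Cmod c + 1)))%R by (field; lra). apply Rmult_lt_compat_l; lra.
Qed.

Lemma is_RInt_hseg_primitive (F F' : C -> C) (a b c : R) : (a <= b)%R ->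
  (forall t, (a <= t <= b)%R -> holoD F F' (t, c)) ->
  is_RInt (V := CV) (fun t : R => F' (t, c)) a b (F (b, c) - F (a, c)).
Proof.
  intros Hab H. apply (is_RInt_derive (V := CCV) (fun t : R => F (t, c)) (fun t : R => F' (t, c)));
    rewrite Rmin_left, Rmax_right by auto; intros x Hx.
  - now apply holoD_derive_h, H.
  - eapply holoD_continuous'_h, H, Hx.
Qed.

Lemma is_RInt_vseg_primitive (F F' : C -> C) (a c d : R) : (c <= d)%R ->
  (forall t, (c <= t <= d)%R -> holoD F F' (a, t)) ->
  is_RInt (V := CV) (fun t : R => Ci * F' (a, t)) c d (F (a, d) - F (a, c)).
Proof.
  intros Hab H. apply (is_RInt_derive (V := CCV) (fun t : R => F (a, t)) (fun t : R => Ci * F' (a, t)));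
    rewrite Rmin_left, Rmax_right by auto; intros x Hx.
  - now apply holoD_derive_v, H.
  - apply continuous_Cmult_l. eapply holoD_continuous'_v, H, Hx.
Qed.

Definition hseg (f : C -> C) (c a b : R) : C := RInt (V := CCV) (fun t : R => f (t, c)) a b.
Definition vseg (f : C -> C) (a c d : R) : C := RInt (V := CCV) (fun t : R => Ci * f (a, t)) c d.

(** Positively oriented, hence the sign change when it is compared with the clockwise loop. *)
Definition rect_int (f : C -> C) (a b c d : R) : C :=
  hseg f c a b + vseg f b c d - hseg f d a b - vseg f a c d.

Lemma hseg_is_RInt f c a b : (a <= b)%R -> (forall t, (a <= t <= b)%R -> holo f (t, c)) ->
  is_RInt (V := CV) (fun t : R => f (t, c)) a b (hseg f c a b).
Proof.
  intros Hab H. apply (RInt_correct (V := CCV)), (ex_RInt_continuous (V := CCV)).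
  rewrite Rmin_left, Rmax_right by auto. intros t Ht. now apply holo_continuous_h, H.
Qed.

Lemma vseg_is_RInt f a c d : (c <= d)%R -> (forall t, (c <= t <= d)%R -> holo f (a, t)) ->
  is_RInt (V := CV) (fun t : R => Ci * f (a, t)) c d (vseg f a c d).
Proof.
  intros Hab H. apply (RInt_correct (V := CCV)), (ex_RInt_continuous (V := CCV)).
  rewrite Rmin_left, Rmax_right by auto. intros t Ht. now apply continuous_Cmult_l, holo_continuous_v, H.
Qed.

Lemma is_RInt_C_unique (g : R -> C) a b (l : C) : is_RInt (V := CV) g a b l -> RInt (V := CCV) g a b = l.
Proof. intros H. exact (is_RInt_unique (V := CCV) g a b l H). Qed.

(** A derivative given by a formula: [holo] yields a separate witness at each point, whereas
    Cauchy's theorem needs one derivative function over a whole rectangle. *)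
Definition cder (f : C -> C) (z : C) : C :=
  CLim_seq (fun n => (f (z + RtoC (/ (1 + INR n))) - f z) * RtoC (1 + INR n)).

Lemma cder_holoD f f' z : holoD f f' z -> cder f z = f' z.
Proof.
  intros H. destruct (holoD_shift_taylor _ _ _ H) as (r & K & Hr & HK & HL).
  apply cv_CLim. apply cv_Cmod.
  assert (HI : is_lim_seq (fun n => / (1 + INR n))%R 0%R).
  { apply (is_lim_seq_inv (fun n => 1 + INR n)%R p_infty); [|discriminate].
    eapply is_lim_seq_plus; [apply is_lim_seq_const | apply is_lim_seq_INR | reflexivity]. }
  assert (HP : forall n, (0 < / (1 + INR n))%R) by (intros n; apply Rinv_0_lt_compat; pose proof (pos_INR n); lra).
  apply is_lim_seq_le_le_loc with (u := fun _ => 0%R) (w := fun n => (K * / (1 + INR n))%R).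
  - apply is_lim_seq_spec in HI. destruct (HI (mkposreal r Hr)) as [N HN]. exists N. intros n Hn.
    specialize (HN n Hn). simpl in HN. rewrite Rminus_0_r in HN.
    split; [apply Cmod_ge_0|]. destruct (HL (RtoC (/ (1 + INR n)))) as [_ A]; [now rewrite Cmod_R|].
    set (h := (/ (1 + INR n))%R) in *. assert (Hh : (0 < h)%R) by apply HP.
    replace (1 + INR n)%R with (/ h)%R by (unfold h; now rewrite Rinv_inv).
    assert (HhC : RtoC h <> 0) by (apply RtoC_neq_0; lra).
    replace ((f (z + h) - f z) * (/ h)%R - f' z) with ((f (z + h) - f z - h * f' z) * (/ h)%R).
    + rewrite Cmod_mult, !Cmod_R in *. rewrite (Rabs_pos_eq h) in A by lra.
      rewrite (Rabs_pos_eq (/ h)) by (left; now apply Rinv_0_lt_compat).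
      apply Rmult_le_reg_r with h; auto. rewrite Rmult_assoc, Rinv_l by lra. nra.
    + rewrite RtoC_inv by lra. field. auto.
  - apply is_lim_seq_const.
  - replace (Finite 0) with (Finite (K * 0)) by (f_equal; ring). apply is_lim_seq_mult'; [apply is_lim_seq_const | exact HI].
Qed.

Lemma holo_cder f z : holo f z -> holoD f (cder f) z.
Proof.
  intros [f' H]. pose proof H as (r & K & Hr & HC).
  apply holoD_ext_loc with (f := f) (f' := f'); auto.
  exists r. split; auto. intros w Hw. split; auto. symmetry. apply cder_holoD.
  exists (r - Cmod (w - z))%R, K. split; [unfold cball in Hw; lra|].
  eapply c11_sub; [|apply Rle_refl | exact HC]. intros v Hv. unfold cball in *.
  replace (v - z) with ((v - w) + (w - z)) by ring. eapply Rle_lt_trans; [apply Cmod_triangle|]. lra.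
Qed.

(** Compactness provides a uniform lower bound only for a gauge [e], so the constant is tied to the
    gauge: [4 e <= r] keeps the points in the ball of radius [r], and [e K <= 1] bounds [K] by
    [/ e]. *)
Lemma holo_uniform_taylor f f' (a b c d : R) :
  (forall x y, (a <= x <= b)%R -> (c <= y <= d)%R -> holoD f f' (x, y)) ->
  exists r K, (0 < r)%R /\ (0 <= K)%R /\ forall x y (h : C), (a <= x <= b)%R -> (c <= y <= d)%R -> (Cmod h < r)%R ->
    (Cmod (f ((x, y) + h)%C - f (x, y) - h * f' (x, y)) <= K * Cmod h ^ 2)%R.
Proof.
  intros H.
  assert (HS : forall u v : R, { e : posreal | (a <= u <= b)%R -> (c <= v <= d)%R -> exists r K, (0 < r)%R /\
     c11 (cball (u, v) r) f f' K /\ (4 * e <= r)%R /\ (e * K <= 1)%R }).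
  { intros u v. apply constructive_indefinite_description.
    destruct (excluded_middle_informative ((a <= u <= b)%R /\ (c <= v <= d)%R)) as [[A B]|N].
    - destruct (H u v A B) as (r & K & Hr & HC). pose proof HC as (K0 & _).
      assert (He : (0 < Rmin (r / 4) (/ (K + 1)))%R) by (apply Rmin_pos; [lra | apply Rinv_0_lt_compat; lra]).
      exists (mkposreal _ He). intros _ _. exists r, K. repeat split; auto; simpl; try apply HC.
      + pose proof (Rmin_l (r / 4) (/ (K + 1))). lra.
      + pose proof (Rmin_r (r / 4) (/ (K + 1))) as P. simpl in He.
        apply Rle_trans with (/ (K + 1) * (K + 1))%R; [nra|]. rewrite Rinv_l; lra.
    - exists (mkposreal 1 Rlt_0_1). intros A B; exfalso; auto. }
  destruct (compactness_value_2d a b c d (fun u v => proj1_sig (HS u v))) as [e He].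
  exists e, (/ e)%R. pose proof (cond_pos e) as Pe.
  split; auto. split; [left; now apply Rinv_0_lt_compat|].
  intros x y h Hx Hy Hh. specialize (He x y Hx Hy). apply NNPP in He || apply Classical_Prop.NNPP in He.
  destruct He as (u & v & Hu & Hv & H1 & H2 & H3). destruct (HS u v) as [e' He']. simpl in *.
  destruct (He' Hu Hv) as (r & K & Hr & (K0 & _ & _ & _ & HC) & H4 & H5).
  assert (Hb : (Cmod ((x, y) - (u, v)) < 2 * e')%R).
  { eapply Rle_lt_trans; [apply Cmod_le_Re_Im|]. unfold Re, Im; simpl. unfold Rminus in *. lra. }
  assert (HK : (K <= / e)%R).
  { apply Rmult_le_reg_l with e; auto. rewrite Rinv_r by lra. nra. }
  pose proof (pow2_ge_0 (Cmod h)).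
  apply Rle_trans with (K * Cmod h ^ 2)%R; [|nra].
  replace h with ((x, y) + h - (x, y)) at 2 3 by ring. apply HC.
  - unfold cball. pose proof (cond_pos e'). lra.
  - unfold cball. replace ((x, y) + h - (u, v)) with (((x, y) - (u, v)) + h) by ring.
    eapply Rle_lt_trans; [apply Cmod_triangle|]. pose proof (cond_pos e'). lra.
Qed.

(* Differentiating the horizontal integral in the height gives the difference of the vertical sides. *)
Lemma Cauchy_rectangle f (a b c d e : R) : (a <= b)%R -> (c <= d)%R -> (0 < e)%R ->
  (forall x y, (a <= x <= b)%R -> (c - e <= y <= d + e)%R -> holo f (x, y)) -> rect_int f a b c d = 0.
Proof.
  intros Hab Hcd He H.
  assert (HD : forall x y, (a <= x <= b)%R -> (c - e <= y <= d + e)%R -> holoD f (cder f) (x, y)) by (intros; apply holo_cder; auto).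
  destruct (holo_uniform_taylor f (cder f) a b (c - e) (d + e) HD) as (r & K & Hr & HK & HT).
  assert (HI : is_RInt (V := CV) (fun y : R => Ci * (f (b, y) - f (a, y))) c d (hseg f d a b - hseg f c a b)).
  { apply (is_RInt_derive (V := CCV) (fun y : R => hseg f y a b)); rewrite Rmin_left, Rmax_right by auto; intros y Hy.
    - apply is_derive_C_taylor. exists (Rmin r e), ((b - a) * K)%R. split; [now apply Rmin_pos|].
      intros h Hh.
      assert (Hh1 : (Rabs h < r)%R) by (eapply Rlt_le_trans; [exact Hh | apply Rmin_l]).
      assert (Hh2 : (Rabs h < e)%R) by (eapply Rlt_le_trans; [exact Hh | apply Rmin_r]).
      apply Rabs_def2 in Hh2.
      assert (I1 : is_RInt (V := CV) (fun t : R => f (t, (y + h)%R)) a b (hseg f (y + h) a b)).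
      { apply hseg_is_RInt; auto. intros; apply H; lra. }
      assert (I2 : is_RInt (V := CV) (fun t : R => f (t, y)) a b (hseg f y a b)).
      { apply hseg_is_RInt; auto. intros; apply H; lra. }
      assert (I3 : is_RInt (V := CV) (fun t : R => cder f (t, y)) a b (f (b, y) - f (a, y))).
      { apply is_RInt_hseg_primitive; auto. intros; apply HD; lra. }
      pose proof (is_RInt_minus (V := CV) _ _ _ _ _ _ (is_RInt_minus (V := CV) _ _ _ _ _ _ I1 I2) (is_RInt_Cmult (h * Ci) _ _ _ _ I3)) as I4.
      replace ((b - a) * K * h ^ 2)%R with ((b - a) * (K * h ^ 2))%R by ring.
      replace (hseg f (y + h) a b - hseg f y a b - h * (Ci * (f (b, y) - f (a, y)))) with
        (hseg f (y + h) a b - hseg f y a b - h * Ci * (f (b, y) - f (a, y))) by ring.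
      eapply is_RInt_C_bound; [exact Hab | | exact I4].
      intros t Ht. specialize (HT t y (Ci * h)). rewrite Cmod_Ci_mult, pow2_abs, <- vline in HT.
      replace (h * Ci) with (Ci * h) by ring. apply HT; auto; lra.
    - apply continuous_Cmult_l.
      apply (continuous_minus (V := CV) (fun y : R => f (b, y)) (fun y : R => f (a, y))); apply holo_continuous_v, H; lra. }
  assert (V1 := vseg_is_RInt f b c d Hcd ltac:(intros; apply H; lra)).
  assert (V2 := vseg_is_RInt f a c d Hcd ltac:(intros; apply H; lra)).
  pose proof (is_RInt_minus (V := CV) _ _ _ _ _ _ V1 V2) as V3.
  assert (E : hseg f d a b - hseg f c a b = vseg f b c d - vseg f a c d).
  { rewrite <- (is_RInt_C_unique _ _ _ _ HI). apply is_RInt_C_unique.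
    eapply is_RInt_ext; [|exact V3]. intros y _.
    change (Ci * f (b, y) - Ci * f (a, y) = Ci * (f (b, y) - f (a, y))). ring. }
  unfold rect_int. replace (hseg f c a b + vseg f b c d - hseg f d a b - vseg f a c d) with
    ((vseg f b c d - vseg f a c d) - (hseg f d a b - hseg f c a b)) by ring. rewrite E. ring.
Qed.

Lemma hseg_chasles f c a m b : (a <= m <= b)%R -> (forall t, (a <= t <= b)%R -> holo f (t, c)) ->
  hseg f c a b = hseg f c a m + hseg f c m b.
Proof.
  intros Hm H. apply is_RInt_C_unique.
  apply (is_RInt_Chasles (V := CV)) with m; apply hseg_is_RInt; intros; try apply H; lra.
Qed.

Lemma vseg_chasles f a c m d : (c <= m <= d)%R -> (forall t, (c <= t <= d)%R -> holo f (a, t)) ->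
  vseg f a c d = vseg f a c m + vseg f a m d.
Proof.
  intros Hm H. apply is_RInt_C_unique.
  apply (is_RInt_Chasles (V := CV)) with m; apply vseg_is_RInt; intros; try apply H; lra.
Qed.

Lemma rect_int_split_h f a m b c d : (a <= m <= b)%R ->
  (forall t, (a <= t <= b)%R -> holo f (t, c)) -> (forall t, (a <= t <= b)%R -> holo f (t, d)) ->
  rect_int f a b c d = rect_int f a m c d + rect_int f m b c d.
Proof.
  intros Hm H1 H2. unfold rect_int. rewrite (hseg_chasles f c a m b), (hseg_chasles f d a m b) by auto. ring.
Qed.

Lemma rect_int_split_v f a b c m d : (c <= m <= d)%R ->
  (forall t, (c <= t <= d)%R -> holo f (a, t)) -> (forall t, (c <= t <= d)%R -> holo f (b, t)) ->
  rect_int f a b c d = rect_int f a b c m + rect_int f a b m d.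
Proof.
  intros Hm H1 H2. unfold rect_int. rewrite (vseg_chasles f a c m d), (vseg_chasles f b c m d) by auto. ring.
Qed.

Definition holo_border (f : C -> C) (a b c d : R) : Prop :=
  (forall t, (a <= t <= b)%R -> holo f (t, c) /\ holo f (t, d)) /\ (forall t, (c <= t <= d)%R -> holo f (a, t) /\ holo f (b, t)).

Lemma rect_int_bound f a b c d M : (a <= b)%R -> (c <= d)%R -> holo_border f a b c d ->
  (forall x y, (a <= x <= b)%R -> (c <= y <= d)%R -> (x = a \/ x = b \/ y = c \/ y = d) -> (Cmod (f (x, y)) <= M)%R) ->
  (Cmod (rect_int f a b c d) <= 2 * ((b - a) + (d - c)) * M)%R.
Proof.
  intros Hab Hcd [H1 H2] HM. unfold rect_int.
  assert (B1 : (Cmod (hseg f c a b) <= (b - a) * M)%R).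
  { eapply is_RInt_C_bound; [exact Hab | | apply hseg_is_RInt; auto; intros; now apply H1]. intros; apply HM; auto; lra. }
  assert (B2 : (Cmod (hseg f d a b) <= (b - a) * M)%R).
  { eapply is_RInt_C_bound; [exact Hab | | apply hseg_is_RInt; auto; intros; now apply H1]. intros; apply HM; auto; lra. }
  assert (B3 : (Cmod (vseg f a c d) <= (d - c) * M)%R).
  { eapply is_RInt_C_bound; [exact Hcd | | apply vseg_is_RInt; auto; intros; now apply H2].
    intros; cbv beta; rewrite Cmod_mult, Cmod_Ci, Rmult_1_l. apply HM; auto; lra. }
  assert (B4 : (Cmod (vseg f b c d) <= (d - c) * M)%R).
  { eapply is_RInt_C_bound; [exact Hcd | | apply vseg_is_RInt; auto; intros; now apply H2].
    intros; cbv beta; rewrite Cmod_mult, Cmod_Ci, Rmult_1_l. apply HM; auto; lra. }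
  pose proof (Cmod_triangle_minus (hseg f c a b + vseg f b c d - hseg f d a b) (vseg f a c d)).
  pose proof (Cmod_triangle_minus (hseg f c a b + vseg f b c d) (hseg f d a b)).
  pose proof (Cmod_triangle (hseg f c a b) (vseg f b c d)). lra.
Qed.

Lemma rect_int_lin f g (k : C) a b c d : (a <= b)%R -> (c <= d)%R -> holo_border f a b c d -> holo_border g a b c d ->
  rect_int (fun s => f s + k * g s) a b c d = rect_int f a b c d + k * rect_int g a b c d.
Proof.
  intros Hab Hcd [F1 F2] [G1 G2].
  assert (HH : forall e, (e = c \/ e = d) -> hseg (fun s => f s + k * g s) e a b = hseg f e a b + k * hseg g e a b).
  { intros e He. apply is_RInt_C_unique.
    apply (is_RInt_plus (V := CV) (fun t : R => f (t, e)) (fun t : R => k * g (t, e))).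
    - apply hseg_is_RInt; auto; intros t Ht; destruct He as [-> | ->]; now apply F1.
    - apply is_RInt_Cmult, hseg_is_RInt; auto; intros t Ht; destruct He as [-> | ->]; now apply G1. }
  assert (HV : forall e, (e = a \/ e = b) -> vseg (fun s => f s + k * g s) e c d = vseg f e c d + k * vseg g e c d).
  { intros e He. apply is_RInt_C_unique.
    apply is_RInt_ext with (f := fun t : R => plus (G := CV) (Ci * f (e, t)) (k * (Ci * g (e, t)))).
    { intros t _. change (Ci * f (e, t) + k * (Ci * g (e, t)) = Ci * (f (e, t) + k * g (e, t))). ring. }
    apply (is_RInt_plus (V := CV) (fun t : R => Ci * f (e, t)) (fun t : R => k * (Ci * g (e, t)))).
    - apply vseg_is_RInt; auto; intros t Ht; destruct He as [-> | ->]; now apply F2.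
    - apply is_RInt_Cmult, vseg_is_RInt; auto; intros t Ht; destruct He as [-> | ->]; now apply G2. }
  unfold rect_int. rewrite !HH, !HV by auto. ring.
Qed.

Lemma rect_int_primitive (F F' : C -> C) a b c d : (a <= b)%R -> (c <= d)%R ->
  (forall t, (a <= t <= b)%R -> holoD F F' (t, c) /\ holoD F F' (t, d)) ->
  (forall t, (c <= t <= d)%R -> holoD F F' (a, t) /\ holoD F F' (b, t)) -> rect_int F' a b c d = 0.
Proof.
  intros Hab Hcd H1 H2. unfold rect_int, hseg, vseg.
  rewrite (is_RInt_C_unique _ _ _ _ (is_RInt_hseg_primitive F F' a b c Hab ltac:(intros; now apply H1))).
  rewrite (is_RInt_C_unique _ _ _ _ (is_RInt_hseg_primitive F F' a b d Hab ltac:(intros; now apply H1))).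
  rewrite (is_RInt_C_unique _ _ _ _ (is_RInt_vseg_primitive F F' a c d Hcd ltac:(intros; now apply H2))).
  rewrite (is_RInt_C_unique _ _ _ _ (is_RInt_vseg_primitive F F' b c d Hcd ltac:(intros; now apply H2))).
  ring.
Qed.

Lemma is_RInt_inv_h (p c a b : R) : (a <= b)%R -> c <> 0%R ->
  is_RInt (V := CV) (fun t : R => / ((t, c) - p)) a b
    ((ln ((b - p) ^ 2 + c ^ 2) / 2 - ln ((a - p) ^ 2 + c ^ 2) / 2)%R, (atan ((a - p) / c) - atan ((b - p) / c))%R).
Proof.
  intros Hab Hc.
  assert (P : forall t, (0 < (t - p) ^ 2 + c ^ 2)%R) by (intros t; assert (0 < c ^ 2)%R by nra; pose proof (pow2_ge_0 (t - p)); lra).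
  apply (is_RInt_fct_extend_pair (U := R_NormedModule) (V := R_NormedModule)).
  - apply is_RInt_ext with (f := fun t => ((t - p) / ((t - p) ^ 2 + c ^ 2))%R).
    { intros t _. simpl. rewrite Ropp_0, Rplus_0_r. reflexivity. }
    apply (is_RInt_derive (V := R_CompleteNormedModule) (fun t => ln ((t - p) ^ 2 + c ^ 2) / 2)%R).
    + intros t _. auto_derive; [apply P|]. pose proof (P t). field. lra.
    + intros t _. apply (ex_derive_continuous (fun t => (t - p) / ((t - p) ^ 2 + c ^ 2))%R). auto_derive. pose proof (P t). lra.
  - apply is_RInt_ext with (f := fun t => (- c / ((t - p) ^ 2 + c ^ 2))%R).
    { intros t _. simpl. rewrite Ropp_0, Rplus_0_r. reflexivity. }
    replace (atan ((a - p) / c) - atan ((b - p) / c))%R with (- atan ((b - p) / c) - - atan ((a - p) / c))%R by ring.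
    apply (is_RInt_derive (V := R_CompleteNormedModule) (fun t => - atan ((t - p) / c))%R).
    + intros t _. auto_derive; auto. pose proof (P t). field. split; auto. lra.
    + intros t _. apply (ex_derive_continuous (fun t => - c / ((t - p) ^ 2 + c ^ 2))%R). auto_derive. pose proof (P t). lra.
Qed.

Lemma is_RInt_inv_v (p a c d : R) : (c <= d)%R -> a <> p ->
  is_RInt (V := CV) (fun t : R => Ci * / ((a, t) - p)) c d
    ((ln ((a - p) ^ 2 + d ^ 2) / 2 - ln ((a - p) ^ 2 + c ^ 2) / 2)%R, (atan (d / (a - p)) - atan (c / (a - p)))%R).
Proof.
  intros Hcd Ha.
  assert (Ha' : (a - p <> 0)%R) by lra.
  assert (P : forall t, (0 < (a - p) ^ 2 + t ^ 2)%R) by (intros t; assert (0 < (a - p) ^ 2)%R by nra; pose proof (pow2_ge_0 t); lra).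
  apply (is_RInt_fct_extend_pair (U := R_NormedModule) (V := R_NormedModule)).
  - apply is_RInt_ext with (f := fun t => (t / ((a - p) ^ 2 + t ^ 2))%R).
    { intros t _. simpl. rewrite Ropp_0, Rplus_0_r. pose proof (P t) as Pt. simpl in Pt. unfold Rminus in *. field. lra. }
    apply (is_RInt_derive (V := R_CompleteNormedModule) (fun t => ln ((a - p) ^ 2 + t ^ 2) / 2)%R).
    + intros t _. auto_derive; [apply P|]. pose proof (P t). field. lra.
    + intros t _. apply (ex_derive_continuous (fun t => t / ((a - p) ^ 2 + t ^ 2))%R). auto_derive. pose proof (P t). lra.
  - apply is_RInt_ext with (f := fun t => ((a - p) / ((a - p) ^ 2 + t ^ 2))%R).
    { intros t _. simpl. rewrite Ropp_0, Rplus_0_r. pose proof (P t) as Pt. simpl in Pt. unfold Rminus in *. field. lra. }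
    apply (is_RInt_derive (V := R_CompleteNormedModule) (fun t => atan (t / (a - p)))%R).
    + intros t _. auto_derive; auto. pose proof (P t). field. split; auto. lra.
    + intros t _. apply (ex_derive_continuous (fun t => (a - p) / ((a - p) ^ 2 + t ^ 2))%R). auto_derive. pose proof (P t). lra.
Qed.

Lemma atan_reciprocal_pos x y : (0 < x)%R -> (0 < y)%R -> (atan (x / y) + atan (y / x) = PI / 2)%R.
Proof.
  intros Hx Hy. replace (y / x)%R with (/ (x / y))%R by (field; lra).
  rewrite atan_inv by now apply Rdiv_lt_0_compat. ring.
Qed.

Lemma atan_reciprocal_neg x y : (0 < x)%R -> (y < 0)%R -> (atan (x / y) + atan (y / x) = - (PI / 2))%R.
Proof.
  intros Hx Hy. pose proof (atan_reciprocal_pos x (- y) Hx ltac:(lra)) as H.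
  replace (x / - y)%R with (- (x / y))%R in H by (field; lra). replace (- y / x)%R with (- (y / x))%R in H by (field; lra).
  rewrite !atan_opp in H. lra.
Qed.

(** In the explicit primitives the logarithms cancel. Each corner contributes the arctangents of a
    ratio and of its reciprocal, which combine to a quarter turn; the four corners give [2 PI]. *)
Lemma rect_int_inv (p a b c d : R) : (a < p < b)%R -> (c < 0 < d)%R ->
  rect_int (fun s => / (s - p)) a b c d = 2 * PI * Ci.
Proof.
  intros Hp Hcd. unfold rect_int, hseg, vseg.
  rewrite (is_RInt_C_unique _ _ _ _ (is_RInt_inv_h p c a b ltac:(lra) ltac:(lra))).
  rewrite (is_RInt_C_unique _ _ _ _ (is_RInt_inv_h p d a b ltac:(lra) ltac:(lra))).
  rewrite (is_RInt_C_unique _ _ _ _ (is_RInt_inv_v p a c d ltac:(lra) ltac:(lra))).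
  rewrite (is_RInt_C_unique _ _ _ _ (is_RInt_inv_v p b c d ltac:(lra) ltac:(lra))).
  pose proof (atan_reciprocal_pos (b - p) d ltac:(lra) ltac:(lra)) as E1.
  pose proof (atan_reciprocal_neg (b - p) c ltac:(lra) ltac:(lra)) as E2.
  pose proof (atan_reciprocal_neg d (a - p) ltac:(lra) ltac:(lra)) as E3.
  pose proof (atan_reciprocal_pos (- c) (- (a - p)) ltac:(lra) ltac:(lra)) as E4.
  replace (- c / - (a - p))%R with (c / (a - p))%R in E4 by (field; lra).
  replace (- (a - p) / - c)%R with ((a - p) / c)%R in E4 by (field; lra).
  unfold Cminus, Cplus, Copp, Cmult, Ci, RtoC; simpl. f_equal; [ring | lra].
Qed.

Lemma Cne_re (x y p : R) : x <> p -> (x, y) - p <> 0.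
Proof. intros H E. apply H. injection E as E1 E2. lra. Qed.

Lemma Cne_im (x y p : R) : y <> 0%R -> (x, y) - p <> 0.
Proof. intros H E. apply H. injection E as E1 E2. lra. Qed.

(** Subtracting the principal part leaves [g], bounded near [p]: its integral reduces by Cauchy's
    theorem to a square around [p] that shrinks to a point. The term in [c2] has a single-valued
    primitive on the border and contributes nothing. *)
Lemma Residue_rectangle f (p c1 c2 : C) (q a b c d e r M : R) :
  p = RtoC q -> (a < q < b)%R -> (c < 0 < d)%R -> (0 < e)%R ->
  (forall x y, (a <= x <= b)%R -> (c - e <= y <= d + e)%R -> (x, y) <> p -> holo f (x, y)) ->
  (0 < r)%R -> (forall s, s <> p -> (Cmod (s - p) < r)%R -> (Cmod (f s - c1 / (s - p) - c2 / (s - p) ^ 2) <= M)%R) ->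
  rect_int f a b c d = 2 * PI * Ci * c1.
Proof.
  intros Ep Hq Hcd He H Hr HM. subst p.
  assert (Hne : forall x y, (x <> q \/ y <> 0%R) -> (x, y) - q <> 0) by (intros x y [A|A]; [now apply Cne_re | now apply Cne_im]).
  assert (Hne' : forall x y, (x <> q \/ y <> 0%R) -> (x, y) <> RtoC q) by (intros x y [A|A] E; injection E; auto).
  assert (HI : forall s, s - q <> 0 -> holo (fun s => / (s - q)) s).
  { intros s Hs. apply holo_inv; auto. apply holo_minus; [apply holo_id | apply holo_const]. }
  assert (HI2 : forall s, s - q <> 0 -> holoD (fun s => - / (s - q)) (fun s => / (s - q) ^ 2) s).
  { intros s Hs. eapply holoD_ext; [| |apply holoD_mult; [apply (holoD_const (- (1))) |
      apply (holoD_comp Cinv (fun w => - / (w * w)) (fun s => s + - q) (fun _ => 1 + 0)); [now apply holoD_inv |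
      apply holoD_plus; [apply holoD_id | apply holoD_const]]]].
    - intros w; simpl. unfold Cminus. ring.
    - intros w; simpl. unfold Cminus. rewrite Cmult_1_r. ring. }
  assert (HI3 : forall s, s - q <> 0 -> holo (fun s => / (s - q) ^ 2) s).
  { intros s Hs. apply holo_ext_loc with (f := fun s => / (s - q) * / (s - q)); [|apply holo_mult; auto].
    exists 1%R; split; [lra|]. intros w _. simpl. rewrite Cmult_1_r, Cinv_total_mult. reflexivity. }
  set (g := fun s => f s + (- c1) * / (s - q) + (- c2) * / (s - q) ^ 2).
  assert (Hg : forall x y, (a <= x <= b)%R -> (c - e <= y <= d + e)%R -> (x <> q \/ y <> 0%R) -> holo g (x, y)).
  { intros x y Hx Hy Hxy. apply holo_plus; [apply holo_plus|]; [apply H; auto | |];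
      (apply holo_mult; [apply holo_const|]); auto. }
  assert (Bf : holo_border f a b c d) by (split; intros t Ht; split; apply H; try lra; apply Hne'; lra).
  assert (B1 : holo_border (fun s => / (s - q)) a b c d) by (split; intros t Ht; split; apply HI; apply Hne; lra).
  assert (B2 : holo_border (fun s => / (s - q) ^ 2) a b c d) by (split; intros t Ht; split; apply HI3; apply Hne; lra).
  assert (B12 : holo_border (fun s => f s + (- c1) * / (s - q)) a b c d).
  { split; intros t Ht; split; (apply holo_plus; [apply H; try lra; apply Hne'; lra | apply holo_mult; [apply holo_const | apply HI; apply Hne; lra]]). }
  assert (Eg : rect_int g a b c d = rect_int f a b c d - c1 * (2 * PI * Ci)).
  { unfold g. rewrite (rect_int_lin (fun s => f s + (- c1) * / (s - q))) by (auto; lra).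
    rewrite (rect_int_lin f) by (auto; lra). rewrite rect_int_inv by auto.
    rewrite (rect_int_primitive (fun s => - / (s - q)) (fun s => / (s - q) ^ 2)); [ring | lra | lra | |].
    - intros t Ht. split; apply HI2, Hne; lra.
    - intros t Ht. split; apply HI2, Hne; lra. }
  assert (Z : rect_int g a b c d = 0).
  { apply Cmod_eq_0. apply Rle_antisym; [|apply Cmod_ge_0]. apply le_epsilon. intros eps Heps. rewrite Rplus_0_l.
    assert (HM0 : (0 <= Rabs M)%R) by apply Rabs_pos.
    (* The entry [r / 3] keeps the square, whose points lie within [2 h] of [q], in the disc of the
       bound; the last entry makes its perimeter [8 h] times that bound at most [eps]. *)
    set (h := Rmin (Rmin (Rmin (q - a) (b - q)) (Rmin (- c) d)) (Rmin (r / 3) (eps / (8 * (Rabs M + 1))))).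
    assert (Hh : (0 < h)%R).
    { unfold h. repeat apply Rmin_pos; try lra. apply Rdiv_lt_0_compat; lra. }
    assert (h1 : (h <= q - a)%R) by (unfold h; do 2 (eapply Rle_trans; [apply Rmin_l|]); apply Rmin_l).
    assert (h2 : (h <= b - q)%R) by (unfold h; do 2 (eapply Rle_trans; [apply Rmin_l|]); apply Rmin_r).
    assert (h3 : (h <= - c)%R) by (unfold h; eapply Rle_trans; [apply Rmin_l|]; eapply Rle_trans; [apply Rmin_r|]; apply Rmin_l).
    assert (h4 : (h <= d)%R) by (unfold h; eapply Rle_trans; [apply Rmin_l|]; eapply Rle_trans; [apply Rmin_r|]; apply Rmin_r).
    assert (h5 : (h <= r / 3)%R) by (unfold h; eapply Rle_trans; [apply Rmin_r|]; apply Rmin_l).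
    assert (h6 : (h <= eps / (8 * (Rabs M + 1)))%R) by (unfold h; eapply Rle_trans; [apply Rmin_r|]; apply Rmin_r).
    rewrite (rect_int_split_h g a (q - h) b) by (try lra; intros; apply Hg; lra).
    rewrite (rect_int_split_h g (q - h) (q + h) b) by (try lra; intros; apply Hg; lra).
    rewrite (rect_int_split_v g (q - h) (q + h) c (- h) d) by (try lra; intros; apply Hg; lra).
    rewrite (rect_int_split_v g (q - h) (q + h) (- h) h d) by (try lra; intros; apply Hg; lra).
    rewrite (Cauchy_rectangle g a (q - h) c d e) by (try lra; intros; apply Hg; lra).
    rewrite (Cauchy_rectangle g (q + h) b c d e) by (try lra; intros; apply Hg; lra).
    rewrite (Cauchy_rectangle g (q - h) (q + h) c (- h) (Rmin e (h / 2))).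
    2: lra. 2: lra. 2: apply Rmin_pos; lra.
    2:{ intros x y Hx Hy. pose proof (Rmin_l e (h / 2)); pose proof (Rmin_r e (h / 2)). apply Hg; lra. }
    rewrite (Cauchy_rectangle g (q - h) (q + h) h d (Rmin e (h / 2))).
    2: lra. 2: lra. 2: apply Rmin_pos; lra.
    2:{ intros x y Hx Hy. pose proof (Rmin_l e (h / 2)); pose proof (Rmin_r e (h / 2)). apply Hg; lra. }
    replace (0 + (0 + (rect_int g (q - h) (q + h) (- h) h + 0) + 0)) with (rect_int g (q - h) (q + h) (- h) h) by ring.
    replace (0 + (0 + (rect_int g (q - h) (q + h) (- h) h + 0 + 0))) with (rect_int g (q - h) (q + h) (- h) h) by ring.
    replace (0 + (0 + (rect_int g (q - h) (q + h) (- h) h + 0)) + 0) with (rect_int g (q - h) (q + h) (- h) h) by ring.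
    apply Rle_trans with (2 * ((q + h - (q - h)) + (h - - h)) * Rabs M)%R.
    - replace (0 + (0 + (rect_int g (q - h) (q + h) (- h) h + 0) + 0)) with (rect_int g (q - h) (q + h) (- h) h) by ring.
      match goal with |- (Cmod ?z <= _)%R => replace z with (rect_int g (q - h) (q + h) (- h) h) by ring end.
      apply rect_int_bound; try lra.
      + split; intros t Ht; split; apply Hg; lra.
      + intros x y Hx Hy Hb. eapply Rle_trans; [|apply Rle_abs]. unfold g.
        replace (f (x, y) + - c1 * / ((x, y) - q) + - c2 * / ((x, y) - q) ^ 2) with
          (f (x, y) - c1 / ((x, y) - q) - c2 / ((x, y) - q) ^ 2) by (unfold Cdiv; ring).
        apply HM.
        * apply Hne'. lra.
        * eapply Rle_lt_trans; [apply Cmod_le_Re_Im|]. unfold Re, Im; simpl.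
          assert (Rabs (x + - q) <= h)%R by (apply Rabs_le; lra). assert (Rabs (y + - 0) <= h)%R by (apply Rabs_le; lra). lra.
    - replace (2 * (q + h - (q - h) + (h - - h)))%R with (8 * h)%R by ring.
      apply Rle_trans with (8 * (eps / (8 * (Rabs M + 1))) * (Rabs M + 1))%R; [|right; field; lra].
      apply Rmult_le_compat; lra. }
  rewrite Z in Eg. replace (rect_int f a b c d) with (rect_int f a b c d - c1 * (2 * PI * Ci) + c1 * (2 * PI * Ci)) by ring.
  rewrite <- Eg. ring.
Qed.

(** * The loop integral *)

(* The integrand of the G-function at argument [z^2], with [L = Cln z]; [Gamma(-s) = - Gamma(1-s) / s]
   is used to cancel one Gamma factor and to make the double pole at 0 explicit. *)
Definition fG (nu : R) (L s : C) : C :=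
  rgam (1 + nu + s) * Cexp (2 * s * L) / (s * s * rgam (1 - s) * rgam (nu - s) * rgam ((1 / 2)%R + s)).

(** The quotient of [fG] at [s + 1] and at [s]: rational in [s] up to the constant [Cexp (2 * L)].
    It governs both the decay along the loop and the ratio of successive residues. *)
Definition rho (nu : R) (L s : C) : C :=
  Cexp (2 * L) * s * ((1 / 2)%R + s) / ((1 + nu + s) * ((s + 1) * (s + 1)) * (s + 1 - nu)).

(* Away from the poles [k] and [nu + k], all of them real. *)
Definition offpole (nu : R) (s : C) : Prop :=
  (- (1 / 2) < Re s)%R /\ (Im s = 0%R -> forall k : nat, Re s <> INR k /\ Re s <> (nu + INR k)%R).

Lemma holo_rgam (g : C -> C) (s : C) : holo g s -> holo (fun w => rgam (g w)) s.
Proof. intros H. apply (holo_comp rgam g); auto. eexists; apply holoD_rgam. Qed.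

Lemma C_eq_ReIm (a b : C) : Re a = Re b -> Im a = Im b -> a = b.
Proof. destruct a, b; unfold Re, Im; simpl; intros; subst; reflexivity. Qed.

Lemma offpole_neq (nu : R) (s : C) : offpole nu s ->
  s <> 0 /\ rgam (1 - s) <> 0 /\ rgam (nu - s) <> 0 /\ rgam ((1 / 2)%R + s) <> 0.
Proof.
  intros [H1 H2]. repeat split.
  - intros E. destruct (H2 ltac:(now rewrite E) O) as [A _]. apply A. rewrite E. reflexivity.
  - apply rgam_neq_0. intros m E. assert (E' : s = RtoC (1 + INR m)).
    { replace s with (1 - (1 - s)) by ring. rewrite E, RtoC_plus. ring. }
    destruct (H2 ltac:(now rewrite E') (S m)) as [A _]. apply A. rewrite E', S_INR. unfold Re; simpl. ring.
  - apply rgam_neq_0. intros m E. assert (E' : s = RtoC (nu + INR m)).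
    { replace s with (nu - (nu - s)) by ring. rewrite E, RtoC_plus. ring. }
    destruct (H2 ltac:(now rewrite E') m) as [_ A]. apply A. now rewrite E'.
  - apply rgam_neq_0_Re. unfold Re in *; simpl. lra.
Qed.

Lemma holo_fG nu L s : offpole nu s -> holo (fG nu L) s.
Proof.
  intros H. destruct (offpole_neq nu s H) as (A & B & C0 & D). unfold fG, Cdiv.
  apply holo_mult; [apply holo_mult|].
  - apply holo_rgam. repeat (apply holo_plus || apply holo_const || apply holo_id).
  - apply holo_Cexp. repeat (apply holo_mult || apply holo_const || apply holo_id).
  - apply holo_inv.
    + repeat apply Cmult_neq_0; auto.
    + repeat apply holo_mult; try apply holo_id; apply holo_rgam;
      repeat (apply holo_minus || apply holo_plus || apply holo_const || apply holo_id).
Qed.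

Lemma fG_rec nu L s : (0 < nu)%R -> offpole nu s -> s + 1 - nu <> 0 -> fG nu L (s + 1) = fG nu L s * rho nu L s.
Proof.
  intros Hnu H HN. destruct (offpole_neq nu s H) as (A & B & C0 & D). destruct H as [H1 _].
  assert (HS : s + 1 <> 0) by (intros E; apply (f_equal Re) in E; unfold Re in *; simpl in E; lra).
  assert (H3 : (1 / 2)%R + s <> 0) by (intros E; apply (f_equal Re) in E; unfold Re in *; simpl in E; lra).
  assert (H4 : 1 + nu + s <> 0) by (intros E; apply (f_equal Re) in E; unfold Re in *; simpl in E; lra).
  assert (D' : rgam ((1 / 2)%R + (s + 1)) <> 0) by (apply rgam_neq_0_Re; unfold Re in *; simpl; lra).
  assert (H6 : nu - s - 1 <> 0) by (intros E; apply HN; replace (s + 1 - nu) with (- (nu - s - 1)) by ring; rewrite E; ring).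
  unfold fG, rho.
  rewrite (rgam_rec (1 + nu + s)), (rgam_rec ((1 / 2)%R + s)).
  replace (1 - (s + 1)) with (- s) by ring. rewrite (rgam_rec (- s)). replace (- s + 1) with (1 - s) by ring.
  replace (nu - (s + 1)) with (nu - s - 1) by ring. rewrite (rgam_rec (nu - s - 1)). replace (nu - s - 1 + 1) with (nu - s) by ring.
  replace (1 + nu + (s + 1)) with (1 + nu + s + 1) by ring. replace ((1 / 2)%R + (s + 1)) with ((1 / 2)%R + s + 1) in * by ring.
  replace (2 * (s + 1) * L) with (2 * s * L + 2 * L) by ring. rewrite Cexp_plus.
  set (h := RtoC (1 / 2)) in *. set (n := RtoC nu) in *.
  field. repeat split; auto.
Qed.

Lemma Cmod_le_of_Re (a b : C) : (0 <= Re a <= Re b)%R -> Im a = Im b -> (Cmod a <= Cmod b)%R.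
Proof.
  intros H E. unfold Cmod. apply sqrt_le_1_alt. change (Re a ^ 2 + Im a ^ 2 <= Re b ^ 2 + Im b ^ 2)%R.
  rewrite E. nra.
Qed.

(** To the right of [- 1/2] the quotients [s / (s + 1)] and [(1/2 + s) / (1 + nu + s)] have modulus
    at most 1. Of the remaining two denominators [s + 1] gives the decay, and [s + 1 - nu] is
    bounded below by the distance [d]. *)
Lemma rho_bound nu L s (d : R) : (0 < nu)%R -> (- (1 / 2) < Re s)%R -> (0 < d)%R -> (d <= Cmod (s + 1 - nu))%R ->
  (Cmod (rho nu L s) <= Cmod (Cexp (2 * L)) / d / (Re s + 1))%R.
Proof.
  intros Hnu H1 Hd HD. unfold rho, Cdiv. rewrite !Cmod_mult, Cmod_inv_total, !Cmod_mult.
  assert (A1 : (Cmod s <= Cmod (s + 1))%R).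
  { unfold Cmod. apply sqrt_le_1_alt. unfold Re in *; simpl. nra. }
  assert (A2 : (Cmod ((1 / 2)%R + s) <= Cmod (1 + nu + s))%R).
  { apply Cmod_le_of_Re; [unfold Re in *; simpl; lra | unfold Im; simpl; ring]. }
  assert (A3 : (Re s + 1 <= Cmod (s + 1))%R) by (eapply Rle_trans; [|apply Cmod_ge_Re]; unfold Re; simpl; lra).
  assert (A4 : (0 < Cmod (1 + nu + s))%R).
  { eapply Rlt_le_trans; [|apply Cmod_ge_Re]. unfold Re in *; simpl. lra. }
  pose proof (Cmod_ge_0 s) as P0. pose proof (Cmod_ge_0 ((1 / 2)%R + s)) as P2. pose proof (Cmod_ge_0 (Cexp (2 * L))) as P3.
  set (z := Cmod (Cexp (2 * L))) in *. set (a := Cmod s) in *. set (b := Cmod (s + 1)) in *.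
  set (u := Cmod ((1 / 2)%R + s)) in *. set (v := Cmod (1 + nu + s)) in *. set (w := Cmod (s + 1 - nu)) in *.
  set (x := (Re s + 1)%R) in *. assert (Hx : (0 < x)%R) by (unfold x; lra).
  replace (z * a * u * / (v * (b * b) * w))%R with (z * (a / b) * (u / v) * (/ b) * (/ w))%R by (field; lra).
  replace (z / d / x)%R with (z * 1 * 1 * / x * / d)%R by (field; lra).
  assert (B1 : (0 <= a / b <= 1)%R).
  { split; [apply Rdiv_le_0_compat; lra|]. apply Rmult_le_reg_r with b; [lra|]. unfold Rdiv. rewrite Rmult_assoc, Rinv_l; lra. }
  assert (B2 : (0 <= u / v <= 1)%R).
  { split; [apply Rdiv_le_0_compat; lra|]. apply Rmult_le_reg_r with v; [lra|]. unfold Rdiv. rewrite Rmult_assoc, Rinv_l; lra. }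
  assert (B3 : (0 <= / b <= / x)%R) by (split; [left; apply Rinv_0_lt_compat; lra | apply Rinv_le_contravar; lra]).
  assert (B4 : (0 <= / w <= / d)%R) by (split; [left; apply Rinv_0_lt_compat; lra | apply Rinv_le_contravar; lra]).
  revert B1 B2 B3 B4. generalize (a / b)%R (u / v)%R (/ b)%R (/ w)%R (/ x)%R (/ d)%R.
  intros q1 q2 q3 q4 q5 q6 B1 B2 B3 B4.
  repeat apply Rmult_le_compat; try lra; repeat apply Rmult_le_pos; lra.
Qed.

(** Iterating the shift gives factorial decay from the values on one unit strip. This one estimate
    makes the horizontal integrals converge, the vertical sides vanish and the series of cells
    summable. *)
Lemma fG_shift_bound nu L s (d : R) (k : nat) : (0 < nu)%R -> (- (1 / 2) < Re s)%R -> (0 < d)%R ->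
  (forall j : nat, offpole nu (s + INR j)) -> (forall j : nat, (d <= Cmod (s + INR j + 1 - nu))%R) ->
  (Cmod (fG nu L (s + INR k)) <= Cmod (fG nu L s) * ((2 * Cmod (Cexp (2 * L)) / d) ^ k / INR (fact k)))%R.
Proof.
  intros Hnu H1 Hd HO HD. set (z := Cmod (Cexp (2 * L))). assert (Hz : (0 <= z)%R) by apply Cmod_ge_0.
  induction k.
  - simpl. rewrite Cplus_0_r. lra.
  - replace (s + INR (S k)) with (s + INR k + 1) by (rewrite S_INR, RtoC_plus; ring).
    rewrite fG_rec, Cmod_mult; auto.
    2:{ intros E. specialize (HD k). rewrite E, Cmod_0 in HD. lra. }
    assert (Hk := pos_INR k).
    assert (HR : (- (1 / 2) < Re (s + INR k))%R) by (unfold Re in *; simpl; lra).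
    pose proof (rho_bound nu L _ d Hnu HR Hd (HD k)) as B. fold z in B.
    (* The factor 2 comes from [Re s + k + 1 >= (k + 1) / 2], valid because [Re s > - 1/2]. *)
    assert (B' : (Cmod (rho nu L (s + INR k)) <= 2 * z / d * / INR (S k))%R).
    { eapply Rle_trans; [exact B|]. replace (2 * z / d * / INR (S k))%R with (z / d * (2 / INR (S k)))%R by (field; split; [apply not_0_INR; lia | lra]).
      unfold Rdiv at 1. apply Rmult_le_compat_l; [apply Rdiv_le_0_compat; lra|].
      rewrite S_INR. unfold Re in *; simpl. simpl in HR.
      replace (2 / (INR k + 1))%R with (/ ((INR k + 1) / 2))%R by (field; lra).
      apply Rinv_le_contravar; lra. }
    replace (fact (S k)) with (S k * fact k)%nat by reflexivity. rewrite mult_INR.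
    replace (Cmod (fG nu L s) * ((2 * z / d) ^ S k / (INR (S k) * INR (fact k))))%R with
      (Cmod (fG nu L s) * ((2 * z / d) ^ k / INR (fact k)) * (2 * z / d * / INR (S k)))%R.
    + apply Rmult_le_compat; auto using Cmod_ge_0.
    + simpl pow. pose proof (INR_fact_neq_0 k). assert (INR (S k) <> 0)%R by (apply not_0_INR; lia). field. repeat split; auto. lra.
Qed.

Lemma ex_series_exp (B D : R) : ex_series (fun k => B * (D ^ k / INR (fact k)))%R.
Proof.
  apply (ex_series_scal_l (K := R_AbsRing) (V := R_NormedModule) B (fun k => D ^ k / INR (fact k))%R).
  exists (exp D). pose proof (is_exp_Reals D) as H. unfold is_pseries in H.
  eapply is_series_ext; [|exact H]. intros n. simpl.
  unfold scal; simpl; unfold mult; simpl. rewrite pow_n_pow. reflexivity.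
Qed.

Lemma exp_term_lim (B D : R) : is_lim_seq (fun k => B * (D ^ k / INR (fact k)))%R 0%R.
Proof. apply (ex_series_lim_0 (fun k => B * (D ^ k / INR (fact k)))%R), ex_series_exp. Qed.

Lemma psum_telescope (u : nat -> C) n : psum (fun k => u (S k) - u k) n = u n - u O.
Proof. induction n; simpl; [ring | rewrite IHn; ring]. Qed.

(** The integrals up to [sigma + N] converge by summability over unit intervals; an arbitrary upper
    limit differs from the nearest such point below it by at most one term of the majorant. *)
Lemma is_RInt_gen_decay (g : R -> C) (sigma B D : R) :
  (forall t, (sigma <= t)%R -> continuous (U := CV) g t) ->
  (forall t k, (sigma <= t <= sigma + 1)%R -> (Cmod (g (t + INR k)%R) <= B * (D ^ k / INR (fact k)))%R) ->
  exists l : C, is_RInt_gen (V := CV) g (at_point sigma) (Rbar_locally p_infty) l /\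
    cv (fun N => RInt (V := CCV) g sigma (sigma + INR N)%R) l.
Proof.
  intros HC HB.
  assert (HI : forall a b, (sigma <= a)%R -> (a <= b)%R -> is_RInt (V := CV) g a b (RInt (V := CCV) g a b)).
  { intros a b Ha Hab. apply (RInt_correct (V := CCV)), (ex_RInt_continuous (V := CCV)).
    rewrite Rmin_left, Rmax_right by auto. intros t Ht. apply HC. lra. }
  set (I := fun X => RInt (V := CCV) g sigma X : C).
  assert (HD : forall a b k, (sigma + INR k <= a)%R -> (a <= b)%R -> (b <= sigma + INR (S k))%R ->
     (Cmod (I b - I a) <= B * (D ^ k / INR (fact k)))%R).
  { intros a b k Ha Hab Hb. rewrite S_INR in Hb. pose proof (pos_INR k).
    assert (E : I b - I a = RInt (V := CCV) g a b).
    { assert (E : I b = I a + RInt (V := CCV) g a b); [|rewrite E; ring].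
      apply is_RInt_C_unique. apply (is_RInt_Chasles (V := CV)) with a; apply HI; lra. }
    rewrite E. eapply Rle_trans; [eapply is_RInt_C_bound; [exact Hab | | apply HI; lra]|].
    - intros t Ht. cbv beta. specialize (HB (t - INR k)%R k ltac:(lra)).
      replace (t - INR k + INR k)%R with t in HB by ring. exact HB.
    - assert (0 <= B * (D ^ k / INR (fact k)))%R.
      { specialize (HB sigma k ltac:(lra)). pose proof (Cmod_ge_0 (g (sigma + INR k)%R)). lra. }
      nra. }
  assert (HS : exists l, cv (fun N => I (sigma + INR N)%R) l).
  { assert (HA : abs_summable (fun N => I (sigma + INR (S N))%R - I (sigma + INR N)%R)).
    { eapply abs_summable_le; [|apply (ex_series_exp B D)]. intros k. apply HD; rewrite ?S_INR; lra. }
    pose proof (abs_summable_cser _ HA) as HS. eexists.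
    eapply cv_ext; [|apply cv_plus; [exact HS | apply (cv_const (I (sigma + INR 0)%R))]].
    intros n. cbv beta. rewrite (psum_telescope (fun N => I (sigma + INR N)%R)). ring. }
  destruct HS as [l Hl]. exists l. split; [|exact Hl].
  intros P [eps HP].
  assert (He2 : (0 < eps / 2)%R) by (pose proof (cond_pos eps); lra).
  apply cv_Cmod in Hl. apply is_lim_seq_spec in Hl. destruct (Hl (mkposreal _ He2)) as [N1 HN1].
  pose proof (exp_term_lim B D) as HT. apply is_lim_seq_spec in HT. destruct (HT (mkposreal _ He2)) as [N2 HN2].
  set (N := (N1 + N2)%nat).
  apply (Filter_prod _ _ _ (fun a => a = sigma) (fun X => (sigma + INR N < X)%R)).
  - reflexivity.
  - exists (sigma + INR N)%R. auto.
  - intros a X -> HX. simpl. exists (I X). pose proof (pos_INR N). split; [apply HI; lra|].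
    destruct (nfloor_ex (X - sigma) ltac:(lra)) as [k Hk].
    assert (HkN : (N <= k)%nat).
    { apply INR_le. destruct (Rle_dec (INR N) (INR k)) as [|C0]; auto. exfalso.
      assert (k < N)%nat by (apply INR_lt; lra). assert (S k <= N)%nat by lia. apply le_INR in H1. rewrite S_INR in H1. lra. }
    apply HP. specialize (HN1 k ltac:(unfold N in HkN; lia)). specialize (HN2 k ltac:(unfold N in HkN; lia)). simpl in HN1, HN2.
    rewrite Rminus_0_r in HN1, HN2. rewrite Rabs_pos_eq in HN1 by apply Cmod_ge_0.
    assert (HDX := HD (sigma + INR k)%R X k ltac:(lra) ltac:(lra) ltac:(rewrite S_INR; lra)).
    pose proof (Rle_abs (B * (D ^ k / INR (fact k)))).
    assert (HF : (Cmod (I X - l) < eps)%R).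
    { replace (I X - l) with ((I X - I (sigma + INR k)%R) + (I (sigma + INR k)%R - l)) by ring.
      eapply Rle_lt_trans; [apply Cmod_triangle|]. lra. }
    split; (eapply Rle_lt_trans; [|exact HF]); [apply (re_le_Cmod (I X - l)) | apply (im_le_Cmod (I X - l))].
Qed.

Lemma bounded_on_segment (g : R -> C) (a b : R) : (forall t, (a <= t <= b)%R -> continuous (U := CV) g t) ->
  exists B, (0 <= B)%R /\ forall t, (a <= t <= b)%R -> (Cmod (g t) <= B)%R.
Proof.
  intros H. destruct (bounded_continuity (V := CV) g a b) as [M HM].
  - intros x Hx. apply H. exact Hx.
  - exists (Rmax 0 M). split; [apply Rmax_l|]. intros t Ht. specialize (HM t Ht). rewrite Cmod_norm_R in HM.
    pose proof (Rmax_r 0 M). lra.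
Qed.

Lemma offpole_im nu (s : C) : (- (1 / 2) < Re s)%R -> Im s <> 0%R -> offpole nu s.
Proof. intros A B. split; [exact A | intros E; contradiction]. Qed.

Lemma hline_shift (t c : R) (k : nat) : (((t + INR k)%R, c) : C) = (t, c) + INR k.
Proof. apply hline. Qed.

Lemma fG_horizontal nu L (sigma c : R) : (0 < nu)%R -> (- (1 / 2) < sigma)%R -> c <> 0%R ->
  exists l : C, is_RInt_gen (V := CV) (fun t : R => fG nu L (t, c)) (at_point sigma) (Rbar_locally p_infty) l /\
    cv (fun N => hseg (fG nu L) c sigma (sigma + INR N)) l.
Proof.
  intros Hnu Hs Hc.
  assert (HO : forall t, (sigma <= t)%R -> offpole nu (t, c)) by (intros t Ht; apply offpole_im; unfold Re, Im; simpl; auto; lra).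
  assert (HCt : forall t, (sigma <= t)%R -> continuous (U := CV) (fun t : R => fG nu L (t, c)) t).
  { intros t Ht. apply holo_continuous_h, holo_fG, HO, Ht. }
  destruct (bounded_on_segment (fun t : R => fG nu L (t, c)) sigma (sigma + 1)) as (B & HB0 & HB).
  { intros t Ht. apply HCt. lra. }
  apply (is_RInt_gen_decay _ sigma B (2 * Cmod (Cexp (2 * L)) / Rabs c)); auto.
  intros t k Ht. rewrite hline_shift.
  assert (Hcp : (0 < Rabs c)%R) by now apply Rabs_pos_lt.
  eapply Rle_trans; [apply (fG_shift_bound nu L (t, c) (Rabs c)); auto|].
  - unfold Re; simpl. lra.
  - intros j. rewrite <- hline_shift. apply HO. pose proof (pos_INR j). lra.
  - intros j. eapply Rle_trans; [|apply im_le_Cmod]. unfold Im; simpl. right. f_equal. ring.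
  - apply Rmult_le_compat_r; [|now apply HB].
    apply Rdiv_le_0_compat; [|apply INR_fact_lt_0]. apply pow_le. apply Rdiv_le_0_compat; auto.
    pose proof (Cmod_ge_0 (Cexp (2 * L))). lra.
Qed.

(** Keeps every vertical line through [sigma + N] off both families of poles: off the integers
    because [sigma] lies strictly between [- 1/2] and 0, and at distance at least [d] from all
    [nu + k], uniformly in [N]. *)
Definition pole_dist (nu sigma d : R) : Prop :=
  (- (1 / 2) < sigma < 0)%R /\ (0 < d)%R /\ forall j : Z, (d <= Rabs (sigma + IZR j - nu))%R.

Lemma pole_dist_offpole nu sigma d (j : nat) y : (0 < nu)%R -> pole_dist nu sigma d -> offpole nu ((sigma + INR j)%R, y).
Proof.
  intros Hnu (Hs & Hd & H). pose proof (pos_INR j). split; [unfold Re; simpl; lra|].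
  intros _ k. unfold Re; simpl. split.
  - intros E. assert (E2 : IZR (Z.of_nat k - Z.of_nat j) = sigma) by (rewrite minus_IZR, <- !INR_IZR_INZ; lra).
    assert (-1 < Z.of_nat k - Z.of_nat j < 0)%Z by (split; apply lt_IZR; rewrite E2; lra). lia.
  - intros E. specialize (H (Z.of_nat j - Z.of_nat k)%Z). rewrite minus_IZR, <- !INR_IZR_INZ in H.
    replace (sigma + (INR j - INR k) - nu)%R with 0%R in H by lra. rewrite Rabs_R0 in H. lra.
Qed.

Lemma pole_dist_bound nu sigma d (j : nat) y : pole_dist nu sigma d -> (d <= Cmod ((sigma, y) + INR j + 1 - nu))%R.
Proof.
  intros (Hs & Hd & H). specialize (H (Z.of_nat j + 1)%Z). rewrite plus_IZR, <- INR_IZR_INZ in H.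
  eapply Rle_trans; [|apply re_le_Cmod]. unfold Re; simpl. replace (sigma + INR j + 1 + - nu)%R with (sigma + (INR j + 1) - nu)%R by ring. exact H.
Qed.

Lemma fG_vertical_lim nu L sigma d c1 c2 : (0 < nu)%R -> pole_dist nu sigma d -> (c1 <= c2)%R ->
  cv (fun N => vseg (fG nu L) (sigma + INR N) c1 c2) 0.
Proof.
  intros Hnu HP Hc. pose proof HP as (Hs & Hd & _).
  assert (HO : forall y, offpole nu (sigma, y)).
  { intros y. pose proof (pole_dist_offpole nu sigma d 0 y Hnu HP) as H. simpl in H. now rewrite Rplus_0_r in H. }
  destruct (bounded_on_segment (fun t : R => fG nu L (sigma, t)) c1 c2) as (B & HB0 & HB).
  { intros t Ht. apply holo_continuous_v, holo_fG, HO. }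
  apply cv_squeeze with (a := fun N => ((c2 - c1) * B * ((2 * Cmod (Cexp (2 * L)) / d) ^ N / INR (fact N)))%R); [|apply exp_term_lim].
  intros N. replace (vseg (fG nu L) (sigma + INR N) c1 c2 - 0) with (vseg (fG nu L) (sigma + INR N) c1 c2) by ring.
  rewrite Rmult_assoc. eapply is_RInt_C_bound; [exact Hc | | apply vseg_is_RInt; auto].
  - intros t Ht. cbv beta. rewrite Cmod_mult, Cmod_Ci, Rmult_1_l, hline_shift.
    eapply Rle_trans; [apply (fG_shift_bound nu L (sigma, t) d); auto|].
    + unfold Re; simpl. lra.
    + intros j. rewrite <- hline_shift. now apply pole_dist_offpole with d.
    + intros j. now apply pole_dist_bound.
    + apply Rmult_le_compat_r; [|now apply HB].
      apply Rdiv_le_0_compat; [|apply INR_fact_lt_0]. apply pow_le. apply Rdiv_le_0_compat; auto.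
      pose proof (Cmod_ge_0 (Cexp (2 * L))). lra.
  - intros t Ht. now apply holo_fG, pole_dist_offpole with d.
Qed.

Lemma offpole_strip nu x y : (0 < nu)%R -> (- (1 / 2) < x < 0)%R -> offpole nu (x, y).
Proof.
  intros Hnu Hx. split; [unfold Re; simpl; lra|]. intros _ k. unfold Re; simpl. pose proof (pos_INR k). lra.
Qed.

(* The part of a loop left of the abscissa [X] does not depend on the loop. *)
Lemma fG_rect_indep nu L X sigma c1 c2 sigma' c1' c2' : (0 < nu)%R -> (0 <= X)%R -> (forall y, offpole nu (X, y)) ->
  (- (1 / 2) < sigma < 0)%R -> (c1 < 0 < c2)%R -> (- (1 / 2) < sigma' < 0)%R -> (c1' < 0 < c2')%R ->
  rect_int (fG nu L) sigma X c1 c2 = rect_int (fG nu L) sigma' X c1' c2'.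
Proof.
  intros Hnu HX HO.
  assert (HI : forall x y, (- (1 / 2) < x)%R -> y <> 0%R -> holo (fG nu L) (x, y)) by (intros; apply holo_fG, offpole_im; auto).
  assert (HL : forall x y, (- (1 / 2) < x < 0)%R -> holo (fG nu L) (x, y)) by (intros; now apply holo_fG, offpole_strip).
  assert (HXh : forall y, holo (fG nu L) (X, y)) by (intros; now apply holo_fG).
  assert (S1 : forall s c c' d, (- (1 / 2) < s < 0)%R -> (c <= c')%R -> (c' < 0 < d)%R ->
    rect_int (fG nu L) s X c d = rect_int (fG nu L) s X c' d).
  { intros s c c' d Hs Hc Hd. rewrite (rect_int_split_v _ s X c c' d) by (auto; lra).
    rewrite (Cauchy_rectangle _ s X c c' (- c' / 2)); [ring | lra | lra | lra |].
    intros x y Hx Hy. apply HI; lra. }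
  assert (S2 : forall s c d d', (- (1 / 2) < s < 0)%R -> (d <= d')%R -> (c < 0 < d)%R ->
    rect_int (fG nu L) s X c d' = rect_int (fG nu L) s X c d).
  { intros s c d d' Hs Hc Hd. rewrite (rect_int_split_v _ s X c d d') by (auto; lra).
    rewrite (Cauchy_rectangle _ s X d d' (d / 2)); [ring | lra | lra | lra |].
    intros x y Hx Hy. apply HI; lra. }
  assert (S3 : forall s s' c d, (- (1 / 2) < s)%R -> (s <= s')%R -> (s' < 0)%R -> (c < 0 < d)%R ->
    rect_int (fG nu L) s X c d = rect_int (fG nu L) s' X c d).
  { intros s s' c d Hs Hss Hs' Hd. rewrite (rect_int_split_h _ s s' X c d); [|lra | intros; apply HI; lra | intros; apply HI; lra].
    rewrite (Cauchy_rectangle _ s s' c d 1); [ring | lra | lra | lra |].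
    intros x y Hx Hy. apply HL; lra. }
  intros Hs Hc Hs' Hc'.
  set (m1 := Rmax c1 c1'). set (m2 := Rmin c2 c2'). set (ms := Rmax sigma sigma').
  assert (Hm1 : (m1 < 0)%R) by (apply Rmax_lub_lt; lra). assert (Hm2 : (0 < m2)%R) by (apply Rmin_pos; lra).
  assert (Hms : (- (1 / 2) < ms < 0)%R) by (split; [eapply Rlt_le_trans; [|apply Rmax_l]; lra | apply Rmax_lub_lt; lra]).
  transitivity (rect_int (fG nu L) ms X m1 m2).
  - rewrite (S3 sigma ms) by (try apply Rmax_l; lra). rewrite (S1 ms c1 m1) by (try apply Rmax_l; lra).
    apply S2; try apply Rmin_l; lra.
  - symmetry. rewrite (S3 sigma' ms) by (try apply Rmax_r; lra). rewrite (S1 ms c1' m1) by (try apply Rmax_r; lra).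
    apply S2; try apply Rmin_r; lra.
Qed.

Lemma hseg_opp_rect f a b c d : hseg f d a b - hseg f c a b + vseg f a c d = vseg f b c d - rect_int f a b c d.
Proof. unfold rect_int. ring. Qed.

(* The horizontal sides are first moved from [s] to [sigma]: the abscissae [sigma + N] keep away from the poles. *)
Lemma fG_loop nu L sigma d Rs : (0 < nu)%R -> pole_dist nu sigma d ->
  cv (fun N => rect_int (fG nu L) sigma (sigma + INR N) (-1) 1) Rs ->
  forall s c1 c2, (- (1 / 2) < s < 0)%R -> (c1 < 0 < c2)%R -> is_loop_integral (fG nu L) s c1 c2 (- Rs).
Proof.
  intros Hnu HP HR s c1 c2 Hs Hc. pose proof HP as (Hsig & _ & _).
  destruct (fG_horizontal nu L sigma c1 Hnu ltac:(lra) ltac:(lra)) as (l1 & _ & C1).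
  destruct (fG_horizontal nu L sigma c2 Hnu ltac:(lra) ltac:(lra)) as (l3 & _ & C3).
  destruct (fG_horizontal nu L s c1 Hnu ltac:(lra) ltac:(lra)) as (k1 & G1 & K1).
  destruct (fG_horizontal nu L s c2 Hnu ltac:(lra) ltac:(lra)) as (k3 & G3 & K3).
  assert (HI : forall x y, (- (1 / 2) < x)%R -> y <> 0%R -> holo (fG nu L) (x, y)) by (intros; apply holo_fG, offpole_im; auto).
  assert (HL : forall x y, (- (1 / 2) < x < 0)%R -> holo (fG nu L) (x, y)) by (intros; now apply holo_fG, offpole_strip).
  exists k1, (vseg (fG nu L) s c1 c2), k3. split; [exact G1|]. split; [|split; [exact G3|]].
  { apply vseg_is_RInt; [lra|]. intros; now apply HL. }
  assert (HM : forall c l k, c <> 0%R -> cv (fun N => hseg (fG nu L) c sigma (sigma + INR N)) l ->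
     is_RInt_gen (V := CV) (fun t : R => fG nu L (t, c)) (at_point s) (Rbar_locally p_infty) k ->
     k = hseg (fG nu L) c s sigma + l).
  { intros c l k Hcc Hl Hk.
    destruct (fG_horizontal nu L sigma c Hnu ltac:(lra) Hcc) as (l' & Gl' & Cl').
    rewrite (cv_unique _ _ _ Hl Cl').
    assert (J : is_RInt (V := CV) (fun t : R => fG nu L (t, c)) s sigma (hseg (fG nu L) c s sigma)).
    { apply (RInt_correct (V := CCV)), (ex_RInt_continuous (V := CCV)). intros t Ht. apply holo_continuous_h, HI; auto.
      unfold Rmin in Ht. destruct (Rle_dec s sigma); lra. }
    apply is_RInt_gen_at_point in J.
    pose proof (is_RInt_gen_Chasles (V := CV) _ _ _ _ J Gl') as J2.
    pose proof (is_RInt_gen_unique (V := CCV) _ _ Hk) as U1. pose proof (is_RInt_gen_unique (V := CCV) _ _ J2) as U2.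
    rewrite <- U1. exact U2. }
  rewrite (HM c1 l1 k1), (HM c2 l3 k3) by (auto; lra).
  assert (E0 : vseg (fG nu L) s c1 c2 = vseg (fG nu L) sigma c1 c2 + hseg (fG nu L) c1 s sigma - hseg (fG nu L) c2 s sigma).
  { destruct (Rle_dec s sigma) as [Hle|Hgt].
    - pose proof (Cauchy_rectangle (fG nu L) s sigma c1 c2 1 Hle ltac:(lra) ltac:(lra) ltac:(intros; apply HL; lra)) as Z.
      unfold rect_int in Z. replace (vseg (fG nu L) s c1 c2) with
        (vseg (fG nu L) sigma c1 c2 + hseg (fG nu L) c1 s sigma - hseg (fG nu L) c2 s sigma -
         (hseg (fG nu L) c1 s sigma + vseg (fG nu L) sigma c1 c2 - hseg (fG nu L) c2 s sigma - vseg (fG nu L) s c1 c2)) by ring.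
      rewrite Z. ring.
    - pose proof (Cauchy_rectangle (fG nu L) sigma s c1 c2 1 ltac:(lra) ltac:(lra) ltac:(lra) ltac:(intros; apply HL; lra)) as Z.
      assert (SW : forall c, c <> 0%R -> hseg (fG nu L) c s sigma = - hseg (fG nu L) c sigma s).
      { intros c Hcc. apply is_RInt_C_unique. apply (is_RInt_swap (V := CV)). apply hseg_is_RInt; [lra|]. intros; apply HI; lra. }
      rewrite !SW by lra. unfold rect_int in Z. replace (vseg (fG nu L) s c1 c2) with
        (vseg (fG nu L) sigma c1 c2 + - hseg (fG nu L) c1 sigma s - - hseg (fG nu L) c2 sigma s +
         (hseg (fG nu L) c1 sigma s + vseg (fG nu L) s c1 c2 - hseg (fG nu L) c2 sigma s - vseg (fG nu L) sigma c1 c2)) by ring.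
      rewrite Z. ring. }
  assert (E1 : l3 - l1 + vseg (fG nu L) sigma c1 c2 = 0 - Rs).
  { apply (cv_unique (fun N => hseg (fG nu L) c2 sigma (sigma + INR N) - hseg (fG nu L) c1 sigma (sigma + INR N) + vseg (fG nu L) sigma c1 c2)).
    - apply cv_plus; [now apply cv_minus | apply cv_const].
    - eapply cv_ext_loc; [|apply cv_minus; [apply (fG_vertical_lim nu L sigma d c1 c2 Hnu HP); lra | exact HR]].
      (* From [N = 1] on the abscissa [sigma + N] is nonnegative, as [fG_rect_indep] requires. *)
      exists 1%nat. intros N HN. cbv beta. apply le_INR in HN. simpl in HN.
      rewrite hseg_opp_rect, (fG_rect_indep nu L (sigma + INR N) sigma c1 c2 sigma (-1) 1); auto; try lra.
      intros y. now apply pole_dist_offpole with d. }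
  rewrite E0. replace (- Rs) with (0 - Rs) by ring. rewrite <- E1. ring.
Qed.

(** Convergence comes from the decay alone and no residue is evaluated, so integral orders are
    covered too. *)
Lemma fG_rect_cv nu L sigma d : (0 < nu)%R -> pole_dist nu sigma d ->
  exists Rs, cv (fun N => rect_int (fG nu L) sigma (sigma + INR N) (-1) 1) Rs.
Proof.
  intros Hnu HP. pose proof HP as (Hsig & _ & _).
  destruct (fG_horizontal nu L sigma (-1) Hnu ltac:(lra) ltac:(lra)) as (l1 & _ & C1).
  destruct (fG_horizontal nu L sigma 1 Hnu ltac:(lra) ltac:(lra)) as (l3 & _ & C3).
  exists (l1 + 0 - l3 - vseg (fG nu L) sigma (-1) 1).
  apply cv_minus; [apply cv_minus; [apply cv_plus|]|]; auto; [|apply cv_const].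
  apply (fG_vertical_lim nu L sigma d); auto; lra.
Qed.

(** * Residues *)

(** A simple pole with residue [c], expressed by boundedness instead of a Laurent series; this form
    is stable under shifts and holomorphic factors, the two operations of the recurrence. *)
Definition spole (f : C -> C) (p c : C) : Prop :=
  exists r M, (0 < r)%R /\ forall s, s <> p -> (Cmod (s - p) < r)%R -> (Cmod (f s - c / (s - p)) <= M)%R.

Lemma spole_quot (Q : C -> C) (p : C) : holo Q p -> spole (fun s => Q s / (s - p)) p (Q p).
Proof.
  intros [Q' H]. destruct (holoD_at _ _ _ H) as (r & K & Hr & HK & H1 & _).
  exists r, K. split; auto. intros s Hs Hb.
  assert (N : s - p <> 0) by (intros E; apply Hs; replace s with (s - p + p) by ring; rewrite E; ring).
  replace (Q s / (s - p) - Q p / (s - p)) with ((Q s - Q p) / (s - p)) by (field; auto).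
  rewrite Cmod_div by auto. specialize (H1 s Hb). apply Cmod_gt_0 in N.
  apply Rmult_le_reg_r with (Cmod (s - p)); auto. unfold Rdiv. rewrite Rmult_assoc, Rinv_l; lra.
Qed.

Lemma spole_ext (f g : C -> C) (p c : C) :
  (exists r, (0 < r)%R /\ forall s, s <> p -> (Cmod (s - p) < r)%R -> f s = g s) -> spole f p c -> spole g p c.
Proof.
  intros (r & Hr & E) (r' & M & Hr' & H). exists (Rmin r r'), M. split; [now apply Rmin_pos|].
  intros s Hs Hb. rewrite <- E; auto.
  - apply H; auto. eapply Rlt_le_trans; [exact Hb | apply Rmin_r].
  - eapply Rlt_le_trans; [exact Hb | apply Rmin_l].
Qed.

Lemma spole_mult (f h : C -> C) (p c : C) : spole f p c -> holo h p -> spole (fun s => f s * h s) p (c * h p).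
Proof.
  intros (r & M & Hr & H) [h' Hh]. destruct (holoD_at _ _ _ Hh) as (r' & K & Hr' & HK & H1 & _).
  exists (Rmin r r'), (M * (Cmod (h p) + K * r') + Cmod c * K)%R. split; [now apply Rmin_pos|].
  intros s Hs Hb.
  assert (Hb1 : (Cmod (s - p) < r)%R) by (eapply Rlt_le_trans; [exact Hb | apply Rmin_l]).
  assert (Hb2 : (Cmod (s - p) < r')%R) by (eapply Rlt_le_trans; [exact Hb | apply Rmin_r]).
  specialize (H s Hs Hb1). specialize (H1 s Hb2).
  assert (N : s - p <> 0) by (intros E; apply Hs; replace s with (s - p + p) by ring; rewrite E; ring).
  replace (f s * h s - c * h p / (s - p)) with ((f s - c / (s - p)) * h s + c * ((h s - h p) / (s - p))) by (field; auto).
  eapply Rle_trans; [apply Cmod_triangle|]. rewrite !Cmod_mult. apply Cmod_gt_0 in N.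
  apply Rplus_le_compat; apply Rmult_le_compat; auto using Cmod_ge_0; try lra.
  - replace (h s) with (h p + (h s - h p)) by ring. eapply Rle_trans; [apply Cmod_triangle|]. nra.
  - rewrite Cmod_div by (now apply Cmod_gt_0). apply Rmult_le_reg_r with (Cmod (s - p)); auto. unfold Rdiv. rewrite Rmult_assoc, Rinv_l; lra.
Qed.

Lemma spole_shift (f : C -> C) (p c : C) : spole f p c -> spole (fun s => f (s - 1)) (p + 1) c.
Proof.
  intros (r & M & Hr & H). exists r, M. split; auto. intros s Hs Hb.
  replace (s - (p + 1)) with (s - 1 - p) in * by ring. apply H; auto.
  intros E. apply Hs. rewrite <- E. ring.
Qed.

Lemma rect_spole f (p c : C) (q a b e : R) :
  p = RtoC q -> (a < q < b)%R -> (0 < e)%R ->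
  (forall x y, (a <= x <= b)%R -> (x, y) <> p -> holo f (x, y)) -> spole f p c ->
  rect_int f a b (-1) 1 = 2 * PI * Ci * c.
Proof.
  intros Ep Hq He H (r & M & Hr & HM).
  apply (Residue_rectangle f p c 0 q a b (-1) 1 e r M); auto; try lra.
  intros s Hs Hb. replace (f s - c / (s - p) - 0 / (s - p) ^ 2) with (f s - c / (s - p)) by (unfold Cdiv; ring). auto.
Qed.

Fixpoint rpoch (a : R) (n : nat) : R :=
  match n with O => 1%R | S k => (rpoch a k * (a + INR k))%R end.

Lemma poch_RtoC a n : poch (RtoC a) n = RtoC (rpoch a n).
Proof. induction n; [reflexivity|]. simpl. now rewrite IHn, RtoC_mult, RtoC_plus. Qed.

Lemma rpoch_S a n : rpoch a (S n) = (rpoch a n * (a + INR n))%R.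
Proof. reflexivity. Qed.

Lemma rpoch_pos a n : (0 < a)%R -> (0 < rpoch a n)%R.
Proof. intros Ha. induction n; simpl; [lra|]. apply Rmult_lt_0_compat; auto. pose proof (pos_INR n); lra. Qed.

Lemma rpoch_neq_0 a n : (forall k : nat, a + INR k <> 0)%R -> (rpoch a n <> 0)%R.
Proof. intros Ha. induction n; simpl; [lra|]. now apply Rmult_integral_contrapositive_currified. Qed.

Definition nonint (x : R) : Prop := forall k : Z, x <> IZR k.

Lemma nonint_plus x (k : nat) : nonint x -> (x + INR k <> 0)%R.
Proof.
  intros H E. apply (H (- Z.of_nat k)%Z). rewrite opp_IZR, <- INR_IZR_INZ. lra.
Qed.

Lemma nonint_1_minus x : nonint x -> nonint (1 - x).
Proof. intros H k E. apply (H (1 - k)%Z). rewrite minus_IZR. lra. Qed.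

(** The coefficients of the [2F3] in the theorem. *)
Definition ucoef (nu : R) (k : nat) : R :=
  (rpoch nu k * rpoch (nu + 1 / 2) k / (rpoch (nu + 1) k * rpoch (nu + 1) k * rpoch (2 * nu + 1) k * INR (fact k)))%R.

(* At [k = 0] the division by [INR 0] makes the coefficient 0. *)
Definition vcoef (nu : R) (k : nat) : R :=
  (rpoch (1 / 2) k / (INR k * INR (fact k) * rpoch (1 - nu) k * rpoch (1 + nu) k))%R.

(* [res0] and [res1] are the residues of [fG nu L] at the double pole 0 and at the simple pole [nu]. *)
Definition res0 (nu : R) (L : C) : C :=
  (sqrt PI / nu)%R * (2 * L - (2 * ln 2 + 2 * psi (1 + nu) - / nu)%R).

Definition res1 (nu : R) (L : C) : C :=
  - (sqrt PI * (rg (1 + nu) * rg (1 + nu)) * (PI / (nu * sin (PI * nu))))%R * Cexp (2 * nu * L - (2 * nu * ln 2)%R).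

Lemma sqrt_PI_pos : (0 < sqrt PI)%R.
Proof. apply sqrt_lt_R0, PI_RGT_0. Qed.

(** Writing [fG = Q / s^2], the two coefficients are the derivative and the value of [Q] at 0. In
    the logarithmic derivative of [Q] the term [psi 1] cancels against the one contained in
    [psi (1/2)], which leaves the [2 ln 2]; the recurrence moves [psi nu] to [psi (1 + nu)]. *)
Lemma fG_double_pole nu L : (0 < nu)%R -> exists r M, (0 < r)%R /\
  forall s : C, s <> 0 -> (Cmod (s - 0) < r)%R ->
   (Cmod (fG nu L s - res0 nu L / (s - 0) - (sqrt PI / nu)%R / (s - 0) ^ 2) <= M)%R.
Proof.
  intros Hnu.
  set (D := fun s => rgam (1 - s) * (rgam (nu - s) * rgam ((1 / 2)%R + s))).
  set (Q := fun s => (rgam (1 + nu + s) * Cexp (2 * s * L)) * / D s).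
  assert (V0 : forall a : R, RtoC a + 0 = RtoC a) by (intros; ring).
  assert (P1 := rg_pos 1 ltac:(lra)). assert (P2 := rg_pos nu Hnu). assert (P3 := rg_pos (1 / 2) ltac:(lra)). assert (P4 := rg_pos (1 + nu) ltac:(lra)).
  assert (E1 : rgam (1 - 0) = rg 1) by (replace (1 - 0) with (RtoC 1) by ring; apply rgam_rg).
  assert (E2 : rgam (nu - 0) = rg nu) by (replace (nu - 0) with (RtoC nu) by ring; apply rgam_rg).
  assert (E3 : rgam ((1 / 2)%R + 0) = rg (1 / 2)) by (rewrite V0; apply rgam_rg).
  assert (E4 : rgam (1 + nu + 0) = rg (1 + nu)) by (replace (1 + nu + 0) with (RtoC (1 + nu)) by (rewrite RtoC_plus; ring); apply rgam_rg).
  assert (E1' : rgam' (1 - 0) = rg' 1) by (replace (1 - 0) with (RtoC 1) by ring; apply rgam'_rg).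
  assert (E2' : rgam' (nu - 0) = rg' nu) by (replace (nu - 0) with (RtoC nu) by ring; apply rgam'_rg).
  assert (E3' : rgam' ((1 / 2)%R + 0) = rg' (1 / 2)) by (rewrite V0; apply rgam'_rg).
  assert (E4' : rgam' (1 + nu + 0) = rg' (1 + nu)) by (replace (1 + nu + 0) with (RtoC (1 + nu)) by (rewrite RtoC_plus; ring); apply rgam'_rg).
  assert (HA : forall (a k : C), holoD (fun s => rgam (a + k * s)) (fun s => rgam' (a + k * s) * (0 + (0 * s + k * 1))) 0).
  { intros a k. apply (holoD_comp rgam rgam' (fun s => a + k * s) (fun s => 0 + (0 * s + k * 1))); [apply holoD_rgam|].
    apply holoD_plus; [apply holoD_const|]. apply holoD_mult; [apply holoD_const | apply holoD_id]. }
  assert (HD1 : holoD (fun s => rgam (1 - s)) (fun s => - rgam' (1 - s)) 0).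
  { eapply holoD_ext; [| |apply (HA 1 (- (1)))]; intros w; simpl; [f_equal; ring|].
    replace (1 + - (1) * w) with (1 - w) by ring. ring. }
  assert (HD2 : holoD (fun s => rgam (nu - s)) (fun s => - rgam' (nu - s)) 0).
  { eapply holoD_ext; [| |apply (HA nu (- (1)))]; intros w; simpl; [f_equal; ring|].
    replace (nu + - (1) * w) with (nu - w) by ring. ring. }
  assert (HD3 : holoD (fun s => rgam ((1 / 2)%R + s)) (fun s => rgam' ((1 / 2)%R + s)) 0).
  { eapply holoD_ext; [| |apply (HA (1 / 2)%R 1)]; intros w; simpl; [f_equal; ring|].
    replace ((1 / 2)%R + 1 * w) with ((1 / 2)%R + w) by ring. ring. }
  assert (HD4 : holoD (fun s => rgam (1 + nu + s)) (fun s => rgam' (1 + nu + s)) 0).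
  { eapply holoD_ext; [| |apply (HA (1 + nu) 1)]; intros w; simpl; [f_equal; ring|].
    replace (1 + nu + 1 * w) with (1 + nu + w) by ring. ring. }
  assert (HDe : holoD (fun s => Cexp (2 * s * L)) (fun s => Cexp (2 * s * L) * (0 * s + 2 * L * 1)) 0).
  { eapply holoD_ext; [| |apply (holoD_comp Cexp Cexp (fun s => 2 * L * s) (fun s => 0 * s + 2 * L * 1)); [apply holoD_Cexp|
      apply holoD_mult; [apply holoD_const | apply holoD_id]]]; intros w; simpl.
    - f_equal; ring.
    - replace (2 * L * w) with (2 * w * L) by ring. reflexivity. }
  assert (N1 : RtoC (rg 1) <> 0) by (apply RtoC_neq_0; lra).
  assert (N2 : RtoC (rg nu) <> 0) by (apply RtoC_neq_0; lra).
  assert (N3 : RtoC (rg (1 / 2)) <> 0) by (apply RtoC_neq_0; lra).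
  assert (ND : D 0 <> 0) by (unfold D; rewrite E1, E2, E3; repeat apply Cmult_neq_0; auto).
  assert (HQ := holoD_mult _ _ _ _ 0 (holoD_mult _ _ _ _ 0 HD4 HDe)
     (holoD_comp Cinv (fun w => - / (w * w)) D _ 0 (holoD_inv _ ND) (holoD_mult _ _ _ _ 0 HD1 (holoD_mult _ _ _ _ 0 HD2 HD3)))).
  fold Q in HQ. destruct (holoD_at _ _ _ HQ) as (r & K & Hr & HK & _ & HT).
  assert (HRG : rg nu = (nu * rg (1 + nu))%R) by (rewrite rg_rec; f_equal; f_equal; ring).
  assert (HPS : psi (1 + nu) = (psi nu + / nu)%R) by (rewrite <- psi_rec by auto; f_equal; ring).
  pose proof sqrt_PI_pos as HSP.
  exists (Rmin r 1), K. split; [apply Rmin_pos; lra|]. intros s Hs Hb.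
  specialize (HT s ltac:(unfold cball; eapply Rlt_le_trans; [exact Hb | apply Rmin_l])). cbv beta in HT.
  assert (EQ0 : Q 0 = (sqrt PI / nu)%R).
  { unfold Q, D. rewrite E1, E2, E3, E4. replace (2 * 0 * L) with (RtoC 0) by ring. rewrite Cexp_0, rg_1, rg_half, HRG.
    rewrite Cmult_1_r, <- !RtoC_mult, <- RtoC_inv, <- RtoC_mult by (repeat apply Rmult_integral_contrapositive_currified; try apply Rinv_neq_0_compat; lra).
    f_equal. field. repeat split; lra. }
  match type of HT with (Cmod (_ - _ - (_ - _) * ?X) <= _)%R => assert (EQ1 : X = res0 nu L) end.
  { unfold D. rewrite E1, E2, E3, E4, E1', E2', E3', E4'. replace (2 * 0 * L) with (RtoC 0) by ring. rewrite Cexp_0.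
    rewrite !psi_rg' by lra. rewrite psi_half, HPS. unfold res0. rewrite HPS.
    replace (RtoC (sqrt PI / nu)) with (rg (1 + nu) * / (rg 1 * (rg nu * rg (1 / 2)))).
    2:{ rewrite rg_1, rg_half, HRG.
        rewrite <- !RtoC_mult, <- RtoC_inv, <- RtoC_mult by (repeat apply Rmult_integral_contrapositive_currified; try apply Rinv_neq_0_compat; lra).
        f_equal. field. repeat split; lra. }
    repeat (rewrite RtoC_mult || rewrite RtoC_opp || rewrite RtoC_minus || rewrite RtoC_plus).
    set (b1 := RtoC (rg 1)) in *. set (b2 := RtoC (rg nu)) in *. set (b3 := RtoC (rg (1 / 2))) in *. set (b4 := RtoC (rg (1 + nu))).
    set (i := RtoC (/ nu)). set (l2 := RtoC (ln 2)). set (p1 := RtoC (psi 1)). set (p2 := RtoC (psi nu)).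
    field. auto. }
  rewrite EQ1 in HT. change (Cmod (Q s - Q 0 - (s - 0) * res0 nu L) <= K * Cmod (s - 0) ^ 2)%R in HT. rewrite EQ0 in HT.
  assert (EF : fG nu L s = Q s / (s * s)).
  { unfold fG, Q, D, Cdiv. rewrite !Cinv_total_mult. ring. }
  assert (S0 : s - 0 = s) by ring. rewrite S0 in HT |- *.
  rewrite EF. replace (Q s / (s * s) - res0 nu L / s - (sqrt PI / nu)%R / s ^ 2) with
    ((Q s - (sqrt PI / nu)%R - s * res0 nu L) * (/ s * / s)) by (simpl Cpow; field; exact Hs).
  rewrite !Cmod_mult, Cmod_inv by auto. apply Cmod_gt_0 in Hs.
  apply Rle_trans with (K * Cmod s ^ 2 * (/ Cmod s * / Cmod s))%R.
  - apply Rmult_le_compat_r; [|exact HT]. apply Rmult_le_pos; left; now apply Rinv_0_lt_compat.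
  - right. field. lra.
Qed.

Lemma holo_rho (nu : R) (L s : C) : (1 + nu + s) <> 0 -> s + 1 <> 0 -> s + 1 - nu <> 0 -> holo (rho nu L) s.
Proof.
  intros A B C0. unfold rho, Cdiv. apply holo_mult; [|apply holo_inv; [repeat apply Cmult_neq_0; auto|]];
  repeat (apply holo_minus || apply holo_plus || apply holo_mult || apply holo_const || apply holo_id).
Qed.

(** Residues propagate by the shift: the pole at [p + 1] is the one at [p] multiplied by [rho],
    which is holomorphic at [p] because [p + 1] differs from [nu]. *)
Lemma fG_spole_step (nu : R) (L : C) (p : R) (c : C) : (0 < nu)%R -> (0 < p)%R -> p + 1 - nu <> 0 ->
  (exists r, (0 < r)%R /\ forall s, s <> RtoC p -> (Cmod (s - p) < r)%R -> offpole nu s) ->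
  spole (fG nu L) p c -> spole (fG nu L) (p + 1)%R (c * rho nu L p).
Proof.
  intros Hnu Hp HN (r & Hr & HO) H.
  assert (HR : holo (rho nu L) p).
  { apply holo_rho; auto.
    - rewrite <- !RtoC_plus. apply RtoC_neq_0. lra.
    - rewrite <- !RtoC_plus. apply RtoC_neq_0. lra. }
  pose proof (spole_shift _ _ _ (spole_mult _ _ _ _ H HR)) as H1. rewrite RtoC_plus.
  eapply spole_ext; [|exact H1]. exists (Rmin r (Cmod (p + 1 - nu))).
  split; [apply Rmin_pos; auto; now apply Cmod_gt_0|]. intros s Hs Hb. cbv beta.
  replace (s - (p + 1)) with (s - 1 - p) in Hb by ring.
  rewrite <- fG_rec; auto.
  - f_equal. ring.
  - apply HO.
    + intros E. apply Hs. rewrite <- E. ring.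
    + eapply Rlt_le_trans; [exact Hb | apply Rmin_l].
  - intros E. assert (Hb' : (Cmod (s - 1 - p) < Cmod (p + 1 - nu))%R) by (eapply Rlt_le_trans; [exact Hb | apply Rmin_r]).
    replace (s - 1 - p) with (- (p + 1 - nu)) in Hb'; [rewrite Cmod_opp in Hb'; lra|].
    replace (s - 1 - p) with (s - 1 + 1 - nu - (p + 1 - nu)) by ring. rewrite E. ring.
Qed.

Lemma INR_between (j k : nat) : (INR k - 1 < INR j < INR k + 1)%R -> j = k.
Proof.
  intros [A B]. assert (INR j < INR (S k))%R by (rewrite S_INR; lra). assert (INR k < INR (S j))%R by (rewrite S_INR; lra).
  apply INR_lt in H, H0. lia.
Qed.

Lemma INR_not_between (j k : nat) : (INR k < INR j < INR k + 1)%R -> False.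
Proof.
  intros [A B]. assert (INR j < INR (S k))%R by (rewrite S_INR; lra). apply INR_lt in H, A. lia.
Qed.

(** * Residues for a non-integral order *)

Section NonInteger.

Variables (nu r : R) (n0 : nat) (L : C).
Hypothesis Hr : (0 < r < 1)%R.
Hypothesis Hnu : nu = (INR n0 + r)%R.

Let nu_pos : (0 < nu)%R.
Proof. rewrite Hnu. pose proof (pos_INR n0). lra. Qed.

(** The cuts are halfway between neighbouring poles: [k + r/2] separates [k] from [k + r], and
    [k + (r + 1)/2] separates [k + r] from [k + 1]. Each strip of width 1/2 holds at most one
    pole. *)
Lemma offpole_near_int (k : nat) x y : (INR k + (r - 1) / 2 <= x <= INR k + r / 2)%R -> (x, y) <> RtoC (INR k) -> offpole nu (x, y).
Proof.
  intros Hx N. pose proof (pos_INR k). split; [unfold Re; simpl; lra|]. unfold Re, Im; simpl. intros E j. subst y. split.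
  - intros E. subst x. assert (j = k) by (apply INR_between; lra). subst. now apply N.
  - intros E. rewrite Hnu in E. rewrite <- plus_INR || idtac.
    assert (E2 : x = (INR (n0 + j) + r)%R) by (rewrite plus_INR; lra).
    assert (INR (n0 + j) < INR k)%R by lra. assert (INR k < INR (n0 + j) + 1)%R by lra.
    apply (INR_not_between k (n0 + j)); lra.
Qed.

(** The point [k + r] is a pole only from [k = n0] on, where the family [nu + j] begins; hence the
    guard on the exclusion. *)
Lemma offpole_near_nu (k : nat) x y : (INR k + r / 2 <= x <= INR k + (r + 1) / 2)%R ->
  ((n0 <= k)%nat -> (x, y) <> RtoC (INR k + r)) -> offpole nu (x, y).
Proof.
  intros Hx N. pose proof (pos_INR k). split; [unfold Re; simpl; lra|]. unfold Re, Im; simpl. intros E j. subst y. split.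
  - intros E. subst x. apply (INR_not_between j k); lra.
  - intros E. rewrite Hnu in E.
    assert (E2 : x = (INR (n0 + j) + r)%R) by (rewrite plus_INR; lra).
    assert (E3 : (n0 + j)%nat = k) by (apply INR_between; lra).
    apply N; [lia|]. rewrite E2, E3. reflexivity.
Qed.

Lemma nonint_nu : nonint nu.
Proof.
  intros k E. rewrite Hnu, INR_IZR_INZ in E.
  assert (H : r = IZR (k - Z.of_nat n0)) by (rewrite minus_IZR; lra).
  assert (0 < k - Z.of_nat n0 < 1)%Z by (split; apply lt_IZR; rewrite <- H; lra). lia.
Qed.

Lemma nonint_sin : sin (PI * nu) <> 0%R.
Proof.
  intros E. apply sin_eq_0_0 in E. destruct E as [k E]. apply (nonint_nu k). pose proof PI_RGT_0. nra.
Qed.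

Lemma offpole_punctured_int (k : nat) : exists e, (0 < e)%R /\ forall s, s <> RtoC (INR k) -> (Cmod (s - INR k) < e)%R -> offpole nu s.
Proof.
  exists (Rmin ((1 - r) / 2) (r / 2)). split; [apply Rmin_pos; lra|]. intros [x y] Hs Hb.
  apply offpole_near_int with k; auto.
  assert (H : (Rabs (x - INR k) < Rmin ((1 - r) / 2) (r / 2))%R) by (eapply Rle_lt_trans; [apply (re_le_Cmod ((x, y) - INR k)) | exact Hb]).
  pose proof (Rmin_l ((1 - r) / 2) (r / 2)); pose proof (Rmin_r ((1 - r) / 2) (r / 2)). apply Rabs_def2 in H. lra.
Qed.

Lemma offpole_punctured_nu (k : nat) : exists e, (0 < e)%R /\ forall s, s <> RtoC (nu + INR k) -> (Cmod (s - (nu + INR k)%R) < e)%R -> offpole nu s.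
Proof.
  exists (Rmin ((1 - r) / 2) (r / 2)). split; [apply Rmin_pos; lra|]. intros [x y] Hs Hb.
  assert (H : (Rabs (x - (nu + INR k)) < Rmin ((1 - r) / 2) (r / 2))%R) by (eapply Rle_lt_trans; [apply (re_le_Cmod ((x, y) - (nu + INR k)%R)) | exact Hb]).
  pose proof (Rmin_l ((1 - r) / 2) (r / 2)); pose proof (Rmin_r ((1 - r) / 2) (r / 2)). apply Rabs_def2 in H.
  apply offpole_near_nu with (n0 + k)%nat.
  - rewrite plus_INR. lra.
  - intros _ E. apply Hs. rewrite E. f_equal. rewrite plus_INR. lra.
Qed.

(** The induction starts at 1: the numerator of [rho] vanishes at 0 and lowers the double pole there
    to a simple pole at 1. Afterwards the residues are multiplied by [rho], which reproduces the
    ratios of [vcoef]. *)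
Lemma fG_spole_int (k : nat) :
  spole (fG nu L) (RtoC (INR (S k))) ((sqrt PI / nu)%R * (vcoef nu (S k)) * Cexp (2 * L) ^ S k).
Proof.
  pose proof sqrt_PI_pos as HSP. pose proof nonint_nu as NI.
  assert (NP : forall j : nat, (1 - nu + INR j <> 0)%R) by (intros; apply nonint_plus, nonint_1_minus, NI).
  induction k.
  - (* near 1, fG(s+1) = Q(s)/s * rho(s)/s with fG = Q/s^2 *)
    pose (h := fun s : C => rgam (1 + nu + s) * Cexp (2 * s * L) * / (rgam (1 - s) * rgam (nu - s) * rgam ((1 / 2)%R + s)) *
       (Cexp (2 * L) * ((1 / 2)%R + s) * / ((1 + nu + s) * ((s + 1) * (s + 1)) * (s + 1 - nu)))).
    assert (Hh : holo h 0).
    { unfold h. assert (A1 : rgam (1 - 0) <> 0) by (apply rgam_neq_0_Re; unfold Re; simpl; lra).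
      assert (A2 : rgam (nu - 0) <> 0) by (apply rgam_neq_0_Re; unfold Re; simpl; lra).
      assert (A3 : rgam ((1 / 2)%R + 0) <> 0) by (apply rgam_neq_0_Re; unfold Re; simpl; lra).
      assert (A4 : (1 + nu + 0) <> 0) by (intros E; apply (f_equal Re) in E; unfold Re in E; simpl in E; lra).
      assert (A5 : (0 + 1) <> RtoC 0) by (intros E; apply (f_equal Re) in E; unfold Re in E; simpl in E; lra).
      assert (A6 : (0 + 1 - nu) <> 0) by (intros E; apply (f_equal Re) in E; unfold Re in E; simpl in E; specialize (NP O); simpl in NP; lra).
      apply holo_mult.
      - apply holo_mult; [apply holo_mult; [apply holo_rgam | apply holo_Cexp]|apply holo_inv].
        + repeat (apply holo_minus || apply holo_plus || apply holo_const || apply holo_id).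
        + repeat (apply holo_mult || apply holo_const || apply holo_id).
        + repeat apply Cmult_neq_0; auto.
        + repeat apply holo_mult; apply holo_rgam; repeat (apply holo_minus || apply holo_plus || apply holo_const || apply holo_id).
      - apply holo_mult; [|apply holo_inv].
        + repeat (apply holo_minus || apply holo_plus || apply holo_mult || apply holo_const || apply holo_id).
        + repeat apply Cmult_neq_0; auto.
        + repeat (apply holo_minus || apply holo_plus || apply holo_mult || apply holo_const || apply holo_id). }
    pose proof (spole_shift _ _ _ (spole_quot h 0 Hh)) as H1.
    replace (RtoC (INR 1)) with (RtoC 0 + 1) by (simpl; ring).
    replace ((sqrt PI / nu)%R * vcoef nu 1 * Cexp (2 * L) ^ 1) with (h 0).
    + eapply spole_ext; [|exact H1]. destruct (offpole_punctured_int 0) as (e & He & HO).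
      exists (Rmin e (Rabs (1 - nu))). specialize (NP O). simpl in NP. rewrite Rplus_0_r in NP.
      split; [apply Rmin_pos; auto; now apply Rabs_pos_lt|].
      intros s Hs Hb. cbv beta. replace (s - (0 + 1)) with (s - 1) in Hb by ring.
      assert (Hs0 : s - 1 <> 0) by (intros E; apply Hs; replace s with (s - 1 + 1) by ring; rewrite E; ring).
      assert (HO' : offpole nu (s - 1)).
      { apply HO; [exact Hs0|]. replace (s - 1 - INR 0) with (s - 1) by (simpl; ring). eapply Rlt_le_trans; [exact Hb | apply Rmin_l]. }
      assert (HN : s - 1 + 1 - nu <> 0).
      { intros E. assert (Hb' : (Cmod (s - 1) < Rabs (1 - nu))%R) by (eapply Rlt_le_trans; [exact Hb | apply Rmin_r]).
        replace (s - 1) with (- RtoC (1 - nu)) in Hb'; [rewrite Cmod_opp, Cmod_R in Hb'; lra|].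
        rewrite RtoC_minus. replace (s - 1) with (s - 1 + 1 - nu - (1 - nu)) by ring. rewrite E. ring. }
      transitivity (fG nu L (s - 1 + 1)); [|f_equal; ring]. rewrite fG_rec; auto.
      unfold h, fG, rho, Cdiv. rewrite !Cinv_total_mult. replace (s - 1 - 0) with (s - 1) by ring.
      set (t := s - 1) in *. transitivity (rgam (1 + nu + t) * Cexp (2 * t * L) * (/ rgam (1 - t) * / rgam (nu - t) * / rgam ((1 / 2)%R + t)) *
        (Cexp (2 * L) * ((1 / 2)%R + t) * (/ (1 + nu + t) * (/ (t + 1) * / (t + 1)) * / (t + 1 - nu))) * (/ t * (t * / t))); [|ring].
      rewrite Cinv_r by auto. ring.
    + unfold h. replace (2 * 0 * L) with (RtoC 0) by ring. rewrite Cexp_0.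
      replace (1 + nu + 0) with (RtoC (1 + nu)) by (rewrite RtoC_plus; ring).
      replace (1 - 0) with (RtoC 1) by ring. replace (nu - 0) with (RtoC nu) by ring.
      replace ((1 / 2)%R + 0) with (RtoC (1 / 2)) by ring. rewrite !rgam_rg, rg_1, rg_half.
      replace (0 + 1) with (RtoC 1) by ring. rewrite <- (RtoC_minus 1 nu), <- !RtoC_mult.
      assert (HRG : rg nu = (nu * rg (1 + nu))%R) by (rewrite rg_rec; f_equal; f_equal; ring). rewrite HRG.
      assert (P4 := rg_pos (1 + nu) ltac:(lra)). specialize (NP O). simpl in NP. rewrite Rplus_0_r in NP.
      rewrite <- !RtoC_inv by (repeat apply Rmult_integral_contrapositive_currified; try apply Rinv_neq_0_compat; lra).
      transitivity (Cexp (2 * L) * RtoC (rg (1 + nu) * 1 * / (1 * (nu * rg (1 + nu)) * / sqrt PI) * (1 / 2 * / ((1 + nu) * (1 * 1) * (1 - nu))))%R).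
      { rewrite !RtoC_mult. ring. }
      transitivity (Cexp (2 * L) * RtoC (sqrt PI / nu * vcoef nu 1)%R); [f_equal; f_equal | rewrite RtoC_mult; simpl; ring].
      unfold vcoef. simpl. field. repeat split; lra.
  - replace (RtoC (INR (S (S k)))) with (RtoC (INR (S k) + 1)) by (f_equal; rewrite (S_INR (S k)); reflexivity).
    pose proof (pos_INR k).
    assert (NPk : (1 - nu + INR (S k) <> 0)%R) by apply NP.
    assert (NPC : INR (S k) + 1 - nu <> 0).
    { rewrite <- RtoC_plus, <- RtoC_minus. apply RtoC_neq_0. lra. }
    pose proof (fG_spole_step nu L (INR (S k)) _ nu_pos ltac:(rewrite S_INR; lra) NPC (offpole_punctured_int (S k)) IHk) as H1.
    replace ((sqrt PI / nu)%R * vcoef nu (S (S k)) * Cexp (2 * L) ^ S (S k)) with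
      ((sqrt PI / nu)%R * vcoef nu (S k) * Cexp (2 * L) ^ S k * rho nu L (INR (S k))); [exact H1|].
    unfold rho, Cdiv. rewrite <- !RtoC_plus, <- !RtoC_minus, <- !RtoC_mult.
    assert (NZ : ((1 + nu + INR (S k)) * ((INR (S k) + 1) * (INR (S k) + 1)) * (INR (S k) + 1 - nu) <> 0)%R).
    { rewrite S_INR in *. repeat apply Rmult_integral_contrapositive_currified; lra. }
    rewrite <- RtoC_inv by auto.
    transitivity (Cexp (2 * L) ^ S (S k) * RtoC (sqrt PI / nu * (vcoef nu (S k) * (INR (S k) * (1 / 2 + INR (S k)) *
       / ((1 + nu + INR (S k)) * ((INR (S k) + 1) * (INR (S k) + 1)) * (INR (S k) + 1 - nu)))))%R).
    { rewrite !RtoC_mult. change (Cexp (2 * L) ^ S (S k)) with (Cexp (2 * L) * Cexp (2 * L) ^ S k). ring. }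
    transitivity (Cexp (2 * L) ^ S (S k) * RtoC (sqrt PI / nu * vcoef nu (S (S k)))%R); [|rewrite RtoC_mult; ring].
    f_equal. f_equal. f_equal. unfold vcoef.
    rewrite (rpoch_S (1 / 2) (S k)), (rpoch_S (1 - nu) (S k)), (rpoch_S (1 + nu) (S k)).
    replace (fact (S (S k))) with (S (S k) * fact (S k))%nat by reflexivity. rewrite mult_INR, (S_INR (S k)).
    pose proof (INR_fact_neq_0 (S k)). assert (INR (S k) <> 0)%R by (apply not_0_INR; lia).
    assert (rpoch (1 - nu) (S k) <> 0)%R by (apply rpoch_neq_0; auto).
    assert (rpoch (1 + nu) (S k) <> 0)%R by (apply Rgt_not_eq, rpoch_pos; lra).
    assert (INR (S k) + 1 <> 0)%R by (rewrite S_INR; lra). assert (1 + nu + INR (S k) <> 0)%R by (rewrite S_INR; lra).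
    assert (INR (S k) + 1 - nu <> 0)%R by lra.
    field. repeat split; auto.
Qed.

(** The functional equation exposes the zero of [rgam (nu - s)] at [nu], so that [fG] is a
    holomorphic function divided by [s - nu]; its value there is the first residue, and [rho]
    supplies the others. *)
Lemma fG_spole_nu (k : nat) :
  spole (fG nu L) (RtoC (nu + INR k)) (res1 nu L * ucoef nu k * Cexp (2 * L) ^ k).
Proof.
  pose proof sqrt_PI_pos as HSP. pose proof nonint_nu as NI.
  assert (NP : forall j : nat, (1 - nu + INR j <> 0)%R) by (intros; apply nonint_plus, nonint_1_minus, NI).
  induction k.
  - pose (h := fun s : C => - (rgam (1 + nu + s) * Cexp (2 * s * L)) * / (s * s * rgam (1 - s) * rgam (nu - s + 1) * rgam ((1 / 2)%R + s))).
    assert (A1 : rgam (1 - nu) <> 0).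
    { apply rgam_neq_0. intros m E. apply (NP m). rewrite <- RtoC_minus, <- RtoC_opp in E. injection E as E. lra. }
    assert (A2 : rgam (nu - nu + 1) <> 0) by (apply rgam_neq_0_Re; unfold Re; simpl; lra).
    assert (A3 : rgam ((1 / 2)%R + nu) <> 0) by (apply rgam_neq_0_Re; unfold Re; simpl; lra).
    assert (A4 : RtoC nu <> 0) by (apply RtoC_neq_0; lra).
    assert (Hh : holo h nu).
    { unfold h. apply holo_mult; [apply holo_opp, holo_mult; [apply holo_rgam | apply holo_Cexp]|apply holo_inv].
        + repeat (apply holo_minus || apply holo_plus || apply holo_const || apply holo_id).
        + repeat (apply holo_mult || apply holo_const || apply holo_id).
        + repeat apply Cmult_neq_0; auto.
        + repeat apply holo_mult; try apply holo_id; apply holo_rgam; repeat (apply holo_minus || apply holo_plus || apply holo_const || apply holo_id). }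
    pose proof (spole_quot h nu Hh) as H1.
    replace (RtoC (nu + INR 0)) with (RtoC nu) by (f_equal; simpl; ring).
    replace (res1 nu L * ucoef nu 0 * Cexp (2 * L) ^ 0) with (h nu).
    + eapply spole_ext; [|exact H1]. exists 1%R. split; [lra|]. intros s Hs _. cbv beta.
      assert (N : s - nu <> 0) by (intros E; apply Hs; replace s with (s - nu + nu) by ring; rewrite E; ring).
      unfold h, fG. rewrite (rgam_rec (nu - s)). unfold Cdiv.
      replace (nu - s) with (- (s - nu)) by ring. rewrite !Cinv_total_mult.
      replace (/ - (s - nu)) with (- / (s - nu)) by (field; auto).
      ring.
    + unfold h, res1. replace (nu - nu + 1) with (RtoC 1) by ring.
      rewrite <- (RtoC_minus 1 nu), <- (RtoC_plus (1 / 2) nu). replace (1 + nu + nu) with (RtoC (1 + 2 * nu)) by (rewrite RtoC_plus, RtoC_mult; ring).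
      rewrite !rgam_rg, rg_1.
      (* duplication at nu + 1/2 and reflection at nu *)
      pose proof (rgam_duplication (nu + 1 / 2)%R) as DU.
      replace (RtoC (nu + 1 / 2) + (1 / 2)%R) with (RtoC (1 + nu)) in DU by (rewrite <- RtoC_plus; f_equal; field).
      replace (2 * RtoC (nu + 1 / 2)) with (RtoC (1 + 2 * nu)) in DU by (rewrite <- RtoC_mult; f_equal; field).
      rewrite !rgam_rg, <- !RtoC_mult, Cexp_RtoC, <- !RtoC_mult in DU. injection DU as DU.
      replace ((1 + 2 * nu) * ln 2)%R with (ln 2 + 2 * nu * ln 2)%R in DU by ring. rewrite exp_plus, exp_ln in DU by lra.
      assert (RF : (rg (1 + nu) * rg (1 - nu) = sin (PI * nu) / (PI * nu))%R).
      { apply rg_reflection. intros j E. assert (E' : (nu = INR j \/ nu = - INR j)%R) by (destruct (Req_dec nu (INR j)); [left; auto | right; nra]).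
        destruct E' as [E'|E']; [apply (NI (Z.of_nat j)); now rewrite <- INR_IZR_INZ | pose proof (pos_INR j); lra]. }
      pose proof nonint_sin as NS. pose proof PI_RGT_0 as HPI.
      assert (P1 := rg_pos (1 + nu) ltac:(lra)). assert (P2 := rg_pos (nu + 1 / 2) ltac:(lra)).
      assert (P3 : (rg (1 - nu) <> 0)%R) by (intros E; apply A1; rewrite <- RtoC_minus, rgam_rg, E; reflexivity).
      replace (1 / 2 + nu)%R with (nu + 1 / 2)%R by ring.
      pose proof (exp_pos (2 * nu * ln 2)) as P4.
      replace (2 * nu * L - (2 * nu * ln 2)%R) with (2 * nu * L + RtoC (- (2 * nu * ln 2))) by (rewrite RtoC_opp; ring).
      rewrite Cexp_plus, Cexp_RtoC, exp_Ropp.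
      replace (2 * nu * L) with (2 * nu * L) by ring.
      assert (NZ : (nu * nu * rg (1 - nu) * 1 * rg (nu + 1 / 2) <> 0)%R) by (repeat apply Rmult_integral_contrapositive_currified; lra).
      rewrite <- !RtoC_mult, <- RtoC_inv by auto.
      transitivity (Cexp (2 * nu * L) * RtoC (- rg (1 + 2 * nu) * / (nu * nu * rg (1 - nu) * 1 * rg (nu + 1 / 2)))%R).
      { rewrite ?(RtoC_mult 2 nu), (RtoC_mult (- rg (1 + 2 * nu))), RtoC_opp. ring. }
      transitivity (Cexp (2 * nu * L) * RtoC (- (sqrt PI * (rg (1 + nu) * rg (1 + nu)) * (PI / (nu * sin (PI * nu)))) * / exp (2 * nu * ln 2) * ucoef nu 0)%R).
      * f_equal. f_equal. unfold ucoef. simpl rpoch. simpl fact. simpl INR.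
        replace (rg (1 + 2 * nu)) with (rg (nu + 1 / 2) * rg (1 + nu) * sqrt PI * / exp (2 * nu * ln 2))%R.
        2:{ apply Rmult_eq_reg_r with (2 * exp (2 * nu * ln 2) * / sqrt PI)%R;
            [|repeat apply Rmult_integral_contrapositive_currified; try apply Rinv_neq_0_compat; lra].
            transitivity (rg (nu + 1 / 2) * rg (1 + nu) * 2)%R; [field; lra|]. rewrite DU. ring. }
        replace (sin (PI * nu)) with (PI * nu * (rg (1 + nu) * rg (1 - nu)))%R by (rewrite RF; field; lra).
        field. repeat split; lra.
      * rewrite !RtoC_mult, RtoC_opp, ?RtoC_mult. change (Cexp (2 * L) ^ 0) with (RtoC 1). ring.
  - replace (RtoC (nu + INR (S k))) with (RtoC (nu + INR k + 1)) by (f_equal; rewrite S_INR; ring).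
    pose proof (pos_INR k).
    assert (NPC : RtoC (nu + INR k) + 1 - nu <> 0).
    { rewrite <- RtoC_plus, <- RtoC_minus. apply RtoC_neq_0. lra. }
    pose proof (fG_spole_step nu L (nu + INR k) _ nu_pos ltac:(lra) NPC (offpole_punctured_nu k) IHk) as H1.
    replace (res1 nu L * ucoef nu (S k) * Cexp (2 * L) ^ S k) with
      (res1 nu L * ucoef nu k * Cexp (2 * L) ^ k * rho nu L (nu + INR k)%R); [exact H1|].
    unfold rho, Cdiv. rewrite <- !RtoC_plus, <- !RtoC_minus, <- !RtoC_mult.
    assert (NZ : ((1 + nu + (nu + INR k)) * ((nu + INR k + 1) * (nu + INR k + 1)) * (nu + INR k + 1 - nu) <> 0)%R).
    { repeat apply Rmult_integral_contrapositive_currified; lra. }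
    rewrite <- RtoC_inv by auto.
    transitivity (Cexp (2 * L) ^ S k * res1 nu L * RtoC (ucoef nu k * ((nu + INR k) * (1 / 2 + (nu + INR k)) *
       / ((1 + nu + (nu + INR k)) * ((nu + INR k + 1) * (nu + INR k + 1)) * (nu + INR k + 1 - nu))))%R).
    { rewrite !RtoC_mult. simpl Cpow. ring. }
    transitivity (Cexp (2 * L) ^ S k * res1 nu L * RtoC (ucoef nu (S k))%R); [|ring].
    f_equal. f_equal. unfold ucoef. rewrite !rpoch_S.
    replace (fact (S k)) with (S k * fact k)%nat by reflexivity. rewrite mult_INR, S_INR.
    pose proof (INR_fact_neq_0 k).
    assert (0 < rpoch (nu + 1) k)%R by (apply rpoch_pos; lra). assert (0 < rpoch (2 * nu + 1) k)%R by (apply rpoch_pos; lra).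
    field. repeat split; try lra.
Qed.

Definition resint (k : nat) : C := match k with O => res0 nu L | S j => (sqrt PI / nu)%R * vcoef nu (S j) * Cexp (2 * L) ^ S j end.
(** Indexed by the unit cell, not by the pole: the first pole [nu] lies in cell [n0]. *)
Definition resnu (k : nat) : C := if Nat.leb n0 k then res1 nu L * ucoef nu (k - n0) * Cexp (2 * L) ^ (k - n0) else 0.

Lemma rect_box_int (k : nat) : rect_int (fG nu L) (INR k + (r - 1) / 2) (INR k + r / 2) (-1) 1 = 2 * PI * Ci * resint k.
Proof.
  assert (HO : forall x y, (INR k + (r - 1) / 2 <= x <= INR k + r / 2)%R -> (x, y) <> RtoC (INR k) -> holo (fG nu L) (x, y)).
  { intros. apply holo_fG. now apply offpole_near_int with k. }
  destruct k as [|k].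
  - destruct (fG_double_pole nu L nu_pos) as (e & M & He & HM).
    apply (Residue_rectangle (fG nu L) (INR 0) (res0 nu L) (sqrt PI / nu)%R (INR 0) _ _ _ _ 1 e M); auto; try lra.
  - apply rect_spole with (p := RtoC (INR (S k))) (q := INR (S k)) (e := 1%R); auto; try lra. apply fG_spole_int.
Qed.

Lemma rect_box_nu (k : nat) : rect_int (fG nu L) (INR k + r / 2) (INR k + (r + 1) / 2) (-1) 1 = 2 * PI * Ci * resnu k.
Proof.
  unfold resnu. destruct (Nat.leb_spec n0 k) as [Hk|Hk].
  - apply rect_spole with (p := RtoC (nu + INR (k - n0))) (q := (INR k + r)%R) (e := 1%R); try lra.
    + rewrite minus_INR by auto. f_equal. rewrite Hnu. ring.
    + intros x y Hx N. apply holo_fG, offpole_near_nu with k; auto. intros _ E. apply N. rewrite E.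
      rewrite minus_INR by auto. f_equal. rewrite Hnu. ring.
    + apply fG_spole_nu.
  - rewrite (Cauchy_rectangle _ _ _ (-1) 1 1); [ring | lra | lra | lra |].
    intros x y Hx _. apply holo_fG, offpole_near_nu with k; auto. lia.
Qed.

Lemma rect_residues (N : nat) :
  rect_int (fG nu L) ((r - 1) / 2) ((r - 1) / 2 + INR N) (-1) 1 = 2 * PI * Ci * (psum resint N + psum resnu N).
Proof.
  induction N.
  - simpl. rewrite Rplus_0_r. unfold rect_int, hseg, vseg. rewrite !RInt_point. change (@zero _) with (RtoC 0). ring.
  - pose proof (pos_INR N).
    assert (HI : forall x y, ((r - 1) / 2 <= x)%R -> y <> 0%R -> holo (fG nu L) (x, y)).
    { intros; apply holo_fG, offpole_im; auto. unfold Re; simpl. lra. }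
    rewrite S_INR. rewrite (rect_int_split_h _ _ ((r - 1) / 2 + INR N)) by (try (intros; apply HI); lra).
    rewrite (rect_int_split_h _ ((r - 1) / 2 + INR N) (INR N + r / 2)) by (try (intros; apply HI); lra).
    rewrite IHN. replace ((r - 1) / 2 + INR N)%R with (INR N + (r - 1) / 2)%R by ring.
    replace ((r - 1) / 2 + (INR N + 1))%R with (INR N + (r + 1) / 2)%R by field.
    rewrite rect_box_int, rect_box_nu. simpl. ring.
Qed.

Lemma pole_dist_nonint : pole_dist nu ((r - 1) / 2) ((1 - r) / 2).
Proof.
  split; [lra|]. split; [lra|]. intros j. rewrite Hnu, INR_IZR_INZ.
  set (m := (j - Z.of_nat n0)%Z).
  replace ((r - 1) / 2 + IZR j - (IZR (Z.of_nat n0) + r))%R with (IZR m - (1 + r) / 2)%R by (unfold m; rewrite minus_IZR; field).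
  destruct (Z_lt_le_dec m 1) as [Hm|Hm].
  - assert (IZR m <= 0)%R by (apply IZR_le; lia). rewrite Rabs_left1; lra.
  - apply IZR_le in Hm. rewrite Rabs_pos_eq; lra.
Qed.

End NonInteger.

Lemma cser_pad (u : nat -> C) (l : C) n0 : cser u l -> cser (fun k => if Nat.leb n0 k then u (k - n0)%nat else 0) l.
Proof.
  intros H. induction n0.
  - eapply cser_ext; [|exact H]. intros n. simpl. now rewrite Nat.sub_0_r.
  - replace l with ((if Nat.leb (S n0) 0 then u (0 - S n0)%nat else 0) + l) by (simpl; ring).
    apply (cser_decr_1 (fun k => if Nat.leb (S n0) k then u (k - S n0)%nat else 0)).
    eapply cser_ext; [|exact IHn0]. intros n. reflexivity.
Qed.

(** * Coefficient bounds and the value of the loop integral by residues *)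

Definition expb (a : nat -> R) : Prop := exists B D, (0 <= B)%R /\ (0 <= D)%R /\ forall k, (Rabs (a k) <= B * (D ^ k / INR (fact k)))%R.

Lemma expb_summable (a : nat -> R) (w : C) : expb a -> abs_summable (fun k => a k * w ^ k).
Proof.
  intros (B & D & HB & HD & H). apply abs_summable_le with (a := fun k => (B * ((D * Cmod w) ^ k / INR (fact k)))%R); [|apply ex_series_exp].
  intros k. rewrite Cmod_mult, Cmod_R, Cmod_pow, Rpow_mult_distr.
  replace (B * (D ^ k * Cmod w ^ k / INR (fact k)))%R with (B * (D ^ k / INR (fact k)) * Cmod w ^ k)%R by (unfold Rdiv; ring).
  apply Rmult_le_compat_r; auto. apply pow_le, Cmod_ge_0.
Qed.

Lemma rpoch_inv_bound a d : (0 < d)%R -> (forall k : nat, (d <= Rabs (a + INR k))%R) -> forall k, (Rabs (/ rpoch a k) <= (/ d) ^ k)%R.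
Proof.
  intros Hd H k. induction k.
  - simpl. rewrite Rinv_1, Rabs_R1. lra.
  - rewrite rpoch_S, Rinv_mult, Rabs_mult, Rmult_comm. simpl pow.
    apply Rmult_le_compat; auto using Rabs_pos. rewrite Rabs_inv. now apply Rinv_le_contravar.
Qed.

Lemma rpoch_ratio_bound a b : (0 < a)%R -> (a <= b)%R -> forall k, (0 <= rpoch a k / rpoch b k <= 1)%R.
Proof.
  intros Ha Hab k. assert (Pa := rpoch_pos a k Ha). assert (Pb := rpoch_pos b k ltac:(lra)).
  split; [apply Rdiv_le_0_compat; lra|]. apply Rmult_le_reg_r with (rpoch b k); auto. unfold Rdiv.
  rewrite Rmult_assoc, Rinv_l, Rmult_1_r, Rmult_1_l by lra. clear Pa Pb.
  induction k; simpl; [lra|]. pose proof (rpoch_pos a k Ha). pose proof (pos_INR k). apply Rmult_le_compat; lra.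
Qed.

Lemma nonint_dist nu : nonint nu -> exists d, (0 < d)%R /\ forall k : nat, (d <= Rabs (1 - nu + INR k))%R.
Proof.
  intros H. destruct (archimed nu) as [A1 A2]. set (m := up nu) in *.
  assert (IZR (m - 1) < nu)%R.
  { rewrite minus_IZR. destruct (Req_dec nu (IZR (m - 1))) as [E|E]; [exfalso; now apply (H (m - 1)%Z)|]. rewrite minus_IZR in E. lra. }
  rewrite minus_IZR in H0.
  exists (Rmin (IZR m - nu) (nu - IZR m + 1)). split; [apply Rmin_pos; lra|].
  intros k. rewrite INR_IZR_INZ. set (j := Z.of_nat k). replace (1 - nu + IZR j)%R with (IZR (1 + j) - nu)%R by (rewrite plus_IZR; ring).
  destruct (Z_lt_le_dec (1 + j) m) as [Hm|Hm].
  - assert (IZR (1 + j) <= IZR m - 1)%R by (rewrite <- minus_IZR; apply IZR_le; lia).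
    pose proof (Rmin_r (IZR m - nu) (nu - IZR m + 1)). rewrite Rabs_left1; lra.
  - apply IZR_le in Hm. pose proof (Rmin_l (IZR m - nu) (nu - IZR m + 1)). rewrite Rabs_pos_eq; lra.
Qed.

(** Both ratios of Pochhammer symbols are at most 1, and [rpoch (2 nu + 1) k] is at least 1. The
    bound does not involve [nu], as dominated convergence in the order requires. *)
Lemma ucoef_bound nu k : (0 < nu)%R -> (Rabs (ucoef nu k) <= / INR (fact k))%R.
Proof.
  intros Hnu.
  pose proof (rpoch_ratio_bound nu (nu + 1) Hnu ltac:(lra) k) as B1.
  pose proof (rpoch_ratio_bound (nu + 1 / 2) (nu + 1) ltac:(lra) ltac:(lra) k) as B2.
  assert (B3 := rpoch_inv_bound (2 * nu + 1) 1 ltac:(lra) ltac:(intros j; pose proof (pos_INR j); rewrite Rabs_pos_eq; lra) k).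
  rewrite Rinv_1 in B3.
  assert (P1 := rpoch_pos (nu + 1) k ltac:(lra)). assert (P2 := rpoch_pos (2 * nu + 1) k ltac:(lra)). pose proof (INR_fact_lt_0 k) as P3.
  rewrite pow1 in *. replace (ucoef nu k) with ((rpoch nu k / rpoch (nu + 1) k) * (rpoch (nu + 1 / 2) k / rpoch (nu + 1) k) * / rpoch (2 * nu + 1) k * / INR (fact k))%R
    by (unfold ucoef; field; repeat split; lra).
  rewrite !Rabs_mult, (Rabs_pos_eq (rpoch nu k / _)), (Rabs_pos_eq (rpoch (nu + 1 / 2) k / _)), (Rabs_pos_eq (/ INR (fact k))) by (try lra; left; now apply Rinv_0_lt_compat).
  replace (/ INR (fact k))%R with (1 * 1 * 1 * / INR (fact k))%R at 2 by (field; lra).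
  apply Rmult_le_compat_r; [left; now apply Rinv_0_lt_compat|].
  apply Rmult_le_compat; auto using Rabs_pos; [apply Rmult_le_pos; lra|]. apply Rmult_le_compat; lra.
Qed.

Lemma expb_ucoef nu : (0 < nu)%R -> expb (ucoef nu).
Proof.
  intros Hnu. exists 1%R, 1%R. repeat split; try lra. intros k.
  rewrite pow1, Rmult_1_l. unfold Rdiv. rewrite Rmult_1_l. now apply ucoef_bound.
Qed.

Lemma expb_vcoef nu : (0 < nu)%R -> nonint nu -> expb (vcoef nu).
Proof.
  intros Hnu NI. destruct (nonint_dist nu NI) as (d & Hd & HD).
  assert (Pd : (0 < / d)%R) by now apply Rinv_0_lt_compat.
  exists 1%R, (/ d)%R. repeat split; try lra. intros k.
  destruct k as [|k].
  { unfold vcoef. simpl. replace (1 / (0 * 1 * 1 * 1))%R with 0%R; [rewrite Rabs_R0; lra|].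
    replace (0 * 1 * 1 * 1)%R with 0%R by ring. unfold Rdiv. rewrite Rinv_0. ring. }
  set (n := S k).
  pose proof (rpoch_ratio_bound (1 / 2) (1 + nu) ltac:(lra) ltac:(lra) n) as B1.
  pose proof (rpoch_inv_bound (1 - nu) d Hd HD n) as B2.
  assert (P1 := rpoch_pos (1 + nu) n ltac:(lra)). pose proof (INR_fact_lt_0 n) as P3.
  assert (N2 : (rpoch (1 - nu) n <> 0)%R) by (apply rpoch_neq_0; intros j E; specialize (HD j); rewrite E, Rabs_R0 in HD; lra).
  assert (P4 : (1 <= INR n)%R) by (unfold n; rewrite S_INR; pose proof (pos_INR k); lra).
  replace (vcoef nu n) with ((rpoch (1 / 2) n / rpoch (1 + nu) n) * (/ INR n) * / rpoch (1 - nu) n * / INR (fact n))%R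
    by (unfold vcoef; field; repeat split; lra).
  assert (B3 : (0 <= / INR n <= 1)%R) by (split; [left; apply Rinv_0_lt_compat; lra | rewrite <- Rinv_1; apply Rinv_le_contravar; lra]).
  rewrite !Rabs_mult, (Rabs_pos_eq (rpoch (1 / 2) n / _)), (Rabs_pos_eq (/ INR n)), (Rabs_pos_eq (/ INR (fact n))) by (try lra; left; now apply Rinv_0_lt_compat).
  replace (1 * ((/ d) ^ n / INR (fact n)))%R with (1 * 1 * (/ d) ^ n * / INR (fact n))%R by (unfold Rdiv; ring).
  apply Rmult_le_compat_r; [left; now apply Rinv_0_lt_compat|].
  apply Rmult_le_compat; auto using Rabs_pos; [apply Rmult_le_pos; lra|]. apply Rmult_le_compat; lra.
Qed.

Definition Useries (nu : R) (w : C) : C := CSeries (fun k => ucoef nu k * w ^ k).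
Definition Vseries (nu : R) (w : C) : C := CSeries (fun k => vcoef nu k * w ^ k).

Lemma nonint_decompose nu : (0 < nu)%R -> nonint nu -> exists (n0 : nat) r, (0 < r < 1)%R /\ nu = (INR n0 + r)%R.
Proof.
  intros Hnu NI. destruct (nfloor_ex nu ltac:(lra)) as [n Hn]. exists n, (nu - INR n)%R.
  split; [|ring]. assert (nu <> INR n) by (rewrite INR_IZR_INZ; apply NI). lra.
Qed.

Lemma fG_loop_nonint nu L : (0 < nu)%R -> nonint nu ->
  forall s c1 c2, (- (1 / 2) < s < 0)%R -> (c1 < 0 < c2)%R ->
  is_loop_integral (fG nu L) s c1 c2
    (2 * PI * Ci * (- (res0 nu L + (sqrt PI / nu)%R * Vseries nu (Cexp (2 * L)) + res1 nu L * Useries nu (Cexp (2 * L))))).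
Proof.
  intros Hnu NI s c1 c2 Hs Hc. destruct (nonint_decompose nu Hnu NI) as (n0 & r & Hr & E).
  set (S1 := res0 nu L + (sqrt PI / nu)%R * Vseries nu (Cexp (2 * L))). set (S2 := res1 nu L * Useries nu (Cexp (2 * L))).
  replace (2 * PI * Ci * - (S1 + S2)) with (- (2 * PI * Ci * (S1 + S2))) by ring.
  apply (fG_loop nu L ((r - 1) / 2) ((1 - r) / 2)); auto; [now apply pole_dist_nonint with n0|].
  apply cv_ext with (u := fun N => 2 * PI * Ci * (psum (resint nu L) N + psum (resnu nu n0 L) N)).
  { intros N. symmetry. now apply rect_residues. }
  apply cv_mult; [apply cv_const|]. apply cv_plus.
  - pose proof (abs_summable_cser _ (expb_summable _ (Cexp (2 * L)) (expb_vcoef nu Hnu NI))) as HV. fold (Vseries nu (Cexp (2 * L))) in HV.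
    (* The term of index 0, where [vcoef] is 0, is dropped; its place is taken by the residue at the
       double pole. *)
    apply (cser_scal (sqrt PI / nu)%R) in HV. apply cser_incr_1 in HV.
    assert (V0 : vcoef nu 0 = 0%R).
    { unfold vcoef. simpl. replace (0 * 1 * 1 * 1)%R with 0%R by ring. unfold Rdiv. rewrite Rinv_0. ring. }
    assert (H := cser_decr_1 (resint nu L) ((sqrt PI / nu)%R * Vseries nu (Cexp (2 * L)))).
    apply H. eapply cser_ext; [|eapply cv_eq; [|exact HV]].
    + intros n. unfold resint. cbv beta. ring.
    + rewrite V0. ring.
  - pose proof (abs_summable_cser _ (expb_summable _ (Cexp (2 * L)) (expb_ucoef nu Hnu))) as HU. fold (Useries nu (Cexp (2 * L))) in HU.
    apply (cser_scal (res1 nu L)) in HU.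
    eapply cser_ext; [|apply (cser_pad _ _ n0 HU)]. intros n. unfold resnu. cbv beta. destruct (Nat.leb n0 n); ring.
Qed.

Open Scope R_scope.

(** * Formal power series identities *)

Definition conv (a b : nat -> R) (n : nat) : R := rsum (fun k => a k * b (n - k)%nat) (S n).

(* The Euler operator [w d/dw] on coefficients: [icoef_rec] is then the modified Bessel equation
   and [wronskian_seq] the Wronskian of its solutions. *)
Definition theta (a : nat -> R) (n : nat) : R := INR n * a n.

Lemma rsum_plus u v n : rsum (fun k => u k + v k) n = rsum u n + rsum v n.
Proof. induction n; simpl; [ring | rewrite IHn; ring]. Qed.

Lemma rsum_scal c u n : rsum (fun k => c * u k) n = c * rsum u n.
Proof. induction n; simpl; [ring | rewrite IHn; ring]. Qed.

Lemma conv_ext a a' b b' n : (forall k, (k <= n)%nat -> a k = a' k) -> (forall k, (k <= n)%nat -> b k = b' k) -> conv a b n = conv a' b' n.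
Proof. intros Ha Hb. apply rsum_ext. intros k Hk. rewrite Ha, Hb by lia. reflexivity. Qed.

Lemma conv_lin_l a a' b c d n : conv (fun k => c * a k + d * a' k) b n = c * conv a b n + d * conv a' b n.
Proof. unfold conv. rewrite <- !rsum_scal, <- rsum_plus. apply rsum_ext. intros; ring. Qed.

Lemma conv_lin_r a b b' c d n : conv a (fun k => c * b k + d * b' k) n = c * conv a b n + d * conv a b' n.
Proof. unfold conv. rewrite <- !rsum_scal, <- rsum_plus. apply rsum_ext. intros; ring. Qed.

Lemma conv_S_l a b n : conv a b (S n) = a O * b (S n) + conv (fun k => a (S k)) b n.
Proof. unfold conv. rewrite rsum_shift. f_equal. Qed.

Lemma conv_S_r a b n : conv a b (S n) = conv a (fun k => b (S k)) n + a (S n) * b O.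
Proof.
  unfold conv. rewrite rsum_S, Nat.sub_diag. f_equal. apply rsum_ext. intros k Hk.
  now replace (S n - k)%nat with (S (n - k)) by lia.
Qed.

Lemma conv_comm a b n : conv a b n = conv b a n.
Proof.
  revert a b. induction n; intros a b; [unfold conv; simpl; ring|].
  rewrite conv_S_l, conv_S_r, IHn. ring.
Qed.

Lemma conv_assoc a b c n : conv (conv a b) c n = conv a (conv b c) n.
Proof.
  revert a. induction n; intros a; [unfold conv; simpl; ring|].
  rewrite (conv_S_l (conv a b)), (conv_S_l a), <- IHn, (conv_S_l b).
  rewrite (conv_ext (fun k => conv a b (S k)) (fun k => a O * b (S k) + 1 * conv (fun k => a (S k)) b k) c c).
  - rewrite conv_lin_l. unfold conv at 1. simpl. ring.
  - intros k _. rewrite conv_S_l. ring.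
  - auto.
Qed.

Lemma theta_conv a b n : INR n * conv a b n = conv (theta a) b n + conv a (theta b) n.
Proof.
  unfold conv. rewrite <- rsum_scal, <- rsum_plus. apply rsum_ext. intros k Hk. unfold theta.
  rewrite minus_INR by lia. ring.
Qed.

Definition unit_seq (n : nat) : R := match n with O => 1 | S _ => 0 end.

Lemma conv_unit a c n : conv a (fun k => c * unit_seq k) n = c * a n.
Proof.
  rewrite conv_comm. destruct n; [unfold conv; simpl; ring|]. rewrite conv_S_l.
  rewrite (conv_ext _ (fun k => 0 * a k + 0 * a k) a a) by (intros; simpl; ring || auto).
  rewrite conv_lin_l. simpl. ring.
Qed.

(** The binomial coefficient with real upper argument, defined by the absorption identity, so that
    multiplication by the index acts in the simplest way. *)
Fixpoint gbin (a : R) (k : nat) : R :=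
  match k with O => 1 | S j => a / INR (S j) * gbin (a - 1) j end.

Lemma gbin_S a k : gbin a (S k) = a / INR (S k) * gbin (a - 1) k.
Proof. reflexivity. Qed.

Lemma theta_gbin a k : INR (S k) * gbin a (S k) = a * gbin (a - 1) k.
Proof. rewrite gbin_S. field. apply not_0_INR; lia. Qed.

Lemma conv_theta_l a b n : conv (theta a) b (S n) = conv (fun k => INR (S k) * a (S k)) b n.
Proof. rewrite conv_S_l. unfold theta at 1. simpl INR at 1. rewrite !Rmult_0_l, Rplus_0_l. reflexivity. Qed.

(** Multiplication by the index is a derivation for [conv]; by absorption it turns the identity of
    degree [n + 1] into two instances of degree [n]. *)
Lemma gbin_vandermonde a b n : conv (gbin a) (gbin b) n = gbin (a + b) n.
Proof.
  revert a b. induction n; intros a b; [unfold conv; simpl; ring|].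
  apply Rmult_eq_reg_l with (INR (S n)); [|apply not_0_INR; lia].
  rewrite theta_gbin, theta_conv, (conv_comm (gbin a)), !conv_theta_l.
  rewrite (conv_ext _ (fun k => a * gbin (a - 1) k + 0 * gbin a k) _ (gbin b)) by (intros; rewrite ?theta_gbin; ring || auto).
  rewrite (conv_ext (fun k => INR (S k) * gbin b (S k)) (fun k => b * gbin (b - 1) k + 0 * gbin b k) (gbin a) (gbin a)) by (intros; rewrite ?theta_gbin; ring || auto).
  rewrite !conv_lin_l, !IHn. replace (a - 1 + b) with (a + b - 1) by ring. replace (b - 1 + a) with (a + b - 1) by ring. ring.
Qed.

Lemma rpoch_shift a n : rpoch a (S n) = a * rpoch (a + 1) n.
Proof.
  induction n; [simpl; ring|]. rewrite rpoch_S, IHn, rpoch_S, S_INR. ring.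
Qed.

Lemma rpoch_add a n m : rpoch a (n + m) = rpoch a n * rpoch (a + INR n) m.
Proof.
  revert a. induction n; intros a; [simpl; rewrite Rplus_0_r; ring|].
  change (S n + m)%nat with (S (n + m)). rewrite !rpoch_shift, IHn, S_INR.
  replace (a + 1 + INR n) with (a + (INR n + 1)) by ring. ring.
Qed.

Lemma gbin_rpoch a k : INR (fact k) * gbin (a + INR k) k = rpoch (a + 1) k.
Proof.
  revert a. induction k; intros a; [simpl; ring|].
  replace (fact (S k)) with (S k * fact k)%nat by reflexivity. rewrite mult_INR.
  rewrite gbin_S, rpoch_S, <- IHk, S_INR.
  replace (a + (INR k + 1) - 1) with (a + INR k) by ring.
  pose proof (pos_INR k). field. lra.
Qed.

(** The coefficients of the series of [I_m] in the variable [(z/2)^2], normalised to start with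
    1. *)
Definition icoef (m : R) (k : nat) : R := / (INR (fact k) * rpoch (m + 1) k).

(** Completing both Pochhammer symbols to length [n] turns the summand into a product of two
    binomial coefficients over a common factor, and Vandermonde's identity sums it. *)
Lemma icoef_product m l n : (forall k : nat, m + 1 + INR k <> 0) -> (forall k : nat, l + 1 + INR k <> 0) ->
  conv (icoef m) (icoef l) n = rpoch (m + l + INR n + 1) n / (INR (fact n) * rpoch (m + 1) n * rpoch (l + 1) n).
Proof.
  intros Hm Hl.
  assert (Nm : forall k, rpoch (m + 1) k <> 0) by (intros; now apply rpoch_neq_0).
  assert (Nl : forall k, rpoch (l + 1) k <> 0) by (intros; now apply rpoch_neq_0).
  pose proof (INR_fact_neq_0) as NF.
  assert (E : conv (icoef m) (icoef l) n = / (rpoch (m + 1) n * rpoch (l + 1) n) * conv (gbin (l + INR n)) (gbin (m + INR n)) n).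
  { unfold conv. rewrite <- rsum_scal. apply rsum_ext. intros k Hk. unfold icoef.
    assert (E1 : rpoch (m + 1) n = rpoch (m + 1) k * (INR (fact (n - k)) * gbin (m + INR n) (n - k))).
    { replace n with (k + (n - k))%nat at 1 by lia. rewrite rpoch_add. f_equal.
      replace (m + 1 + INR k) with (m + INR k + 1) by ring. rewrite <- gbin_rpoch. rewrite (minus_INR n k) by lia. f_equal. f_equal. ring. }
    assert (E2 : rpoch (l + 1) n = rpoch (l + 1) (n - k) * (INR (fact k) * gbin (l + INR n) k)).
    { replace n with ((n - k) + k)%nat at 1 by lia. rewrite rpoch_add. f_equal.
      replace (l + 1 + INR (n - k)) with (l + INR (n - k) + 1) by ring. rewrite <- gbin_rpoch. rewrite (minus_INR n k) by lia. f_equal. f_equal. ring. }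
    pose proof (Nm n) as M1. pose proof (Nl n) as M2. rewrite E1 in M1 |- *. rewrite E2 in M2 |- *.
    pose proof (Nm k). pose proof (Nl (n - k)%nat). pose proof (NF k). pose proof (NF (n - k)%nat).
    assert (gbin (m + INR n) (n - k) <> 0) by (intros Z; apply M1; rewrite Z; ring).
    assert (gbin (l + INR n) k <> 0) by (intros Z; apply M2; rewrite Z; ring).
    field. repeat split; auto. }
  rewrite E, gbin_vandermonde.
  rewrite <- (gbin_rpoch (m + l + INR n)). replace (l + INR n + (m + INR n)) with (m + l + INR n + INR n) by ring.
  field. auto.
Qed.

Lemma rpoch_double m n : rpoch (m + INR n + 1) n * rpoch (m + 1) n = 4 ^ n * rpoch (m / 2 + 1 / 2) n * rpoch (m / 2 + 1) n.
Proof.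
  pose proof (poch_duplication (RtoC (m / 2 + 1 / 2)) n) as H.
  replace (RtoC (m / 2 + 1 / 2) + RtoC (1 / 2))%C with (RtoC (m / 2 + 1)) in H by (rewrite <- RtoC_plus; f_equal; field).
  replace (RtoC 2 * RtoC (m / 2 + 1 / 2))%C with (RtoC (m + 1)) in H by (rewrite <- RtoC_mult; f_equal; field).
  rewrite !poch_RtoC, <- RtoC_pow, <- !RtoC_mult in H. injection H as H.
  replace (n + (n + 0))%nat with (n + n)%nat in H by lia. rewrite rpoch_add in H.
  replace (m + 1 + INR n) with (m + INR n + 1) in H by ring. lra.
Qed.

(** * The derivative of the Bessel coefficients in the order, by variation of parameters *)

Section DerivativeIdentity.

Variable nu : R.
Hypothesis nu_pos : 0 < nu.
Hypothesis nu_nonint : nonint nu.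

Let y1 := icoef nu.
Let y2 := icoef (- nu).
(** The powers of 4 pass from the variable [z^2] of the residue series to the variable [(z/2)^2] of
    the Bessel series. *)
Let U (k : nat) := 4 ^ k * ucoef nu k.
Let V (k : nat) := 4 ^ k * vcoef nu k.
Let shift (a : nat -> R) (n : nat) : R := match n with O => 0 | S k => a k end.

Lemma y1_den (k : nat) : nu + 1 + INR k <> 0.
Proof. pose proof (pos_INR k). lra. Qed.

Lemma y2_den (k : nat) : - nu + 1 + INR k <> 0.
Proof. replace (- nu + 1 + INR k) with (1 - nu + INR k) by ring. apply nonint_plus, nonint_1_minus, nu_nonint. Qed.

Lemma icoef_rec m n : (forall k : nat, m + 1 + INR k <> 0) -> INR n * (INR n + m) * icoef m n = shift (icoef m) n.
Proof.
  intros H. destruct n; [simpl; ring|]. unfold shift, icoef. rewrite rpoch_S.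
  replace (fact (S n)) with (S n * fact n)%nat by reflexivity. rewrite mult_INR, S_INR.
  pose proof (INR_fact_neq_0 n). pose proof (rpoch_neq_0 _ n H). pose proof (H n). pose proof (pos_INR n).
  field. repeat split; auto. lra.
Qed.

Lemma conv_shift_l a b n : conv (shift a) b n = shift (conv a b) n.
Proof.
  destruct n; [unfold conv; simpl; ring|]. rewrite conv_S_l. change (0 * b (S n) + conv a b n = conv a b n). ring.
Qed.

(** A first-order equation: up to a power of the variable, [U] is an integral of [I_nu^2]. *)
Lemma U_ode n : (INR n + nu) * U n = nu * conv y1 y1 n.
Proof.
  unfold U, y1. rewrite icoef_product by apply y1_den. unfold ucoef.
  pose proof (rpoch_double (2 * nu) n) as D. replace (2 * nu / 2) with nu in D by field.
  replace (nu + nu + INR n + 1) with (2 * nu + INR n + 1) by ring.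
  assert (P1 := rpoch_pos (nu + 1) n ltac:(lra)). assert (P2 := rpoch_pos (2 * nu + 1) n ltac:(lra)). pose proof (INR_fact_lt_0 n). pose proof (pos_INR n).
  assert (E : (nu + INR n) * rpoch nu n = nu * rpoch (nu + 1) n) by (rewrite <- rpoch_shift, rpoch_S; ring).
  replace (rpoch (2 * nu + INR n + 1) n) with (4 ^ n * rpoch (nu + 1 / 2) n * rpoch (nu + 1) n / rpoch (2 * nu + 1) n) by (rewrite <- D; field; lra).
  replace (rpoch nu n) with (nu * rpoch (nu + 1) n / (nu + INR n)) by (rewrite <- E; field; lra).
  field. repeat split; lra.
Qed.

(** [V] is the logarithmic integral of the product of the two solutions; its constant term 1 is
    removed since [theta] annihilates constants. *)
Lemma V_ode n : theta V n = conv y1 y2 n - unit_seq n.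
Proof.
  unfold theta, V, y1, y2. rewrite icoef_product by (apply y1_den || apply y2_den).
  destruct n; [simpl; field|]. set (n' := S n). replace (unit_seq n') with 0 by reflexivity.
  pose proof (rpoch_double 0 n') as D.
  replace (0 / 2 + 1 / 2) with (1 / 2) in D by field. replace (0 / 2 + 1) with 1 in D by field. replace (0 + 1) with 1 in D by ring.
  assert (P1 := rpoch_pos 1 n' ltac:(lra)). assert (P2 := rpoch_neq_0 _ n' y2_den). assert (P3 := rpoch_pos (nu + 1) n' ltac:(lra)).
  pose proof (INR_fact_lt_0 n'). assert (N : INR n' <> 0) by (apply not_0_INR; unfold n'; lia).
  apply Rmult_eq_reg_r in D; [|lra]. replace (nu + - nu + INR n' + 1) with (0 + INR n' + 1) by ring. rewrite D.
  unfold vcoef. replace (1 - nu) with (- nu + 1) by ring. replace (1 + nu) with (nu + 1) by ring.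
  field. repeat split; auto; lra.
Qed.

(** Applying [theta] to the left side gives 0 by the two second-order equations, so only the
    constant term remains. *)
Lemma wronskian_seq n : conv (theta y1) y2 n - conv y1 (theta y2) n + nu * conv y1 y2 n = nu * unit_seq n.
Proof.
  destruct n; [unfold conv, theta, y1, y2, icoef; simpl; field|].
  apply Rmult_eq_reg_l with (INR (S n)); [|apply not_0_INR; lia].
  replace (unit_seq (S n)) with 0 by reflexivity.
  transitivity (INR (S n) * conv (theta y1) y2 (S n) - INR (S n) * conv y1 (theta y2) (S n) + nu * (INR (S n) * conv y1 y2 (S n))); [ring|].
  rewrite !theta_conv.
  assert (E1 : conv (theta (theta y1)) y2 (S n) = conv y1 y2 n - nu * conv (theta y1) y2 (S n)).
  { change (conv y1 y2 n) with (shift (conv y1 y2) (S n)). rewrite <- conv_shift_l.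
    rewrite (conv_ext _ (fun k => 1 * shift y1 k + (- nu) * theta y1 k) _ y2); [rewrite conv_lin_l; ring | | auto].
    intros k _. unfold y1 at 2. rewrite <- (icoef_rec nu k y1_den). unfold theta. fold y1. ring. }
  assert (E2 : conv y1 (theta (theta y2)) (S n) = conv y1 y2 n + nu * conv y1 (theta y2) (S n)).
  { change (conv y1 y2 n) with (shift (conv y1 y2) (S n)). rewrite <- conv_shift_l, (conv_comm (shift y1)).
    rewrite (conv_ext _ y1 (theta (theta y2)) (fun k => 1 * shift y2 k + nu * theta y2 k)); [| auto |].
    - rewrite conv_lin_r. rewrite <- (conv_comm (shift y1)), conv_shift_l. rewrite (conv_comm y1 (shift y2)), conv_shift_l.
      simpl shift. rewrite (conv_comm y2 y1). ring.
    - intros k _. unfold y2 at 2. rewrite <- (icoef_rec (- nu) k y2_den). unfold theta. fold y2. ring. }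
  rewrite E1, E2. ring.
Qed.

(** The ansatz of variation of parameters for the derivative of [y1] in the order. Its first term is
    the homogeneous solution that makes [e 0] vanish. *)
Let e (n : nat) : R := y1 n / (2 * nu) + conv y1 V n / 2 - conv y2 U n / (2 * nu).

(** Differentiating [icoef_rec] in the order produces exactly this recurrence; for [e] it follows
    from the equations of [U], [V], [y1], [y2] and the Wronskian. *)
Lemma e_rec n : INR n * (INR n + nu) * e n = shift e n - INR n * y1 n.
Proof.
  set (T := conv y1 (conv y1 y2) n).
  assert (A1 : conv y1 (theta V) n = T - y1 n).
  { rewrite (conv_ext _ y1 (theta V) (fun k => 1 * conv y1 y2 k + (-1) * (1 * unit_seq k))) by (auto; intros; rewrite V_ode; ring).
    rewrite conv_lin_r, conv_unit. unfold T. ring. }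
  assert (TU : forall k, theta U k = nu * conv y1 y1 k + (- nu) * U k) by (intros k; rewrite <- U_ode; unfold theta; ring).
  assert (A2 : conv y2 (theta U) n = nu * T - nu * conv y2 U n).
  { rewrite (conv_ext _ y2 _ _ n (fun k _ => eq_refl) (fun k _ => TU k)), conv_lin_r.
    rewrite (conv_comm y2 (conv y1 y1)), conv_assoc. unfold T. ring. }
  (* This is [theta e]: the triple product [T] arising from [theta V] and from [theta U] cancels, as
     the ansatz intends. *)
  set (g := fun n => theta y1 n / (2 * nu) + conv (theta y1) V n / 2 - y1 n / 2 - conv (theta y2) U n / (2 * nu) + conv y2 U n / 2).
  assert (G : INR n * e n = g n).
  { unfold e, g. transitivity (INR n * y1 n / (2 * nu) + (INR n * conv y1 V n) / 2 - (INR n * conv y2 U n) / (2 * nu)); [field; lra|].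
    rewrite !theta_conv, A1, A2. replace (theta y1 n) with (INR n * y1 n) by reflexivity. field. lra. }
  transitivity ((INR n + nu) * (INR n * e n)); [ring|]. rewrite G. unfold g.
  assert (B1 : conv (theta y1) (theta V) n = conv (theta y1) (conv y1 y2) n - theta y1 n).
  { rewrite (conv_ext _ (theta y1) (theta V) (fun k => 1 * conv y1 y2 k + (-1) * (1 * unit_seq k))) by (auto; intros; rewrite V_ode; ring).
    rewrite conv_lin_r, conv_unit. ring. }
  assert (B2 : conv (theta y2) (theta U) n = nu * conv (theta y2) (conv y1 y1) n - nu * conv (theta y2) U n).
  { rewrite (conv_ext _ (theta y2) _ _ n (fun k _ => eq_refl) (fun k _ => TU k)), conv_lin_r. ring. }
  assert (B3 : conv (theta (theta y1)) V n = shift (conv y1 V) n - nu * conv (theta y1) V n).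
  { rewrite <- conv_shift_l. rewrite (conv_ext _ (fun k => 1 * shift y1 k + (- nu) * theta y1 k) _ V); [rewrite conv_lin_l; ring | | auto].
    intros k _. unfold y1 at 2. rewrite <- (icoef_rec nu k y1_den). unfold theta. fold y1. ring. }
  assert (B4 : conv (theta (theta y2)) U n = shift (conv y2 U) n + nu * conv (theta y2) U n).
  { rewrite <- conv_shift_l. rewrite (conv_ext _ (fun k => 1 * shift y2 k + nu * theta y2 k) _ U); [rewrite conv_lin_l; ring | | auto].
    intros k _. unfold y2 at 2. rewrite <- (icoef_rec (- nu) k y2_den). unfold theta. fold y2. ring. }
  assert (B5 : INR n * theta y1 n = shift y1 n - nu * theta y1 n).
  { unfold y1 at 2. rewrite <- (icoef_rec nu n y1_den). fold y1. unfold theta. ring. }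
  (* The Wronskian identity multiplied by [y1]; it removes the triple products left by the second
     application of [theta]. *)
  assert (B6 : conv (theta y1) (conv y1 y2) n - conv (theta y2) (conv y1 y1) n + nu * T = nu * y1 n).
  { rewrite <- conv_unit. rewrite (conv_ext y1 y1 (fun k => nu * unit_seq k)
       (fun k => 1 * (1 * conv (theta y1) y2 k + (-1) * conv y1 (theta y2) k) + nu * conv y1 y2 k)) by (auto; intros; rewrite <- wronskian_seq; ring).
    rewrite !conv_lin_r. fold T.
    replace (conv (theta y1) (conv y1 y2) n) with (conv y1 (conv (theta y1) y2) n)
      by (rewrite <- !conv_assoc; apply conv_ext; auto using conv_comm).
    rewrite (conv_comm (theta y2)), (conv_assoc y1 y1 (theta y2)).
    ring. }
  transitivity (INR n * theta y1 n / (2 * nu) + INR n * conv (theta y1) V n / 2 - INR n * y1 n / 2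
    - INR n * conv (theta y2) U n / (2 * nu) + INR n * conv y2 U n / 2
    + (theta y1 n / 2 + nu * conv (theta y1) V n / 2 - nu * y1 n / 2 - conv (theta y2) U n / 2 + nu * conv y2 U n / 2)); [field; lra|].
  rewrite !theta_conv, B1, B2, B3, B4, B5, A2.
  assert (ES : shift e n = shift y1 n / (2 * nu) + shift (conv y1 V) n / 2 - shift (conv y2 U) n / (2 * nu)).
  { destruct n; simpl; [field; lra | reflexivity]. }
  rewrite ES. assert (TE : theta y1 n = INR n * y1 n) by reflexivity. rewrite !TE.
  replace (nu * T) with (nu * y1 n - conv (theta y1) (conv y1 y2) n + conv (theta y2) (conv y1 y1) n) by lra.
  field. lra.
Qed.

(** The left side is the derivative of [icoef nu n] in [nu]. It obeys the recurrence [e_rec] and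
    starts with 0, and the leading factor [n (n + nu)] does not vanish for [n >= 1]. *)
Lemma icoef_derivative_identity n :
  - rsum (fun j => / (nu + 1 + INR j)) n * y1 n = e n.
Proof.
  assert (E0 : e 0 = 0).
  { assert (V0 : V 0 = 0) by (unfold V, vcoef; simpl; rewrite !Rmult_0_l; unfold Rdiv; rewrite Rinv_0; ring).
    unfold e, conv. simpl. rewrite V0. unfold y1, y2, U, icoef, ucoef. simpl. field. lra. }
  induction n; [rewrite E0; simpl; ring|].
  assert (N : INR (S n) * (INR (S n) + nu) <> 0).
  { rewrite S_INR. pose proof (pos_INR n). apply Rmult_integral_contrapositive_currified; lra. }
  apply Rmult_eq_reg_l with (INR (S n) * (INR (S n) + nu)); auto.
  rewrite e_rec. simpl shift. rewrite <- IHn, rsum_S.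
  transitivity (- (rsum (fun j => / (nu + 1 + INR j)) n + / (nu + 1 + INR n)) * (INR (S n) * (INR (S n) + nu) * y1 (S n))); [ring|].
  unfold y1 at 1. rewrite (icoef_rec nu (S n) y1_den). simpl shift. fold y1.
  replace (INR (S n) * y1 (S n)) with (y1 n / (nu + 1 + INR n)).
  - pose proof (y1_den n). field. auto.
  - pose proof (icoef_rec nu (S n) y1_den) as R1. fold y1 in R1. simpl shift in R1. rewrite <- R1, S_INR.
    pose proof (y1_den n). field. auto.
Qed.

End DerivativeIdentity.

(** * Rothe-Hagen convolution *)

(** Polynomial functions of degree at most [n], characterised by division by [x - a] at every [a];
    this is all that counting zeros requires. *)
Fixpoint polyf (n : nat) (f : R -> R) : Prop :=
  match n with
  | O => forall x y, f x = f y
  | S k => forall a, exists g, polyf k g /\ forall x, f x = f a + (x - a) * g x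
  end.

Lemma polyf_ext n f g : (forall x, f x = g x) -> polyf n f -> polyf n g.
Proof.
  destruct n; simpl; intros E H; [intros; rewrite <- !E; auto|].
  intros a. destruct (H a) as (h & Hh & Eh). exists h. split; auto. intros; rewrite <- !E; auto.
Qed.

Lemma polyf_const c n : polyf n (fun _ => c).
Proof.
  revert c. induction n; simpl; intros c; auto. intros a. exists (fun _ => 0). split; auto. intros; ring.
Qed.

Lemma polyf_lin n f g c d : polyf n f -> polyf n g -> polyf n (fun x => c * f x + d * g x).
Proof.
  revert f g. induction n; simpl; intros f g Hf Hg; [intros x y; rewrite (Hf x y), (Hg x y); reflexivity|].
  intros a. destruct (Hf a) as (f1 & F1 & E1). destruct (Hg a) as (g1 & G1 & E2).
  exists (fun x => c * f1 x + d * g1 x). split; auto. intros x. rewrite (E1 x), (E2 x). ring.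
Qed.

Lemma polyf_S n f : polyf n f -> polyf (S n) f.
Proof.
  revert f. induction n; intros f H.
  - intros a. exists (fun _ => 0). split; [intros x y; auto|]. intros x. simpl in H. rewrite (H x a). ring.
  - intros a. destruct (H a) as (g & Hg & E). exists g. split; auto.
Qed.

Lemma polyf_mul_affine n f c d : polyf n f -> polyf (S n) (fun x => (c * x + d) * f x).
Proof.
  revert f. induction n; intros f H a.
  - exists (fun x => c * f x). split; [intros x y; simpl in H; rewrite (H x y); reflexivity|].
    intros x. simpl in H. rewrite (H x a). ring.
  - destruct (H a) as (g & Hg & E). exists (fun x => c * f x + 1 * ((c * a + d) * g x + 0 * g x)). split.
    + apply polyf_lin; auto. apply polyf_S. apply (polyf_lin n g g); auto.
    + intros x. rewrite (E x). ring.
Qed.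

Lemma polyf_le n m f : (n <= m)%nat -> polyf n f -> polyf m f.
Proof. induction 1; auto. intros. now apply polyf_S, IHle. Qed.

(** Dividing out the zero [INR m] leaves a quotient of lower degree that still vanishes at all later
    integers, so the degree can be exhausted. *)
Lemma polyf_zero n f m : polyf n f -> (forall k : nat, (m <= k)%nat -> f (INR k) = 0) -> forall x, f x = 0.
Proof.
  revert f m. induction n; intros f m H Z x.
  - simpl in H. rewrite (H x (INR m)). apply Z; lia.
  - destruct (H (INR m)) as (g & Hg & E). rewrite E, (Z m) by lia. rewrite (IHn g (S m)); auto; [ring|].
    intros k Hk. specialize (E (INR k)). rewrite (Z k), (Z m) in E by lia.
    assert (INR m < INR k) by (apply lt_INR; lia).
    apply Rmult_eq_reg_l with (INR k - INR m); lra.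
Qed.

Lemma polyf_gbin k c : polyf k (fun x => gbin (x + c) k).
Proof.
  revert c. induction k; intros c; [simpl; auto|].
  apply polyf_ext with (f := fun x => (/ INR (S k) * x + c / INR (S k)) * gbin (x + (c - 1)) k).
  - intros x. rewrite gbin_S. replace (x + (c - 1)) with (x + c - 1) by ring. field. apply not_0_INR; lia.
  - now apply polyf_mul_affine.
Qed.

Lemma gbin_pascal a k : gbin a (S k) = gbin (a - 1) (S k) + gbin (a - 1) k.
Proof.
  revert a. induction k; intros a; [simpl; field|].
  assert (N : INR (S (S k)) <> 0) by (apply not_0_INR; lia).
  apply Rmult_eq_reg_l with (INR (S (S k))); auto.
  rewrite Rmult_plus_distr_l, !theta_gbin.
  pose proof (IHk (a - 1)) as I1. pose proof (theta_gbin (a - 1) k) as T.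
  rewrite (S_INR (S k)), Rmult_plus_distr_r, T.
  replace (gbin (a - 1 - 1) (S k)) with (gbin (a - 1) (S k) - gbin (a - 1 - 1) k) by lra. ring.
Qed.

(* Equal to [nu / (nu + 2k) * C(nu + 2k, k)], written so that it is visibly a polynomial in [nu]. *)
Definition hagA (nu : R) (k : nat) : R := gbin (nu + 2 * INR k) k - 2 * match k with O => 0 | S j => gbin (nu + 2 * INR k - 1) j end.
Definition hagB (mu : R) (k : nat) : R := gbin (mu + 2 * INR k) k.

Lemma hagA_step nu k : hagA nu (S k) - hagA (nu - 1) (S k) = hagA (nu + 1) k.
Proof.
  unfold hagA. rewrite (gbin_pascal (nu + 2 * INR (S k)) k).
  replace (nu - 1 + 2 * INR (S k)) with (nu + 2 * INR (S k) - 1) by ring.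
  destruct k as [|k].
  - simpl. ring.
  - replace (nu + 2 * INR (S (S k)) - 1) with (nu + 1 + 2 * INR (S k)) by (rewrite !S_INR; ring).
    rewrite (gbin_pascal (nu + 1 + 2 * INR (S k)) k). ring.
Qed.

Lemma hagB_step mu k : hagB mu (S k) - hagB (mu - 1) (S k) = hagB (mu + 1) k.
Proof.
  unfold hagB. rewrite (gbin_pascal (mu + 2 * INR (S k)) k).
  replace (mu - 1 + 2 * INR (S k)) with (mu + 2 * INR (S k) - 1) by ring.
  replace (mu + 2 * INR (S k) - 1) with (mu + 1 + 2 * INR k) by (rewrite !S_INR; ring). ring.
Qed.

Lemma hagA_eq nu k : (nu + 2 * INR k) * hagA nu k = nu * hagB nu k.
Proof.
  unfold hagA, hagB. destruct k; [simpl; ring|].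
  pose proof (theta_gbin (nu + 2 * INR (S k)) k) as T.
  transitivity ((nu + 2 * INR (S k)) * gbin (nu + 2 * INR (S k)) (S k) - 2 * ((nu + 2 * INR (S k)) * gbin (nu + 2 * INR (S k) - 1) k)); [ring|].
  rewrite <- T. ring.
Qed.

Lemma hagA_0 k : hagA 0 (S k) = 0.
Proof.
  pose proof (hagA_eq 0 (S k)) as H. rewrite Rmult_0_l, Rplus_0_l in H.
  apply Rmult_eq_reg_l with (2 * INR (S k)); [rewrite H; ring|]. rewrite S_INR. pose proof (pos_INR k). lra.
Qed.

Lemma polyf_hagA k : polyf k (fun x => hagA x k).
Proof.
  destruct k.
  - unfold hagA. simpl. intros; ring.
  - apply polyf_ext with (f := fun x => 1 * gbin (x + 2 * INR (S k)) (S k) + (-2) * gbin (x + (2 * INR (S k) - 1)) k).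
    + intros x. unfold hagA. replace (x + (2 * INR (S k) - 1)) with (x + 2 * INR (S k) - 1) by ring. ring.
    + apply polyf_lin; [apply polyf_gbin | apply polyf_S, polyf_gbin].
Qed.

(** The difference [E] of the two sides is a polynomial in [nu]. The difference equations of [hagA]
    and [hagB] together with the induction hypothesis give it period 1, and it vanishes at 0, hence
    at all natural numbers, hence everywhere. *)
Lemma rothe_hagen n : forall nu mu, conv (hagA nu) (hagB mu) n = hagB (nu + mu) n.
Proof.
  induction n; intros nu mu.
  - unfold conv, hagA, hagB. simpl. ring.
  - pose (E := fun x => 1 * conv (hagA x) (hagB mu) (S n) + (-1) * hagB (x + mu) (S n)).
    assert (HP : polyf (S n) E).
    { apply polyf_lin.
      - unfold conv. assert (G : forall m, (m <= S (S n))%nat -> polyf (S n) (fun x => rsum (fun k => hagA x k * hagB mu (S n - k)) m)).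
        { induction m; intros Hm; [apply (polyf_const 0)|].
          apply polyf_ext with (f := fun x => 1 * rsum (fun k => hagA x k * hagB mu (S n - k)) m + hagB mu (S n - m) * hagA x m).
          - intros x. rewrite rsum_S. ring.
          - apply polyf_lin; [apply IHm; lia|]. apply polyf_le with m; [lia | apply polyf_hagA]. }
        apply G. lia.
      - apply polyf_ext with (f := fun x => gbin (x + (mu + 2 * INR (S n))) (S n)); [|apply polyf_gbin].
        intros x. unfold hagB. f_equal. ring. }
    assert (HS : forall x, E x = E (x - 1)).
    { intros x. unfold E. rewrite !(conv_S_l (hagA _)).
      assert (C : conv (fun k => hagA x (S k)) (hagB mu) n = conv (fun k => 1 * hagA (x - 1) (S k) + 1 * hagA (x + 1) k) (hagB mu) n).
      { apply conv_ext; auto. intros k _. rewrite <- hagA_step. ring. }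
      rewrite C, conv_lin_l, IHn. pose proof (hagB_step (x + mu) n) as B.
      replace (x - 1 + mu) with (x + mu - 1) by ring. replace (x + 1 + mu) with (x + mu + 1) by ring.
      assert (A0 : hagA x 0 = hagA (x - 1) 0) by (unfold hagA; simpl; ring). rewrite A0. lra. }
    assert (E0 : E 0 = 0).
    { unfold E. rewrite conv_S_l. rewrite (conv_ext (fun k => hagA 0 (S k)) (fun k => 0 * hagA 0 k + 0 * hagA 0 k) (hagB mu) (hagB mu)) by (auto; intros; rewrite hagA_0; ring).
      rewrite conv_lin_l, Rplus_0_l. unfold hagA at 1. simpl gbin. ring. }
    assert (HZ : forall k : nat, E (INR k) = 0).
    { induction k; [exact E0|]. rewrite HS, S_INR. replace (INR k + 1 - 1) with (INR k) by ring. exact IHk. }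
    pose proof (polyf_zero (S n) E 0 HP (fun k _ => HZ k) nu) as Z. unfold E in Z. lra.
Qed.

Open Scope C_scope.

(** * Logarithm and powers *)

Lemma Cmod_sq (z : C) : (Cmod z * Cmod z = Re z * Re z + Im z * Im z)%R.
Proof. pose proof (Cmod2_alt z). simpl in H. lra. Qed.

Lemma Arg_polar (z : C) : z <> 0 -> (cos (Arg z) = Re z / Cmod z)%R /\ (sin (Arg z) = Im z / Cmod z)%R.
Proof.
  intros Hz. apply Cmod_gt_0 in Hz. pose proof (Cmod_sq z) as S.
  pose proof (re_le_Cmod z) as B. apply Rabs_le_between in B.
  set (u := (Re z / Cmod z)%R).
  assert (Hu : (-1 <= u <= 1)%R).
  { unfold u. split; apply Rmult_le_reg_r with (Cmod z); auto; unfold Rdiv; rewrite Rmult_assoc, Rinv_l; lra. }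
  assert (Hs : (sqrt (1 - u ^ 2) = Rabs (Im z) / Cmod z)%R).
  { replace (1 - u ^ 2)%R with ((Im z / Cmod z) ^ 2)%R.
    - rewrite <- (pow2_abs (Im z / Cmod z)), sqrt_pow2 by apply Rabs_pos. unfold Rdiv. rewrite Rabs_mult, Rabs_inv, (Rabs_pos_eq (Cmod z)) by lra. reflexivity.
    - unfold u. apply Rmult_eq_reg_r with (Cmod z * Cmod z)%R; [|nra]. field_simplify; [|lra|lra]. simpl. rewrite !Rmult_1_r. lra. }
  unfold Arg. fold u. destruct (Rlt_dec (Im z) 0) as [H|H].
  - rewrite cos_neg, sin_neg, cos_acos, sin_acos by auto. unfold Rsqr. replace (1 - u * u)%R with (1 - u ^ 2)%R by ring.
    rewrite Hs. split; [reflexivity|]. rewrite Rabs_left by auto. field. lra.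
  - rewrite cos_acos, sin_acos by auto. unfold Rsqr. replace (1 - u * u)%R with (1 - u ^ 2)%R by ring.
    rewrite Hs. split; [reflexivity|]. rewrite Rabs_pos_eq by lra. reflexivity.
Qed.

Lemma Cexp_Cln (z : C) : z <> 0 -> Cexp (Cln z) = z.
Proof.
  intros Hz. destruct (Arg_polar z Hz) as [A B]. apply Cmod_gt_0 in Hz.
  unfold Cexp, Cln, Re, Im; simpl. unfold Re, Im in A, B. rewrite A, B, exp_ln by auto.
  destruct z as [x y]; simpl. f_equal; field; lra.
Qed.

Lemma Cln_scale (z : C) (t : R) : z <> 0 -> (0 < t)%R -> Cln (z * t) = Cln z + ln t.
Proof.
  intros Hz Ht. apply Cmod_gt_0 in Hz.
  assert (HM : Cmod (z * t) = (Cmod z * t)%R) by (rewrite Cmod_mult, Cmod_nonneg; lra).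
  assert (HR : Re (z * t) = (Re z * t)%R) by (unfold Re; simpl; ring).
  assert (HI : Im (z * t) = (Im z * t)%R) by (unfold Im; simpl; ring).
  unfold Cln, Arg. rewrite HM, HR, HI, ln_mult by auto.
  replace (Re z * t / (Cmod z * t))%R with (Re z / Cmod z)%R by (field; lra).
  unfold Cplus, RtoC; simpl. f_equal. rewrite Rplus_0_r.
  destruct (Rlt_dec (Im z * t) 0), (Rlt_dec (Im z) 0); auto; exfalso; nra.
Qed.

Lemma acos_pos_lt (u : R) : (0 < u <= 1)%R -> (0 <= acos u < PI / 2)%R.
Proof.
  intros Hu. split; [apply acos_bound|]. pose proof (acos_bound u) as B.
  destruct (Rlt_le_dec (acos u) (PI / 2)) as [|H]; auto. exfalso.
  pose proof (cos_acos u ltac:(lra)) as E. assert (cos (acos u) <= 0)%R by (apply cos_le_0; pose proof PI_RGT_0; lra). lra.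
Qed.

(** In the right half-plane the argument stays strictly within [PI / 2], so its double is again
    principal. This lets the powers of [z^2] in the G-function be expressed through [Cln z]. *)
Lemma Cln_sqr (z : C) : (0 < Re z)%R -> Cln (z ^ 2) = 2 * Cln z.
Proof.
  intros Hz. assert (Hz0 : z <> 0) by (intros E; rewrite E in Hz; simpl in Hz; lra).
  pose proof PI_RGT_0 as HPI.
  destruct (Arg_polar z Hz0) as [A B]. pose proof Hz0 as HM. apply Cmod_gt_0 in HM.
  pose proof (re_le_Cmod z) as RB. pose proof (Rle_abs (Re z)).
  set (a := Arg z) in *.
  assert (Hu : (0 < Re z / Cmod z <= 1)%R).
  { split; [apply Rdiv_lt_0_compat; auto|]. apply Rmult_le_reg_r with (Cmod z); auto; unfold Rdiv; rewrite Rmult_assoc, Rinv_l; lra. }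
  assert (Ha : ((Im z < 0)%R /\ (- (PI / 2) < a < 0)%R) \/ ((0 <= Im z)%R /\ (0 <= a < PI / 2)%R)).
  { unfold a, Arg. pose proof (acos_pos_lt _ Hu) as P. destruct (Rlt_dec (Im z) 0) as [H0|H0]; [left | right]; split; try lra.
    split; [lra|]. destruct (Req_dec (acos (Re z / Cmod z)) 0) as [E|E]; [|lra]. exfalso.
    assert (a = 0)%R by (unfold a, Arg; destruct (Rlt_dec (Im z) 0); lra). rewrite H1, sin_0 in B.
    assert (Im z = 0)%R by (apply Rmult_eq_reg_r with (/ Cmod z)%R; [unfold Rdiv in B; lra | apply Rinv_neq_0_compat; lra]). lra. }
  assert (HR2 : (Re (z ^ 2) / Cmod (z ^ 2) = cos (2 * a))%R).
  { rewrite cos_2a, A, B, Cmod_pow. unfold Re, Im in *; simpl. field. lra. }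
  assert (HI2 : (Im (z ^ 2) = 2 * Re z * Im z)%R) by (unfold Re, Im; simpl; ring).
  unfold Cln. fold a. apply C_eq_ReIm.
  - change (ln (Cmod (z ^ 2)%C) = 2 * ln (Cmod z) - 0 * a)%R. rewrite Cmod_pow. simpl pow. rewrite Rmult_1_r, ln_mult by auto. ring.
  - replace (Im (2 * (ln (Cmod z), a))) with (2 * a)%R by (unfold Im; simpl; ring).
    change (Arg (z ^ 2)%C = 2 * a)%R. unfold Arg. rewrite HR2, HI2. destruct Ha as [[H1 H2]|[H1 H2]].
    + destruct (Rlt_dec (2 * Re z * Im z) 0); [|exfalso; nra]. rewrite <- (cos_neg (2 * a)), acos_cos; lra.
    + destruct (Rlt_dec (2 * Re z * Im z) 0); [exfalso; nra|]. rewrite acos_cos; lra.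
Qed.

Lemma Csin_RtoC x : Csin (RtoC x) = RtoC (sin x).
Proof.
  unfold Csin, RtoC, Re, Im; simpl. unfold cosh, sinh. rewrite Ropp_0, exp_0. f_equal; field.
Qed.

(** * Bessel functions as functions of their order *)

Lemma holoD_unique f f1 f2 z : holoD f f1 z -> holoD f f2 z -> f1 z = f2 z.
Proof. intros H1 H2. now rewrite <- (cder_holoD _ _ _ H1), <- (cder_holoD _ _ _ H2). Qed.

Lemma rgam'_rec (s : C) : s <> 0 -> rgam' (s + 1) = rgam' s * / s + rgam s * (- / (s * s)).
Proof.
  intros Hs.
  assert (H1 : holoD (fun w => rgam (w + 1)) (fun w => rgam' (w + 1) * (1 + 0)) s).
  { apply (holoD_comp rgam rgam' (fun w => w + 1) (fun _ => 1 + 0)); [apply holoD_rgam|].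
    apply holoD_plus; [apply holoD_id | apply holoD_const]. }
  assert (H2 : holoD (fun w => rgam w * / w) (fun w => rgam' w * / w + rgam w * (- / (w * w))) s).
  { apply holoD_mult; [apply holoD_rgam | now apply holoD_inv]. }
  assert (H3 : holoD (fun w => rgam w * / w) (fun w => rgam' (w + 1) * (1 + 0)) s).
  { eapply holoD_ext_loc; [|exact H1]. apply Cmod_gt_0 in Hs. exists (Cmod s). split; auto. intros w Hw. split; auto.
    assert (Hw0 : w <> 0). { intros E. unfold cball in Hw. rewrite E in Hw. replace (0 - s) with (- s) in Hw by ring. rewrite Cmod_opp in Hw. lra. }
    rewrite (rgam_rec w). field. auto. }
  pose proof (holoD_unique _ _ _ _ H3 H2) as E. cbv beta in E. rewrite <- E. ring.
Qed.

Lemma c11_translate (D E : C -> Prop) f f' K a : (forall w, D w -> E (w + a)) -> c11 E f f' K ->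
  c11 D (fun w => f (w + a)) (fun w => f' (w + a)) K.
Proof.
  intros HD (H0 & H1 & H2 & H3 & H4). repeat split; auto.
  - intros w v Hw Hv. replace (v - w) with (v + a - (w + a)) by ring. auto.
  - intros w v Hw Hv. replace (v - w) with (v + a - (w + a)) by ring. auto.
Qed.

(** Once [k] exceeds [Rd + 1], each further shift divides by [w + k] of modulus at least 1. The step
    factor 9 is the 3 of the product rule times the 3 of [c11_inv] at [m = 1]; such geometric growth
    is harmless beside the factorials of the Bessel series. *)
Lemma rgam_shift_c11 (Rd : R) : (1 <= Rd)%R -> exists K, (0 <= K)%R /\ forall k : nat,
  c11 (fun w => Cmod w <= Rd)%R (fun w => rgam (w + INR k)) (fun w => rgam' (w + INR k)) (K * 9 ^ k).
Proof.
  intros HR. destruct (nfloor_ex Rd ltac:(lra)) as [n [_ Hn]]. set (k0 := S (S n)).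
  assert (Hk0 : (Rd + 1 <= INR k0)%R) by (unfold k0; rewrite !S_INR; lra).
  pose proof (pos_INR k0). destruct (rgam_c11 (Rd + INR k0) ltac:(lra)) as [K HK].
  pose proof HK as (K0 & _). exists K. split; auto.
  assert (P9 : forall k, (1 <= 9 ^ k)%R) by (intros k; apply pow_R1_Rle; lra).
  assert (HS : forall k, (k <= k0)%nat -> c11 (fun w => Cmod w <= Rd)%R (fun w => rgam (w + INR k)) (fun w => rgam' (w + INR k)) (K * 9 ^ k)).
  { intros k Hk. apply c11_sub with (D := fun w => (Cmod w <= Rd)%R) (K := K); [auto | specialize (P9 k); nra|].
    apply c11_translate with (E := fun w => (Cmod w <= Rd + INR k0)%R); auto.
    intros w Hw. eapply Rle_trans; [apply Cmod_triangle|]. rewrite Cmod_nonneg by apply pos_INR. apply le_INR in Hk. lra. }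
  induction k; [apply HS; lia|].
  destruct (le_lt_dec (S k) k0) as [Hk|Hk]; [now apply HS|].
  assert (Hkk : (k0 <= k)%nat) by lia. apply le_INR in Hkk.
  assert (HN : forall w : C, (Cmod w <= Rd)%R -> (1 <= Cmod (w + INR k))%R).
  { intros w Hw. pose proof (Cmod_triangle_inv (INR k) (- w)) as T. rewrite Cmod_opp, Cmod_nonneg in T by apply pos_INR.
    replace (INR k - - w) with (w + INR k) in T by ring. lra. }
  assert (HN0 : forall w : C, (Cmod w <= Rd)%R -> w + INR k <> 0).
  { intros w Hw. apply Cmod_gt_0. specialize (HN w Hw). lra. }
  eapply c11_ext; [| |eapply c11_sub; [intros w Hw; exact Hw | |
    apply c11_mult; [exact IHk | apply (c11_translate (fun w => Cmod w <= Rd)%R (fun w => 1 <= Cmod w)%R Cinv (fun w => - / (w * w)) (/ 1 + / 1 ^ 2 + / 1 ^ 3)%R (INR k) HN);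
      apply (c11_inv (fun w => 1 <= Cmod w)%R 1); [lra | auto]]]].
  - intros w Hw. cbv beta. rewrite (rgam_rec (w + INR k)). replace (w + INR (S k)) with (w + INR k + 1) by (rewrite S_INR, RtoC_plus; ring).
    field. auto.
  - intros w Hw. cbv beta. replace (w + INR (S k)) with (w + INR k + 1) by (rewrite S_INR, RtoC_plus; ring).
    rewrite (rgam'_rec (w + INR k)) by auto. reflexivity.
  - simpl. specialize (P9 k). rewrite !Rmult_1_r, Rinv_1. lra.
Qed.

Lemma c11_psum D (f f' : nat -> C -> C) (K : nat -> R) n : (forall k, c11 D (f k) (f' k) (K k)) ->
  c11 D (fun w => psum (fun k => f k w) n) (fun w => psum (fun k => f' k w) n) (rsum K n).
Proof.
  intros H. induction n; simpl.
  - eapply c11_sub; [intros w Hw; exact Hw | | apply (c11_const D 0)]. rewrite Cmod_0. lra.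
  - apply c11_plus; auto.
Qed.

Lemma rsum_le_Series (a : nat -> R) n : (forall k, (0 <= a k)%R) -> ex_series a -> (rsum a n <= Series a)%R.
Proof.
  intros Ha Hs. assert (E : forall n, rsum a (S n) = sum_n a n).
  { induction n0; [rewrite sum_O; simpl; ring|]. rewrite sum_Sn, <- IHn0. reflexivity. }
  apply Series_correct in Hs.
  assert (HM : forall n m, (n <= m)%nat -> (rsum a n <= rsum a m)%R).
  { intros i m Him. induction Him; [lra|]. simpl. specialize (Ha m). lra. }
  refine (is_lim_seq_le_loc (fun _ => rsum a n) (sum_n a) (Finite _) (Finite _) _ (is_lim_seq_const _) Hs).
  exists n. intros m Hm. rewrite <- E. apply HM. lia.
Qed.

Lemma c11_series D (f f' : nat -> C -> C) (K : nat -> R) : (forall k, c11 D (f k) (f' k) (K k)) -> ex_series K ->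
  c11 D (fun w => CSeries (fun k => f k w)) (fun w => CSeries (fun k => f' k w)) (Series K).
Proof.
  intros H HK. apply c11_limit with (f := fun n w => psum (fun k => f k w) n) (f' := fun n w => psum (fun k => f' k w) n).
  - intros n. eapply c11_sub; [intros w Hw; exact Hw | | apply c11_psum; exact H].
    apply rsum_le_Series; auto. intros k. apply (H k).
  - intros w Hw. apply abs_summable_cser. eapply abs_summable_le; [|exact HK]. intros k. now apply (H k).
  - intros w Hw. apply abs_summable_cser. eapply abs_summable_le; [|exact HK]. intros k. now apply (H k).
Qed.

(** The Bessel series without its power factor, in [w = (z/2)^2]. Written with [rgam] it is entire
    in the order, whereas the normalisation of [icoef] breaks down at negative integers. *)
Definition Iser (mu w : C) : C := CSeries (fun k => (w ^ k / INR (fact k)) * rgam (mu + 1 + INR k)).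
Definition Iser' (mu w : C) : C := CSeries (fun k => (w ^ k / INR (fact k)) * rgam' (mu + 1 + INR k)).

Lemma Iser_terms (mu : C) (w : C) : exists B D, (0 <= B)%R /\ (0 <= D)%R /\ forall (v : C) k, (Cmod (v - mu) <= 1)%R ->
  (Cmod ((w ^ k / INR (fact k)) * rgam (v + 1 + INR k)) <= B * (D ^ k / INR (fact k)))%R /\
  (Cmod ((w ^ k / INR (fact k)) * rgam' (v + 1 + INR k)) <= B * (D ^ k / INR (fact k)))%R.
Proof.
  set (Rd := (Cmod mu + 2)%R). assert (HR : (1 <= Rd)%R) by (unfold Rd; pose proof (Cmod_ge_0 mu); lra).
  destruct (rgam_shift_c11 Rd HR) as (K & HK0 & HK). exists K, (9 * Cmod w)%R. pose proof (Cmod_ge_0 w).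
  split; [auto|]. split; [lra|]. intros v k Hv. specialize (HK k). destruct HK as (_ & K1 & K2 & _).
  assert (Hv1 : (Cmod (v + 1) <= Rd)%R).
  { replace (v + 1) with ((v - mu) + (mu + 1)) by ring. eapply Rle_trans; [apply Cmod_triangle|].
    pose proof (Cmod_triangle mu 1) as T. rewrite Cmod_1 in T. unfold Rd. lra. }
  specialize (K1 _ Hv1). specialize (K2 _ Hv1). cbv beta in K1, K2. pose proof (INR_fact_lt_0 k).
  assert (E : Cmod (w ^ k / INR (fact k)) = (Cmod w ^ k / INR (fact k))%R).
  { rewrite Cmod_div by (apply RtoC_neq_0, INR_fact_neq_0). rewrite Cmod_pow, Cmod_nonneg by lra. reflexivity. }
  replace (K * ((9 * Cmod w) ^ k / INR (fact k)))%R with (Cmod w ^ k / INR (fact k) * (K * 9 ^ k))%R by (rewrite Rpow_mult_distr; unfold Rdiv; ring).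
  rewrite !Cmod_mult, E.
  assert (0 <= Cmod w ^ k / INR (fact k))%R by (apply Rdiv_le_0_compat; auto; apply pow_le; auto).
  split; apply Rmult_le_compat_l; auto.
Qed.

Lemma Iser_summable mu w : abs_summable (fun k => (w ^ k / INR (fact k)) * rgam (mu + 1 + INR k)) /\
  abs_summable (fun k => (w ^ k / INR (fact k)) * rgam' (mu + 1 + INR k)).
Proof.
  destruct (Iser_terms mu w) as (B & D & _ & _ & H).
  assert (Z : (Cmod (mu - mu) <= 1)%R) by (replace (mu - mu) with (RtoC 0) by ring; rewrite Cmod_0; lra).
  split; eapply abs_summable_le; try apply (ex_series_exp B D); intros k; now apply H.
Qed.

Lemma holoD_Iser mu w : holoD (fun m => Iser m w) (fun m => Iser' m w) mu.
Proof.
  set (Rd := (Cmod mu + 2)%R). assert (HR : (1 <= Rd)%R) by (unfold Rd; pose proof (Cmod_ge_0 mu); lra).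
  destruct (rgam_shift_c11 Rd HR) as (K & HK0 & HK).
  exists 1%R, (Series (fun k => 3 * Cmod (w ^ k / INR (fact k)) * (K * 9 ^ k)))%R. split; [lra|].
  apply (c11_series _ (fun k m => (w ^ k / INR (fact k)) * rgam (m + 1 + INR k)) (fun k m => (w ^ k / INR (fact k)) * rgam' (m + 1 + INR k))).
  - intros k. eapply c11_ext; [| |apply c11_mult; [apply (c11_const _ (w ^ k / INR (fact k))) |
      apply (c11_translate (cball mu 1) (fun v => Cmod v <= Rd)%R (fun w => rgam (w + INR k)) (fun w => rgam' (w + INR k)) (K * 9 ^ k)%R 1); [|apply HK]]].
    + intros v _. reflexivity.
    + intros v _. cbv beta. ring.
    + intros v Hv. unfold cball in Hv. replace (v + 1) with ((v - mu) + (mu + 1)) by ring. eapply Rle_trans; [apply Cmod_triangle|].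
      pose proof (Cmod_triangle mu 1) as T. rewrite Cmod_1 in T. unfold Rd. lra.
  - eapply ex_series_ext; [|apply (ex_series_exp (3 * K) (9 * Cmod w))]. intros k. simpl.
    rewrite Cmod_div by (apply RtoC_neq_0, INR_fact_neq_0). rewrite Cmod_pow, (Cmod_nonneg (INR _)) by apply pos_INR.
    rewrite Rpow_mult_distr. unfold Rdiv. ring.
Qed.

(** [I_mu] as a function of [l], the logarithm of [z/2]: scaling [z] becomes a translation, and
    differentiation in the order brings down the factor [l]. *)
Definition Ibes (mu l : C) : C := Cexp (mu * l) * Iser mu (Cexp (2 * l)).
Definition Ibes' (mu l : C) : C := Cexp (mu * l) * (l * Iser mu (Cexp (2 * l)) + Iser' mu (Cexp (2 * l))).

Lemma holoD_Ibes mu l : holoD (fun m => Ibes m l) (fun m => Ibes' m l) mu.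
Proof.
  eapply holoD_ext; [| |apply holoD_mult; [apply (holoD_comp Cexp Cexp (fun m => m * l) (fun m => 1 * l + m * 0)); [apply holoD_Cexp |
    apply holoD_mult; [apply holoD_id | apply holoD_const]] | apply (holoD_Iser mu (Cexp (2 * l)))]].
  - intros m. reflexivity.
  - intros m. unfold Ibes'. cbv beta. ring.
Qed.

Lemma Cexp_2Cln (z : C) : z <> 0 -> Cexp (2 * Cln (z / 2)) = (z / 2) ^ 2.
Proof.
  intros Hz. replace (2 * Cln (z / 2)) with (Cln (z / 2) + Cln (z / 2)) by ring. rewrite Cexp_plus, Cexp_Cln; [simpl; ring|].
  unfold Cdiv. apply Cmult_neq_0; auto. rewrite <- RtoC_inv by lra. apply RtoC_neq_0. lra.
Qed.

Lemma BesselI_Ibes (mu z : C) : z <> 0 -> BesselI mu z = Ibes mu (Cln (z / 2)).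
Proof.
  intros Hz. unfold BesselI, Ibes, Cpower. f_equal. rewrite Cexp_2Cln by auto.
  apply cser_CSeries. eapply cser_ext; [|apply abs_summable_cser, (proj1 (Iser_summable mu ((z / 2) ^ 2)))].
  intros k. cbv beta. rewrite Cgamma_rgam. unfold Cdiv. rewrite Cinv_total_mult, Cinv_inv_total, <- Cpow_mult_r.
  replace (mu + INR k + 1) with (mu + 1 + INR k) by ring. ring.
Qed.

Lemma BesselK_nonint_real (x : R) (z : C) : z <> 0 ->
  BesselK_nonint (RtoC x) z = (PI / 2)%R * ((Ibes (RtoC (- x)) (Cln (z / 2)) - Ibes (RtoC x) (Cln (z / 2))) / sin (PI * x)%R).
Proof.
  intros Hz. unfold BesselK_nonint. rewrite !BesselI_Ibes, <- RtoC_mult, Csin_RtoC, <- RtoC_opp by auto.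
  f_equal. unfold Cdiv, Rdiv. rewrite RtoC_mult, RtoC_inv by lra. reflexivity.
Qed.

Lemma rg_fact (k : nat) : rg (INR k + 1) = (/ INR (fact k))%R.
Proof.
  induction k; [simpl; rewrite Rplus_0_l, rg_1, Rinv_1; reflexivity|].
  pose proof (pos_INR k). pose proof (INR_fact_neq_0 k).
  rewrite S_INR. replace (fact (S k)) with (S k * fact k)%nat by reflexivity. rewrite mult_INR, S_INR, Rinv_mult, <- IHk, (rg_rec (INR k + 1)).
  field. lra.
Qed.

Lemma rgam_fact (k : nat) : rgam (INR k + 1) = / INR (fact k).
Proof. rewrite <- RtoC_plus, rgam_rg, rg_fact, RtoC_inv by apply INR_fact_neq_0. reflexivity. Qed.

Lemma Cexp_pow (a : C) (n : nat) : Cexp a ^ n = Cexp (INR n * a).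
Proof.
  induction n; [simpl; rewrite Cmult_0_l, Cexp_0; reflexivity|].
  rewrite Cpow_S, IHn, <- Cexp_plus. f_equal. rewrite S_INR, RtoC_plus. ring.
Qed.

(* [1/Gamma] vanishes at the first [n] terms, so the series at [-n] is the one at [n] shifted. *)
Lemma Ibes_opp_nat (n : nat) (l : C) : Ibes (- INR n) l = Ibes (INR n) l.
Proof.
  unfold Ibes. set (w := Cexp (2 * l)).
  set (u := fun k => (w ^ k / INR (fact k)) * rgam (- INR n + 1 + INR k)).
  assert (Hs : cser (fun k => if Nat.leb n k then u ((k - n) + n)%nat else 0) (w ^ n * Iser (INR n) w)).
  { apply (cser_pad (fun k => u (k + n)%nat)).
    eapply cser_ext; [|apply (cser_scal (w ^ n)), abs_summable_cser, (proj1 (Iser_summable (INR n) w))].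
    intros k. unfold u. cbv beta. replace (- INR n + 1 + INR (k + n)) with (INR k + 1) by (rewrite plus_INR, RtoC_plus; ring).
    replace (INR n + 1 + INR k) with (INR (k + n) + 1) by (rewrite plus_INR, RtoC_plus; ring). rewrite !rgam_fact, Cpow_add_r. unfold Cdiv. ring. }
  assert (Hu : cser u (w ^ n * Iser (INR n) w)).
  { eapply cser_ext; [|exact Hs]. intros k. cbv beta. destruct (Nat.leb_spec n k) as [H|H].
    - now replace (k - n + n)%nat with k by lia.
    - unfold u. replace (- INR n + 1 + INR k) with (- INR (n - 1 - k)).
      + rewrite rgam_pole. ring.
      + rewrite <- RtoC_opp, minus_INR, minus_INR by lia. rewrite !RtoC_opp, !RtoC_minus. simpl. ring. }
  pose proof (abs_summable_cser _ (proj1 (Iser_summable (- INR n) w))) as H2. fold (Iser (- INR n) w) in H2.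
  assert (E : Iser (- INR n) w = w ^ n * Iser (INR n) w) by exact (cser_unique _ _ _ H2 Hu).
  rewrite E, Cmult_assoc. f_equal.
  unfold w. rewrite Cexp_pow, <- Cexp_plus. f_equal. ring.
Qed.

Lemma sin_PI_shift (n : nat) (h : R) : (sin (PI * (INR n + h)) = (-1) ^ n * sin (PI * h))%R.
Proof.
  induction n; [simpl; rewrite Rplus_0_l; ring|].
  rewrite S_INR. replace (PI * (INR n + 1 + h))%R with (PI * (INR n + h) + PI)%R by ring.
  rewrite neg_sin, IHn. simpl. ring.
Qed.

(** L'Hopital's value for [K_n]: the derivative of the numerator in the order, divided by the
    derivative [(-1)^n PI] of the sine and multiplied by [PI / 2]. *)
Definition Klim (n : nat) (l : C) : C := ((-1) ^ n / 2)%R * (- Ibes' (RtoC (- INR n)) l - Ibes' (INR n) l).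

Lemma quotient_lim (f : R -> R) (x l : R) :
  (exists d K, (0 < d)%R /\ forall h, (Rabs h < d)%R -> (Rabs (f (x + h) - h * l) <= K * h ^ 2)%R) ->
  is_lim (fun y => f y / (y - x))%R x l.
Proof.
  intros (d & K & Hd & H). apply is_lim_spec. intros eps.
  pose proof (cond_pos eps) as He. pose proof (Rabs_pos K).
  assert (Hm : (0 < Rmin d (eps / (Rabs K + 1)))%R) by (apply Rmin_pos; auto; apply Rdiv_lt_0_compat; lra).
  exists (mkposreal _ Hm). intros y Hy Hne.
  change (Rabs (y - x) < Rmin d (eps / (Rabs K + 1)))%R in Hy.
  assert (H1 := H (y - x)%R (Rlt_le_trans _ _ _ Hy (Rmin_l _ _))). rewrite Rplus_minus in H1.
  assert (H2 : (Rabs (y - x) < eps / (Rabs K + 1))%R) by (eapply Rlt_le_trans; [exact Hy | apply Rmin_r]).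
  assert (Hn : (y - x <> 0)%R) by (intros E; apply Hne; lra). pose proof (Rabs_pos_lt _ Hn) as P.
  replace (f y / (y - x) - l)%R with ((f y - (y - x) * l) / (y - x))%R by (field; auto).
  unfold Rdiv. rewrite Rabs_mult, Rabs_inv.
  apply Rmult_lt_reg_r with (Rabs (y - x)); auto. rewrite Rmult_assoc, Rinv_l, Rmult_1_r by lra.
  eapply Rle_lt_trans; [exact H1|]. rewrite <- (pow2_abs (y - x)). pose proof (Rle_abs K).
  assert (Rabs (y - x) * (Rabs K + 1) < eps)%R.
  { replace (pos eps) with (eps / (Rabs K + 1) * (Rabs K + 1))%R by (field; lra). apply Rmult_lt_compat_r; lra. }
  assert (K * Rabs (y - x) < eps)%R by nra. nra.
Qed.

Lemma quotient_lim_ratio (f g : R -> R) (x lf lg : R) : lg <> 0%R ->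
  is_lim (fun y => f y / (y - x))%R x lf -> is_lim (fun y => g y / (y - x))%R x lg -> is_lim (fun y => f y / g y)%R x (lf / lg)%R.
Proof.
  intros N Hf Hg. eapply is_lim_ext_loc; [|apply (is_lim_div _ _ _ _ _ Hf Hg); [intros E; apply N; now injection E | now simpl]].
  exists (mkposreal 1 Rlt_0_1). intros y _ Hne. assert (Hn : (y - x <> 0)%R) by lra.
  unfold Rdiv. rewrite Rinv_mult, Rinv_inv. transitivity (f y * / g y * ((y - x) * / (y - x)))%R; [ring|]. rewrite Rinv_r by auto. ring.
Qed.

(** The numerator vanishes at the integer because [I_{-n} = I_n]; numerator and sine are then both
    expanded to first order with a quadratic error. *)
Lemma BesselK_nat_lim (n : nat) (z : C) : z <> 0 -> let l := Cln (z / 2) in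
  is_lim (fun x => Re (BesselK_nonint (RtoC x) z)) (INR n) (Re (Klim n l)) /\
  is_lim (fun x => Im (BesselK_nonint (RtoC x) z)) (INR n) (Im (Klim n l)).
Proof.
  intros Hz l. pose proof PI_RGT_0 as HPI.
  pose (N := fun m : C => Ibes (- m) l - Ibes m l).
  assert (HN : holoD N (fun m => - Ibes' (- m) l - Ibes' m l) (INR n)).
  { assert (H1 : holoD (fun m => Ibes (- m) l) (fun m => - Ibes' (- m) l) (INR n)).
    { eapply holoD_ext; [| |apply (holoD_comp (fun m => Ibes m l) (fun m => Ibes' m l) (fun m => - (1) * m) (fun m => 0 * m + - (1) * 1));
        [apply holoD_Ibes | apply holoD_mult; [apply holoD_const | apply holoD_id]]].
      - intros m. cbv beta. f_equal. ring.
      - intros m. cbv beta. replace (- (1) * m) with (- m) by ring. ring. }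
    eapply holoD_ext; [| |apply holoD_plus; [exact H1 | apply holoD_mult; [apply (holoD_const (- (1))) | apply (holoD_Ibes (INR n) l)]]].
    - intros m. unfold N. ring.
    - intros m. cbv beta. ring. }
  destruct (holoD_shift_taylor _ _ _ HN) as (r & K & Hr & HK & HT).
  assert (N0 : N (INR n) = 0) by (unfold N; rewrite Ibes_opp_nat; ring).
  assert (HT' : forall h : R, (Rabs h < r)%R -> (Cmod (N (RtoC (INR n + h)) - h * (- Ibes' (RtoC (- INR n)) l - Ibes' (INR n) l)) <= K * h ^ 2)%R).
  { intros h Hh. destruct (HT (RtoC h)) as [_ T]; [now rewrite Cmod_R|]. rewrite Cmod_R, pow2_abs, N0 in T.
    rewrite RtoC_plus, RtoC_opp. eapply Rle_trans; [|exact T]. right. f_equal. ring. }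
  set (D := - Ibes' (RtoC (- INR n)) l - Ibes' (INR n) l) in *.
  assert (HS : is_lim (fun y => sin (PI * y) / (y - INR n))%R (INR n) ((-1) ^ n * PI)%R).
  { apply quotient_lim. exists 1%R, (PI ^ 2)%R. split; [lra|]. intros h _. rewrite sin_PI_shift.
    replace ((-1) ^ n * sin (PI * h) - h * ((-1) ^ n * PI))%R with ((-1) ^ n * (sin (PI * h) - PI * h))%R by ring.
    rewrite Rabs_mult, pow_1_abs, Rmult_1_l. replace (PI ^ 2 * h ^ 2)%R with ((PI * h) ^ 2)%R by ring. apply sin_taylor_bound. }
  assert (Hs2 : ((-1) ^ n * (-1) ^ n = 1)%R) by (rewrite <- Rpow_mult_distr; replace (-1 * -1)%R with 1%R by ring; apply pow1).
  assert (NZ : ((-1) ^ n * PI <> 0)%R) by (apply Rmult_integral_contrapositive_currified; [apply pow_nonzero|]; lra).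
  assert (EK : forall x, BesselK_nonint (RtoC x) z = ((PI / 2 * (Re (N x) / sin (PI * x)))%R, (PI / 2 * (Im (N x) / sin (PI * x)))%R)).
  { intros x. rewrite BesselK_nonint_real by auto. fold l. rewrite RtoC_opp. change (Ibes (- x) l - Ibes x l) with (N x).
    unfold Cdiv. rewrite <- (Cinv_inv_total (sin (PI * x)%R)).
    replace (/ / / RtoC (sin (PI * x))) with (RtoC (/ sin (PI * x))).
    - destruct (N x) as [u v]. unfold Cmult, RtoC, Re, Im, Rdiv; simpl. f_equal; ring.
    - destruct (Req_dec (sin (PI * x)) 0) as [E|E]; [rewrite E, !Cinv_0, Rinv_0; reflexivity|]. rewrite Cinv_inv_total. now rewrite RtoC_inv. }
  assert (Fin : forall c, (PI / 2 * (c / ((-1) ^ n * PI)) = (-1) ^ n / 2 * c)%R).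
  { intros c. assert (Hn : ((-1) ^ n <> 0)%R) by (apply pow_nonzero; lra).
    apply Rmult_eq_reg_l with ((-1) ^ n)%R; auto. transitivity ((-1) ^ n * (-1) ^ n / 2 * c)%R; [rewrite Hs2; field; lra | field]. }
  split.
  - apply is_lim_ext with (f := fun x : R => (PI / 2 * (Re (N x) / sin (PI * x)))%R); [intros x; now rewrite EK|].
    replace (Re (Klim n l)) with (PI / 2 * (Re D / ((-1) ^ n * PI)))%R.
    + apply (is_lim_scal_l (fun x => Re (N (RtoC x)) / sin (PI * x))%R (PI / 2)%R (INR n) (Finite (Re D / ((-1) ^ n * PI)))).
      apply quotient_lim_ratio; auto. apply (quotient_lim (fun x => Re (N (RtoC x)))). exists r, K. split; auto. intros h Hh. eapply Rle_trans; [|apply (HT' h Hh)].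
      eapply Rle_trans; [|apply re_le_Cmod]. right. f_equal. unfold Re; simpl. ring.
    + rewrite Fin. unfold Klim. fold D. unfold Re; simpl. ring.
  - apply is_lim_ext with (f := fun x : R => (PI / 2 * (Im (N x) / sin (PI * x)))%R); [intros x; now rewrite EK|].
    replace (Im (Klim n l)) with (PI / 2 * (Im D / ((-1) ^ n * PI)))%R.
    + apply (is_lim_scal_l (fun x => Im (N (RtoC x)) / sin (PI * x))%R (PI / 2)%R (INR n) (Finite (Im D / ((-1) ^ n * PI)))).
      apply quotient_lim_ratio; auto. apply (quotient_lim (fun x => Im (N (RtoC x)))). exists r, K. split; auto. intros h Hh. eapply Rle_trans; [|apply (HT' h Hh)].
      eapply Rle_trans; [|apply im_le_Cmod]. right. f_equal. unfold Im; simpl. ring.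
    + rewrite Fin. unfold Klim. fold D. unfold Im; simpl. ring.
Qed.

Lemma BesselK_nat (n : nat) (z : C) : z <> 0 -> BesselK (RtoC (INR n)) z = Klim n (Cln (z / 2)).
Proof.
  intros Hz. unfold BesselK. destruct (excluded_middle_informative _) as [_|N].
  - destruct (BesselK_nat_lim n z Hz) as [A B].
    change ((real (Lim (fun x => Re (BesselK_nonint (RtoC x) z)) (INR n)), real (Lim (fun x => Im (BesselK_nonint (RtoC x) z)) (INR n))) = Klim n (Cln (z / 2))).
    rewrite (is_lim_unique _ _ _ A), (is_lim_unique _ _ _ B). now destruct (Klim n (Cln (z / 2))).
  - exfalso. apply N. exists (Z.of_nat n). now rewrite <- INR_IZR_INZ.
Qed.

Lemma BesselK_nonint_eq (nu : R) (z : C) : nonint nu -> BesselK (RtoC nu) z = BesselK_nonint (RtoC nu) z.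
Proof.
  intros NI. unfold BesselK. destruct (excluded_middle_informative _) as [[k E]|N]; [|reflexivity].
  exfalso. injection E as E. now apply (NI k).
Qed.

(** At order 0 the two derivatives in [Klim] coincide and absorb the factor 1/2. *)
Lemma BesselK_0 (z : C) : z <> 0 -> BesselK 0 z = - Ibes' 0 (Cln (z / 2)).
Proof.
  intros Hz. change (RtoC 0) with (RtoC (INR 0)). rewrite BesselK_nat by auto. unfold Klim. simpl. rewrite Ropp_0.
  replace (RtoC (1 / 2)) with (/ 2) by (rewrite <- RtoC_inv by lra; f_equal; field). field.
Qed.

Open Scope R_scope.

(** * Improper integrals over (0, PI/2) *)

(** Continuity inside the interval is part of the notion, so that every truncated integral exists;
    the two ends are approached independently, as in [is_RInt_gen]. *)
Definition oint (f : R -> C) (A : C) : Prop :=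
  (forall t, 0 < t < PI / 2 -> continuous (U := CV) f t) /\
  forall eps, 0 < eps -> exists d, 0 < d /\ forall x y, 0 < x < d -> PI / 2 - d < y < PI / 2 -> x <= y ->
    Cmod (RInt (V := CCV) f x y - A)%C <= eps.

Lemma oint_is_RInt f A x y : oint f A -> 0 < x -> x <= y -> y < PI / 2 -> is_RInt (V := CV) f x y (RInt (V := CCV) f x y).
Proof.
  intros [HC _] Hx Hxy Hy. apply (RInt_correct (V := CCV)), (ex_RInt_continuous (V := CCV)).
  rewrite Rmin_left, Rmax_right by auto. intros t Ht. apply HC. lra.
Qed.

Lemma oint_ext f g A : (forall t, 0 < t < PI / 2 -> f t = g t) -> oint f A -> oint g A.
Proof.
  intros E [HC H]. split.
  - intros t Ht. apply (continuous_ext_loc (T := R_UniformSpace) (U := CV) g f); [|now apply HC].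
    assert (Hd : 0 < Rmin t (PI / 2 - t)) by (apply Rmin_pos; lra).
    exists (mkposreal _ Hd). intros u Hu. change (Rabs (u - t) < Rmin t (PI / 2 - t)) in Hu. apply E.
    pose proof (Rmin_l t (PI / 2 - t)). pose proof (Rmin_r t (PI / 2 - t)). apply Rabs_def2 in Hu. lra.
  - intros eps He. destruct (H eps He) as (d & Hd & HD). exists d. split; auto. intros x y Hx Hy Hxy.
    rewrite <- (RInt_ext (V := CCV) f g); [now apply HD|].
    rewrite Rmin_left, Rmax_right by auto. intros t Ht. apply E. lra.
Qed.

Lemma oint_eq f A B : A = B -> oint f A -> oint f B.
Proof. now intros ->. Qed.

Lemma oint_plus f g A B : oint f A -> oint g B -> oint (fun t => f t + g t)%C (A + B)%C.
Proof.
  intros Hf Hg. pose proof Hf as [F1 F2]. pose proof Hg as [G1 G2]. split.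
  - intros t Ht. apply (continuous_plus (V := CV) f g); auto.
  - intros eps He. destruct (F2 (eps / 2) ltac:(lra)) as (d1 & Hd1 & H1). destruct (G2 (eps / 2) ltac:(lra)) as (d2 & Hd2 & H2).
    exists (Rmin d1 d2). split; [now apply Rmin_pos|]. intros x y Hx Hy Hxy.
    pose proof (Rmin_l d1 d2); pose proof (Rmin_r d1 d2).
    assert (E : RInt (V := CCV) (fun t => f t + g t)%C x y = (RInt (V := CCV) f x y + RInt (V := CCV) g x y)%C).
    { apply is_RInt_C_unique. apply (is_RInt_plus (V := CV) f g); eapply oint_is_RInt; eauto; lra. }
    rewrite E. specialize (H1 x y ltac:(lra) ltac:(lra) Hxy). specialize (H2 x y ltac:(lra) ltac:(lra) Hxy).
    replace (RInt (V := CCV) f x y + RInt (V := CCV) g x y - (A + B))%C with ((RInt (V := CCV) f x y - A) + (RInt (V := CCV) g x y - B))%C by ring.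
    eapply Rle_trans; [apply Cmod_triangle|]. lra.
Qed.

Lemma oint_scal c f A : oint f A -> oint (fun t => c * f t)%C (c * A)%C.
Proof.
  intros Hf. pose proof Hf as [F1 F2]. split.
  - intros t Ht. apply continuous_Cmult_l; auto.
  - intros eps He. pose proof (Cmod_ge_0 c). destruct (F2 (eps / (Cmod c + 1)) ltac:(apply Rdiv_lt_0_compat; lra)) as (d1 & Hd1 & H1).
    exists d1. split; auto. intros x y Hx Hy Hxy.
    assert (E : RInt (V := CCV) (fun t => c * f t)%C x y = (c * RInt (V := CCV) f x y)%C).
    { apply is_RInt_C_unique. apply is_RInt_Cmult. eapply oint_is_RInt; eauto; lra. }
    rewrite E. specialize (H1 x y Hx Hy Hxy).
    replace (c * RInt (V := CCV) f x y - c * A)%C with (c * (RInt (V := CCV) f x y - A))%C by ring. rewrite Cmod_mult.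
    apply Rle_trans with ((Cmod c + 1) * (eps / (Cmod c + 1))); [|right; field; lra].
    apply Rmult_le_compat; auto using Cmod_ge_0; lra.
Qed.

Lemma oint_zero : oint (fun _ => RtoC 0) (RtoC 0).
Proof.
  split; [intros; apply continuous_const|]. intros eps He. exists 1. split; [lra|]. intros x y _ _ _.
  replace (RInt (V := CCV) (fun _ : R => RtoC 0) x y) with (RtoC 0).
  - replace (0 - 0)%C with (RtoC 0) by ring. rewrite Cmod_0. lra.
  - symmetry. apply is_RInt_C_unique.
    pose proof (is_RInt_const (V := CV) x y (RtoC 0)) as H. rewrite scal_C_R, Cmult_0_r in H. exact H.
Qed.

Lemma oint_psum (f : nat -> R -> C) (A : nat -> C) n : (forall k, (k < n)%nat -> oint (f k) (A k)) -> oint (fun t => psum (fun k => f k t) n) (psum A n).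
Proof.
  induction n; intros H; simpl; [apply oint_zero|]. apply oint_plus; [apply IHn; intros; apply H; lia | apply H; lia].
Qed.

Lemma oint_primitive (G g : R -> R) (a b : R) :
  (forall t, 0 < t < PI / 2 -> is_derive G t (g t) /\ continuous g t) ->
  (forall eps, 0 < eps -> exists d, 0 < d /\ forall x, 0 < x < d -> x < PI / 2 -> Rabs (G x - a) <= eps) ->
  (forall eps, 0 < eps -> exists d, 0 < d /\ forall x, 0 < x -> PI / 2 - d < x < PI / 2 -> Rabs (G x - b) <= eps) ->
  oint (fun t => RtoC (g t)) (RtoC (b - a)).
Proof.
  intros HG Ha Hb. split.
  - intros t Ht. apply continuous_C. intros eps He. destruct (HG t Ht) as [_ HC].
    assert (HB : locally (g t) (fun y => Rabs (y - g t) < eps)) by (exists (mkposreal _ He); intros y Hy; exact Hy).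
    destruct (HC _ HB) as [d Hd]. exists d. split; [apply cond_pos|]. intros u Hu.
    rewrite <- RtoC_minus, Cmod_R. exact (Hd u Hu).
  - intros eps He. destruct (Ha (eps / 2) ltac:(lra)) as (d1 & Hd1 & H1). destruct (Hb (eps / 2) ltac:(lra)) as (d2 & Hd2 & H2).
    exists (Rmin d1 d2). split; [now apply Rmin_pos|]. intros x y Hx Hy Hxy.
    pose proof (Rmin_l d1 d2); pose proof (Rmin_r d1 d2).
    assert (E : RInt (V := CCV) (fun t => RtoC (g t)) x y = RtoC (G y - G x)).
    { apply is_RInt_C_unique, is_RInt_RtoC. apply (is_RInt_derive (V := R_CompleteNormedModule) G g); rewrite Rmin_left, Rmax_right by auto; intros t Ht; apply HG; lra. }
    rewrite E, <- RtoC_minus, Cmod_R. specialize (H1 x ltac:(lra) ltac:(lra)). specialize (H2 y ltac:(lra) ltac:(lra)).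
    replace (G y - G x - (b - a)) with ((G y - b) - (G x - a)) by ring.
    eapply Rle_trans; [apply Rabs_triang|]. rewrite Rabs_Ropp. lra.
Qed.

Lemma rsum_Series_lim (M : nat -> R) : ex_series M -> is_lim_seq (rsum M) (Series M).
Proof.
  intros H. apply is_lim_seq_incr_1. apply Series_correct in H.
  refine (is_lim_seq_ext _ _ (Finite _) _ H). induction n; [rewrite sum_O; simpl; ring|]. rewrite sum_Sn, IHn. reflexivity.
Qed.

Lemma cser_tail (u : nat -> C) (l : C) (M : nat -> R) (b : R) N : cser u l -> (forall n, Cmod (u n) <= M n * b) -> (forall n, 0 <= M n) -> 0 <= b -> ex_series M ->
  Cmod (l - psum u N)%C <= (Series M - rsum M N) * b.
Proof.
  intros H HB HM Hb HS.
  apply cv_Cmod_le with (u := fun m => (psum u m - psum u N)%C); [apply cv_minus; [exact H | apply cv_const]|].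
  exists N. intros m Hm.
  assert (HA : forall m, (N <= m)%nat -> Cmod (psum u m - psum u N)%C <= (rsum M m - rsum M N) * b).
  { intros p Hp. induction Hp.
    - replace (psum u N - psum u N)%C with (RtoC 0) by ring. rewrite Cmod_0. lra.
    - simpl. replace (psum u m0 + u m0 - psum u N)%C with ((psum u m0 - psum u N) + u m0)%C by ring.
      eapply Rle_trans; [apply Cmod_triangle|]. specialize (HB m0). lra. }
  eapply Rle_trans; [apply HA, Hm|]. apply Rmult_le_compat_r; auto.
  pose proof (rsum_le_Series M m HM HS). lra.
Qed.

(* Dominated termwise integration; the dominating function is given through a bounded primitive. *)
Lemma oint_series (f : R -> C) (a : nat -> R -> C) (A : nat -> C) (M : nat -> R) (Phi phi : R -> R) (B : R) :
  (forall n, oint (a n) (A n)) ->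
  (forall t, 0 < t < PI / 2 -> cser (fun n => a n t) (f t)) ->
  (forall t n, 0 < t < PI / 2 -> Cmod (a n t) <= M n * phi t) ->
  (forall n, 0 <= M n) -> ex_series M ->
  (forall t, 0 < t < PI / 2 -> is_derive Phi t (phi t) /\ continuous phi t /\ Rabs (Phi t) <= B /\ 0 <= phi t) ->
  forall S, cser A S -> oint f S.
Proof.
  intros Ha Hf HM M0 MS HP S HS.
  set (T := fun N => Series M - rsum M N).
  assert (HT0 : forall N, 0 <= T N) by (intros N; pose proof (rsum_le_Series M N M0 MS); unfold T; lra).
  assert (HTl : is_lim_seq T 0).
  { apply is_lim_seq_eq with (Series M - Series M)%R; [ring|]. apply is_lim_seq_minus'; [apply is_lim_seq_const | now apply rsum_Series_lim]. }
  pose proof PI_RGT_0 as HPI.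
  assert (B0 : 0 <= B).
  { destruct (HP (PI / 4) ltac:(lra)) as (_ & _ & H & _). pose proof (Rabs_pos (Phi (PI / 4))). lra. }
  assert (HTail : forall t N, 0 < t < PI / 2 -> Cmod (f t - psum (fun n => a n t) N)%C <= T N * phi t).
  { intros t N Ht. apply cser_tail; auto. now apply HP. }
  assert (HSmall : forall eps, 0 < eps -> exists N, T N < eps /\ Cmod (psum A N - S)%C < eps).
  { intros eps He. apply is_lim_seq_spec in HTl. destruct (HTl (mkposreal _ He)) as [N1 H1].
    apply cv_Cmod in HS. apply is_lim_seq_spec in HS. destruct (HS (mkposreal _ He)) as [N2 H2].
    exists (N1 + N2)%nat. specialize (H1 (N1 + N2)%nat ltac:(lia)). specialize (H2 (N1 + N2)%nat ltac:(lia)). simpl in H1, H2.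
    rewrite Rminus_0_r in H1, H2. rewrite Rabs_pos_eq in H1 by auto. rewrite Rabs_pos_eq in H2 by apply Cmod_ge_0. auto. }
  assert (HPs : forall N, oint (fun t => psum (fun n => a n t) N) (psum A N)) by (intros; apply oint_psum; auto).
  assert (HC : forall t, 0 < t < PI / 2 -> continuous (U := CV) f t).
  { intros t Ht. apply continuous_C. intros eps He. destruct (HP t Ht) as (_ & Hphi & _ & P0).
    assert (HB : locally (phi t) (fun y => Rabs (y - phi t) < 1)) by (exists (mkposreal _ Rlt_0_1); intros y Hy; exact Hy).
    destruct (Hphi _ HB) as [d1 Hd1].
    (* Near [t] the majorant [phi] stays below [phi t + 1], so the tail is small locally uniformly
       and continuity passes to the sum. *)
    destruct (HSmall (eps / (3 * (phi t + 1))) ltac:(apply Rdiv_lt_0_compat; lra)) as (N & HN & _).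
    destruct (HPs N) as [HPc _]. specialize (HPc t Ht).
    assert (HB2 : locally (T := CV) (psum (fun n => a n t) N) (fun y => (Cmod (y - psum (fun n => a n t) N)%C < eps / 3))).
    { assert (He' : 0 < eps / 6) by lra. exists (mkposreal _ He'). intros y [U1 U2]. eapply Rle_lt_trans; [apply Cmod_le_Re_Im|].
      unfold ball in U1, U2; simpl in U1, U2. unfold AbsRing_ball, abs, minus, plus, opp in U1, U2; simpl in U1, U2. unfold Re, Im; simpl. lra. }
    destruct (HPc _ HB2) as [d2 Hd2].
    pose proof (cond_pos d1). pose proof (cond_pos d2).
    exists (Rmin (Rmin d1 d2) (Rmin t (PI / 2 - t))). split; [repeat apply Rmin_pos; lra|]. intros u Hu.
    assert (u1 : Rabs (u - t) < d1) by (eapply Rlt_le_trans; [exact Hu|]; eapply Rle_trans; apply Rmin_l).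
    assert (u2 : Rabs (u - t) < d2) by (eapply Rlt_le_trans; [exact Hu|]; eapply Rle_trans; [apply Rmin_l | apply Rmin_r]).
    assert (u3 : Rabs (u - t) < t) by (eapply Rlt_le_trans; [exact Hu|]; eapply Rle_trans; [apply Rmin_r | apply Rmin_l]).
    assert (u4 : Rabs (u - t) < PI / 2 - t) by (eapply Rlt_le_trans; [exact Hu|]; eapply Rle_trans; [apply Rmin_r | apply Rmin_r]).
    assert (Hu' : 0 < u < PI / 2) by (apply Rabs_def2 in u3; apply Rabs_def2 in u4; lra).
    specialize (Hd1 u u1). specialize (Hd2 u u2). simpl in Hd2. cbv beta in Hd1. apply Rabs_def2 in Hd1.
    pose proof (HTail u N Hu') as K1. pose proof (HTail t N Ht) as K2.
    destruct (HP u Hu') as (_ & _ & _ & Pu).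
    assert (Q : T N * (phi t + 1) < eps / 3).
    { replace (eps / 3) with (eps / (3 * (phi t + 1)) * (phi t + 1)) by (field; lra). apply Rmult_lt_compat_r; lra. }
    assert (T N * phi u <= T N * (phi t + 1)) by (apply Rmult_le_compat_l; auto; lra).
    assert (T N * phi t <= T N * (phi t + 1)) by (apply Rmult_le_compat_l; auto; lra).
    replace (f u - f t)%C with ((f u - psum (fun n => a n u) N) + (psum (fun n => a n u) N - psum (fun n => a n t) N) - (f t - psum (fun n => a n t) N))%C by ring.
    eapply Rle_lt_trans; [apply Cmod_triangle_minus|]. eapply Rle_lt_trans; [apply Rplus_le_compat_r, Cmod_triangle|]. lra. }
  split; [exact HC|]. intros eps He.
  destruct (HSmall (eps / (4 * (B + 1))) ltac:(apply Rdiv_lt_0_compat; lra)) as (N & HN1 & HN2).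
  assert (He2 : 0 < eps / 4) by lra.
  destruct (HPs N) as [_ HPi]. destruct (HPi _ He2) as (d & Hd & HD). exists d. split; auto. intros x y Hx Hy Hxy.
  assert (If : is_RInt (V := CV) f x y (RInt (V := CCV) f x y)).
  { apply (RInt_correct (V := CCV)), (ex_RInt_continuous (V := CCV)). rewrite Rmin_left, Rmax_right by auto. intros t Ht. apply HC. lra. }
  assert (Ip := oint_is_RInt _ _ x y (HPs N) ltac:(lra) Hxy ltac:(lra)).
  assert (Iphi : is_RInt phi x y (Phi y - Phi x)).
  { apply (is_RInt_derive (V := R_CompleteNormedModule) Phi phi); rewrite Rmin_left, Rmax_right by auto; intros t Ht; apply HP; lra. }
  pose proof (is_RInt_C_le _ (fun t => T N * phi t) x y _ _ Hxy ltac:(intros t Ht; apply (HTail t N); lra) (is_RInt_minus (V := CV) _ _ _ _ _ _ If Ip)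
    (is_RInt_scal (V := R_NormedModule) _ _ _ (T N) _ Iphi)) as LE.
  change (Cmod (RInt (V := CCV) f x y - RInt (V := CCV) (fun t => psum (fun n => a n t) N) x y)%C <= T N * (Phi y - Phi x)) in LE.
  specialize (HD x y Hx Hy Hxy).
  (* [Phi] stays within [B] on the whole interval, so the integral of [phi] is at most [2 B]
     wherever it is truncated. *)
  assert (L2 : T N * (Phi y - Phi x) <= eps / (4 * (B + 1)) * (2 * B)).
  { destruct (HP x ltac:(lra)) as (_ & _ & X1 & _). destruct (HP y ltac:(lra)) as (_ & _ & X2 & _).
    apply Rabs_le_between in X1, X2.
    destruct (Rle_dec 0 (Phi y - Phi x)).
    - apply Rmult_le_compat; auto; lra.
    - apply Rle_trans with 0; [specialize (HT0 N); nra|]. apply Rmult_le_pos; [left; apply Rdiv_lt_0_compat|]; lra. }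
  assert (L3 : eps / (4 * (B + 1)) * (2 * B) <= eps / 2).
  { apply Rle_trans with (eps / (4 * (B + 1)) * (2 * (B + 1))); [|right; field; lra].
    apply Rmult_le_compat_l; [left; apply Rdiv_lt_0_compat|]; lra. }
  assert (L4 : eps / (4 * (B + 1)) <= eps / 4).
  { apply Rmult_le_compat_l; [lra|]. apply Rinv_le_contravar; lra. }
  set (If' := RInt (V := CCV) f x y) in *. set (Ip' := RInt (V := CCV) (fun t => psum (fun n => a n t) N) x y) in *.
  replace (If' - S)%C with ((If' - Ip') + (Ip' - psum A N) + (psum A N - S))%C by ring.
  eapply Rle_trans; [apply Cmod_triangle|]. eapply Rle_trans; [apply Rplus_le_compat_r, Cmod_triangle|]. lra.
Qed.

Lemma oint_is_RInt_gen f A : oint f A -> is_RInt_gen (V := CV) f (at_right 0) (at_left (PI / 2)) A.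
Proof.
  intros Hf P [eps HP]. pose proof Hf as [_ H]. pose proof PI_RGT_0.
  assert (He : 0 < eps / 2) by (pose proof (cond_pos eps); lra).
  destruct (H _ He) as (d & Hd & HD).
  assert (Hm : 0 < Rmin d (PI / 4)) by (apply Rmin_pos; lra).
  pose proof (Rmin_l d (PI / 4)); pose proof (Rmin_r d (PI / 4)).
  apply (Filter_prod _ _ _ (fun x => 0 < x < Rmin d (PI / 4)) (fun y => PI / 2 - Rmin d (PI / 4) < y < PI / 2)).
  - exists (mkposreal _ Hm). intros x Hx Hx0. change (Rabs (x - 0) < Rmin d (PI / 4)) in Hx. apply Rabs_def2 in Hx. lra.
  - exists (mkposreal _ Hm). intros y Hy Hy0. change (Rabs (y - PI / 2) < Rmin d (PI / 4)) in Hy. apply Rabs_def2 in Hy. lra.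
  - intros x y Hx Hy. simpl. exists (RInt (V := CCV) f x y). split; [eapply oint_is_RInt; eauto; lra|].
    apply HP. specialize (HD x y ltac:(lra) ltac:(lra) ltac:(lra)).
    assert (HF : Cmod (RInt (V := CCV) f x y - A)%C < eps) by (pose proof (cond_pos eps); lra).
    split; (eapply Rle_lt_trans; [|exact HF]); [apply (re_le_Cmod (RInt (V := CCV) f x y - A)%C) | apply (im_le_Cmod (RInt (V := CCV) f x y - A)%C)].
Qed.

(** * Logarithmic beta integrals *)

Definition lc (t : R) : R := ln (cos t ^ 2).
Definition ls (t : R) : R := ln (sin t ^ 2).

(** The exponential is [cos t ^ (2 a)] with a real exponent. Substituting [u = sin t ^ 2] shows the
    integral to be half of the Beta function at [(m + 1, a)], which is [mv m a]. *)
Definition mf (m : nat) (a t : R) : R := tan t * (sin t ^ 2) ^ m * exp (a * lc t).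
Definition mv (m : nat) (a : R) : R := / 2 * INR (fact m) / rpoch a (S m).

Lemma trig_pos t : 0 < t < PI / 2 -> 0 < sin t /\ 0 < cos t /\ sin t < 1 /\ cos t < 1 /\ sin t * sin t + cos t * cos t = 1.
Proof.
  intros Ht. pose proof PI_RGT_0. assert (S := sin_gt_0 t ltac:(lra) ltac:(lra)). assert (C := cos_gt_0 t ltac:(lra) ltac:(lra)).
  pose proof (sin2_cos2 t) as E. unfold Rsqr in E. repeat split; auto; nra.
Qed.

Lemma lc_neg t : 0 < t < PI / 2 -> lc t < 0.
Proof.
  intros Ht. destruct (trig_pos t Ht) as (S & C & S1 & C1 & E). unfold lc. rewrite <- ln_1. apply ln_increasing; simpl; nra.
Qed.

Lemma ls_neg t : 0 < t < PI / 2 -> ls t < 0.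
Proof.
  intros Ht. destruct (trig_pos t Ht) as (S & C & S1 & C1 & E). unfold ls. rewrite <- ln_1. apply ln_increasing; simpl; nra.
Qed.

Lemma exp_lc t : 0 < t < PI / 2 -> exp (lc t) = cos t ^ 2.
Proof. intros Ht. destruct (trig_pos t Ht) as (S & C & _). unfold lc. apply exp_ln. simpl; nra. Qed.

Lemma exp_ls t : 0 < t < PI / 2 -> exp (ls t) = sin t ^ 2.
Proof. intros Ht. destruct (trig_pos t Ht) as (S & C & _). unfold ls. apply exp_ln. simpl; nra. Qed.

Lemma is_derive_lc t : 0 < t < PI / 2 -> is_derive lc t (- 2 * tan t).
Proof.
  intros Ht. destruct (trig_pos t Ht) as (S & C & _). unfold lc, tan. auto_derive; [simpl; nra|]. simpl. field. lra.
Qed.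

Lemma is_derive_ls t : 0 < t < PI / 2 -> is_derive ls t (2 * cos t / sin t).
Proof.
  intros Ht. destruct (trig_pos t Ht) as (S & C & _). unfold ls. auto_derive; [simpl; nra|]. simpl. field. lra.
Qed.

Lemma is_derive_exp_lc a t : 0 < t < PI / 2 -> is_derive (fun t => exp (a * lc t)) t (- 2 * a * (tan t * exp (a * lc t))).
Proof.
  intros Ht. pose proof (is_derive_lc t Ht) as D.
  replace (- 2 * a * (tan t * exp (a * lc t))) with (scal (a * (- 2 * tan t)) (exp (a * lc t))) by (unfold scal; simpl; unfold mult; simpl; ring).
  apply (is_derive_comp exp (fun t => a * lc t)); [apply is_derive_exp|]. apply is_derive_scal. exact D.
Qed.

Lemma continuous_tan_exp_lc a t : 0 < t < PI / 2 -> continuous (fun t => tan t * exp (a * lc t)) t.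
Proof.
  intros Ht. destruct (trig_pos t Ht) as (S & C & _).
  apply (continuous_mult (K := R_AbsRing) tan (fun t => exp (a * lc t))).
  - apply (ex_derive_continuous tan). unfold tan. auto_derive. lra.
  - apply (ex_derive_continuous (fun t => exp (a * lc t))). eexists. now apply is_derive_exp_lc.
Qed.

Lemma exp_lc_left a eps : 0 < eps -> exists d, 0 < d /\ forall x, 0 < x < d -> x < PI / 2 -> Rabs (exp (a * lc x) - 1) <= eps.
Proof.
  intros He. assert (HC : continuous (fun x => exp (a * lc x)) 0).
  { apply (ex_derive_continuous (fun x => exp (a * lc x))). unfold lc. auto_derive. rewrite cos_0. simpl. lra. }
  assert (E0 : exp (a * lc 0) = 1) by (unfold lc; rewrite cos_0; replace (1 ^ 2) with 1 by ring; rewrite ln_1, Rmult_0_r; apply exp_0).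
  assert (HB : locally (exp (a * lc 0)) (fun y => Rabs (y - 1) < eps)).
  { rewrite E0. exists (mkposreal _ He). intros y Hy. exact Hy. }
  destruct (HC _ HB) as [d Hd]. exists d. split; [apply cond_pos|]. intros x Hx _. left. apply Hd.
  change (Rabs (x - 0) < d). rewrite Rminus_0_r, Rabs_pos_eq; lra.
Qed.

Lemma exp_lc_right a eps : 0 < a -> 0 < eps -> exists d, 0 < d /\ forall x, 0 < x -> PI / 2 - d < x < PI / 2 -> exp (a * lc x) <= eps.
Proof.
  intros Ha He. set (d := exp (ln eps / (2 * a))). exists d. split; [apply exp_pos|]. intros x Hx Hxd.
  destruct (trig_pos x ltac:(lra)) as (S & C & _).
  assert (Hc : cos x <= d).
  { rewrite <- (sin_shift x). pose proof (sin_abs_le (PI / 2 - x)) as SA. rewrite (Rabs_pos_eq (PI / 2 - x)) in SA by lra.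
    pose proof (Rle_abs (sin (PI / 2 - x))). lra. }
  assert (HL : lc x <= 2 * (ln eps / (2 * a))).
  { unfold lc. simpl. rewrite Rmult_1_r, ln_mult by auto.
    assert (ln (cos x) <= ln eps / (2 * a)); [|lra]. rewrite <- (ln_exp (ln eps / (2 * a))). fold d.
    destruct Hc as [Hc|Hc]; [left; now apply ln_increasing | rewrite Hc; lra]. }
  assert (HA : a * lc x <= ln eps).
  { replace (ln eps) with (a * (2 * (ln eps / (2 * a)))) by (field; lra). apply Rmult_le_compat_l; lra. }
  rewrite <- (exp_ln eps) by auto. destruct HA as [HA|HA]; [left; now apply exp_increasing | rewrite HA; lra].
Qed.

Lemma oint_mf0 a : 0 < a -> oint (fun t => RtoC (mf 0 a t)) (RtoC (mv 0 a)).
Proof.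
  intros Ha. replace (mv 0 a) with (0 - (- / (2 * a))) by (unfold mv; simpl; field; lra).
  apply oint_ext with (f := fun t => RtoC (tan t * exp (a * lc t))); [intros t _; f_equal; unfold mf; simpl; ring|].
  apply (oint_primitive (fun t => - / (2 * a) * exp (a * lc t))).
  - intros t Ht. split; [|now apply continuous_tan_exp_lc].
    replace (tan t * exp (a * lc t)) with (- / (2 * a) * (- 2 * a * (tan t * exp (a * lc t)))) by (field; lra).
    apply is_derive_scal. now apply is_derive_exp_lc.
  - intros eps He. destruct (exp_lc_left a (eps * (2 * a)) ltac:(nra)) as (d & Hd & H). exists d. split; auto. intros x Hx Hx2.
    replace (- / (2 * a) * exp (a * lc x) - - / (2 * a)) with (- / (2 * a) * (exp (a * lc x) - 1)) by ring.
    rewrite Rabs_mult, Rabs_Ropp, (Rabs_pos_eq (/ (2 * a))) by (left; apply Rinv_0_lt_compat; lra).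
    apply Rmult_le_reg_l with (2 * a); [lra|]. rewrite <- Rmult_assoc, Rinv_r, Rmult_1_l by lra. specialize (H x Hx Hx2). lra.
  - intros eps He. destruct (exp_lc_right a (eps * (2 * a)) Ha ltac:(nra)) as (d & Hd & H). exists d. split; auto. intros x Hx Hx2.
    replace (- / (2 * a) * exp (a * lc x) - 0) with (- / (2 * a) * exp (a * lc x)) by ring.
    rewrite Rabs_mult, Rabs_Ropp, (Rabs_pos_eq (/ (2 * a))), (Rabs_pos_eq (exp _)) by (left; apply exp_pos || (apply Rinv_0_lt_compat; lra)).
    apply Rmult_le_reg_l with (2 * a); [lra|]. rewrite <- Rmult_assoc, Rinv_r, Rmult_1_l by lra. specialize (H x Hx Hx2). lra.
Qed.

(** Replacing one [sin t ^ 2] by [1 - cos t ^ 2] trades [m] for [a], so only the case [m = 0] has to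
    be integrated, both with and without the logarithm. *)
Lemma mf_step m a t : 0 < t < PI / 2 -> mf (S m) a t = mf m a t - mf m (a + 1) t.
Proof.
  intros Ht. destruct (trig_pos t Ht) as (_ & _ & _ & _ & E).
  unfold mf. replace ((a + 1) * lc t) with (a * lc t + lc t) by ring. rewrite exp_plus, exp_lc by auto.
  change ((sin t ^ 2) ^ S m) with (sin t ^ 2 * (sin t ^ 2) ^ m).
  replace (sin t ^ 2) with (1 - cos t ^ 2) at 1 by (simpl; lra). ring.
Qed.

Lemma mv_step m a : 0 < a -> mv (S m) a = mv m a - mv m (a + 1).
Proof.
  intros Ha. unfold mv. replace (fact (S m)) with (S m * fact m)%nat by reflexivity. rewrite mult_INR.
  rewrite (rpoch_S a (S m)). pose proof (rpoch_shift a (S m)) as E. rewrite rpoch_S in E.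
  pose proof (pos_INR m). assert (P1 := rpoch_pos a (S m) Ha). assert (P2 := rpoch_pos (a + 1) (S m) ltac:(lra)).
  rewrite !S_INR in *.
  replace (rpoch (a + 1) (S m)) with (rpoch a (S m) * (a + (INR m + 1)) / a) by (rewrite E; field; lra).
  field. repeat split; lra.
Qed.

Lemma oint_mf m a : 0 < a -> oint (fun t => RtoC (mf m a t)) (RtoC (mv m a)).
Proof.
  revert a. induction m; intros a Ha; [now apply oint_mf0|].
  rewrite mv_step by auto.
  apply oint_ext with (f := fun t => (RtoC (mf m a t) + - (1) * RtoC (mf m (a + 1) t))%C).
  - intros t Ht. rewrite mf_step by auto. rewrite RtoC_minus. ring.
  - apply oint_eq with (mv m a + - (1) * mv m (a + 1))%C; [rewrite RtoC_minus; ring|].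
    apply oint_plus; [now apply IHm | apply oint_scal, IHm; lra].
Qed.

Lemma psum_RtoC (u : nat -> R) n : psum (fun k => RtoC (u k)) n = RtoC (rsum u n).
Proof. induction n; [reflexivity|]. simpl. now rewrite IHn, RtoC_plus. Qed.

(** The remainder has the derivative [- u^N / (1 - u)], so by the mean value theorem it is at most a
    multiple of [t^N]. *)
Lemma ln_series (t : R) : 0 < t < 1 -> cser (fun n => RtoC (- (t ^ S n / INR (S n)))) (RtoC (ln (1 - t))).
Proof.
  intros Ht.
  assert (HB : forall N, Rabs (ln (1 - t) - rsum (fun n => - (t ^ S n / INR (S n))) N) <= t ^ N * (t / (1 - t))).
  { intros N. pose (g := fun u => ln (1 - u) - rsum (fun n => - (u ^ S n / INR (S n))) N).
    pose (g' := fun u => - u ^ N / (1 - u)).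
    assert (HD : forall u, 0 <= u <= t -> is_derive g u (g' u)).
    { intros u Hu. assert (HR : forall M, is_derive (fun u => rsum (fun n => - (u ^ S n / INR (S n))) M) u (- rsum (fun n => u ^ n) M)).
      { induction M; [simpl; rewrite Ropp_0; apply (is_derive_const (K := R_AbsRing) (V := R_NormedModule))|].
        replace (- rsum (fun n => u ^ n) (S M)) with (plus (- rsum (fun n => u ^ n) M) (- u ^ M)) by (unfold plus; simpl; ring).
        apply (is_derive_plus (fun u => rsum (fun n => - (u ^ S n / INR (S n))) M) (fun u => - (u ^ S M / INR (S M)))); [exact IHM|].
        assert (INR (S M) <> 0) by (apply not_0_INR; lia). auto_derive; auto. simpl Init.Nat.pred. fold (INR (S M)). field. auto. }
      assert (HG : rsum (fun n => u ^ n) N * (1 - u) = 1 - u ^ N).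
      { clear. induction N; [simpl; ring|]. simpl rsum. rewrite Rmult_plus_distr_r, IHN. simpl. ring. }
      replace (g' u) with (minus (- / (1 - u)) (- rsum (fun n => u ^ n) N)).
      - apply (is_derive_minus (fun u => ln (1 - u))); [|apply HR]. auto_derive; [lra|]. field. lra.
      - unfold g', minus, plus, opp; simpl. apply Rmult_eq_reg_r with (1 - u); [|lra].
        replace ((- / (1 - u) + - - rsum (fun n => u ^ n) N) * (1 - u)) with (-1 + rsum (fun n => u ^ n) N * (1 - u)) by (field; lra). rewrite HG. field. lra. }
    destruct (MVT_gen g 0 t g') as [c [Hc E]].
    - intros x Hx. rewrite Rmin_left, Rmax_right in Hx by lra. apply HD. lra.
    - intros x Hx. rewrite Rmin_left, Rmax_right in Hx by lra. apply continuity_pt_filterlim.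
      apply (ex_derive_continuous g). eexists. apply HD. lra.
    - rewrite Rmin_left, Rmax_right in Hc by lra.
      assert (G0 : g 0 = 0).
      { unfold g. rewrite Rminus_0_r, ln_1.
        assert (Z : forall M, rsum (fun n => - (0 ^ S n / INR (S n))) M = 0).
        { induction M; [reflexivity|]. rewrite rsum_S, IHM, pow_i by lia. unfold Rdiv. ring. }
        rewrite Z. ring. }
      rewrite G0, !Rminus_0_r in E. fold (g t). rewrite E. unfold g'.
      rewrite Rabs_mult, (Rabs_pos_eq t) by lra. unfold Rdiv. rewrite Rabs_mult, Rabs_Ropp, Rabs_inv, (Rabs_pos_eq (1 - c)), (Rabs_pos_eq (c ^ N)) by (try apply pow_le; lra).
      assert (c ^ N <= t ^ N) by (apply pow_incr; lra). assert (0 <= c ^ N) by (apply pow_le; lra).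
      assert (/ (1 - c) <= / (1 - t)) by (apply Rinv_le_contravar; lra). assert (0 < / (1 - c)) by (apply Rinv_0_lt_compat; lra).
      rewrite (Rmult_comm t (/ _)), <- Rmult_assoc. apply Rmult_le_compat_r; [lra|]. apply Rmult_le_compat; lra. }
  apply cv_squeeze with (a := fun N => t ^ N * (t / (1 - t))).
  - intros N. rewrite psum_RtoC.
    rewrite <- RtoC_minus, Cmod_R, Rabs_minus_sym. apply HB.
  - apply is_lim_seq_eq with (0 * (t / (1 - t))); [ring|]. apply is_lim_seq_mult'; [|apply is_lim_seq_const].
    apply is_lim_seq_geom. rewrite Rabs_pos_eq; lra.
Qed.

(** At [t = cos^2] this gains a factor [m^(-1/2)] at the price of [1 / sin], which the tangent pays
    for: the logarithmic series becomes dominated by the summable [m^(-3/2)]. *)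
Lemma pow_sqrt_bound (t : R) (m : nat) : 0 <= t <= 1 -> t ^ m * (sqrt (INR m) * sqrt (1 - t)) <= 1.
Proof.
  intros Ht. assert (H : INR m * t ^ m * (1 - t) <= 1).
  { assert (HG : INR m * t ^ m * (1 - t) <= 1 - t ^ m).
    { induction m; [simpl; lra|]. rewrite S_INR. simpl pow. set (p := t ^ m) in *. assert (0 <= p) by (apply pow_le; lra).
      assert (p <= 1) by (unfold p; rewrite <- (pow1 m); apply pow_incr; lra).
      replace ((INR m + 1) * (t * p) * (1 - t)) with (t * (INR m * p * (1 - t)) + t * p * (1 - t)) by ring.
      assert (t * (INR m * p * (1 - t)) <= t * (1 - p)) by (apply Rmult_le_compat_l; lra).
      assert (t * p * (1 - t) <= 1 * (1 - t)) by (apply Rmult_le_compat_r; nra). lra. }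
    assert (0 <= t ^ m) by (apply pow_le; lra). lra. }
  rewrite <- sqrt_mult by (try apply pos_INR; lra). pose proof (pos_INR m). assert (0 <= t ^ m) by (apply pow_le; lra).
  assert (t ^ m <= 1) by (rewrite <- (pow1 m); apply pow_incr; lra).
  rewrite <- (sqrt_pow2 (t ^ m)) by auto. rewrite <- sqrt_mult by nra.
  apply Rle_trans with (sqrt 1); [apply sqrt_le_1_alt | rewrite sqrt_1; lra].
  set (p := t ^ m) in *. replace (p ^ 2 * (INR m * (1 - t))) with (p * (INR m * p * (1 - t))) by ring.
  apply Rle_trans with (p * 1); [apply Rmult_le_compat_l|]; lra.
Qed.

(** Compared with a telescoping series: [1 / sqrt m - 1 / sqrt (m + 1)] has the order [m^(-3/2)],
    and the factor 4 covers every [m >= 1]. *)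
Lemma ex_series_three_halves : ex_series (fun n => / (INR (S n) * sqrt (INR (S n)))).
Proof.
  apply (ex_series_le (K := R_AbsRing) (V := R_CompleteNormedModule)) with (b := fun n => 4 * (/ sqrt (INR (S n)) - / sqrt (INR (S (S n))))).
  - intros n. set (m := INR (S n)). assert (Hm : 1 <= m) by (unfold m; rewrite S_INR; pose proof (pos_INR n); lra).
    replace (INR (S (S n))) with (m + 1) by (unfold m; rewrite (S_INR (S n)); reflexivity).
    assert (X2 := sqrt_sqrt m ltac:(lra)). assert (Y2 := sqrt_sqrt (m + 1) ltac:(lra)).
    assert (X1 : 1 <= sqrt m) by (rewrite <- sqrt_1; apply sqrt_le_1_alt; lra). assert (Y1 : sqrt m < sqrt (m + 1)) by (apply sqrt_lt_1_alt; lra).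
    set (x := sqrt m) in *. set (y := sqrt (m + 1)) in *.
    assert (P : 0 < m * x) by nra.
    change (Rabs (/ (m * x)) <= 4 * (/ x - / y)). rewrite Rabs_pos_eq by (left; now apply Rinv_0_lt_compat).
    rewrite <- X2. replace (/ x - / y) with (/ (x * y * (x + y))).
    + replace (4 * / (x * y * (x + y))) with (/ (x * y * (x + y) / 4)) by (field; repeat split; nra).
      apply Rinv_le_contravar; [nra|]. assert (y * (x + y) <= 4 * (x * x)) by nra.
      replace (x * x * x) with (x * (x * x)) by ring. assert (x * (y * (x + y)) <= x * (4 * (x * x))) by (apply Rmult_le_compat_l; lra). lra.
    + assert (E : (y - x) * (x + y) = 1) by nra. apply Rmult_eq_reg_r with (x * y * (x + y)); [|nra]. rewrite Rinv_l by nra.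
      replace ((/ x - / y) * (x * y * (x + y))) with ((y - x) * (x + y)) by (field; split; nra). lra.
  - apply (ex_series_scal_l (K := R_AbsRing) (V := R_NormedModule) 4 (fun n => / sqrt (INR (S n)) - / sqrt (INR (S (S n))))).
    exists 1. apply (is_lim_seq_ext (fun n => 1 - / sqrt (INR (S (S n)))) _ (Finite 1)).
    + induction n; [rewrite sum_O; simpl INR; rewrite sqrt_1, Rinv_1; reflexivity|]. rewrite sum_Sn, <- IHn. change (plus ?a ?b) with (a + b). ring.
    + apply is_lim_seq_eq with (1 - 0); [ring|]. apply is_lim_seq_minus'; [apply is_lim_seq_const|].
      apply (is_lim_seq_inv (fun n => sqrt (INR (S (S n)))) p_infty); [|discriminate].
      apply (is_lim_comp_seq sqrt (fun n => INR (S (S n))) p_infty p_infty); [apply (is_lim_sqrt_p (fun x => x)), is_lim_id | exists O; intros; discriminate |].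
      apply (is_lim_seq_incr_1 (fun n => INR (S n))), (is_lim_seq_incr_1 INR), is_lim_seq_INR.
Qed.

Lemma exp_INR_lc (k : nat) t : 0 < t < PI / 2 -> exp (INR k * lc t) = (cos t ^ 2) ^ k.
Proof.
  intros Ht. induction k; [simpl; rewrite Rmult_0_l; apply exp_0|].
  rewrite S_INR, Rmult_plus_distr_r, exp_plus, IHk, Rmult_1_l, exp_lc by auto. simpl. ring.
Qed.

Lemma mv0 a : 0 < a -> mv 0 a = / (2 * a).
Proof. intros Ha. unfold mv. simpl. field. lra. Qed.

Definition lf (m : nat) (a t : R) : R := mf m a t * ls t.
(** The derivative of half the Beta function in its first argument, taken at [m + 1];
    correspondingly [lf] carries the logarithm of [sin^2]. *)
Definition lv (m : nat) (a : R) : R := mv m a * (psi (INR m + 1) - psi (a + INR m + 1)).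

Lemma exp_nonpos x : x <= 0 -> exp x <= 1.
Proof. intros [H|H]; [rewrite <- exp_0; left; now apply exp_increasing | rewrite H, exp_0; lra]. Qed.

(** Expanding [ln (1 - cos t ^ 2)] gives a series of known integrals; partial fractions of
    [1 / (n (a + n))] turn their sum into the difference of two harmonic sums, hence of two digamma
    values. *)
Lemma oint_lf0 a : 0 < a -> oint (fun t => RtoC (lf 0 a t)) (RtoC (lv 0 a)).
Proof.
  intros Ha. pose proof PI_RGT_0 as HPI.
  apply (oint_series _ (fun n t => RtoC (- / INR (S n)) * RtoC (mf 0 (a + INR (S n)) t))%C
    (fun n => RtoC (- / INR (S n)) * RtoC (mv 0 (a + INR (S n))))%C
    (fun n => / (INR (S n) * sqrt (INR (S n)))) (fun t => - / a * exp (a * lc t) + 2 * t) (fun t => 2 * (tan t * exp (a * lc t)) + 2) (/ a + PI)).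
  - intros n. apply oint_scal, oint_mf. pose proof (pos_INR (S n)). lra.
  - intros t Ht. destruct (trig_pos t Ht) as (S & C & S1 & C1 & E).
    assert (H := cser_scal (RtoC (mf 0 a t)) _ _ (ln_series (cos t ^ 2) ltac:(simpl; nra))).
    replace (1 - cos t ^ 2) with (sin t ^ 2) in H by (simpl; lra). fold (ls t) in H. rewrite <- RtoC_mult in H.
    eapply cser_ext; [|exact H]. intros n. cbv beta. rewrite <- !RtoC_mult. f_equal. unfold mf.
    rewrite Rmult_plus_distr_r, exp_plus, exp_INR_lc by auto. unfold Rdiv. ring.
  - intros t n Ht. destruct (trig_pos t Ht) as (S & C & S1 & C1 & E). pose proof (lc_neg t Ht) as L.
    rewrite Cmod_mult, !Cmod_R, Rabs_Ropp.
    set (m := INR (Datatypes.S n)). assert (Hm : 1 <= m) by (unfold m; rewrite S_INR; pose proof (pos_INR n); lra).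
    assert (Em : mf 0 (a + m) t = tan t * exp (a * lc t) * (cos t ^ 2) ^ Datatypes.S n).
    { unfold mf, m. rewrite Rmult_plus_distr_r, exp_plus, exp_INR_lc by auto. simpl. ring. }
    rewrite Em. pose proof (exp_pos (a * lc t)) as Pe.
    assert (Pc : 0 <= (cos t ^ 2) ^ Datatypes.S n) by (apply pow_le; simpl; nra).
    pose proof (pow_sqrt_bound (cos t ^ 2) (Datatypes.S n) ltac:(simpl; nra)) as B. fold m in B.
    replace (1 - cos t ^ 2) with (sin t ^ 2) in B by (simpl; lra). rewrite sqrt_pow2 in B by lra.
    assert (Psm : 0 < sqrt m) by (apply sqrt_lt_R0; lra).
    assert (Pt : 0 < tan t) by (unfold tan; now apply Rdiv_lt_0_compat).
    assert (Ee : exp (a * lc t) <= 1) by (apply exp_nonpos; nra).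
    (* Either [sin t >= 1/2] and the tangent absorbs [1 / cos t], or [cos t > 1/2] and the constant
       2 suffices. *)
    assert (D : exp (a * lc t) / cos t <= 2 * (tan t * exp (a * lc t)) + 2).
    { unfold tan. set (e := exp (a * lc t)) in *. destruct (Rle_dec (1 / 2) (sin t)).
      - apply Rle_trans with (2 * (sin t / cos t * e)); [|lra]. unfold Rdiv. assert (0 < / cos t) by now apply Rinv_0_lt_compat.
        replace (2 * (sin t * / cos t * e)) with (2 * sin t * (e * / cos t)) by ring. assert (0 < e * / cos t) by nra. nra.
      - assert (1 / 2 < cos t) by nra. apply Rle_trans with 2.
        + apply Rmult_le_reg_r with (cos t); auto. unfold Rdiv. rewrite Rmult_assoc, Rinv_l; lra.
        + assert (0 < sin t / cos t) by now apply Rdiv_lt_0_compat. nra. }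
    rewrite (Rabs_pos_eq (/ m)) by (left; apply Rinv_0_lt_compat; lra).
    rewrite Rabs_pos_eq by (apply Rmult_le_pos; [nra | exact Pc]).
    apply Rle_trans with (/ (m * sqrt m) * (exp (a * lc t) / cos t)).
    2:{ apply Rmult_le_compat_l; [left; apply Rinv_0_lt_compat; nra | exact D]. }
    unfold tan. set (p := (cos t ^ 2) ^ Datatypes.S n) in *. set (e := exp (a * lc t)) in *.
    replace (/ m * (sin t / cos t * e * p)) with (/ (m * sqrt m) * (e / cos t) * (p * (sqrt m * sin t))) by (field; repeat split; lra).
    rewrite <- (Rmult_1_r (/ (m * sqrt m) * (e / cos t))) at 2. apply Rmult_le_compat_l; auto.
    apply Rmult_le_pos; [left; apply Rinv_0_lt_compat; nra | left; now apply Rdiv_lt_0_compat].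
  - intros n. left. apply Rinv_0_lt_compat. assert (0 < INR (S n)) by (apply lt_0_INR; lia). apply Rmult_lt_0_compat; auto. now apply sqrt_lt_R0.
  - apply ex_series_three_halves.
  - intros t Ht. destruct (trig_pos t Ht) as (S & C & _). pose proof (lc_neg t Ht) as L.
    pose proof (exp_pos (a * lc t)) as Pe. assert (Ee : exp (a * lc t) <= 1) by (apply exp_nonpos; nra).
    assert (Pt : 0 < tan t) by (unfold tan; now apply Rdiv_lt_0_compat).
    split; [|split; [|split]].
    + replace (2 * (tan t * exp (a * lc t)) + 2) with (plus (- / a * (- 2 * a * (tan t * exp (a * lc t)))) (2 * 1)) by (unfold plus; simpl; field; lra).
      apply (is_derive_plus (fun t => - / a * exp (a * lc t)) (fun t => 2 * t)); apply is_derive_scal; [now apply is_derive_exp_lc | apply (is_derive_id (K := R_AbsRing))].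
    + apply (continuous_plus (V := R_NormedModule) (fun t => 2 * (tan t * exp (a * lc t))) (fun _ => 2)); [|apply continuous_const].
      apply (continuous_scal_r (V := R_NormedModule) 2 (fun t => tan t * exp (a * lc t))). now apply continuous_tan_exp_lc.
    + assert (0 < / a) by now apply Rinv_0_lt_compat. apply Rabs_le. nra.
    + nra.
  - unfold cser. apply cv_decr_1, cv_decr_1.
    apply cv_ext with (u := fun k => RtoC (/ (2 * a) * ((ln (INR (k + 1)) - rsum (fun j => / (1 + INR j)) (k + 2)) - (ln (INR (k + 1)) - rsum (fun j => / (a + 1 + INR j)) (k + 2))))).
    + intros k. replace (S (S k)) with (k + 2)%nat by lia.
      rewrite (psum_ext _ (fun n => RtoC (- / INR (S n) * mv 0 (a + INR (S n))))) by (intros; rewrite RtoC_mult; reflexivity).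
      rewrite psum_RtoC. f_equal.
      induction (k + 2)%nat as [|n IH]; [simpl; ring|]. rewrite !rsum_S, <- IH.
      pose proof (pos_INR n). rewrite mv0, S_INR by (rewrite ?S_INR; lra). field. repeat split; lra.
    + apply cv_RtoC. unfold lv. rewrite mv0 by auto. simpl INR. rewrite Rplus_0_l, Rplus_0_r.
      apply is_lim_seq_mult'; [apply is_lim_seq_const|]. apply is_lim_seq_minus'; apply psi_lim; lra.
Qed.

Lemma lv_step m a : 0 < a -> lv (S m) a = lv m a - lv m (a + 1).
Proof.
  intros Ha. unfold lv. pose proof (pos_INR m).
  rewrite S_INR, (psi_rec (INR m + 1)) by lra.
  replace (a + (INR m + 1) + 1) with (a + INR m + 1 + 1) by ring. replace (a + 1 + INR m + 1) with (a + INR m + 1 + 1) by ring.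
  rewrite (psi_rec (a + INR m + 1)) by lra. rewrite mv_step by auto.
  assert (E : mv m (a + 1) * (INR m + 1) = a * (mv m a - mv m (a + 1))).
  { rewrite <- mv_step by auto. unfold mv. replace (fact (S m)) with (S m * fact m)%nat by reflexivity. rewrite mult_INR, (rpoch_shift a (S m)), S_INR.
    assert (P2 := rpoch_pos (a + 1) (S m) ltac:(lra)). field. lra. }
  set (x := mv m a) in *. set (y := mv m (a + 1)) in *.
  replace x with (y * (INR m + 1) / a + y) by (rewrite E; field; lra). field. lra.
Qed.

Lemma oint_lf m a : 0 < a -> oint (fun t => RtoC (lf m a t)) (RtoC (lv m a)).
Proof.
  revert a. induction m; intros a Ha; [now apply oint_lf0|].
  rewrite lv_step by auto.
  apply oint_ext with (f := fun t => (RtoC (lf m a t) + - (1) * RtoC (lf m (a + 1) t))%C).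
  - intros t Ht. unfold lf. rewrite mf_step by auto. rewrite Rmult_minus_distr_r, RtoC_minus. ring.
  - apply oint_eq with (lv m a + - (1) * lv m (a + 1))%C; [rewrite RtoC_minus; ring|].
    apply oint_plus; [now apply IHm | apply oint_scal, IHm; lra].
Qed.

(** * Summation of the beta integrals *)

Lemma rg_rpoch x n : rg x = rpoch x n * rg (x + INR n).
Proof.
  revert x. induction n; intros x; [simpl; rewrite Rplus_0_r; ring|].
  rewrite rpoch_shift, rg_rec, (IHn (x + 1)), S_INR. replace (x + 1 + INR n) with (x + (INR n + 1)) by ring. ring.
Qed.

Lemma psi_rpoch x n : 0 < x -> psi (x + INR n) = psi x + rsum (fun i => / (x + INR i)) n.
Proof.
  intros Hx. induction n; [simpl; rewrite !Rplus_0_r; reflexivity|].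
  rewrite S_INR, rsum_S. replace (x + (INR n + 1)) with (x + INR n + 1) by ring. pose proof (pos_INR n).
  rewrite psi_rec, IHn by lra. ring.
Qed.

Lemma hagB_rpoch x n : INR (fact n) * hagB x n = rpoch (x + INR n + 1) n.
Proof. unfold hagB. rewrite <- gbin_rpoch. f_equal. f_equal. ring. Qed.

Lemma is_derive_rpoch c n x : (forall i : nat, x + c + INR i <> 0) ->
  is_derive (fun y => rpoch (y + c) n) x (rpoch (x + c) n * rsum (fun i => / (x + c + INR i)) n).
Proof.
  intros H. induction n.
  - simpl. rewrite Rmult_0_r. apply (is_derive_const (K := R_AbsRing) (V := R_NormedModule)).
  - rewrite rpoch_S, rsum_S. specialize (H n).
    replace (rpoch (x + c) n * (x + c + INR n) * (rsum (fun i => / (x + c + INR i)) n + / (x + c + INR n))) with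
      (plus (mult (rpoch (x + c) n * rsum (fun i => / (x + c + INR i)) n) (x + c + INR n)) (mult (rpoch (x + c) n) 1)) by (unfold plus, mult; simpl; field; auto).
    apply (is_derive_mult (fun y => rpoch (y + c) n) (fun y => y + c + INR n) x); [exact IHn | | intros; apply Rmult_comm].
    auto_derive; auto.
Qed.

Definition hagB' (x : R) (n : nat) : R := hagB x n * rsum (fun i => / (x + INR n + 1 + INR i)) n.

Lemma is_derive_hagB x n : 0 <= x -> is_derive (fun y => hagB y n) x (hagB' x n).
Proof.
  intros Hx. pose proof (INR_fact_neq_0 n).
  apply is_derive_ext with (f := fun y => / INR (fact n) * rpoch (y + (INR n + 1)) n).
  - intros t. replace (t + (INR n + 1)) with (t + INR n + 1) by ring. rewrite <- hagB_rpoch. change (/ INR (fact n) * (INR (fact n) * hagB t n) = hagB t n). field. auto.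
  - replace (hagB' x n) with (/ INR (fact n) * (rpoch (x + (INR n + 1)) n * rsum (fun i => / (x + (INR n + 1) + INR i)) n)).
    + apply is_derive_scal, is_derive_rpoch. intros i. pose proof (pos_INR i). pose proof (pos_INR n). lra.
    + unfold hagB'. replace (x + (INR n + 1)) with (x + INR n + 1) by ring. rewrite <- hagB_rpoch. field. auto.
Qed.

(** In the convolution only [hagB] depends on [mu], so differentiating the identity at [mu = 0]
    affects one factor. *)
Lemma rothe_hagen_derivative nu n : 0 < nu -> conv (hagA nu) (hagB' 0) n = hagB' nu n.
Proof.
  intros Hnu.
  assert (D1 : is_derive (fun mu => conv (hagA nu) (hagB mu) n) 0 (conv (hagA nu) (hagB' 0) n)).
  { unfold conv. generalize (S n) as m. induction m; [simpl; apply (is_derive_const (K := R_AbsRing) (V := R_NormedModule))|].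
    rewrite rsum_S. apply (is_derive_plus (fun mu => rsum (fun k => hagA nu k * hagB mu (n - k)) m) (fun mu => hagA nu m * hagB mu (n - m))); [exact IHm|].
    apply is_derive_scal. apply is_derive_hagB. lra. }
  assert (D2 : is_derive (fun mu => conv (hagA nu) (hagB mu) n) 0 (hagB' nu n)).
  { apply is_derive_ext with (f := fun mu => hagB (nu + mu) n); [intros; symmetry; apply rothe_hagen|].
    replace (hagB' nu n) with (scal 1 (hagB' nu n)) by (unfold scal; simpl; unfold mult; simpl; ring).
    apply (is_derive_comp (fun y => hagB y n) (fun mu => nu + mu)).
    - rewrite Rplus_0_r. apply is_derive_hagB. lra.
    - auto_derive; auto. }
  apply is_derive_unique in D1. apply is_derive_unique in D2. congruence.
Qed.

(** The coefficient of the double series: index [j] belongs to [K_0], index [k] to [I_nu]. *)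
Definition wq (nu : R) (j k : nat) : R := rg (nu + 1 + INR k) / (INR (fact j) * INR (fact j) * INR (fact k)).

(** The beta integral combines the Gamma factors into one that depends on [j + k] only, times a
    summand of Rothe-Hagen type. The doubled indices, from the squares of sine and cosine, are what
    produces [nu + 2k]. *)
Lemma wq_mv nu j k : 0 < nu -> wq nu j k * mv (2 * j) (nu + 2 * INR k) = rg (nu + 2 * INR (j + k) + 1) / (2 * nu) * (hagA nu k * hagB 0 j).
Proof.
  intros Hnu. pose proof (pos_INR k). pose proof (pos_INR j). pose proof (INR_fact_neq_0 k). pose proof (INR_fact_neq_0 j).
  unfold wq, mv. rewrite rpoch_shift. rewrite plus_INR.
  assert (E1 := rg_rpoch (nu + 1 + INR k) k). replace (nu + 1 + INR k + INR k) with (nu + 2 * INR k + 1) in E1 by ring.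
  replace (nu + 1 + INR k) with (nu + INR k + 1) in E1 by ring. rewrite <- hagB_rpoch in E1.
  assert (E2 := rg_rpoch (nu + 2 * INR k + 1) (2 * j)). rewrite mult_INR in E2. replace (nu + 2 * INR k + 1 + INR 2 * INR j) with (nu + 2 * (INR j + INR k) + 1) in E2 by (simpl; ring).
  assert (P1 := rpoch_pos (nu + 2 * INR k + 1) (2 * j) ltac:(lra)).
  assert (E3 : INR (fact (2 * j)) = INR (fact j) * INR (fact j) * hagB 0 j).
  { rewrite Rmult_assoc, hagB_rpoch. rewrite Rplus_0_l.
    assert (F : forall n, rpoch 1 n = INR (fact n)).
    { induction n; [reflexivity|]. rewrite rpoch_S, IHn. replace (fact (S n)) with (S n * fact n)%nat by reflexivity. rewrite mult_INR, S_INR. ring. }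
    rewrite <- !F. replace (2 * j)%nat with (j + j)%nat by lia. rewrite rpoch_add. f_equal. f_equal. ring. }
  assert (E4 : nu * hagB nu k = (nu + 2 * INR k) * hagA nu k) by (symmetry; apply hagA_eq).
  replace (nu + 1 + INR k) with (nu + INR k + 1) by ring. rewrite E1, E2, E3.
  replace (hagA nu k) with (nu * hagB nu k / (nu + 2 * INR k)) by (rewrite E4; field; lra).
  field. repeat split; auto; lra.
Qed.

Lemma rg_hagB nu n : rg (nu + 2 * INR n + 1) * hagB nu n = rg (nu + 1 + INR n) / INR (fact n).
Proof.
  pose proof (INR_fact_neq_0 n). rewrite (rg_rpoch (nu + 1 + INR n) n).
  replace (nu + 1 + INR n + INR n) with (nu + 2 * INR n + 1) by ring.
  replace (nu + 1 + INR n) with (nu + INR n + 1) by ring. rewrite <- hagB_rpoch. field. auto.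
Qed.

Lemma beta_sum nu n : 0 < nu ->
  rsum (fun j => wq nu j (n - j) * mv (2 * j) (nu + 2 * INR (n - j))) (S n) = rg (nu + 1 + INR n) / (2 * nu * INR (fact n)).
Proof.
  intros Hnu.
  rewrite (rsum_ext _ (fun j => rg (nu + 2 * INR n + 1) / (2 * nu) * (hagB 0 j * hagA nu (n - j)))).
  - rewrite rsum_scal. change (rsum _ (S n)) with (conv (hagB 0) (hagA nu) n).
    rewrite conv_comm, rothe_hagen, Rplus_0_r. pose proof (INR_fact_neq_0 n).
    transitivity (/ (2 * nu) * (rg (nu + 2 * INR n + 1) * hagB nu n)); [field; lra|]. rewrite rg_hagB. field. lra.
  - intros j Hj. rewrite wq_mv by auto. replace (j + (n - j))%nat with n by lia. ring.
Qed.

(** On a diagonal the digamma value at [nu + 2k + 2j + 1] is the constant [p2]. What remains,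
    [psi (j + 1) - psi (2j + 1)], is minus the logarithmic derivative of [hagB] at 0, so the
    differentiated convolution applies. *)
Lemma beta_log_sum nu n : 0 < nu ->
  rsum (fun j => wq nu j (n - j) * (psi (INR j + 1) * mv (2 * j) (nu + 2 * INR (n - j)) - lv (2 * j) (nu + 2 * INR (n - j)))) (S n) =
  rg (nu + 1 + INR n) / (2 * nu * INR (fact n)) * psi (nu + 1 + INR n).
Proof.
  intros Hnu. pose proof (pos_INR n).
  set (p2 := psi (nu + 2 * INR n + 1)).
  rewrite (rsum_ext _ (fun j => p2 * (wq nu j (n - j) * mv (2 * j) (nu + 2 * INR (n - j))) +
     (- (rg (nu + 2 * INR n + 1) / (2 * nu))) * (hagB' 0 j * hagA nu (n - j)))).
  - rewrite rsum_plus, !rsum_scal, beta_sum by auto. change (rsum (fun k => hagB' 0 k * hagA nu (n - k)) (S n)) with (conv (hagB' 0) (hagA nu) n).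
    rewrite conv_comm, rothe_hagen_derivative by auto. unfold hagB'.
    pose proof (psi_rpoch (nu + INR n + 1) n ltac:(lra)) as E. replace (nu + INR n + 1 + INR n) with (nu + 2 * INR n + 1) in E by ring. fold p2 in E.
    replace (rsum (fun i => / (nu + INR n + 1 + INR i)) n) with (p2 - psi (nu + INR n + 1)) by lra.
    pose proof (INR_fact_neq_0 n).
    transitivity (p2 * (rg (nu + 1 + INR n) / (2 * nu * INR (fact n))) - / (2 * nu) * (rg (nu + 2 * INR n + 1) * hagB nu n) * (p2 - psi (nu + INR n + 1))); [field; lra|].
    rewrite rg_hagB. replace (nu + 1 + INR n) with (nu + INR n + 1) by ring. field. lra.
  - intros j Hj. unfold lv. pose proof (pos_INR j).
    assert (E1 : nu + 2 * INR (n - j) + INR (2 * j) + 1 = nu + 2 * INR n + 1) by (rewrite minus_INR, mult_INR by lia; simpl; ring).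
    rewrite E1. fold p2.
    assert (E2 : psi (INR (2 * j) + 1) = psi (INR j + 1) + rsum (fun i => / (0 + INR j + 1 + INR i)) j).
    { rewrite mult_INR. replace (INR 2 * INR j + 1) with (INR j + 1 + INR j) by (simpl; ring). rewrite psi_rpoch by lra. f_equal. apply rsum_ext. intros; f_equal; ring. }
    rewrite E2. unfold hagB'.
    transitivity (p2 * (wq nu j (n - j) * mv (2 * j) (nu + 2 * INR (n - j))) - (wq nu j (n - j) * mv (2 * j) (nu + 2 * INR (n - j))) * rsum (fun i => / (0 + INR j + 1 + INR i)) j); [ring|].
    rewrite wq_mv by auto. replace (j + (n - j))%nat with n by lia. ring.
Qed.

Lemma sum_f_R0_rsum u n : sum_f_R0 u n = rsum u (S n).
Proof. induction n; [simpl; ring|]. simpl sum_f_R0. rewrite IHn. reflexivity. Qed.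

Lemma ex_series_conv (a b : nat -> R) : (forall n, 0 <= a n) -> (forall n, 0 <= b n) -> ex_series a -> ex_series b -> ex_series (conv a b).
Proof.
  intros Ha Hb [la La] [lb Lb]. exists (la * lb).
  eapply is_series_ext; [|exact (is_series_mult_pos a b la lb La Lb Ha Hb)]. intros n. simpl. apply sum_f_R0_rsum.
Qed.

Lemma psum_Cmod_le (u : nat -> C) (b : nat -> R) n : (forall k, (k < n)%nat -> Cmod (u k) <= b k) -> Cmod (psum u n) <= rsum b n.
Proof.
  induction n; intros H; simpl; [rewrite Cmod_0; lra|]. eapply Rle_trans; [apply Cmod_triangle|].
  apply Rplus_le_compat; [apply IHn; intros; apply H; lia | apply H; lia].
Qed.

Lemma rsum_scal_r c u n : rsum (fun k => u k * c) n = rsum u n * c.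
Proof. induction n; simpl; [ring | rewrite IHn; ring]. Qed.

Open Scope C_scope.

Lemma Cexp_2_plus_ln (l : C) (x : R) (k : nat) : Cexp (2 * (l + x)) ^ k = Cexp (2 * l) ^ k * RtoC (exp x ^ (2 * k)).
Proof.
  rewrite RtoC_pow, Cpow_mult_r, <- Cpow_mult_l. f_equal.
  replace (2 * (l + x)) with (2 * l + (x + x)) by ring. rewrite Cexp_plus. f_equal. rewrite <- RtoC_plus, Cexp_RtoC, exp_plus, RtoC_mult. simpl. ring.
Qed.

(** The Cauchy product arranges the integrand by powers of [w], so termwise integration meets
    exactly the diagonals for which the convolution sums are available. *)
Lemma bessel_integral (nu : R) (l : C) : (0 < nu)%R ->
  oint (fun t => tan t * (- Ibes' 0 (l + ls t)) * Ibes nu (l + lc t)) (- (/ (2 * nu))%R * Ibes' nu l).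
Proof.
  intros Hnu. pose proof PI_RGT_0 as HPI.
  set (w := Cexp (2 * l)).
  pose (term := fun (n j : nat) (t : R) => w ^ n * Cexp (nu * l) * RtoC (wq nu j (n - j)) *
     ((psi (INR j + 1) - l) * RtoC (mf (2 * j) (nu + 2 * INR (n - j)) t) - RtoC (lf (2 * j) (nu + 2 * INR (n - j)) t))).
  pose (val := fun (n j : nat) => w ^ n * Cexp (nu * l) * RtoC (wq nu j (n - j)) *
     ((psi (INR j + 1) - l) * RtoC (mv (2 * j) (nu + 2 * INR (n - j))) - RtoC (lv (2 * j) (nu + 2 * INR (n - j))))).
  (* The [j]-th term of the [K_0] series is at most [al j * (1 - ls t)], because [Cmod (l + ls t) <=
     (Cmod l + 1) * (1 - ls t)]; [be] plays the same part for [I_nu]. *)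
  pose (al := fun j : nat => (((Cmod l + 1) * Cmod ((w ^ j / INR (fact j)) * rgam (0 + 1 + INR j)) + Cmod ((w ^ j / INR (fact j)) * rgam' (0 + 1 + INR j))))%R).
  pose (be := fun k : nat => (Cmod (Cexp (nu * l)) * Cmod ((w ^ k / INR (fact k)) * rgam (nu + 1 + INR k)))%R).
  destruct (Iser_summable 0 w) as [SA1 SA2]. destruct (Iser_summable nu w) as [SB1 SB2].
  assert (al0 : forall j, (0 <= al j)%R).
  { intros j. unfold al. pose proof (Cmod_ge_0 l). apply Rplus_le_le_0_compat; [apply Rmult_le_pos; [lra|]|]; apply Cmod_ge_0. }
  assert (be0 : forall j, (0 <= be j)%R) by (intros j; unfold be; apply Rmult_le_pos; apply Cmod_ge_0).
  set (U := fun (t : R) (j : nat) => (l + ls t) * ((Cexp (2 * (l + ls t)) ^ j / INR (fact j)) * rgam (0 + 1 + INR j)) + (Cexp (2 * (l + ls t)) ^ j / INR (fact j)) * rgam' (0 + 1 + INR j)).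
  set (V := fun (t : R) (k : nat) => (Cexp (2 * (l + lc t)) ^ k / INR (fact k)) * rgam (nu + 1 + INR k)).
  assert (Eterm : forall t n j, (0 < t < PI / 2)%R -> (j <= n)%nat -> - (tan t * Cexp (nu * (l + lc t))) * (U t j * V t (n - j)%nat) = term n j t).
  { intros t n j Ht Hj. unfold U, V, term, lf, mf, wq. set (k := (n - j)%nat).
    rewrite !Cexp_2_plus_ln, exp_ls, exp_lc by auto. fold w.
    replace (0 + 1 + INR j) with (RtoC (INR j + 1)) by (rewrite RtoC_plus; ring). replace (nu + 1 + INR k) with (RtoC (nu + 1 + INR k)) by (rewrite !RtoC_plus; ring).
    pose proof (pos_INR j). rewrite !rgam_rg, rgam'_rg, psi_rg', rg_fact by lra.
    replace (nu * (l + lc t)) with (nu * l + RtoC (nu * lc t)) by (rewrite RtoC_mult; ring). rewrite Cexp_plus, Cexp_RtoC.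
    replace ((nu + 2 * INR k) * lc t)%R with (nu * lc t + INR (2 * k) * lc t)%R by (rewrite mult_INR; simpl; ring).
    rewrite exp_plus, exp_INR_lc by auto.
    replace (w ^ n) with (w ^ j * w ^ k) by (rewrite <- Cpow_add_r; f_equal; unfold k; lia).
    pose proof (INR_fact_neq_0 j). pose proof (INR_fact_neq_0 k).
    assert (F1 : RtoC (INR (fact j)) <> 0) by now apply RtoC_neq_0. assert (F2 : RtoC (INR (fact k)) <> 0) by now apply RtoC_neq_0.
    set (s := ((sin t ^ 2) ^ (2 * j))%R). set (c := ((cos t ^ 2) ^ (2 * k))%R).
    unfold Rdiv. rewrite !RtoC_mult, !RtoC_inv, !RtoC_opp, ?RtoC_mult by (auto; repeat apply Rmult_integral_contrapositive_currified; auto).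
    field. auto. }
  (* The majorant has an elementary bounded primitive: the power of the cosine integrates
     [2 tan t * exp (nu * lc t)], and [- sin t ^ 2 * ls t - cos t ^ 2] integrates the logarithmic
     part. *)
  apply (oint_series _ (fun n t => psum (fun j => term n j t) (S n)) (fun n => psum (val n) (S n)) (conv al be)
     (fun t => - / nu * exp (nu * lc t) - sin t ^ 2 * ls t - cos t ^ 2)%R (fun t => 2 * (tan t * exp (nu * lc t)) - 2 * (sin t * cos t) * ls t)%R (/ nu + 2)%R).
  - intros n. apply (oint_psum (fun j t => term n j t)). intros j Hj. unfold term, val. apply oint_scal.
    pose proof (pos_INR (n - j)).
    apply oint_plus; [apply oint_scal, oint_mf; lra|].
    apply oint_ext with (f := fun t => - (1) * RtoC (lf (2 * j) (nu + 2 * INR (n - j)) t)); [intros; ring|].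
    apply oint_eq with (- (1) * RtoC (lv (2 * j) (nu + 2 * INR (n - j)))); [ring|]. apply oint_scal, oint_lf. lra.
  - intros t Ht.
    destruct (Iser_summable 0 (Cexp (2 * (l + ls t)))) as [T1 T2]. destruct (Iser_summable nu (Cexp (2 * (l + lc t)))) as [T3 _].
    assert (HU : cser (U t) (Ibes' 0 (l + ls t))).
    { unfold Ibes'. rewrite Cmult_0_l, Cexp_0, Cmult_1_l. unfold U. apply cser_plus; [apply cser_scal|]; now apply abs_summable_cser. }
    assert (HV : cser (V t) (Iser nu (Cexp (2 * (l + lc t))))) by (now apply abs_summable_cser).
    assert (AU : abs_summable (U t)).
    { apply abs_summable_le with (a := fun j => (Cmod (l + ls t) * Cmod ((Cexp (2 * (l + ls t)) ^ j / INR (fact j)) * rgam (0 + 1 + INR j)) + Cmod ((Cexp (2 * (l + ls t)) ^ j / INR (fact j)) * rgam' (0 + 1 + INR j)))%R).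
      - intros j. unfold U. eapply Rle_trans; [apply Cmod_triangle|]. rewrite (Cmod_mult (l + ls t)). lra.
      - apply (ex_series_plus (K := R_AbsRing) (V := R_NormedModule)); [|exact T2].
        apply (ex_series_scal_l (K := R_AbsRing) (V := R_NormedModule)). exact T1. }
    pose proof (cser_scal (- (tan t * Cexp (nu * (l + lc t)))) _ _ (cser_Cauchy_product _ _ _ _ HU HV AU T3)) as H.
    eapply cser_ext; [|eapply cv_eq; [|exact H]].
    + intros n. cbv beta. rewrite <- psum_scal. apply psum_ext. intros j Hj. apply Eterm; auto. lia.
    + unfold Ibes. ring.
  - intros t n Ht. destruct (trig_pos t Ht) as (Sp & Cp & S1 & C1 & E). pose proof (lc_neg t Ht) as L. pose proof (ls_neg t Ht) as L'.
    pose proof (exp_pos (nu * lc t)) as Pe.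
    assert (Pt : (0 < tan t)%R) by (unfold tan; now apply Rdiv_lt_0_compat).
    set (phi := (2 * (tan t * exp (nu * lc t)) - 2 * (sin t * cos t) * ls t)%R).
    (* If [- ls t <= 1], the first part of [phi] is enough; otherwise [cos t ^ 2 >= 1/2], so the
       tangent is at most [2 sin t cos t] and the second part takes the logarithm. *)
    assert (HD : (tan t * exp (nu * lc t) * (1 - ls t) <= phi)%R).
    { unfold phi. set (e := exp (nu * lc t)) in *. destruct (Rle_dec (- ls t) 1) as [H1|H1].
      - assert (0 < sin t * cos t)%R by nra. assert (0 < tan t * e)%R by nra. nra.
      - assert (Hs : (sin t ^ 2 <= 1 / 2)%R).
        { rewrite <- exp_ls by auto. apply Rle_trans with (exp (-1)); [left; apply exp_increasing; lra|].
          replace (-1)%R with (- (1))%R by ring. rewrite exp_Ropp. apply Rle_trans with (/ 2)%R; [|lra]. apply Rinv_le_contravar; [lra|]. pose proof (exp_ge_1_plus 1). lra. }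
        assert (Hc : (e * / (cos t * cos t) <= 2)%R).
        { assert (e <= 1)%R by (unfold e; apply exp_nonpos; nra). assert (1 / 2 <= cos t * cos t)%R by (simpl in Hs; lra).
          apply Rmult_le_reg_r with (cos t * cos t)%R; [nra|]. rewrite Rmult_assoc, Rinv_l by nra. lra. }
        assert (T : (tan t * e = sin t * cos t * (e * / (cos t * cos t)))%R) by (unfold tan; field; lra).
        assert (0 < sin t * cos t)%R by nra.
        assert (tan t * e * (- ls t) <= 2 * (sin t * cos t) * (- ls t))%R.
        { apply Rmult_le_compat_r; [lra|]. rewrite T. nra. }
        assert (0 < tan t * e)%R by nra. lra. }
    unfold conv. rewrite <- rsum_scal_r. apply psum_Cmod_le. intros j Hj.
    rewrite <- Eterm by (auto; lia). set (k := (n - j)%nat).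
    rewrite !Cmod_mult, Cmod_opp, Cmod_mult, Cmod_nonneg by lra.
    assert (BU : (Cmod (U t j) <= al j * (1 - ls t))%R).
    { unfold U, al. rewrite Cexp_2_plus_ln, exp_ls by auto. fold w.
      assert (Ps : (0 <= (sin t ^ 2) ^ (2 * j) <= 1)%R) by (split; [apply pow_le; simpl; nra | rewrite <- (pow1 (2 * j)); apply pow_incr; simpl; nra]).
      set (s := ((sin t ^ 2) ^ (2 * j))%R) in *.
      replace (w ^ j * s / INR (fact j) * rgam (0 + 1 + INR j)) with (s * (w ^ j / INR (fact j) * rgam (0 + 1 + INR j))) by (unfold Cdiv; ring).
      replace (w ^ j * s / INR (fact j) * rgam' (0 + 1 + INR j)) with (s * (w ^ j / INR (fact j) * rgam' (0 + 1 + INR j))) by (unfold Cdiv; ring).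
      eapply Rle_trans; [apply Cmod_triangle|]. rewrite (Cmod_mult (l + ls t)), !(Cmod_mult s), Cmod_nonneg by lra.
      set (x := Cmod (w ^ j / INR (fact j) * rgam (0 + 1 + INR j))). set (y := Cmod (w ^ j / INR (fact j) * rgam' (0 + 1 + INR j))).
      assert (0 <= x)%R by apply Cmod_ge_0. assert (0 <= y)%R by apply Cmod_ge_0. pose proof (Cmod_ge_0 l) as Hl.
      assert (Hll : (Cmod (l + ls t) <= (Cmod l + 1) * (1 - ls t))%R).
      { eapply Rle_trans; [apply Cmod_triangle|]. rewrite Cmod_R, Rabs_left by auto. nra. }
      pose proof (Cmod_ge_0 (l + ls t)).
      assert (s * x <= x)%R by nra. assert (s * y <= y)%R by nra. assert (0 <= s * x)%R by nra.
      assert (Cmod (l + ls t) * (s * x) <= (Cmod l + 1) * (1 - ls t) * x)%R by (apply Rmult_le_compat; auto).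
      assert (y <= y * (1 - ls t))%R by nra. lra. }
    assert (BV : (Cmod (Cexp (nu * (l + lc t))) * Cmod (V t k) <= exp (nu * lc t) * be k)%R).
    { unfold V, be. rewrite Cexp_2_plus_ln, exp_lc by auto. fold w.
      assert (Ps : (0 <= (cos t ^ 2) ^ (2 * k) <= 1)%R) by (split; [apply pow_le; simpl; nra | rewrite <- (pow1 (2 * k)); apply pow_incr; simpl; nra]).
      set (s := ((cos t ^ 2) ^ (2 * k))%R) in *.
      replace (w ^ k * s / INR (fact k) * rgam (nu + 1 + INR k)) with (s * (w ^ k / INR (fact k) * rgam (nu + 1 + INR k))) by (unfold Cdiv; ring).
      replace (nu * (l + lc t)) with (nu * l + RtoC (nu * lc t)) by (rewrite RtoC_mult; ring).
      rewrite Cexp_plus, Cexp_RtoC, (Cmod_mult (Cexp _)), (Cmod_mult s), !Cmod_nonneg by lra.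
      set (x := Cmod (w ^ k / INR (fact k) * rgam (nu + 1 + INR k))). assert (0 <= x)%R by apply Cmod_ge_0. pose proof (Cmod_ge_0 (Cexp (nu * l))) as Hc.
      assert (s * x <= x)%R by nra. replace (exp (nu * lc t) * (Cmod (Cexp (nu * l)) * x))%R with (Cmod (Cexp (nu * l)) * exp (nu * lc t) * x)%R by ring.
      apply Rmult_le_compat_l; [nra | auto]. }
    pose proof (Cmod_ge_0 (U t j)). pose proof (Cmod_ge_0 (V t k)). pose proof (Cmod_ge_0 (Cexp (nu * (l + lc t)))).
    apply Rle_trans with (al j * be k * (tan t * exp (nu * lc t) * (1 - ls t)))%R.
    + replace (tan t * Cmod (Cexp (nu * (l + lc t))) * (Cmod (U t j) * Cmod (V t k)))%R with
        (tan t * (Cmod (U t j) * (Cmod (Cexp (nu * (l + lc t))) * Cmod (V t k))))%R by ring.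
      replace (al j * be k * (tan t * exp (nu * lc t) * (1 - ls t)))%R with (tan t * ((al j * (1 - ls t)) * (exp (nu * lc t) * be k)))%R by ring.
      apply Rmult_le_compat_l; [lra|]. apply Rmult_le_compat; auto. nra.
    + apply Rmult_le_compat_l; auto. specialize (al0 j). specialize (be0 k). nra.
  - intros n. unfold conv. generalize (S n) as m. intros m. induction m; simpl; [lra|].
    specialize (al0 m). specialize (be0 (n - m)%nat). nra.
  - apply ex_series_conv; auto.
    + unfold al. apply (ex_series_plus (K := R_AbsRing) (V := R_NormedModule)); [|exact SA2].
      apply (ex_series_scal_l (K := R_AbsRing) (V := R_NormedModule)). exact SA1.
    + unfold be. apply (ex_series_scal_l (K := R_AbsRing) (V := R_NormedModule)). exact SB1.
  - intros t Ht. destruct (trig_pos t Ht) as (Sp & Cp & S1 & C1 & E). pose proof (lc_neg t Ht) as L. pose proof (ls_neg t Ht) as L'.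
    pose proof (exp_pos (nu * lc t)) as Pe. assert (Ee : (exp (nu * lc t) <= 1)%R) by (apply exp_nonpos; nra).
    assert (Pt : (0 < tan t)%R) by (unfold tan; now apply Rdiv_lt_0_compat).
    split; [|split; [|split]].
    + replace (2 * (tan t * exp (nu * lc t)) - 2 * (sin t * cos t) * ls t)%R with
        (minus (minus (- / nu * (- 2 * nu * (tan t * exp (nu * lc t))))%R (plus (mult (2 * sin t * cos t)%R (ls t)) (mult (sin t ^ 2) (2 * cos t / sin t)%R))) (- (2 * sin t * cos t)))%R
        by (unfold minus, plus, opp, mult; simpl; field; lra).
      apply (is_derive_minus (fun t => - / nu * exp (nu * lc t) - sin t ^ 2 * ls t)%R (fun t => cos t ^ 2)%R).
      * apply (is_derive_minus (fun t => - / nu * exp (nu * lc t))%R (fun t => sin t ^ 2 * ls t)%R).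
        -- apply is_derive_scal. now apply is_derive_exp_lc.
        -- apply (is_derive_mult (fun t => sin t ^ 2)%R ls t); [|now apply is_derive_ls | intros; apply Rmult_comm].
           auto_derive; auto. simpl. ring.
      * auto_derive; auto. simpl. ring.
    + apply (continuous_minus (V := R_NormedModule) (fun t => 2 * (tan t * exp (nu * lc t)))%R (fun t => 2 * (sin t * cos t) * ls t)%R).
      * apply (continuous_scal_r (V := R_NormedModule) 2 (fun t => tan t * exp (nu * lc t))%R). now apply continuous_tan_exp_lc.
      * apply (ex_derive_continuous (fun t => 2 * (sin t * cos t) * ls t)%R). unfold ls. auto_derive. simpl. nra.
    + assert (0 < / nu)%R by now apply Rinv_0_lt_compat.
      assert (Hu : (0 <= - (sin t ^ 2 * ls t) <= 1)%R).
      { pose proof (exp_ge_1_plus (- ls t)) as X. rewrite exp_Ropp, exp_ls in X by auto.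
        assert (P2 : (0 < sin t ^ 2)%R) by (simpl; nra). split; [nra|].
        assert (sin t ^ 2 * (1 + - ls t) <= sin t ^ 2 * / sin t ^ 2)%R by (apply Rmult_le_compat_l; lra).
        rewrite Rinv_r in H0 by lra. nra. }
      assert (0 <= cos t ^ 2 <= 1)%R by (simpl; nra).
      assert (0 <= / nu * exp (nu * lc t) <= / nu)%R by nra. apply Rabs_le. lra.
    + assert (0 < sin t * cos t)%R by nra. assert (0 < tan t * exp (nu * lc t))%R by nra. nra.
  - assert (H1 := cser_scal (- (/ (2 * nu))%R * Cexp (nu * l)) _ _ (cser_plus _ _ _ _ (cser_scal l _ _ (abs_summable_cser _ SB1)) (abs_summable_cser _ SB2))).
    eapply cser_ext; [|eapply cv_eq; [|exact H1]].
    2:{ unfold Ibes', Iser, Iser'. fold w. ring. }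
    intros n. cbv beta. pose proof (INR_fact_neq_0 n). pose proof (pos_INR n).
    replace (nu + 1 + INR n) with (RtoC (nu + 1 + INR n)) by (rewrite !RtoC_plus; ring).
    rewrite rgam_rg, rgam'_rg, psi_rg' by lra.
    (* The factor [psi (j + 1) - l] splits the diagonal into the logarithmic sum and [- l] times the
       plain one; they become the [Iser'] and the [Iser] part of [Ibes']. *)
    rewrite (psum_ext (val n) (fun j => (w ^ n * Cexp (nu * l)) *
       (RtoC (wq nu j (n - j) * (psi (INR j + 1) * mv (2 * j) (nu + 2 * INR (n - j)) - lv (2 * j) (nu + 2 * INR (n - j)))) +
        (- l) * RtoC (wq nu j (n - j) * mv (2 * j) (nu + 2 * INR (n - j)))))).
    2:{ intros j Hj. unfold val. rewrite !RtoC_mult, RtoC_minus, RtoC_mult. ring. }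
    rewrite psum_scal, psum_plus, psum_scal, !psum_RtoC, beta_sum, beta_log_sum by auto.
    unfold Rdiv, Cdiv. repeat (rewrite RtoC_mult || rewrite RtoC_opp). rewrite !RtoC_inv, !RtoC_mult by (auto; repeat apply Rmult_integral_contrapositive_currified; auto; lra).
    assert (RtoC (INR (fact n)) <> 0) by now apply RtoC_neq_0. assert (RtoC nu <> 0) by (apply RtoC_neq_0; lra).
    assert (RtoC 2 <> 0) by (apply RtoC_neq_0; lra). field. auto.
Qed.

(** * The G-function of the theorem *)

(** After writing both [Gamma(-s)] as [- Gamma(1 - s) / s], the factor [1 / Gamma(1 - s)] cancels
    one of them, which is legitimate off the poles, where [rgam (1 - s)] is nonzero. *)
Lemma meijerG_integrand_fG (nu : R) (z s : C) : (0 < Re z)%R -> offpole nu s ->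
  meijerG_integrand 3 1 [RtoC (1 / 2); RtoC 1] [RtoC 0; RtoC 0; RtoC nu; RtoC (- nu)] (z ^ 2) s = fG nu (Cln z) s.
Proof.
  intros Hz H. destruct (offpole_neq nu s H) as (A & B & C0 & D). unfold meijerG_integrand, fG. simpl firstn. simpl skipn. simpl map. unfold Cprod; simpl fold_right.
  rewrite !Cgamma_rgam. unfold Cpower. rewrite Cln_sqr by auto.
  replace (0 - s) with (- s) by ring. rewrite (rgam_rec (- s)). replace (- s + 1) with (1 - s) by ring.
  replace (1 - RtoC (1 / 2) + s) with (RtoC (1 / 2) + s) by (replace (RtoC (1 / 2)) with (RtoC (1 - 1 / 2)) at 2 by (f_equal; field); rewrite RtoC_minus; ring).
  replace (1 - RtoC (- nu) + s) with (1 + nu + s) by (rewrite RtoC_opp; ring).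
  replace (s * (2 * Cln z)) with (2 * s * Cln z) by ring.
  unfold Cdiv. rewrite !Cinv_total_mult, !Cinv_inv_total.
  assert (Hi : / rgam (1 - s) * rgam (1 - s) = 1) by now apply Cinv_l.
  assert (Hs : / - s = - / s) by (field; auto).
  assert (H1 : / RtoC 1 = 1) by (rewrite <- RtoC_inv by lra; rewrite Rinv_1; reflexivity).
  rewrite Hs, H1.
  transitivity (rgam (1 + nu + s) * Cexp (2 * s * Cln z) * (/ s * / s * (/ rgam (1 - s) * rgam (1 - s)) * / rgam (1 - s) * / rgam (nu - s) * / rgam (RtoC (1 / 2) + s))); [ring|].
  rewrite Hi. ring.
Qed.

Lemma is_loop_integral_ext (f g : C -> C) (sigma c1 c2 : R) (l : C) : (c1 <= c2)%R ->
  (forall t, (sigma <= t)%R -> f (t, c1) = g (t, c1)) -> (forall t, (sigma <= t)%R -> f (t, c2) = g (t, c2)) -> (forall t, f (sigma, t) = g (sigma, t)) ->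
  is_loop_integral f sigma c1 c2 l -> is_loop_integral g sigma c1 c2 l.
Proof.
  intros Hc H1 H2 H3 (l1 & l2 & l3 & A & B & D & E). exists l1, l2, l3.
  assert (G : forall (c : R) m, (forall t, (sigma <= t)%R -> f (t, c) = g (t, c)) ->
     is_RInt_gen (V := CV) (fun t : R => f (t, c)) (at_point sigma) (Rbar_locally p_infty) m ->
     is_RInt_gen (V := CV) (fun t : R => g (t, c)) (at_point sigma) (Rbar_locally p_infty) m).
  { intros c m Hf. apply is_RInt_gen_ext. apply (Filter_prod _ _ _ (fun a => a = sigma) (fun b => (sigma < b)%R)).
    - reflexivity.
    - exists sigma. auto.
    - intros x y -> Hy t Ht. simpl in Ht. rewrite Rmin_left in Ht by lra. apply Hf. lra. }
  split; [now apply G|]. split; [|split; [now apply G | exact E]].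
  eapply (is_RInt_ext (V := CV)); [|exact B]. intros t _. cbv beta. now rewrite H3.
Qed.

(** The pole 0 has to lie inside, and the pole [1/2 - 1] sits at height 0 between [c1] and [c2], so
    it can only be excluded by lying to the left of [sigma]. *)
Lemma loop_separates_bounds (nu sigma c1 c2 : R) :
  loop_separates 3 1 [RtoC (1 / 2); RtoC 1] [RtoC 0; RtoC 0; RtoC nu; RtoC (- nu)] sigma c1 c2 ->
  (- (1 / 2) < sigma < 0)%R /\ (c1 < 0 < c2)%R.
Proof.
  intros (H & P & Q). destruct (P 0 O) as [P1 P2]; [simpl; auto|].
  specialize (Q (RtoC (1 / 2)) O (or_introl eq_refl)). unfold Re, Im in *; simpl in *.
  split; [|lra]. split; [|lra]. apply Rnot_le_lt. intros N. apply Q. lra.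
Qed.

Lemma loop_separates_ex (nu : R) : (0 < nu)%R ->
  loop_separates 3 1 [RtoC (1 / 2); RtoC 1] [RtoC 0; RtoC 0; RtoC nu; RtoC (- nu)] (- (1 / 4)) (- 1) 1.
Proof.
  intros Hnu. split; [lra|]. split.
  - intros be k H. pose proof (pos_INR k). simpl in H. destruct H as [<-|[<-|[<-|[]]]]; unfold Re, Im; simpl; lra.
  - intros al k H. pose proof (pos_INR k). simpl in H. destruct H as [<-|[]]; unfold Re, Im; simpl; lra.
Qed.

Lemma is_meijerG_fG (nu : R) (z g : C) : (0 < nu)%R -> (0 < Re z)%R ->
  (forall s c1 c2, (- (1 / 2) < s < 0)%R -> (c1 < 0 < c2)%R -> is_loop_integral (fG nu (Cln z)) s c1 c2 (2 * PI * Ci * g)) ->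
  is_meijerG 3 1 [RtoC (1 / 2); RtoC 1] [RtoC 0; RtoC 0; RtoC nu; RtoC (- nu)] (z ^ 2) g.
Proof.
  intros Hnu Hz H. split; [simpl; lia|]. split; [eexists _, _, _; now apply loop_separates_ex|].
  intros sigma c1 c2 HS. apply loop_separates_bounds in HS. destruct HS as [Hs Hc].
  apply (is_loop_integral_ext (fG nu (Cln z))); [lra | | | | now apply H];
    intros; symmetry; apply meijerG_integrand_fG; auto; try (apply offpole_im; unfold Re, Im; simpl; lra).
  now apply offpole_strip.
Qed.

Lemma neq_0_Re (z : C) : (0 < Re z)%R -> z <> 0.
Proof. intros H E. rewrite E in H. unfold Re in H; simpl in H. lra. Qed.

Lemma half_neq_0 (z : C) : z <> 0 -> z / 2 <> 0.
Proof. intros H. unfold Cdiv. apply Cmult_neq_0; auto. rewrite <- RtoC_inv by lra. apply RtoC_neq_0. lra. Qed.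

Lemma Cln_half_scale (z : C) (t : R) : z <> 0 -> (0 < t)%R -> Cln (z * t / 2) = Cln (z / 2) + ln t.
Proof.
  intros Hz Ht. replace (z * t / 2) with (z / 2 * t) by (unfold Cdiv; ring). apply Cln_scale; auto using half_neq_0.
Qed.

Lemma scale_neq_0 (z : C) (t : R) : z <> 0 -> (0 < t)%R -> z * t <> 0.
Proof. intros Hz Ht. apply Cmult_neq_0; auto. apply RtoC_neq_0; lra. Qed.

Lemma bessel_product_integral (nu : R) (z : C) : (0 < nu)%R -> (0 < Re z)%R ->
  is_RInt_gen (V := C_R_NormedModule)
      (fun theta : R =>
         tan theta * BesselK 0 (z * (sin theta ^ 2)%R) * BesselI nu (z * (cos theta ^ 2)%R))
      (at_right 0) (at_left (PI / 2)%R) (- (/ (2 * nu))%R * Ibes' nu (Cln (z / 2))).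
Proof.
  intros Hnu Hz. apply neq_0_Re in Hz. apply oint_is_RInt_gen.
  eapply oint_ext; [|apply bessel_integral, Hnu]. intros t Ht. cbv beta.
  destruct (trig_pos t Ht) as (Sp & Cp & S1 & C1 & E).
  assert (P1 : (0 < sin t ^ 2)%R) by (simpl; nra). assert (P2 : (0 < cos t ^ 2)%R) by (simpl; nra).
  rewrite BesselK_0, BesselI_Ibes, !Cln_half_scale by auto using scale_neq_0. reflexivity.
Qed.

(** * Non-integral order *)

Definition pser (a : nat -> R) (w : C) : C := CSeries (fun k => a k * w ^ k).

Lemma cser_pser a w : expb a -> cser (fun k => a k * w ^ k) (pser a w).
Proof. intros H. now apply abs_summable_cser, expb_summable. Qed.

Lemma cser_pser_conv a b w : expb a -> expb b -> cser (fun n => conv a b n * w ^ n) (pser a w * pser b w).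
Proof.
  intros Ha Hb.
  pose proof (cser_Cauchy_product _ _ _ _ (cser_pser a w Ha) (cser_pser b w Hb) (expb_summable a w Ha) (expb_summable b w Hb)) as H.
  eapply cser_ext; [|exact H]. intros n. cbv beta. unfold conv. rewrite <- psum_RtoC, Cmult_comm, <- psum_scal.
  apply psum_ext. intros k Hk. replace (w ^ n) with (w ^ k * w ^ (n - k)) by (rewrite <- Cpow_add_r; f_equal; lia).
  rewrite (RtoC_mult (a k)). ring.
Qed.

Lemma expb_geom a : expb a -> expb (fun k => 4 ^ k * a k)%R.
Proof.
  intros (B & D & HB & HD & H). exists B, (4 * D)%R. repeat split; auto; [lra|]. intros k. specialize (H k).
  assert (P : (0 < 4 ^ k)%R) by (apply pow_lt; lra). rewrite Rabs_mult, (Rabs_pos_eq (4 ^ k)), Rpow_mult_distr by lra.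
  replace (B * (4 ^ k * D ^ k / INR (fact k)))%R with (4 ^ k * (B * (D ^ k / INR (fact k))))%R by (unfold Rdiv; ring).
  apply Rmult_le_compat_l; lra.
Qed.

Lemma pser_geom a w : expb a -> CSeries (fun k => a k * (4 * w) ^ k) = pser (fun k => 4 ^ k * a k)%R w.
Proof.
  intros H. apply cser_CSeries. eapply cser_ext; [|apply (cser_pser _ w (expb_geom a H))]. intros k. cbv beta.
  rewrite Cpow_mult_l, RtoC_mult, RtoC_pow. ring.
Qed.

Lemma expb_icoef m d : (0 < d)%R -> (forall k : nat, (d <= Rabs (m + 1 + INR k))%R) -> expb (icoef m).
Proof.
  intros Hd H. assert (0 < / d)%R by now apply Rinv_0_lt_compat. exists 1%R, (/ d)%R. repeat split; try lra. intros k.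
  pose proof (rpoch_inv_bound (m + 1) d Hd H k) as B. pose proof (INR_fact_lt_0 k) as F.
  unfold icoef. rewrite Rinv_mult, Rabs_mult, (Rabs_pos_eq (/ INR (fact k))) by (left; now apply Rinv_0_lt_compat).
  unfold Rdiv. rewrite Rmult_1_l, Rmult_comm. apply Rmult_le_compat_r; auto. left. now apply Rinv_0_lt_compat.
Qed.

Lemma rg_icoef m k : (forall k : nat, m + 1 + INR k <> 0)%R -> (rg (m + 1 + INR k) / INR (fact k) = rg (m + 1) * icoef m k)%R.
Proof.
  intros H. rewrite (rg_rpoch (m + 1) k). unfold icoef. pose proof (rpoch_neq_0 _ k H). pose proof (INR_fact_neq_0 k). field. auto.
Qed.

Lemma Iser_pser m w : (forall k : nat, m + 1 + INR k <> 0)%R -> expb (icoef m) -> Iser m w = rg (m + 1) * pser (icoef m) w.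
Proof.
  intros H He. apply cser_CSeries. eapply cser_ext; [|apply (cser_scal (rg (m + 1))), (cser_pser _ w He)].
  intros k. cbv beta. replace (m + 1 + INR k) with (RtoC (m + 1 + INR k)) by (rewrite !RtoC_plus; ring).
  rewrite rgam_rg, Cmult_assoc, <- RtoC_mult, <- rg_icoef by auto.
  unfold Rdiv, Cdiv. rewrite RtoC_mult, RtoC_inv by apply INR_fact_neq_0. ring.
Qed.

(** [psi_rpoch] splits each digamma value into [psi (nu + 1)] and a harmonic sum, and
    [icoef_derivative_identity] replaces the latter by Cauchy products of entire series. *)
Lemma Iser'_pser (nu : R) (w : C) : (0 < nu)%R -> nonint nu ->
  Iser' nu w = rg (nu + 1) * (- psi (nu + 1) * pser (icoef nu) w + (/ (2 * nu))%R * pser (icoef nu) w +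
     (/ 2)%R * (pser (icoef nu) w * Vseries nu (4 * w)) - (/ (2 * nu))%R * (pser (icoef (- nu)) w * Useries nu (4 * w))).
Proof.
  intros Hnu NI. destruct (nonint_dist nu NI) as (d & Hd & HD).
  assert (E1 : expb (icoef nu)) by (apply (expb_icoef nu 1); [lra|]; intros k; pose proof (pos_INR k); rewrite Rabs_pos_eq; lra).
  assert (E2 : expb (icoef (- nu))) by (apply (expb_icoef _ d); auto; intros k; replace (- nu + 1 + INR k)%R with (1 - nu + INR k)%R by ring; auto).
  pose proof (expb_vcoef nu Hnu NI) as EV. pose proof (expb_ucoef nu Hnu) as EU.
  unfold Vseries, Useries. rewrite !pser_geom by auto.
  pose proof (cser_pser _ w E1) as S1. pose proof (cser_pser_conv _ _ w E1 (expb_geom _ EV)) as S2.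
  pose proof (cser_pser_conv _ _ w E2 (expb_geom _ EU)) as S3.
  apply cser_CSeries. eapply cser_ext; [|apply (cser_scal (rg (nu + 1))), cser_minus;
    [apply cser_plus; [apply cser_plus|]; apply cser_scal; [exact S1 | exact S1 | exact S2] | apply cser_scal; exact S3]].
  intros n. cbv beta. pose proof (icoef_derivative_identity nu Hnu NI n) as EI.
  pose proof (pos_INR n). replace (nu + 1 + INR n) with (RtoC (nu + 1 + INR n)) by (rewrite !RtoC_plus; ring).
  rewrite rgam'_rg, psi_rg' by lra. rewrite psi_rpoch by lra.
  assert (N0 : forall k : nat, (nu + 1 + INR k <> 0)%R) by (intros k; pose proof (pos_INR k); lra).
  assert (EC : (- psi (nu + 1) * icoef nu n + / (2 * nu) * icoef nu n + / 2 * conv (icoef nu) (fun k => 4 ^ k * vcoef nu k) n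
       - / (2 * nu) * conv (icoef (- nu)) (fun k => 4 ^ k * ucoef nu k) n = - (psi (nu + 1) + rsum (fun i => / (nu + 1 + INR i)) n) * icoef nu n)%R).
  { transitivity (- psi (nu + 1) * icoef nu n + - rsum (fun i => / (nu + 1 + INR i)) n * icoef nu n)%R; [|ring]. rewrite EI. unfold Rdiv. ring. }
  transitivity (RtoC (rg (nu + 1) * (- (psi (nu + 1) + rsum (fun i => / (nu + 1 + INR i)) n) * icoef nu n))%R * w ^ n).
  - rewrite <- EC. rewrite RtoC_mult, RtoC_minus, !RtoC_plus, !RtoC_mult, RtoC_opp. ring.
  - replace (rg (nu + 1) * (- (psi (nu + 1) + rsum (fun i => / (nu + 1 + INR i)) n) * icoef nu n))%R
      with (- (psi (nu + 1) + rsum (fun i => / (nu + 1 + INR i)) n) * (rg (nu + 1) * icoef nu n))%R by ring.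
    rewrite <- rg_icoef by auto. unfold Rdiv, Cdiv. rewrite !RtoC_mult, RtoC_inv by apply INR_fact_neq_0. ring.
Qed.

Lemma RtoC_inv_total (x : R) : RtoC (/ x) = / RtoC x.
Proof. destruct (Req_dec x 0) as [->|H]; [now rewrite Rinv_0, Cinv_0 | now apply RtoC_inv]. Qed.

Lemma pFq_Useries (nu : R) (x : C) : pFq [RtoC nu; nu + (1 / 2)%R] [nu + 1; nu + 1; 2 * nu + 1] x = Useries nu x.
Proof.
  assert (H : forall k, Cprod (map (fun al => poch al k) [RtoC nu; nu + (1 / 2)%R]) / Cprod (map (fun be => poch be k) [nu + 1; nu + 1; 2 * nu + 1]) * (x ^ k / INR (fact k)) = ucoef nu k * x ^ k).
  { intros k. unfold Cprod. simpl map. simpl fold_right.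
    rewrite <- RtoC_mult, <- !RtoC_plus, !poch_RtoC. unfold ucoef, Rdiv, Cdiv. rewrite (RtoC_mult _ (/ _)), RtoC_inv_total, !RtoC_mult, !Cinv_total_mult.
    assert (H1 : / RtoC 1 = 1) by (rewrite <- RtoC_inv by lra; now rewrite Rinv_1). rewrite H1. ring. }
  unfold pFq, Useries, CSeries. f_equal; apply Series_ext; intros k; now rewrite H.
Qed.

(** The value of the G-function is left as a parameter, so that it can be passed to the limit
    together with the order. *)
Definition closed_form (nu : R) (z g : C) : C :=
  BesselI nu z / (4 * sqrt PI) * g
       + BesselK nu z * Cpower (z / 2) (2 * nu) / (2 * nu * Cgamma (nu + 1) ^ 2)
         * pFq [RtoC nu; nu + (1 / 2)%R] [nu + 1; nu + 1; 2 * nu + 1] (z ^ 2).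

(** Minus the sum of all residues, the loop being clockwise: the double pole 0, the integers from 1
    on, and the family [nu + k]. *)
Definition gval (nu : R) (L : C) : C :=
  - (res0 nu L + (sqrt PI / nu)%R * Vseries nu (Cexp (2 * L)) + res1 nu L * Useries nu (Cexp (2 * L))).

Lemma Cln_half (z : C) : z <> 0 -> Cln (z / 2) = Cln z - ln 2.
Proof.
  intros Hz. pose proof (Cln_scale z (/ 2) Hz ltac:(lra)) as H. rewrite ln_Rinv, RtoC_opp in H by lra.
  unfold Cdiv. rewrite <- RtoC_inv by lra. exact H.
Qed.

Lemma nonint_sqr_neq (nu : R) : nonint nu -> forall k : nat, (nu ^ 2 <> INR k ^ 2)%R.
Proof.
  intros NI k E. assert ((nu - INR k) * (nu + INR k) = 0)%R by (simpl in E; lra).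
  apply Rmult_integral in H. destruct H as [H|H]; [|now apply (nonint_plus nu k)].
  apply (NI (Z.of_nat k)). rewrite <- INR_IZR_INZ. lra.
Qed.

Lemma nonint_sin_neq (nu : R) : nonint nu -> (sin (PI * nu) <> 0)%R.
Proof.
  intros NI E. apply sin_eq_0_0 in E. destruct E as [k Hk]. apply (NI k). pose proof PI_RGT_0. apply Rmult_eq_reg_l with PI; lra.
Qed.

(** The residues at [nu + k] cancel the [I_nu] part of [K_nu]. The [I_{-nu}] part, after reflection
    removes [rg (1 - nu)], is the [U] term of [Iser'_pser]; the residues at the integers give its
    [V] term and the logarithmic and digamma terms. *)
Lemma closed_form_nonint (nu : R) (z : C) : (0 < nu)%R -> nonint nu -> (0 < Re z)%R ->
  closed_form nu z (gval nu (Cln z)) = - (/ (2 * nu))%R * Ibes' nu (Cln (z / 2)).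
Proof.
  intros Hnu NI Hz. apply neq_0_Re in Hz. pose proof PI_RGT_0 as HPI. pose proof (nonint_sin_neq nu NI) as Hsin.
  unfold closed_form. rewrite pFq_Useries, BesselI_Ibes, BesselK_nonint_eq, BesselK_nonint_real, Cgamma_rgam by auto.
  set (l := Cln (z / 2)). unfold Cpower. fold l.
  assert (EL : Cln z = l + ln 2) by (unfold l; rewrite Cln_half by auto; ring).
  set (w := Cexp (2 * l)).
  assert (E4 : Cexp (2 * Cln z) = 4 * w).
  { rewrite EL. replace (2 * (l + ln 2)) with (2 * l + (ln 2 + ln 2)) by ring. rewrite Cexp_plus, Cexp_plus, Cexp_RtoC, exp_ln by lra. unfold w.
    replace (RtoC 4) with (RtoC 2 * 2) by (rewrite <- RtoC_mult; f_equal; ring). ring. }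
  assert (Ez : z ^ 2 = 4 * w).
  { rewrite <- E4. replace (2 * Cln z) with (Cln z + Cln z) by ring. rewrite Cexp_plus, Cexp_Cln by auto. simpl. ring. }
  rewrite Ez. unfold gval, res0, res1. rewrite E4.
  assert (ER : Cexp (2 * nu * Cln z - (2 * nu * ln 2)%R) = Cexp (nu * l) * Cexp (nu * l)).
  { rewrite <- Cexp_plus, EL. f_equal. rewrite !RtoC_mult. ring. }
  rewrite ER. replace (2 * nu * l) with (nu * l + nu * l) by ring. rewrite Cexp_plus.
  unfold Ibes', Ibes. fold w. rewrite Iser'_pser by auto.
  destruct (nonint_dist nu NI) as (d & Hd & HD).
  assert (N1 : forall k : nat, (nu + 1 + INR k <> 0)%R) by (intros k; pose proof (pos_INR k); lra).
  assert (N2 : forall k : nat, (- nu + 1 + INR k <> 0)%R).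
  { intros k. replace (- nu + 1 + INR k)%R with (1 - nu + INR k)%R by ring. apply nonint_plus, nonint_1_minus, NI. }
  assert (X1 : expb (icoef nu)) by (apply (expb_icoef nu 1); [lra|]; intros k; pose proof (pos_INR k); rewrite Rabs_pos_eq; lra).
  assert (X2 : expb (icoef (- nu))) by (apply (expb_icoef _ d); auto; intros k; replace (- nu + 1 + INR k)%R with (1 - nu + INR k)%R by ring; auto).
  rewrite !Iser_pser by auto. rewrite <- RtoC_plus, rgam_rg.
  replace (1 + nu)%R with (nu + 1)%R by ring.
  set (Y1 := pser (icoef nu) w). set (Y2 := pser (icoef (- nu)) w). set (U := Useries nu (4 * w)). set (V := Vseries nu (4 * w)).
  assert (RF := rg_reflection nu (nonint_sqr_neq nu NI)). replace (1 + nu)%R with (nu + 1)%R in RF by ring. replace (1 - nu)%R with (- nu + 1)%R in RF by ring.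
  pose proof (rg_pos (nu + 1) ltac:(lra)) as P. set (r := rg (nu + 1)) in *.
  assert (RF2 : rg (- nu + 1) = (sin (PI * nu) / (PI * nu * r))%R) by (apply Rmult_eq_reg_l with r; [rewrite RF; field; lra | lra]).
  rewrite RF2. rewrite RtoC_opp. replace (- RtoC nu * l) with (- (nu * l)) by ring. rewrite Cexp_opp.
  pose proof (Cexp_neq_0 (nu * l)) as He. set (e := Cexp (nu * l)) in *.
  pose proof sqrt_PI_pos as HS. set (q := sqrt PI) in *. set (ps := psi (nu + 1)). set (sn := sin (PI * nu)) in *.
  rewrite EL.
  assert (C1 : RtoC nu <> 0) by (apply RtoC_neq_0; lra). assert (C2 : RtoC sn <> 0) by now apply RtoC_neq_0.
  assert (C3 : RtoC r <> 0) by (apply RtoC_neq_0; lra). assert (C4 : RtoC q <> 0) by (apply RtoC_neq_0; lra).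
  assert (C5 : RtoC PI <> 0) by (apply RtoC_neq_0; lra). assert (C6 : RtoC 2 <> 0) by (apply RtoC_neq_0; lra).
  unfold Rdiv, Cdiv. repeat (rewrite RtoC_mult || rewrite RtoC_inv_total || rewrite RtoC_plus || rewrite RtoC_minus).
  replace (RtoC 4) with (RtoC 2 * 2) by (rewrite <- RtoC_mult; f_equal; ring).
  field. auto 10.
Qed.

(** * Continuity of the loop integral in the order *)

Lemma cv_psum (u : nat -> nat -> C) (v : nat -> C) N : (forall k, cv (fun j => u j k) (v k)) -> cv (fun j => psum (u j) N) (psum v N).
Proof. intros H. induction N; simpl; [apply cv_const | now apply cv_plus]. Qed.

(** Both series are cut where the tail of the majorant is below [eps / 4]. Domination is asked only
    from some index on, because the bound on the integrands is obtained near the limit order. *)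
Lemma cv_tannery (u : nat -> nat -> C) (v : nat -> C) (l : nat -> C) (l0 : C) (M : nat -> R) :
  (forall j, cser (u j) (l j)) -> cser v l0 -> ex_series M -> (forall k, 0 <= M k)%R ->
  (exists J, forall j, (J <= j)%nat -> forall k, (Cmod (u j k) <= M k)%R) -> (forall k, (Cmod (v k) <= M k)%R) ->
  (forall k, cv (fun j => u j k) (v k)) -> cv l l0.
Proof.
  intros Hu Hv HM HM0 [J HJ] Hv' Hk. apply cv_Cmod. apply is_lim_seq_spec. intros eps. pose proof (cond_pos eps) as He.
  pose proof (rsum_Series_lim M HM) as HL. apply is_lim_seq_spec in HL.
  assert (He4 : (0 < eps / 4)%R) by lra. destruct (HL (mkposreal _ He4)) as [N HN]. specialize (HN N (le_n N)). simpl in HN.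
  pose proof (cv_psum u v N Hk) as HP. apply cv_Cmod in HP. apply is_lim_seq_spec in HP. destruct (HP (mkposreal _ He4)) as [J' HJ'].
  exists (max J J'). intros j Hj. specialize (HJ' j ltac:(lia)). simpl in HJ'. rewrite Rminus_0_r, Rabs_pos_eq in * by apply Cmod_ge_0.
  assert (T1 : (Cmod (l j - psum (u j) N) <= (Series M - rsum M N) * 1)%R).
  { apply cser_tail; auto; [|lra]. intros k. rewrite Rmult_1_r. apply HJ. lia. }
  assert (T2 : (Cmod (l0 - psum v N) <= (Series M - rsum M N) * 1)%R).
  { apply cser_tail; auto; [|lra]. intros k. rewrite Rmult_1_r. apply Hv'. }
  replace (l j - l0) with ((l j - psum (u j) N) + (psum (u j) N - psum v N) - (l0 - psum v N)) by ring.
  pose proof (Cmod_triangle_minus ((l j - psum (u j) N) + (psum (u j) N - psum v N)) (l0 - psum v N)).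
  pose proof (Cmod_triangle (l j - psum (u j) N) (psum (u j) N - psum v N)). apply Rabs_def2 in HN. lra.
Qed.

Definition on_border (a b c d : R) (s : C) : Prop :=
  (a <= Re s <= b)%R /\ (c <= Im s <= d)%R /\ (Re s = a \/ Re s = b \/ Im s = c \/ Im s = d).

Lemma border_bounded (f : C -> C) (a b c d : R) : (a <= b)%R -> (c <= d)%R ->
  (forall s, on_border a b c d s -> holo f s) -> exists B, (0 <= B)%R /\ forall s, on_border a b c d s -> (Cmod (f s) <= B)%R.
Proof.
  intros Hab Hcd H.
  assert (V : forall x, x = a \/ x = b -> exists B, (0 <= B)%R /\ forall t, (c <= t <= d)%R -> (Cmod (f (x, t)) <= B)%R).
  { intros x Hx. apply (bounded_on_segment (fun t : R => f (x, t))). intros t Ht. apply holo_continuous_v, H.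
    unfold on_border, Re, Im; simpl. intuition lra. }
  assert (W : forall y, y = c \/ y = d -> exists B, (0 <= B)%R /\ forall t, (a <= t <= b)%R -> (Cmod (f (t, y)) <= B)%R).
  { intros y Hy. apply (bounded_on_segment (fun t : R => f (t, y))). intros t Ht. apply holo_continuous_h, H.
    unfold on_border, Re, Im; simpl. intuition lra. }
  destruct (V a (or_introl eq_refl)) as (B1 & P1 & Q1). destruct (V b (or_intror eq_refl)) as (B2 & P2 & Q2).
  destruct (W c (or_introl eq_refl)) as (B3 & P3 & Q3). destruct (W d (or_intror eq_refl)) as (B4 & P4 & Q4).
  exists (B1 + B2 + B3 + B4)%R. split; [lra|]. intros [x y] (Hx & Hy & Hb). unfold Re, Im in *; simpl in *.
  destruct Hb as [-> | [-> | [-> | ->]]]; [specialize (Q1 y Hy) | specialize (Q2 y Hy) | specialize (Q3 x Hx) | specialize (Q4 x Hx)]; lra.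
Qed.

Lemma holo_border_intro (f : C -> C) (a b c d : R) : (a <= b)%R -> (c <= d)%R ->
  (forall s, on_border a b c d s -> holo f s) -> holo_border f a b c d.
Proof.
  intros Hab Hcd H. split; intros t Ht; split; apply H; unfold on_border, Re, Im; simpl; intuition lra.
Qed.

Definition fGh (L s : C) : C := Cexp (2 * s * L) / (s * s * rgam (1 - s) * rgam ((1 / 2)%R + s)).

Lemma fG_fGh nu L s : fG nu L s = fGh L s * (rgam (1 + nu + s) * / rgam (nu - s)).
Proof. unfold fG, fGh, Cdiv. rewrite !Cinv_total_mult. ring. Qed.

(** The limit on [h] keeps [b] at least [/ (2 A)] away from 0, half of the lower bound known for
    [b0]. *)
Lemma quotient_lip (a a0 b b0 : C) (K A h : R) : (1 <= K)%R -> (1 <= A)%R -> (0 <= h <= / (2 * K * A))%R -> b0 <> 0 ->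
  (Cmod (a - a0) <= K * h)%R -> (Cmod (b - b0) <= K * h)%R -> (Cmod a0 <= K)%R -> (Cmod (/ b0) <= A)%R ->
  (Cmod (a * / b - a0 * / b0) <= (2 * A * K + 2 * A * A * K * K) * h)%R.
Proof.
  intros HK HA Hh Nb H1 H2 H3 H4.
  assert (HKA : (0 < 2 * K * A)%R) by nra.
  assert (Hh2 : (K * h <= / (2 * A))%R).
  { apply Rle_trans with (K * / (2 * K * A))%R; [apply Rmult_le_compat_l; lra|]. right. field. lra. }
  assert (Pb0 : (0 < Cmod b0)%R) by now apply Cmod_gt_0.
  assert (Lb0 : (/ A <= Cmod b0)%R).
  { rewrite Cmod_inv_total in H4. rewrite <- (Rinv_inv (Cmod b0)). apply Rinv_le_contravar; auto. now apply Rinv_0_lt_compat. }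
  assert (Lb : (/ (2 * A) <= Cmod b)%R).
  { pose proof (Cmod_triangle_inv b0 b) as T. rewrite (Cmod_minus_sym b0 b) in T.
    replace (/ A)%R with (/ (2 * A) + / (2 * A))%R in Lb0 by (field; lra). lra. }
  assert (P2A : (0 < / (2 * A))%R) by (apply Rinv_0_lt_compat; lra).
  assert (Nb' : b <> 0) by (intros E; rewrite E, Cmod_0 in Lb; lra).
  assert (Ib : (Cmod (/ b) <= 2 * A)%R).
  { rewrite Cmod_inv_total, <- (Rinv_inv (2 * A)). now apply Rinv_le_contravar. }
  replace (a * / b - a0 * / b0) with ((a - a0) * / b + a0 * (b0 - b) * (/ b * / b0)) by (field; auto).
  eapply Rle_trans; [apply Cmod_triangle|]. rewrite !Cmod_mult, (Cmod_minus_sym b0 b).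
  pose proof (Cmod_ge_0 (a - a0)). pose proof (Cmod_ge_0 (b - b0)). pose proof (Cmod_ge_0 a0). pose proof (Cmod_ge_0 (/ b)). pose proof (Cmod_ge_0 (/ b0)).
  assert (X1 : (Cmod (a - a0) * Cmod (/ b) <= K * h * (2 * A))%R) by (apply Rmult_le_compat; auto).
  assert (X2 : (Cmod a0 * Cmod (b - b0) <= K * (K * h))%R) by (apply Rmult_le_compat; auto).
  assert (X3 : (Cmod (/ b) * Cmod (/ b0) <= 2 * A * A)%R) by (apply Rmult_le_compat; auto).
  assert (X4 : (Cmod a0 * Cmod (b - b0) * (Cmod (/ b) * Cmod (/ b0)) <= K * (K * h) * (2 * A * A))%R).
  { apply Rmult_le_compat; auto; now apply Rmult_le_pos. }
  lra.
Qed.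

(** The order enters only through [rgam (1 + nu + s) / rgam (nu - s)]. Both factors are Lipschitz on
    a disc, and on the compact border the denominator at [nu] is bounded away from 0. *)
Lemma fG_order_lip (nu : R) (L : C) (a b c d : R) : (0 < nu)%R -> (a <= b)%R -> (c <= d)%R ->
  (forall s, on_border a b c d s -> offpole nu s) ->
  exists dl K, (0 < dl)%R /\ (0 <= K)%R /\ forall (mu : R) s, (Rabs (mu - nu) <= dl)%R -> on_border a b c d s ->
    (Cmod (fG mu L s - fG nu L s) <= K * Rabs (mu - nu))%R.
Proof.
  intros Hnu Hab Hcd HO.
  destruct (border_bounded (fGh L) a b c d Hab Hcd) as (H & H0 & HH).
  { intros s Hs. destruct (offpole_neq nu s (HO s Hs)) as (A & B & C0 & D). unfold fGh, Cdiv. apply holo_mult.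
    - apply holo_Cexp. repeat (apply holo_mult || apply holo_const || apply holo_id).
    - apply holo_inv; [repeat apply Cmult_neq_0; auto|].
      repeat apply holo_mult; try apply holo_id; apply holo_rgam; repeat (apply holo_minus || apply holo_plus || apply holo_const || apply holo_id). }
  destruct (border_bounded (fun s => / rgam (nu - s)) a b c d Hab Hcd) as (A & A0 & HA).
  { intros s Hs. destruct (offpole_neq nu s (HO s Hs)) as (_ & _ & C0 & _). apply holo_inv; auto.
    apply holo_rgam. repeat (apply holo_minus || apply holo_const || apply holo_id). }
  destruct (border_bounded (fun s => s) a b c d Hab Hcd) as (S & S0 & HS); [intros; apply holo_id|].
  destruct (rgam_c11 (S + nu + 3) ltac:(lra)) as (K & K0 & K1 & _ & K3 & _).
  set (K' := (K + 1)%R). set (A' := (A + 1)%R).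
  assert (HKA : (0 < 2 * K' * A')%R) by (unfold K', A'; nra).
  exists (Rmin 1 (/ (2 * K' * A'))), (H * (2 * A' * K' + 2 * A' * A' * K' * K'))%R.
  split; [apply Rmin_pos; [lra | now apply Rinv_0_lt_compat]|].
  assert (HC : (0 <= 2 * A' * K' + 2 * A' * A' * K' * K')%R).
  { assert (0 <= A' * K')%R by (unfold A', K'; nra). nra. }
  split; [apply Rmult_le_pos; auto|]. intros mu s Hmu Hs.
  assert (M1 : (Rabs (mu - nu) <= 1)%R) by (eapply Rle_trans; [exact Hmu | apply Rmin_l]).
  assert (M2 : (Rabs (mu - nu) <= / (2 * K' * A'))%R) by (eapply Rle_trans; [exact Hmu | apply Rmin_r]).
  specialize (HH s Hs). specialize (HA s Hs). specialize (HS s Hs). cbv beta in HA, HS.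
  destruct (offpole_neq nu s (HO s Hs)) as (_ & _ & C0 & _).
  assert (Hm : (Cmod mu <= nu + 1)%R) by (rewrite Cmod_R; apply Rabs_le_between' in M1; apply Rabs_le; lra).
  assert (Hn : (Cmod nu <= nu + 1)%R) by (rewrite Cmod_nonneg; lra).
  assert (D1 : forall x : R, (Cmod x <= nu + 1)%R -> (Cmod (1 + x + s) <= S + nu + 3)%R).
  { intros x Hx. pose proof (Cmod_triangle (1 + x) s). pose proof (Cmod_triangle 1 x) as T. rewrite Cmod_1 in T. lra. }
  assert (D2 : forall x : R, (Cmod x <= nu + 1)%R -> (Cmod (x - s) <= S + nu + 3)%R).
  { intros x Hx. pose proof (Cmod_triangle_minus x s). lra. }
  rewrite !fG_fGh. replace (fGh L s * (rgam (1 + mu + s) * / rgam (mu - s)) - fGh L s * (rgam (1 + nu + s) * / rgam (nu - s))) with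
    (fGh L s * (rgam (1 + mu + s) * / rgam (mu - s) - rgam (1 + nu + s) * / rgam (nu - s))) by ring.
  rewrite Cmod_mult, Rmult_assoc. apply Rmult_le_compat; auto using Cmod_ge_0.
  assert (Hd : Cmod (mu - nu) = Rabs (mu - nu)) by (rewrite <- RtoC_minus; apply Cmod_R).
  pose proof (Rabs_pos (mu - nu)) as Hp.
  apply quotient_lip; auto; try (unfold K', A'; lra).
  - eapply Rle_trans; [apply K3; auto|]. replace (1 + mu + s - (1 + nu + s)) with (mu - nu) by ring. rewrite Hd. apply Rmult_le_compat_r; unfold K'; lra.
  - eapply Rle_trans; [apply K3; auto|]. replace (mu - s - (nu - s)) with (mu - nu) by ring. rewrite Hd. apply Rmult_le_compat_r; unfold K'; lra.
  - apply Rle_trans with K; [now apply K1, D1 | unfold K'; lra].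
Qed.

Definition box (nu : R) (L : C) (sigma : R) (k : nat) : C := rect_int (fG nu L) (sigma + INR k) (sigma + INR k + 1) (-1) 1.

Lemma rect_box (nu : R) (L : C) (sigma : R) N : (- (1 / 2) < sigma)%R ->
  rect_int (fG nu L) sigma (sigma + INR N) (-1) 1 = psum (box nu L sigma) N.
Proof.
  intros Hs. induction N.
  - simpl. rewrite Rplus_0_r. unfold rect_int, hseg, vseg. rewrite !RInt_point. change (@zero _) with (RtoC 0). ring.
  - pose proof (pos_INR N).
    assert (HI : forall x y, (sigma <= x)%R -> y <> 0%R -> holo (fG nu L) (x, y)).
    { intros; apply holo_fG, offpole_im; auto. unfold Re; simpl. lra. }
    rewrite S_INR. rewrite (rect_int_split_h _ _ (sigma + INR N)) by (try (intros; apply HI); lra).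
    rewrite IHN. simpl. unfold box. now replace (sigma + (INR N + 1))%R with (sigma + INR N + 1)%R by ring.
Qed.

Lemma on_border_offpole (nu sigma d : R) (k : nat) (s : C) : (0 < nu)%R -> pole_dist nu sigma d ->
  on_border (sigma + INR k) (sigma + INR k + 1) (-1) 1 s -> offpole nu s.
Proof.
  intros Hnu HP (H1 & H2 & H3). pose proof (pos_INR k). destruct s as [x y]. unfold Re, Im in *; simpl in *.
  destruct H3 as [-> | [-> | [-> | ->]]].
  - now apply pole_dist_offpole with d.
  - replace (sigma + INR k + 1)%R with (sigma + INR (S k))%R by (rewrite S_INR; ring). now apply pole_dist_offpole with d.
  - apply offpole_im; unfold Re, Im; simpl; destruct HP; lra.
  - apply offpole_im; unfold Re, Im; simpl; destruct HP; lra.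
Qed.

(** Only the border of the cell enters, and it stays clear of the poles for all orders considered,
    although inside the cell two poles may merge. *)
Lemma box_lip (nu : R) (L : C) (sigma d d' e : R) (k : nat) : (0 < e < nu)%R -> (forall mu, (Rabs (mu - nu) <= e)%R -> pole_dist mu sigma d) ->
  exists dl K, (0 < dl)%R /\ (0 <= K)%R /\ forall mu : R, (Rabs (mu - nu) <= dl)%R -> (Cmod (box mu L sigma k - box nu L sigma k) <= K * Rabs (mu - nu))%R.
Proof.
  intros He HP. set (a := (sigma + INR k)%R). set (b := (sigma + INR k + 1)%R). assert (Hab : (a <= b)%R) by (unfold a, b; lra).
  assert (HO : forall mu s, (Rabs (mu - nu) <= e)%R -> on_border a b (-1) 1 s -> offpole mu s).
  { intros mu s Hmu Hs. apply (on_border_offpole mu sigma d k); auto. apply Rabs_le_between' in Hmu. lra. }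
  assert (Hnn : (Rabs (nu - nu) <= e)%R) by (rewrite Rminus_diag, Rabs_R0; lra).
  destruct (fG_order_lip nu L a b (-1) 1) as (dl & K & Hdl & HK & H); auto; try lra.
  exists (Rmin dl e), (2 * ((b - a) + (1 - -1)) * K)%R. split; [apply Rmin_pos; lra|].
  split; [apply Rmult_le_pos; auto; lra|]. intros mu Hmu.
  assert (M1 : (Rabs (mu - nu) <= dl)%R) by (eapply Rle_trans; [exact Hmu | apply Rmin_l]).
  assert (M2 : (Rabs (mu - nu) <= e)%R) by (eapply Rle_trans; [exact Hmu | apply Rmin_r]).
  assert (B1 : holo_border (fG mu L) a b (-1) 1) by (apply holo_border_intro; auto; try lra; intros s Hs; apply holo_fG; eauto).
  assert (B2 : holo_border (fG nu L) a b (-1) 1) by (apply holo_border_intro; auto; try lra; intros s Hs; apply holo_fG; eauto).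
  unfold box. change (sigma + INR k + 1)%R with b. fold a. replace (rect_int (fG mu L) a b (-1) 1 - rect_int (fG nu L) a b (-1) 1) with
    (rect_int (fG mu L) a b (-1) 1 + (- (1)) * rect_int (fG nu L) a b (-1) 1) by ring.
  rewrite <- (rect_int_lin (fG mu L) (fG nu L) (- (1)) a b (-1) 1) by (auto; lra). rewrite Rmult_assoc. apply rect_int_bound; auto; try lra.
  - apply holo_border_intro; auto; try lra. intros s Hs. apply holo_plus; [apply holo_fG; eauto | apply holo_mult; [apply holo_const | apply holo_fG; eauto]].
  - intros x y Hx Hy Hb. replace (fG mu L (x, y) + - (1) * fG nu L (x, y)) with (fG mu L (x, y) - fG nu L (x, y)) by ring.
    apply H; auto. unfold on_border, Re, Im; simpl. intuition lra.
Qed.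

(** Shifting back to the first cell leaves a bound that depends on the order only through [B] and
    [d], hence a common majorant. The factor 6 is the perimeter of the cell. *)
Lemma box_bound (nu : R) (L : C) (sigma d B : R) (k : nat) : (0 < nu)%R -> pole_dist nu sigma d -> (d <= 1)%R ->
  (forall s, on_border sigma (sigma + 1) (-1) 1 s -> (Cmod (fG nu L s) <= B)%R) ->
  (Cmod (box nu L sigma k) <= 6 * B * ((2 * Cmod (Cexp (2 * L)) / d) ^ k / INR (fact k)))%R.
Proof.
  intros Hnu HP Hd1 HB. pose proof HP as (Hs & Hd & _).
  set (q := ((2 * Cmod (Cexp (2 * L)) / d) ^ k / INR (fact k))%R).
  assert (Hq : (0 <= q)%R).
  { unfold q. apply Rdiv_le_0_compat; [|apply INR_fact_lt_0]. apply pow_le. apply Rdiv_le_0_compat; auto. pose proof (Cmod_ge_0 (Cexp (2 * L))). lra. }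
  unfold box. replace (6 * B * q)%R with (2 * ((sigma + INR k + 1 - (sigma + INR k)) + (1 - -1)) * (B * q))%R by ring.
  apply rect_int_bound; try lra.
  - apply holo_border_intro; try lra. intros s H. apply holo_fG, (on_border_offpole nu sigma d k); auto.
  - intros x y Hx Hy Hb.
    assert (H0 : on_border sigma (sigma + 1) (-1) 1 ((x - INR k)%R, y)).
    { unfold on_border, Re, Im; simpl. intuition lra. }
    assert (EO : forall j : nat, (((x - INR k)%R, y) : C) + INR j = ((x - INR k + INR j)%R, y)) by (intros j; unfold Cplus, RtoC; simpl; f_equal; ring).
    replace (((x, y)) : C) with ((((x - INR k)%R, y) : C) + INR k) by (rewrite EO; f_equal; ring).
    eapply Rle_trans; [apply (fG_shift_bound nu L _ d); auto|].
    + unfold Re; simpl. lra.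
    + intros j. rewrite EO. apply (on_border_offpole nu sigma d j); auto. unfold on_border, Re, Im in *; simpl in *. intuition lra.
    + intros j. destruct H0 as (A1 & A2 & A3). unfold Re, Im in A1, A2, A3; simpl in A1, A2, A3.
      (* On the horizontal sides the height 1 alone gives the distance, because [d <= 1]. *)
      assert (IM : (Rabs y = 1 -> d <= Cmod ((((x - INR k)%R, y) : C) + INR j + 1 - nu))%R).
      { intros E. eapply Rle_trans; [|apply im_le_Cmod]. unfold Im; simpl. replace (y + 0 + 0 + - 0)%R with y by ring. lra. }
      destruct A3 as [E | [E | [E | E]]].
      * rewrite E. now apply pole_dist_bound.
      * rewrite E. replace ((((sigma + 1)%R, y) : C) + INR j) with (((sigma, y) : C) + INR (S j)) by (rewrite S_INR; unfold Cplus, RtoC; simpl; f_equal; ring).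
        now apply pole_dist_bound.
      * apply IM. rewrite E. rewrite Rabs_left; lra.
      * apply IM. rewrite E. apply Rabs_R1.
    + fold q. apply Rmult_le_compat_r; auto.
Qed.

Lemma is_loop_integral_unique (f : C -> C) (sigma c1 c2 : R) (l l' : C) :
  is_loop_integral f sigma c1 c2 l -> is_loop_integral f sigma c1 c2 l' -> l = l'.
Proof.
  intros (l1 & l2 & l3 & A & B & D & ->) (k1 & k2 & k3 & A' & B' & D' & ->).
  assert (E1 : l1 = k1) by (rewrite <- (is_RInt_gen_unique (V := CCV) _ _ A); apply (is_RInt_gen_unique (V := CCV) _ _ A')).
  assert (E3 : l3 = k3) by (rewrite <- (is_RInt_gen_unique (V := CCV) _ _ D); apply (is_RInt_gen_unique (V := CCV) _ _ D')).
  apply is_RInt_C_unique in B. apply is_RInt_C_unique in B'. congruence.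
Qed.

(** * Integral order *)

Lemma holo_cv (f : C -> C) (u : nat -> C) (a : C) : holo f a -> cv u a -> cv (fun n => f (u n)) (f a).
Proof.
  intros [f' H] Hu. destruct (holoD_at f f' a H) as (r & K & Hr & HK & H1 & _).
  apply cv_Cmod in Hu. apply cv_Cmod. apply is_lim_seq_le_le_loc with (u := fun _ => 0%R) (w := fun n => (K * Cmod (u n - a))%R).
  - apply is_lim_seq_spec in Hu. destruct (Hu (mkposreal r Hr)) as [N HN]. exists N. intros n Hn. split; [apply Cmod_ge_0|].
    apply H1. specialize (HN n Hn). simpl in HN. rewrite Rminus_0_r, Rabs_pos_eq in HN by apply Cmod_ge_0. exact HN.
  - apply is_lim_seq_const.
  - replace (Finite 0) with (Rbar_mult K 0%R) by (simpl; f_equal; ring). now apply is_lim_seq_scal_l.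
Qed.

Lemma holoD_cv' (f f' : C -> C) (u : nat -> C) (a : C) : holoD f f' a -> cv u a -> cv (fun n => f' (u n)) (f' a).
Proof.
  intros H Hu. destruct (holoD_f'_lip f f' a H) as (r & K & Hr & HK & H1).
  apply cv_Cmod in Hu. apply cv_Cmod. apply is_lim_seq_le_le_loc with (u := fun _ => 0%R) (w := fun n => (K * Cmod (u n - a))%R).
  - apply is_lim_seq_spec in Hu. destruct (Hu (mkposreal r Hr)) as [N HN]. exists N. intros n Hn. split; [apply Cmod_ge_0|].
    apply H1. specialize (HN n Hn). simpl in HN. rewrite Rminus_0_r, Rabs_pos_eq in HN by apply Cmod_ge_0. exact HN.
  - apply is_lim_seq_const.
  - replace (Finite 0) with (Rbar_mult K 0%R) by (simpl; f_equal; ring). now apply is_lim_seq_scal_l.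
Qed.

Lemma rpoch_lim (u : nat -> R) (a : R) k : is_lim_seq u a -> is_lim_seq (fun j => rpoch (u j) k) (rpoch a k).
Proof.
  intros H. induction k; simpl; [apply is_lim_seq_const|].
  apply is_lim_seq_mult'; [exact IHk|]. apply is_lim_seq_plus'; [exact H | apply is_lim_seq_const].
Qed.

Lemma ucoef_lim (u : nat -> R) (a : R) k : (0 < a)%R -> is_lim_seq u a -> is_lim_seq (fun j => ucoef (u j) k) (ucoef a k).
Proof.
  intros Ha H. unfold ucoef.
  assert (D : forall c, is_lim_seq (fun j => (u j + c)%R) (a + c)%R) by (intros c; apply is_lim_seq_plus'; [exact H | apply is_lim_seq_const]).
  assert (D2 : is_lim_seq (fun j => (2 * u j + 1)%R) (2 * a + 1)%R).
  { apply is_lim_seq_plus'; [|apply is_lim_seq_const]. apply is_lim_seq_mult'; [apply is_lim_seq_const | exact H]. }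
  apply is_lim_seq_div'.
  - apply is_lim_seq_mult'; apply rpoch_lim; auto.
  - repeat apply is_lim_seq_mult'; try apply is_lim_seq_const; apply rpoch_lim; auto.
  - pose proof (rpoch_pos (a + 1) k ltac:(lra)). pose proof (rpoch_pos (2 * a + 1) k ltac:(lra)). pose proof (INR_fact_lt_0 k).
    repeat apply Rmult_integral_contrapositive_currified; lra.
Qed.

Lemma Useries_cv (u : nat -> R) (a : R) (x : C) : (0 < a)%R -> (forall j, (0 < u j)%R) -> is_lim_seq u a -> cv (fun j => Useries (u j) x) (Useries a x).
Proof.
  intros Ha Hu H. apply cv_tannery with (u := fun j k => ucoef (u j) k * x ^ k) (v := fun k => ucoef a k * x ^ k) (M := fun k => (1 * (Cmod x ^ k / INR (fact k)))%R).
  - intros j. now apply cser_pser, expb_ucoef.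
  - now apply cser_pser, expb_ucoef.
  - apply ex_series_exp.
  - intros k. rewrite Rmult_1_l. apply Rdiv_le_0_compat; [apply pow_le, Cmod_ge_0 | apply INR_fact_lt_0].
  - exists O. intros j _ k. rewrite Cmod_mult, Cmod_R, Cmod_pow. replace (1 * (Cmod x ^ k / INR (fact k)))%R with (/ INR (fact k) * Cmod x ^ k)%R by (unfold Rdiv; ring).
    apply Rmult_le_compat_r; [apply pow_le, Cmod_ge_0 | now apply ucoef_bound].
  - intros k. rewrite Cmod_mult, Cmod_R, Cmod_pow. replace (1 * (Cmod x ^ k / INR (fact k)))%R with (/ INR (fact k) * Cmod x ^ k)%R by (unfold Rdiv; ring).
    apply Rmult_le_compat_r; [apply pow_le, Cmod_ge_0 | now apply ucoef_bound].
  - intros k. apply cv_mult; [apply cv_RtoC; now apply ucoef_lim | apply cv_const].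
Qed.

Section IntegralOrder.

Variables (n : nat) (z : C).
Hypothesis n_pos : (1 <= n)%nat.
Hypothesis z_pos : (0 < Re z)%R.

(** Non-integral orders decreasing to [n]. The 10 keeps them within [1 / 10] of [n], so that the
    abscissa [- 1/4] and the distance [1 / 10] serve all of them. *)
Let mu (j : nat) : R := (INR n + / (10 + INR j))%R.

Lemma mu_bound j : (0 < mu j - INR n <= 1 / 10)%R.
Proof.
  unfold mu. pose proof (pos_INR j). replace (INR n + / (10 + INR j) - INR n)%R with (/ (10 + INR j))%R by ring.
  split; [apply Rinv_0_lt_compat; lra|]. replace (1 / 10)%R with (/ 10)%R by field. apply Rinv_le_contravar; lra.
Qed.

Lemma INR_n_pos : (1 <= INR n)%R.
Proof. now apply (le_INR 1). Qed.

Lemma mu_pos j : (0 < mu j)%R.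
Proof. pose proof (mu_bound j). pose proof INR_n_pos. lra. Qed.

Lemma mu_nonint j : nonint (mu j).
Proof.
  intros k E. pose proof (mu_bound j) as B. rewrite E, INR_IZR_INZ, <- minus_IZR in B.
  assert (0 < k - Z.of_nat n < 1)%Z; [|lia]. split; apply lt_IZR; lra.
Qed.

Lemma mu_lim : is_lim_seq mu (INR n).
Proof.
  unfold mu. apply is_lim_seq_eq with (INR n + 0)%R; [ring|]. apply is_lim_seq_plus'; [apply is_lim_seq_const|]. apply is_lim_seq_inv_INR_S.
Qed.

Lemma pole_dist_near (m : R) : (Rabs (m - INR n) <= 1 / 10)%R -> pole_dist m (- (1 / 4)) (1 / 10).
Proof.
  intros H. apply Rabs_le_between' in H. split; [lra|]. split; [lra|]. intros j.
  rewrite INR_IZR_INZ in H. set (k := (j - Z.of_nat n)%Z).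
  assert (E : IZR j = (IZR k + IZR (Z.of_nat n))%R) by (unfold k; rewrite minus_IZR; ring).
  destruct (Z_lt_le_dec k 1) as [Hk|Hk].
  - assert (IZR k <= 0)%R by (apply IZR_le; lia). rewrite Rabs_left1; lra.
  - apply IZR_le in Hk. rewrite Rabs_pos_eq; lra.
Qed.

(** At the integral order the loop integral exists by decay alone; Tannery's theorem on the series
    of cells identifies it with the limit of the residue sums, so no residue at a merged pole is
    computed. *)
Lemma gval_limit : exists g, cv (fun j => gval (mu j) (Cln z)) g /\
  forall s c1 c2, (- (1 / 2) < s < 0)%R -> (c1 < 0 < c2)%R -> is_loop_integral (fG (INR n) (Cln z)) s c1 c2 (2 * PI * Ci * g).
Proof.
  set (L := Cln z). pose proof INR_n_pos as Hn. pose proof PI_RGT_0 as HPI.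
  assert (P0 : pole_dist (INR n) (- (1 / 4)) (1 / 10)) by (apply pole_dist_near; rewrite Rminus_diag, Rabs_R0; lra).
  assert (Pj : forall j, (Rabs (mu j - INR n) <= 1 / 10)%R) by (intros j; pose proof (mu_bound j); rewrite Rabs_pos_eq; lra).
  destruct (fG_rect_cv (INR n) L _ _ ltac:(lra) P0) as [Rs HRs].
  assert (N2 : 2 * PI * Ci <> 0).
  { apply Cmult_neq_0; [rewrite <- RtoC_mult; apply RtoC_neq_0; lra|]. intros E. apply (f_equal Im) in E. unfold Im, Ci in E; simpl in E. lra. }
  exists (- Rs / (2 * PI * Ci)). split.
  - assert (HR : cv (fun j => - (2 * PI * Ci * gval (mu j) L)) Rs).
    { assert (HB : exists B, (0 <= B)%R /\ exists J, (forall j, (J <= j)%nat -> forall s, on_border (- (1 / 4)) (- (1 / 4) + 1) (-1) 1 s -> (Cmod (fG (mu j) L s) <= B)%R) /\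
         (forall s, on_border (- (1 / 4)) (- (1 / 4) + 1) (-1) 1 s -> (Cmod (fG (INR n) L s) <= B)%R)).
      { assert (HO : forall s, on_border (- (1 / 4)) (- (1 / 4) + 1) (-1) 1 s -> offpole (INR n) s).
        { intros s Hs. apply (on_border_offpole (INR n) (- (1 / 4)) (1 / 10) 0); auto; [lra|]. simpl. now rewrite Rplus_0_r. }
        destruct (border_bounded (fG (INR n) L) (- (1 / 4)) (- (1 / 4) + 1) (-1) 1) as (B & B0 & HB); [lra | lra | intros; now apply holo_fG, HO|].
        destruct (fG_order_lip (INR n) L (- (1 / 4)) (- (1 / 4) + 1) (-1) 1) as (dl & K & Hdl & HK & HL); [lra | lra | lra | exact HO |].
        exists (B + K)%R. split; [lra|].
        pose proof mu_lim as ML. apply is_lim_seq_spec in ML. destruct (ML (mkposreal dl Hdl)) as [J HJ]. exists J. split.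
        - intros j Hj s Hs. specialize (HJ j Hj). simpl in HJ. specialize (HL (mu j) s ltac:(lra) Hs). specialize (HB s Hs). specialize (Pj j).
          replace (fG (mu j) L s) with ((fG (mu j) L s - fG (INR n) L s) + fG (INR n) L s) by ring.
          eapply Rle_trans; [apply Cmod_triangle|]. nra.
        - intros s Hs. specialize (HB s Hs). lra. }
      destruct HB as (B & B0 & J & HJ & HB).
      apply (cv_tannery (fun j k => box (mu j) L (- (1 / 4)) k) (box (INR n) L (- (1 / 4))) _ _
        (fun k => 6 * B * ((2 * Cmod (Cexp (2 * L)) / (1 / 10)) ^ k / INR (fact k)))%R).
      - intros j. pose proof (mu_pos j) as Mp. pose proof (pole_dist_near _ (Pj j)) as PD.
        destruct (fG_rect_cv (mu j) L _ _ Mp PD) as [Rj HRj].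
        (* The same loop integral is evaluated twice, by cells and by residues; its uniqueness
           equates the results. *)
        assert (E : - Rj = 2 * PI * Ci * gval (mu j) L).
        { apply (is_loop_integral_unique (fG (mu j) L) (- (1 / 4)) (-1) 1).
          - apply (fG_loop (mu j) L _ _ Rj Mp PD HRj); lra.
          - apply fG_loop_nonint; auto using mu_nonint; lra. }
        rewrite <- E. eapply cv_eq; [|eapply cv_ext; [|exact HRj]]; [ring|]. intros N. cbv beta. rewrite rect_box by lra. reflexivity.
      - eapply cv_ext; [|exact HRs]. intros N. cbv beta. rewrite rect_box by lra. reflexivity.
      - apply ex_series_exp.
      - intros k. apply Rmult_le_pos; [lra|]. apply Rdiv_le_0_compat; [|apply INR_fact_lt_0]. apply pow_le. apply Rdiv_le_0_compat; [|lra].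
        pose proof (Cmod_ge_0 (Cexp (2 * L))). lra.
      - exists J. intros j Hj k. apply box_bound; auto using mu_pos, pole_dist_near; lra.
      - intros k. apply box_bound; auto; lra.
      - intros k. destruct (box_lip (INR n) L (- (1 / 4)) (1 / 10) 0 (1 / 10) k ltac:(lra) pole_dist_near) as (dl & K & Hdl & HK & HL).
        apply cv_Cmod. pose proof mu_lim as ML.
        apply is_lim_seq_le_le_loc with (u := fun _ => 0%R) (w := fun j => (K * Rabs (mu j - INR n))%R).
        + apply is_lim_seq_spec in ML. destruct (ML (mkposreal dl Hdl)) as [N HN]. exists N. intros j Hj. split; [apply Cmod_ge_0|].
          apply HL. specialize (HN j Hj). simpl in HN. lra.
        + apply is_lim_seq_const.
        + replace (Finite 0) with (Rbar_mult K (Rbar_abs (INR n - INR n)%R)) by (simpl; rewrite Rminus_diag, Rabs_R0; f_equal; ring).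
          apply is_lim_seq_scal_l, is_lim_seq_abs, is_lim_seq_minus'; [exact ML | apply is_lim_seq_const]. }
    apply (cv_mult _ _ _ _ (cv_const (- / (2 * PI * Ci)))) in HR.
    eapply cv_eq; [|eapply cv_ext; [|exact HR]].
    + unfold Cdiv. ring.
    + intros j. cbv beta. field. repeat split; auto; intros E; apply N2; rewrite E; ring.
  - intros s c1 c2 Hs Hc. replace (2 * PI * Ci * (- Rs / (2 * PI * Ci))) with (- Rs) by (field; repeat split; auto; intros E; apply N2; rewrite E; ring).
    apply (fG_loop (INR n) L (- (1 / 4)) (1 / 10)); auto. lra.
Qed.

Lemma BesselK_order_cv : cv (fun j => BesselK (mu j) z) (BesselK (INR n) z).
Proof.
  pose proof (neq_0_Re z z_pos) as Hz. rewrite BesselK_nat by auto. destruct (BesselK_nat_lim n z Hz) as [A B].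
  apply cv_ext with (u := fun j => BesselK_nonint (RtoC (mu j)) z); [intros j; symmetry; apply BesselK_nonint_eq, mu_nonint|].
  assert (HN : eventually (fun j => Finite (mu j) <> Finite (INR n))).
  { exists O. intros j _ E. injection E. pose proof (mu_bound j). lra. }
  split; [apply (is_lim_comp_seq _ _ _ _ A HN mu_lim) | apply (is_lim_comp_seq _ _ _ _ B HN mu_lim)].
Qed.

Lemma closed_form_cv (g : nat -> C) (g0 : C) : cv g g0 -> cv (fun j => closed_form (mu j) z (g j)) (closed_form (INR n) z g0).
Proof.
  intros Hg. pose proof (neq_0_Re z z_pos) as Hz. pose proof INR_n_pos as Hn.
  assert (M : cv (fun j => RtoC (mu j)) (RtoC (INR n))) by apply cv_RtoC, mu_lim.
  assert (Nn : RtoC (INR n) <> 0) by (apply RtoC_neq_0; lra).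
  unfold closed_form, Cdiv. apply cv_plus; [apply cv_mult; [apply cv_mult; [|apply cv_const] | exact Hg]|].
  - apply cv_ext with (u := fun j => Ibes (mu j) (Cln (z / 2))); [intros j; now rewrite BesselI_Ibes|].
    rewrite BesselI_Ibes by auto. apply (holo_cv (fun m => Ibes m (Cln (z / 2)))); [eexists; apply holoD_Ibes | exact M].
  - apply cv_mult; [apply cv_mult; [apply cv_mult|]|].
    + apply BesselK_order_cv.
    + unfold Cpower. apply (holo_cv (fun m => Cexp (2 * m * Cln (z / 2)))); [|exact M].
      apply holo_Cexp. repeat (apply holo_mult || apply holo_const || apply holo_id).
    + apply cv_ext with (u := fun j => / (2 * mu j) * (rgam (mu j + 1) * rgam (mu j + 1))).
      * intros j. rewrite Cgamma_rgam. simpl Cpow. rewrite !Cinv_total_mult, !Cinv_inv_total, <- (RtoC_inv 1) by lra. rewrite Rinv_1. ring.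
      * rewrite Cgamma_rgam. apply cv_eq with (/ (2 * INR n) * (rgam (INR n + 1) * rgam (INR n + 1))).
        { simpl Cpow. rewrite !Cinv_total_mult, !Cinv_inv_total, <- (RtoC_inv 1) by lra. rewrite Rinv_1. ring. }
        apply (holo_cv (fun m => / (2 * m) * (rgam (m + 1) * rgam (m + 1)))); [|exact M].
        apply holo_mult; [apply holo_inv; [apply Cmult_neq_0; auto; apply RtoC_neq_0; lra | apply holo_mult; [apply holo_const | apply holo_id]]|].
        apply holo_mult; apply holo_rgam; apply holo_plus; (apply holo_id || apply holo_const).
    + apply cv_ext with (u := fun j => Useries (mu j) (z ^ 2)); [intros j; symmetry; apply pFq_Useries|].
      rewrite pFq_Useries. apply Useries_cv; [lra | apply mu_pos | apply mu_lim].
Qed.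

Lemma closed_form_integral : exists g,
  (forall s c1 c2, (- (1 / 2) < s < 0)%R -> (c1 < 0 < c2)%R -> is_loop_integral (fG (INR n) (Cln z)) s c1 c2 (2 * PI * Ci * g)) /\
  closed_form (INR n) z g = - (/ (2 * INR n))%R * Ibes' (INR n) (Cln (z / 2)).
Proof.
  destruct gval_limit as (g & Hg & HL). exists g. split; [exact HL|]. pose proof INR_n_pos as Hn.
  apply (cv_unique _ _ _ (closed_form_cv _ _ Hg)).
  apply cv_ext with (u := fun j => - (/ (2 * mu j))%R * Ibes' (mu j) (Cln (z / 2))).
  { intros j. symmetry. apply closed_form_nonint; auto using mu_pos, mu_nonint. }
  apply cv_mult.
  - apply cv_opp, cv_RtoC. apply (is_lim_seq_inv (fun j => 2 * mu j)%R (2 * INR n)%R); [|intros E; injection E; lra].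
    apply is_lim_seq_mult'; [apply is_lim_seq_const | apply mu_lim].
  - apply (holoD_cv' _ (fun m => Ibes' m (Cln (z / 2))) _ _ (holoD_Ibes (INR n) (Cln (z / 2)))). apply cv_RtoC, mu_lim.
Qed.

End IntegralOrder.

(** * The identity for every positive order *)

Theorem mainTheorem12 :
  forall (nu : R) (z : C), (0 < nu)%R -> (0 < Re z)%R ->
  exists g : C,
    is_meijerG 3 1 [RtoC (1 / 2); RtoC 1] [RtoC 0; RtoC 0; RtoC nu; RtoC (- nu)] (z ^ 2) g /\
    is_RInt_gen (V := C_R_NormedModule)
      (fun theta : R =>
         tan theta * BesselK 0 (z * (sin theta ^ 2)%R) * BesselI nu (z * (cos theta ^ 2)%R))
      (at_right 0) (at_left (PI / 2)%R)
      (BesselI nu z / (4 * sqrt PI) * g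
       + BesselK nu z * Cpower (z / 2) (2 * nu) / (2 * nu * Cgamma (nu + 1) ^ 2)
         * pFq [RtoC nu; nu + (1 / 2)%R] [nu + 1; nu + 1; 2 * nu + 1] (z ^ 2)).
Proof.
  intros nu z Hnu Hz.
  assert (H : exists g, (forall s c1 c2, (- (1 / 2) < s < 0)%R -> (c1 < 0 < c2)%R ->
      is_loop_integral (fG nu (Cln z)) s c1 c2 (2 * PI * Ci * g)) /\
      closed_form nu z g = - (/ (2 * nu))%R * Ibes' nu (Cln (z / 2))).
  { destruct (excluded_middle_informative (nonint nu)) as [NI|NI].
    - exists (gval nu (Cln z)). split; [now apply fG_loop_nonint | now apply closed_form_nonint].
    - apply not_all_ex_not in NI. destruct NI as [k Hk]. apply NNPP in Hk.
      assert (Hk0 : (0 < k)%Z) by (apply lt_IZR; lra).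
      rewrite <- (Z2Nat.id k), <- INR_IZR_INZ in Hk by lia. subst nu.
      apply closed_form_integral; auto. lia. }
  destruct H as (g & HG & HE). exists g. split; [now apply is_meijerG_fG|].
  unfold closed_form in HE. rewrite HE. now apply bessel_product_integral.
Qed.
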